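(* Let $d\ge2$, $0<p,q\le\infty$ and $t\in\mathbb{R}$. Then the continuous embedding $$B^{td}_{p,q}(\mathbb{R}^d)\hookrightarrow S^t_{p,q}B(\mathbb{R}^d)$$ holds if and only if one of the following conditions is satisfied: (a) $t>\max(0,\frac1p-1)$; (b) $t=0$, $1<p\le\infty$ and $\max(2,p)\le q\le\infty$; (c) $0<p\le1$, $t=\frac1p-1$ and $q=\infty$.
   Context: Isotropic Besov spaces: let $\psi_0\in C_0^\infty(\mathbb{R}^d)$ with $\psi_0(x)=1$ if $\max_i|x_i|\le1$ and $\psi_0(x)=0$ if $\max_i|x_i|\ge 3/2$, and $\psi_j(x)=\psi_0(2^{-j}x)-\psi_0(2^{-j+1}x)$, $j\in\mathbb{N}$. For $s\in\mathbb{R}$, $0<p,q\le\infty$, $B^s_{p,q}(\mathbb{R}^d)$ is the set of tempered distributions $f$ with $\big(\sum_{j\ge0}2^{jsq}\|\mathcal{F}^{-1}[\psi_j\mathcal{F}f]\|_{L_p}^q\big)^{1/q}<\infty$ (modification if $q=\infty$), $\mathcal{F}$ the Fourier transform. Dominating mixed spaces: let $\varphi_0\in C_0^\infty(\mathbb{R})$ with $\varphi_0=1$ on $[-1,1]$, $\operatorname{supp}\varphi_0\subset[-3/2,3/2]$, $\varphi_j(s)=\varphi_0(2^{-j}s)-\varphi_0(2^{-j+1}s)$, and $\varphi_{\bar k}(x)=\prod_{i=1}^d\varphi_{k_i}(x_i)$, $|\bar k|=k_1+\dots+k_d$. $S^t_{p,q}B(\mathbb{R}^d)$ is the set of tempered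 distributions $f$ with $\big(\sum_{\bar k\in\mathbb{N}_0^d}2^{|\bar k|tq}\|\mathcal{F}^{-1}[\varphi_{\bar k}\mathcal{F}f]\|_{L_p}^q\big)^{1/q}<\infty$. $\hookrightarrow$ is a continuous embedding. *)

(* Defs.v *)
From HB Require Import structures.
From mathcomp Require Import all_boot all_order all_algebra.
From mathcomp Require Import all_classical all_reals all_analysis.
Set Implicit Arguments. Unset Strict Implicit. Unset Printing Implicit Defensive.
Import Order.TTheory GRing.Theory Num.Theory.
Import numFieldNormedType.Exports.
Local Open Scope classical_set_scope.
Local Open Scope ring_scope.

Section Besov.
Variable R : realType.
Variable d : nat.

Notation Rd := 'rV[R]_d.

Definition evec (i : 'I_d) : Rd := delta_mx 0 i.

Fixpoint pder (s : seq 'I_d) (f : Rd -> R) : Rd -> R :=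
  match s with
  | [::] => f
  | i :: s' => fun x => derive (pder s' f) x (evec i)
  end.

Definition smooth (f : Rd -> R) : Prop :=
  forall (s : seq 'I_d) (x : Rd), differentiable (pder s f) x.

Definition schwartz (f : Rd -> R) : Prop :=
  smooth f /\
  forall (s : seq 'I_d) (N : nat), exists M : R, forall x : Rd,
      (1 + `|x|) ^+ N * `|pder s f x| <= M.

Definition tempered (u : (Rd -> R) -> R) : Prop :=
  (forall (a : R) (f g : Rd -> R), schwartz f -> schwartz g ->
      u (fun x => a * f x + g x) = a * u f + u g) /\
  exists (C : R) (N : nat), forall (f : Rd -> R) (M : R), schwartz f ->
      (forall (s : seq 'I_d) (x : Rd), (size s <= N)%N ->
           (1 + `|x|) ^+ N * `|pder s f x| <= M) ->
      `|u f| <= C * M.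

(* a complex tempered distribution f is determined by its (complex) values on
   real Schwartz functions:  f(phi) = u1 phi + i u2 phi *)
Definition tdist := (((Rd -> R) -> R) * ((Rd -> R) -> R))%type.
Definition ctempered (f : tdist) : Prop := tempered f.1 /\ tempered f.2.

(* Lebesgue integral over R^d, written as an iterated integral over the
   coordinates (Tonelli / Fubini). *)
Fixpoint iint (n : nat) (G : (nat -> R) -> \bar R) (v : nat -> R) : \bar R :=
  match n with
  | 0 => G v
  | n'.+1 => (\int[lebesgue_measure]_(y in [set: R])
                 iint n' G (fun k => if k == n' then y else v k))%E
  end.

Definition intRd (g : Rd -> \bar R) : \bar R :=
  iint d (fun v => g (\row_(i < d) v i)) (fun _ => 0).

Definition dotRd (x y : Rd) : R := \sum_(i < d) x 0 i * y 0 i.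

(* kernel of F^{-1}[psi F .]: K = F^{-1} psi,
   K(z) = (2 pi)^{-d} int psi(xi) e^{i z.xi} dxi = Kre z + i Kim z *)
Definition Kre (psi : Rd -> R) (z : Rd) : R :=
  (2 * pi) ^- d * fine (intRd (fun xi => (psi xi * cos (dotRd z xi))%:E)).
Definition Kim (psi : Rd -> R) (z : Rd) : R :=
  (2 * pi) ^- d * fine (intRd (fun xi => (psi xi * sin (dotRd z xi))%:E)).

(* |F^{-1}[psi F f](x)| = |f(K(x - .))| for a tempered distribution f *)
Definition absDelta (psi : Rd -> R) (f : tdist) (x : Rd) : R :=
  let kr := fun y => Kre psi (x - y) in
  let ki := fun y => Kim psi (x - y) in
  let a := f.1 kr - f.2 ki in
  let b := f.2 kr + f.1 ki in
  Num.sqrt (a ^+ 2 + b ^+ 2).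

Definition esssupRd (g : Rd -> R) : \bar R :=
  ereal_inf [set M%:E | M in [set M : R |
     intRd (fun x => (if M < `|g x| then 1 else 0)%:E) = 0%E]].

Definition Lpnorm (p : \bar R) (g : Rd -> R) : \bar R :=
  match p with
  | r%:E => ((intRd (fun x => (`|g x| `^ r)%:E)) `^ r^-1)%E
  | +oo%E => esssupRd g
  | -oo%E => 0%E
  end.

Definition lqnorm (I : choiceType) (q : \bar R) (a : I -> \bar R) : \bar R :=
  match q with
  | r%:E => ((\esum_(i in [set: I]) (a i `^ r)%E) `^ r^-1)%E
  | +oo%E => ereal_sup (range a)
  | -oo%E => 0%E
  end.

Definition admissible_psi0 (psi0 : Rd -> R) : Prop :=
  smooth psi0 /\
  (forall x : Rd, (forall i, `|x 0 i| <= 1) -> psi0 x = 1) /\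
  (forall x : Rd, (exists i, 3/2 <= `|x 0 i|) -> psi0 x = 0).

Definition psij (psi0 : Rd -> R) (j : nat) (x : Rd) : R :=
  match j with
  | 0 => psi0 x
  | j'.+1 => psi0 ((2 ^- j) *: x) - psi0 ((2 ^- j') *: x)
  end.

Definition besov_norm (psi0 : Rd -> R) (s : R) (p q : \bar R) (f : tdist) : \bar R :=
  lqnorm q (fun j : nat =>
    ((2 `^ (j%:R * s))%:E * Lpnorm p (absDelta (psij psi0 j) f))%E).

Definition admissible_phi0 (phi0 : R -> R) : Prop :=
  (forall (n : nat) (x : R), derivable (derive1n n phi0) x 1) /\
  (forall x : R, `|x| <= 1 -> phi0 x = 1) /\
  (forall x : R, 3/2 <= `|x| -> phi0 x = 0).

Definition phij (phi0 : R -> R) (j : nat) (s : R) : R :=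
  match j with
  | 0 => phi0 s
  | j'.+1 => phi0 (2 ^- j * s) - phi0 (2 ^- j' * s)
  end.

Definition phik (phi0 : R -> R) (k : {ffun 'I_d -> nat}) (x : Rd) : R :=
  \prod_(i < d) phij phi0 (k i) (x 0 i).

Definition mixed_norm (phi0 : R -> R) (t : R) (p q : \bar R) (f : tdist) : \bar R :=
  lqnorm q (fun k : {ffun 'I_d -> nat} =>
    ((2 `^ ((\sum_(i < d) k i)%:R * t))%:E * Lpnorm p (absDelta (phik phi0 k) f))%E).

Definition embeds (psi0 : Rd -> R) (phi0 : R -> R) (s t : R) (p q : \bar R) : Prop :=
  exists C : R, forall f : tdist, ctempered f ->
    (besov_norm psi0 s p q f < +oo)%E ->
    (mixed_norm phi0 t p q f <= C%:E * besov_norm psi0 s p q f)%E.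

End Besov.

Definition invp {R : realType} (p : \bar R) : R :=
  match p with r%:E => r^-1 | _ => 0 end.

(* Main.v *)
Require Import Defs.
From HB Require Import structures.
From mathcomp Require Import all_boot all_order all_algebra.
From mathcomp Require Import all_classical all_reals all_analysis.
From mathcomp Require Import measurable_realfun.
From mathcomp Require Import ring lra.
Set Implicit Arguments. Unset Strict Implicit. Unset Printing Implicit Defensive.
Import Order.TTheory GRing.Theory Num.Theory.
Import numFieldNormedType.Exports.
Local Open Scope classical_set_scope.
Local Open Scope ring_scope.

(** Writing the multiplier [phi_k] as a cosine series turns [F^-1[phi_k F f]] into an
    absolutely convergent combination of translates of [F^-1[psi_j F f]]; this gives
    [L_p] bounds that grow like [2 ^ (sigma_p (k_1 + ... + k_d))] relative to the isotropic piece,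
    with [sigma_p = max(0, 1/p - 1)], hence (a), and (c) together with (b) for [q = oo].
    For [t = 0] and [1 < p < oo] the symbols [cos] and [sin] of a coordinate satisfy a
    parallelogram identity; uniform convexity of [L_p] lets one dyadic shell after the
    other be peeled off with an [l^(max 2 p)] gain, one coordinate at a time.

    Conversely, a single modulated bump at a frequency [2^j] on a coordinate axis forces
    [t >= 0]; one bump dilated to the cube of side [2^j] charges about [j] mixed pieces and
    forces [t >= 1/p - 1], with [q = oo] in case of equality.  For [t = 0], sums of [N]
    bumps with frequencies [(2^N, 2^n, 0, ...)], [n < N], form a single isotropic piece but
    [N] mixed ones: centered far apart they have [L_p] norm [O(N ^ (1/p))], so [p <= q];
    centered at the same point with greedily chosen signs they have norm [O(N ^ (1/2))] for
    [p <= 2], so [2 <= q]. *)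

(** * Iterated integrals *)

(** Two obstacles shape the code. The integral over R^d is an iterated one, with no product
    measurability at hand: integrands are either Lipschitz with bounded support or nonnegative and
    sequentially lower semicontinuous, two classes stable under integration in one variable. And
    distributions act on real functions only, a complex one being a pair of real functionals:
    estimates are therefore made for [W f psi x w], the real part of a piece turned by the phase
    [w]. Multiplying a symbol by a cosine averages two translates with opposite phase shifts, and
    moduli return as suprema over [w]. The loss comes from the cosine coefficients of a bump dilated
    by [s], of size [s / (1 + s k) ^ N]: their l^rho quasi-norm, rho = min(1, p), has order
    [s ^ (1 - 1 / rho)]. The peeling at t = 0 rests on sin 2u = 2 sin u cos u, which turns a product
    of cosines into a quotient of sines. The counterexamples must be tempered distributions with
    prescribed compactly supported Fourier transform; they are made from a Dirac mass by multiplying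
    in one coordinate after the other. *)

Section affine_change.
Context {R : realType}.
Variables (s c : R).
Hypothesis s0 : 0 < s.
Let mu := @lebesgue_measure R.
Let aff (y : measurableTypeR R) : measurableTypeR R := s * y + c.

Let maff : measurable_fun setT aff.
Proof. by apply: measurable_funD => //; apply: measurable_funM. Qed.

(** By uniqueness of Lebesgue measure it is enough to compare it with the scaled image measure on
    half-open intervals. *)
Lemma lebesgue_measure_affine (A : set R) : measurable A ->
  mu A = (s%:E * mu (aff @^-1` A))%E.
Proof.
move=> mA.
pose k : {nonneg R} := NngNum (ltW s0).
have -> : (s%:E * mu (aff @^-1` A))%E = mscale k (pushforward mu aff) A by [].
apply: lebesgue_measure_unique => //= _ [[a b]] _ <-.
rewrite /mscale/= /pushforward.
have -> : aff @^-1` `]a, b] = `](a - c) / s, (b - c) / s]%classic.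
  apply/seteqP; split => y /=; rewrite !in_itv /= /aff ltr_pdivrMr// ler_pdivlMr//
    ltrBlDr lerBrDr [y * s]mulrC//.
rewrite [LHS]lebesgue_measure_itv/= lebesgue_measure_itv/= !lte_fin.
rewrite ltr_pM2r ?invr_gt0// ltrD2r; case: ifP => ab; last by rewrite mule0.
by rewrite -!EFinB -EFinM -mulrBl mulrC divfK ?gt_eqF// opprB addrA subrK.
Qed.

Lemma ge0_integral_affine (f : R -> \bar R) :
  measurable_fun setT f -> (forall y, 0 <= f y)%E ->
  (\int[mu]_y f (s * y + c)%R = (s^-1)%:E * \int[mu]_y f y)%E.
Proof.
move=> mf f0; pose k : {nonneg R} := NngNum (ltW s0).
have E : (\int[mu]_y f y = \int[mscale k (pushforward mu aff)]_y f y)%E.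
  move=> m; apply: eq_measure_integral => /= A mA _; exact: lebesgue_measure_affine.
rewrite (E maff).
rewrite (ge0_integral_mscale (pushforward mu aff))//.
rewrite ge0_integral_pushforward//.
by rewrite preimage_setT muleA -EFinM mulVf ?gt_eqF// mul1e.
Qed.

(** No integrability is assumed, so both parts of [f] may have infinite integral; a positive finite
    factor distributes over their difference in each of the cases. *)
Lemma integral_affine (f : R -> \bar R) : measurable_fun setT f ->
  (\int[mu]_y f (s * y + c)%R = (s^-1)%:E * \int[mu]_y f y)%E.
Proof.
move=> mf; rewrite integralE [in RHS]integralE.
set a := (X in (_ = _ * (X - _))%E); set b := (X in (_ = _ * (_ - X))%E).
transitivity ((s^-1)%:E * a - (s^-1)%:E * b)%E.
  have P := ge0_integral_affine (measurable_funepos mf) (fun y => funepos_ge0 f y).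
  have N := ge0_integral_affine (measurable_funeneg mf) (fun y => funeneg_ge0 f y).
  rewrite -P -N; congr (_ - _)%E; apply: eq_integral => y _.
    by rewrite !funeposE.
  by rewrite !funenegE.
have a0 : (0 <= a)%E by exact: integral_ge0.
have b0 : (0 <= b)%E by exact: integral_ge0.
have si : (0 < s^-1)%R by rewrite invr_gt0.
case: a a0 => [a| |]// a0; case: b b0 => [b| |]// b0.
- by rewrite muleBr.
- by rewrite gt0_muley ?lte_fin//= gt0_muleNy ?lte_fin.
- by rewrite gt0_muley ?lte_fin//= gt0_muley ?lte_fin.
- by rewrite gt0_muley ?lte_fin//= gt0_muleNy ?lte_fin.
Qed.

End affine_change.

(** * Lipschitz functions of bounded support on the line *)

Section lipschitz_integral.
Context {R : realType}.
Local Notation mu := (@lebesgue_measure R).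

Lemma lipschitz_continuous (h : R -> R) (L : R) :
  (forall y y', `|h y - h y'| <= L * `|y - y'|) -> continuous h.
Proof.
move=> hL y; apply/cvgrPdist_le => e e0.
have L1 : 0 < `|L| + 1 by rewrite ltr_pwDr.
near=> z.
rewrite (le_trans (hL _ _))// (@le_trans _ _ ((`|L| + 1) * `|y - z|))//.
  by rewrite ler_wpM2r// (le_trans (ler_norm _))// lerDl.
rewrite mulrC -ler_pdivlMr//; near: z; apply: (cvgrPdist_le _ _).1; first exact: cvg_id.
by rewrite divr_gt0.
Unshelve. all: by end_near. Qed.

Variables (A M L : R) (h : R -> R).
Hypotheses (A0 : 0 <= A) (hM : forall y, `|h y| <= M)
  (hA : forall y, A < `|y| -> h y = 0)
  (hL : forall y y', `|h y - h y'| <= L * `|y - y'|).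

Lemma lipschitz_integrable : mu.-integrable setT (EFin \o h).
Proof.
apply: (le_integrable measurableT _ _ (integrableZl measurableT M
  (integrable_indic_itv (- A) A true false))).
  apply/measurable_EFinP; exact: (continuous_measurable_fun (lipschitz_continuous hL)).
move=> y _ /=; rewrite lee_fin indicE.
have M0 : 0 <= M by exact: le_trans (hM 0).
rewrite normrM (ger0_norm M0).
have [yA|yA] := leP `|y| A; last by rewrite hA// normr0 mulr_ge0.
by rewrite mem_set/= ?normr1 ?mulr1// in_itv/= -ler_norml.
Qed.

Lemma le_lipschitz_integral :
  `|fine (\int[mu]_y (h y)%:E)| <= 2 * A * M.
Proof.
have M0 : 0 <= M by exact: le_trans (hM 0).
have ih := lipschitz_integrable.
have fi : (\int[mu]_y (h y)%:E)%E \is a fin_num by exact: integrable_fin_num.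
rewrite -lee_fin -abse_EFin fineK//.
apply: le_trans (le_abse_integral _ _ _) _ => //; first by case/integrableP : ih.
have ii := integrableZl measurableT M (integrable_indic_itv (- A) A true false).
apply: (@le_trans _ _ (\int[mu]_y (M%:E * (\1_`[- A, A]%classic y)%:E))%E).
  apply: le_integral => //; first exact/integrable_abse.
  move=> y _ /=; rewrite -EFinM lee_fin indicE.
  have [yA|yA] := leP `|y| A; last by rewrite hA// normr0 mulr_ge0.
  by rewrite mem_set/= ?mulr1// in_itv/= -ler_norml.
rewrite integralZl//; last exact: integrable_indic_itv.
rewrite integral_indic// setIT [X in (_ * X)%E]lebesgue_measure_itv/= lte_fin.
case: ifP => // _; last by rewrite mule0 lee_fin !mulr_ge0.
by rewrite -EFinD -EFinM lee_fin opprK -mulr2n -[A *+ 2]mulr_natl mulrC.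
Qed.

End lipschitz_integral.

(** * Iterated integrals of Lipschitz functions *)

Section iterated.
Context {R : realType}.
Local Notation mu := (@lebesgue_measure R).
Implicit Types (v : nat -> R) (g : (nat -> R) -> R).

Definition upd v (n : nat) (y : R) : nat -> R := fun k => if k == n then y else v k.

Lemma upd_upd v n y y' : upd (upd v n y) n y' = upd v n y'.
Proof. by apply/funext => k; rewrite /upd; case: (k == n). Qed.

Lemma updC v n m y y' : n != m -> upd (upd v n y) m y' = upd (upd v m y') n y.
Proof.
move=> nm; apply/funext => k; rewrite /upd; case: ifP => [/eqP ->|//].
by rewrite eq_sym (negbTE nm).
Qed.

Lemma upd_eq v n y : upd v n y n = y. Proof. by rewrite /upd eqxx. Qed.

Lemma upd_ne v n y k : k != n -> upd v n y k = v k.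
Proof. by rewrite /upd => /negbTE ->. Qed.

Lemma iintS n G v : iint n.+1 G v = (\int[mu]_y iint n G (upd v n y))%E.
Proof. by []. Qed.

(** In each variable separately: a bound, a Lipschitz constant and, for the variables of index in
    [[a, b)], a cut-off at [A]. Integrating out variable [a] leads to the same class with [a.+1],
    the constants being multiplied by [2 * A], so iterated integrals are finite without any joint
    measurability. *)
Definition LC (a b : nat) (A L M : R) g :=
  [/\ forall v, `|g v| <= M,
     forall v k y, `|g (upd v k y) - g v| <= L * `|y - v k| &
     forall v k, (a <= k < b)%N -> A < `|v k| -> g v = 0].

Definition rint n g v : R := fine (iint n (fun v => (g v)%:E) v).

Lemma LC_step a b A L M g v : LC a b A L M g ->
  forall y y', `|g (upd v a y) - g (upd v a y')| <= L * `|y - y'|.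
Proof.
move=> [_ gL _] y y'; have := gL (upd v a y') a y.
by rewrite upd_upd upd_eq.
Qed.

Lemma LC_supp a b A L M g v : LC a b A L M g -> (a < b)%N ->
  forall y, A < `|y| -> g (upd v a y) = 0.
Proof.
move=> [_ _ gA] ab y yA; apply: (gA _ a); first by rewrite leqnn ab.
by rewrite upd_eq.
Qed.

Lemma LC_integrable a b A L M g v : 0 <= A -> LC a b A L M g -> (a < b)%N ->
  mu.-integrable setT (fun y => (g (upd v a y))%:E).
Proof.
move=> A0 gLC ab; apply: (@lipschitz_integrable _ A M L) => //.
- by case: gLC => gM _ _ y; exact: gM.
- exact: LC_supp gLC ab.
- exact: LC_step gLC.
Qed.

Lemma LC_lin a b A L M L' M' g h (c : R) :
  LC a b A L M g -> LC a b A L' M' h ->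
  LC a b A (`|c| * L + L') (`|c| * M + M') (fun v => c * g v + h v).
Proof.
move=> [gM gL gA] [hM hL hA]; split.
- move=> v; apply: le_trans (ler_normD _ _) _; rewrite lerD// normrM.
  by rewrite ler_wpM2l.
- move=> v k y; rewrite opprD addrACA -mulrBr mulrDl.
  apply: le_trans (ler_normD _ _) _; rewrite lerD// normrM -mulrA.
  by rewrite ler_wpM2l.
- by move=> v k akb Ak; rewrite (gA _ _ akb Ak) (hA _ _ akb Ak) mulr0 addr0.
Qed.

Lemma LC_int a b A L M g : 0 <= A -> LC a b A L M g -> (a < b)%N ->
  LC a.+1 b A (2 * A * L) (2 * A * M)
    (fun v => fine (\int[mu]_y (g (upd v a y))%:E)).
Proof.
move=> A0 gLC ab; have [gM gL gA] := gLC; split.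
- move=> v; apply: (@le_lipschitz_integral _ A M L) => //.
  + exact: LC_supp gLC ab.
  + exact: LC_step gLC.
- move=> v k y.
  have [->|ka] := eqVneq k a.
    under eq_integral do rewrite upd_upd.
    have L0 : 0 <= L.
      have := gL v a (v a + 1); rewrite [v a + 1 - _]addrC addKr normr1 mulr1.
      exact: le_trans.
    by rewrite subrr normr0 !mulr_ge0.
  have i1 := LC_integrable v A0 gLC ab.
  have i2 := LC_integrable (upd v k y) A0 gLC ab.
  rewrite -fineB ?integrable_fin_num// -integralB//=.
  rewrite -(mulrA (2 * A)).
  apply: (@le_lipschitz_integral _ A _ (L + L)
    (fun z => g (upd (upd v k y) a z) - g (upd v a z))) => //.
  + by move=> z; rewrite updC//; apply: le_trans (gL _ _ _) _; rewrite upd_ne.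
  + by move=> z zA; rewrite !(LC_supp _ gLC ab)// subr0.
  + move=> z z'; rewrite [X in `|X|](_ : _ = (g (upd (upd v k y) a z) -
      g (upd (upd v k y) a z')) - (g (upd v a z) - g (upd v a z'))); last by ring.
    by rewrite mulrDl (le_trans (ler_normB _ _))// lerD// (LC_step _ gLC).
- move=> v k /andP[ak kb] Ak.
  under eq_integral do rewrite (gA _ k) ?(ltnW ak)// ?upd_ne ?gtn_eqF//.
  by rewrite integral0.
Qed.

(** The first half justifies [fine] in [rint]: every partial integral is finite, so nothing is lost
    by working with real values. *)
Lemma rint_spec N A L M g n : 0 <= A -> LC 0 N A L M g -> (n <= N)%N ->
  (forall v, iint n (fun v => (g v)%:E) v = (rint n g v)%:E) /\
  LC n N A ((2 * A) ^+ n * L) ((2 * A) ^+ n * M) (rint n g).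
Proof.
move=> A0 gLC; elim: n => [|n IH] nN.
  by rewrite !expr0 !mul1r /rint.
have [IH1 IH2] := IH (ltnW nN).
have E v : rint n.+1 g v = fine (\int[mu]_y (rint n g (upd v n y))%:E).
  by rewrite /rint/=; congr fine; apply: eq_integral => y _; rewrite -IH1.
split.
  move=> v; rewrite E iintS.
  under eq_integral do rewrite IH1.
  by rewrite fineK//; apply: integrable_fin_num => //; exact: LC_integrable IH2 _.
rewrite !exprS -!mulrA (_ : rint n.+1 g = (fun v => fine (\int[mu]_y (rint n g (upd v n y))%:E))).
  have := LC_int A0 IH2 nN; by rewrite !mulrA.
exact/funext/E.
Qed.

Lemma rintS N A L M g n v : 0 <= A -> LC 0 N A L M g -> (n < N)%N ->
  rint n.+1 g v = fine (\int[mu]_y (rint n g (upd v n y))%:E).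
Proof.
move=> A0 gLC nN; have [IH1 _] := rint_spec A0 gLC (ltnW nN).
by rewrite /rint/=; congr fine; apply: eq_integral => y _; rewrite -IH1.
Qed.

Lemma rint_lin N A L M L' M' g h (c : R) n v :
  0 <= A -> LC 0 N A L M g -> LC 0 N A L' M' h -> (n <= N)%N ->
  rint n (fun v => c * g v + h v) v = c * rint n g v + rint n h v.
Proof.
move=> A0 gLC hLC; elim: n v => [//|n IH] v nN.
have ghLC := LC_lin c gLC hLC.
rewrite (rintS _ A0 ghLC nN) (rintS _ A0 gLC nN) (rintS _ A0 hLC nN).
under eq_integral do rewrite (IH _ (ltnW nN)) EFinD EFinM.
have [_ g1] := rint_spec A0 gLC (ltnW nN).
have [_ h1] := rint_spec A0 hLC (ltnW nN).
have ig := LC_integrable v A0 g1 nN.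
have ih := LC_integrable v A0 h1 nN.
rewrite integralD//; last exact: integrableZl.
rewrite integralZl// fineD ?fineM//; [exact: integrable_fin_num| |exact: integrable_fin_num].
by rewrite fin_numM// integrable_fin_num.
Qed.

Definition aff (s c : nat -> R) v : nat -> R := fun k => s k * v k + c k.

Lemma aff_upd s c v n y : aff s c (upd v n y) = upd (aff s c v) n (s n * y + c n).
Proof. by apply/funext => k; rewrite /aff /upd; case: eqP => [->|]. Qed.

Lemma rint_aff N A L M g s c n v :
  0 <= A -> LC 0 N A L M g -> (n <= N)%N -> (forall k, 0 < s k) ->
  forall A' L' M', 0 <= A' -> LC 0 N A' L' M' (fun v => g (aff s c v)) ->
  rint n (fun v => g (aff s c v)) v = (\prod_(k < n) (s k)^-1) * rint n g (aff s c v).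
Proof.
move=> A0 gLC nN s0 A' L' M' A'0 g'LC; elim: n v nN => [|n IH] v nN.
  by rewrite big_ord0 mul1r.
rewrite (rintS _ A'0 g'LC nN) (rintS _ A0 gLC nN).
under eq_integral do rewrite (IH _ (ltnW nN)) aff_upd EFinM.
have [_ g1] := rint_spec A0 gLC (ltnW nN).
have ig := LC_integrable (aff s c v) A0 g1 nN.
have mg : measurable_fun setT (fun y => (rint n g (upd (aff s c v) n y))%:E).
  by case/integrableP : ig.
have ia : mu.-integrable setT (fun y => (rint n g (upd (aff s c v) n (s n * y + c n)))%:E).
  apply/integrableP; split.
    have := measurableT_comp mg; apply.
    by apply: measurable_funD => //; apply: measurable_funM.
  have := integral_affine (c n) (s0 n) (measurableT_comp (@abse_measurable R setT) mg) => /= ->.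
  have /integrableP[_ +] := ig => igy.
  by rewrite lte_mul_pinfty// lee_fin invr_ge0 ltW.
rewrite integralZl// (integral_affine _ _ mg)//.
rewrite big_ord_recr/= !fineM//; last 2 first.
- exact: integrable_fin_num.
- by rewrite fin_numM// integrable_fin_num.
by rewrite mulrA.
Qed.

End iterated.

(** * Nonnegative lower semicontinuous integrands *)

Section slsc.
Context {R : realType}.
Local Notation mu := (@lebesgue_measure R).
Implicit Types (v : nat -> R) (G H : (nat -> R) -> \bar R).

(* Sequential lower semicontinuity for coordinatewise convergence: by Fatou's
   lemma this class is stable under integration in one variable. *)
Definition slsc G := forall (w : nat -> nat -> R) v,
  (forall k, w m k @[m --> \oo] --> v k) ->
  forall a : R, (a%:E < G v)%E -> \forall m \near \oo, (a%:E < G (w m))%E.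

Definition nneg G := forall v, (0 <= G v)%E.

Lemma cvg_upd (w : nat -> nat -> R) v (y : nat -> R) z n :
  (forall k, w m k @[m --> \oo] --> v k) -> y m @[m --> \oo] --> z ->
  forall k, upd (w m) n (y m) k @[m --> \oo] --> upd v n z k.
Proof. by move=> wv yz k; rewrite /upd; case: (k == n). Qed.

(** Along one coordinate the sequential notion is the topological one, because points of R have a
    countable base of balls; measurability of sections follows. *)
Lemma slsc_lsc G v n : slsc G -> lower_semicontinuous (fun y => G (upd v n y)).
Proof.
move=> sG y a aG.
apply: contrapT => H.
have P (m : nat) : exists z : R, `|y - z| < m.+1%:R^-1 /\ (G (upd v n z) <= a%:E)%E.
  apply: contrapT => K; apply: H; exists (ball y m.+1%:R^-1).
    by apply: nbhsx_ballx; rewrite invr_gt0.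
  move=> z yz; rewrite ltNge; apply/negP => Ga; apply: K; exists z; split => //.
have [z zP] := choice P.
have zy : z m @[m --> \oo] --> y.
  apply/cvgrPdist_lt => e e0; near=> m.
  apply: lt_trans (zP m).1 _; near: m; exact: near_infty_natSinv_lt (PosNum e0).
have wv k : v k @[m --> \oo] --> v k by exact: cvg_cst.
have [m _ /(_ m (leqnn _)) /=] := sG _ _ (cvg_upd (n:=n) wv zy) a aG.
by rewrite ltNge (zP m).2.
Unshelve. all: by end_near. Qed.

Lemma slsc_measurable G v n : slsc G ->
  measurable_fun setT (fun y => G (upd v n y)).
Proof. by move=> sG; apply: lower_semicontinuous_measurable; exact: slsc_lsc. Qed.

Lemma limn_einf_gt (u : nat -> \bar R) (a : \bar R) :
  (a < limn_einf u)%E -> \forall m \near \oo, (a < u m)%E.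
Proof.
move=> au; apply: contrapT => H.
have : (limn_einf u <= a)%E.
  rewrite limn_einf_lim; apply: lime_le; first exact: is_cvg_einfs.
  near=> n; rewrite leNgt; apply/negP => /= an; apply: H; exists n => // m /= nm.
  apply: lt_le_trans an _; apply: ereal_inf_lbound; by exists m.
by rewrite leNgt au.
Unshelve. all: by end_near. Qed.

Lemma ge_limn_einf (u : nat -> \bar R) (l : \bar R) : (0 <= l)%E ->
  (forall m, 0 <= u m)%E ->
  (forall a : R, (a%:E < l)%E -> \forall m \near \oo, (a%:E < u m)%E) ->
  (l <= limn_einf u)%E.
Proof.
move=> l0 u0 H; rewrite leNgt; apply/negP => ul.
have i0 : (0 <= limn_einf u)%E.
  rewrite limn_einf_lim; apply: lime_ge; first exact: is_cvg_einfs.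
  by near=> n; apply: le_ereal_inf_tmp => _ [m _ <-].
have [a [ua al]] : exists a : R, (limn_einf u < a%:E)%E /\ (a%:E < l)%E.
  case: (limn_einf u) ul i0 => [r| |]// + _; last by rewrite ltNge leey.
  case: l {l0 H} => [s| |]//.
    by rewrite !lte_fin => rs; exists ((r + s) / 2); rewrite !lte_fin midf_lt// midf_lt.
  by move=> _; exists (r + 1); rewrite lte_fin ltrDl ltr01 ltry.
have [N _ NP] := H _ al.
suff : (a%:E <= limn_einf u)%E by rewrite leNgt ua.
rewrite limn_einf_lim; apply: lime_ge; first exact: is_cvg_einfs.
near=> n; apply: le_ereal_inf_tmp => _ [m /= nm <-]; apply/ltW/NP => /=.
by apply: leq_trans nm; near: n; exists N.
Unshelve. all: by end_near. Qed.

Lemma nneg_iint G n : nneg G -> nneg (iint n G).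
Proof.
move=> G0; elim: n => [//|n IH] v; rewrite iintS.
by apply: integral_ge0 => y _; exact: IH.
Qed.

Lemma measurable_limn_einf (f : nat -> R -> \bar R) :
  (forall n, measurable_fun setT (f n)) ->
  measurable_fun setT (fun y => limn_einf (f ^~ y)).
Proof.
move=> mf.
rewrite (_ : (fun y => _) = (fun y => (- limn_esup (fun n => - f n y))%E)); last by [].
apply: measurableT_comp => //.
apply: measurable_fun_limn_esup => n; exact: measurableT_comp.
Qed.

Lemma slsc_iint G n : nneg G -> slsc G -> slsc (iint n G).
Proof.
move=> G0 sG; elim: n => [//|n IH] w v wv a; rewrite iintS => aG.
apply: limn_einf_gt.
have mw m : measurable_fun setT (fun y => iint n G (upd (w m) n y)).
  exact: slsc_measurable.
apply: lt_le_trans (fatou mu measurableT mw _); last first.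
  by move=> m y _; exact: nneg_iint.
apply: (lt_le_trans aG); apply: ge0_le_integral => //.
- by move=> y _; exact: nneg_iint.
- exact: slsc_measurable.
- exact: measurable_limn_einf.
- move=> y _; apply: ge_limn_einf; [exact: nneg_iint|by move=> m; exact: nneg_iint|].
  move=> b bG; apply: IH bG; apply: cvg_upd => //; exact: cvg_cst.
Qed.

Lemma iint_measurable G n v : nneg G -> slsc G ->
  measurable_fun setT (fun y => iint n G (upd v n y)).
Proof. by move=> G0 sG; apply: slsc_measurable; exact: slsc_iint. Qed.

Lemma slscD G H : nneg G -> nneg H -> slsc G -> slsc H ->
  slsc (fun v => G v + H v)%E.
Proof.
move=> G0 H0 sG sH w v wv a.
have [Gf|] := boolP (G v \is a fin_num); last first.
  rewrite ge0_fin_numE// -leNgt leye_eq => /eqP Gy _.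
  have := sG _ _ wv a; rewrite Gy ltry => /(_ isT); apply: filterS => m.
  by move=> /lt_le_trans; apply; rewrite leeDl.
have [Hf|] := boolP (H v \is a fin_num); last first.
  rewrite ge0_fin_numE// -leNgt leye_eq => /eqP Hy _.
  have := sH _ _ wv a; rewrite Hy ltry => /(_ isT); apply: filterS => m.
  by move=> /lt_le_trans; apply; rewrite leeDr.
have := sG _ _ wv; have := sH _ _ wv.
rewrite -(fineK Gf) -(fineK Hf); move: (fine _) (fine _) => g h hP gP.
rewrite -EFinD lte_fin => agh.
(* Half of the slack [g + h - a] is given to each summand. *)
have h1 : ((h - (g + h - a) / 2)%:E < h%:E)%E by rewrite lte_fin; lra.
have g1 : ((g - (g + h - a) / 2)%:E < g%:E)%E by rewrite lte_fin; lra.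
near=> m.
rewrite (_ : a = (g - (g + h - a) / 2) + (h - (g + h - a) / 2)); last by lra.
rewrite EFinD lteD//; near: m; [exact: gP|exact: hP].
Unshelve. all: by end_near. Qed.

Lemma slscZ (c : R) G : 0 <= c -> nneg G -> slsc G -> slsc (fun v => c%:E * G v)%E.
Proof.
rewrite le_eqVlt => /predU1P[<-|c0] G0 sG w v wv a.
  by rewrite mul0e => a0; near=> m; rewrite mul0e.
rewrite -lte_pdivrMl// -EFinM => /(sG _ _ wv); apply: filterS => m.
by rewrite -lte_pdivrMl// -EFinM.
Unshelve. all: by end_near. Qed.

Lemma slsc_sum (F : nat -> (nat -> R) -> \bar R) N :
  (forall i, nneg (F i)) -> (forall i, slsc (F i)) ->
  slsc (fun v => \sum_(0 <= i < N) F i v)%E.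
Proof.
move=> F0 sF; elim: N => [|N IH].
  move=> w v wv a; rewrite big_geq// => a0.
  by near=> m; rewrite big_geq.
rewrite (_ : (fun v => _) = (fun v => \sum_(0 <= i < N) F i v + F N v)%E).
  by apply: slscD => // v; rewrite /nneg/= ?sume_ge0// => i _; exact: F0.
by apply/funext => v; rewrite big_nat_recr.
Unshelve. all: by end_near. Qed.

(** A strict lower bound for the series is already exceeded by a partial sum, to which the finite
    case applies. *)
Lemma slsc_series (F : nat -> (nat -> R) -> \bar R) :
  (forall i, nneg (F i)) -> (forall i, slsc (F i)) ->
  slsc (fun v => \sum_(0 <= i <oo) F i v)%E.
Proof.
move=> F0 sF w v wv a aF.
have [N aN] : exists N, (a%:E < \sum_(0 <= i < N) F i v)%E.
  apply: contrapT => H; move: aF; rewrite ltNge => /negP; apply.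
  apply: lime_le; first by apply: is_cvg_nneseries => n _ _; exact: F0.
  near=> n; rewrite leNgt; apply/negP => an; apply: H; by exists n.
have := slsc_sum F0 sF wv aN; apply: filterS => m /lt_le_trans; apply.
by apply: nneseries_lim_ge => n _ _; exact: F0.
Unshelve. all: by end_near. Qed.

Definition scont (g : (nat -> R) -> R) := forall (w : nat -> nat -> R) v,
  (forall k, w m k @[m --> \oo] --> v k) -> g (w m) @[m --> \oo] --> g v.

Lemma scont_slsc g : scont g -> slsc (fun v => (g v)%:E).
Proof.
move=> sg w v wv a; rewrite lte_fin => ag.
have := sg _ _ wv => /cvgr_gt/(_ _ ag); apply: filterS => m.
by rewrite lte_fin.
Qed.

(** Indicators of this kind occur in the definition of the essential supremum; the set is open along
    convergent sequences. *)
Lemma scont_slsc_gt g (M : R) : scont g ->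
  slsc (fun v => (if M < g v then 1 else 0)%:E).
Proof.
move=> sg w v wv a; case: ifP => Mg; rewrite lte_fin => a1.
  have := sg _ _ wv => /cvgr_gt/(_ _ Mg); apply: filterS => m ->.
  by rewrite lte_fin.
by near=> m; case: ifP => _; rewrite lte_fin// (lt_trans a1).
Unshelve. all: by end_near. Qed.

Lemma iint_le G H n v : nneg G -> slsc G -> slsc H ->
  (forall v, G v <= H v)%E -> (iint n G v <= iint n H v)%E.
Proof.
move=> G0 sG sH GH; have H0 : nneg H by move=> u; exact: le_trans (GH u).
elim: n v => [//|n IH] v; rewrite !iintS; apply: ge0_le_integral => //.
- by move=> y _; exact: nneg_iint.
- exact: iint_measurable.
- exact: iint_measurable.
Qed.

Lemma iintD G H n v : nneg G -> nneg H -> slsc G -> slsc H ->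
  (iint n (fun v => G v + H v) v = iint n G v + iint n H v)%E.
Proof.
move=> G0 H0 sG sH; elim: n v => [//|n IH] v; rewrite !iintS.
under eq_integral do rewrite IH.
rewrite ge0_integralD//; [by move=> y _; exact: nneg_iint|
  exact: iint_measurable|by move=> y _; exact: nneg_iint|
  exact: iint_measurable].
Qed.

Lemma iintZ (c : R) G n v : 0 <= c -> nneg G -> slsc G ->
  (iint n (fun v => c%:E * G v) v = c%:E * iint n G v)%E.
Proof.
move=> c0 G0 sG; elim: n v => [//|n IH] v; rewrite !iintS.
under eq_integral do rewrite IH.
by rewrite ge0_integralZl//; [exact: iint_measurable|
  move=> y _; exact: nneg_iint].
Qed.

Lemma iint_series (F : nat -> (nat -> R) -> \bar R) n v :
  (forall i, nneg (F i)) -> (forall i, slsc (F i)) ->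
  (iint n (fun v => \sum_(0 <= i <oo) F i v) v = \sum_(0 <= i <oo) iint n (F i) v)%E.
Proof.
move=> F0 sF; elim: n v => [//|n IH] v; rewrite !iintS.
under eq_integral do rewrite IH.
rewrite integral_nneseries//.
- by move=> i; exact: iint_measurable.
- by move=> i y _; exact: nneg_iint.
Qed.

Lemma iint_aff G (s c : nat -> R) n v : (forall k, 0 < s k) -> nneg G -> slsc G ->
  (iint n (fun v => G (aff s c v)) v =
   (\prod_(k < n) (s k)^-1)%:E * iint n G (aff s c v))%E.
Proof.
move=> s0 G0 sG; elim: n v => [|n IH] v; first by rewrite big_ord0 mul1e.
have m1 v' : measurable_fun setT (fun y => iint n G (upd v' n y)).
  exact: iint_measurable.
rewrite !iintS; under eq_integral do rewrite IH aff_upd.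
rewrite ge0_integralZl//; last 3 first.
- apply: (measurableT_comp (m1 _)) => //.
  by apply: measurable_funD => //; apply: measurable_funM.
- by move=> y _; exact: nneg_iint.
- by rewrite lee_fin prodr_ge0// => k _; rewrite invr_ge0 ltW.
rewrite (integral_affine (c n) (s0 n) (m1 _)) big_ord_recr/= EFinM.
by rewrite muleA.
Qed.

End slsc.

(** * Smooth symbols and their kernels *)

Section mean_value.
Context {R : realType}.
Implicit Types (f df : R -> R).

Lemma is_derive_continuous f df : (forall x : R, is_derive x 1 f (df x)) -> continuous f.
Proof.
move=> fd x; apply: differentiable_continuous; apply/derivable1_diffP.
by have [] := fd x.
Qed.

Lemma mvt f df (a b : R) : (forall x : R, is_derive x 1 f (df x)) ->
  exists2 c, `|c - a| <= `|b - a| & f b - f a = df c * (b - a).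
Proof.
move=> fd; have fc := is_derive_continuous fd.
have [ab|/ltW ba] := leP a b.
  have [c + E] := MVT_segment ab (fun x _ => fd x) (continuous_subspaceT fc).
  rewrite in_itv/= => /andP[ac cb]; exists c => //.
  by rewrite !ger0_norm ?subr_ge0// lerD2r.
have [c + E] := MVT_segment ba (fun x _ => fd x) (continuous_subspaceT fc).
rewrite in_itv/= => /andP[bc ca]; exists c.
  by rewrite !ler0_norm ?subr_le0// lerN2 lerD2r.
by rewrite -[LHS]opprB E -mulrN opprB.
Qed.

Lemma mvt_le f df (L : R) (a b : R) : (forall x : R, is_derive x 1 f (df x)) ->
  (forall x, `|df x| <= L) -> `|f b - f a| <= L * `|b - a|.
Proof.
move=> fd dL; have [c _ ->] := mvt a b fd.
by rewrite normrM ler_wpM2r.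
Qed.

Lemma sin_lip (x y : R) : `|sin x - sin y| <= `|x - y|.
Proof.
rewrite -[leRHS]mul1r; apply: (@mvt_le _ cos) => z.
by rewrite cos_max.
Qed.

Lemma cos_taylor (a b : R) : `|cos (a + b) - cos a + b * sin a| <= b ^+ 2.
Proof.
have [c ca E] := @mvt (@cos R) (fun x => - sin x) a (a + b) (fun x => is_derive_cos x).
rewrite E addrAC subrr add0r mulNr mulrC addrC -mulrBr normrM.
rewrite -(ger0_norm (sqr_ge0 b)) expr2 normrM ler_wpM2l// (le_trans (sin_lip _ _))// distrC.
by rewrite (le_trans ca)// addrAC subrr add0r.
Qed.

End mean_value.

(** * Calculus of smooth functions on R^d *)

Section smooth.
Context {R : realType} {d : nat}.
Notation Rd := 'rV[R]_d.
Implicit Types (f g : Rd -> R) (i : 'I_d).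

Definition D i f : Rd -> R := fun x => 'D_(evec R i) f x.

(** [pder] adds derivatives on the outside, [Sm] takes them from the inside; the second order lets
    the rules for products and affine substitutions go through by induction on [n]. *)
Fixpoint Sm n f : Prop :=
  (forall x, differentiable f x) /\
  (if n is n'.+1 then forall i, Sm n' (D i f) else True).

Lemma pder_rcons s i f : pder (rcons s i) f = pder s (D i f).
Proof. by elim: s => [//|j s IH] /=; rewrite IH. Qed.

Lemma smoothP f : smooth f <-> forall n, Sm n f.
Proof.
split.
  move=> fs n; elim: n f fs => [|n IH] f fs.
    by split => // x; exact: (fs [::]).
  split=> [x|i]; first exact: (fs [::]).
  by apply: IH => s x; rewrite -pder_rcons; exact: fs.
move=> fn s; have := fn (size s); elim/last_ind: s f {fn} => [|s i IH] f.
  by case.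
by rewrite size_rcons pder_rcons => -[_ /(_ i)]; exact: IH.
Qed.

Lemma SmW n f : Sm n.+1 f -> Sm n f.
Proof.
elim: n f => [|n IH] f [df H]; first by split.
by split => // i; exact: IH.
Qed.

(** Coinduction principle: for families closed under differentiation, such as multiples of shifted
    cosines, no formula for higher derivatives is needed. *)
Lemma smooth_class (P : (Rd -> R) -> Prop) :
  (forall f, P f -> (forall x, differentiable f x) /\ forall i, P (D i f)) ->
  forall f, P f -> smooth f.
Proof.
move=> H f Pf; apply/smoothP => n; elim: n f Pf => [|n IH] f /H[df Pi].
  by split.
by split => // i; exact: IH.
Qed.

Lemma smooth_diff f x : smooth f -> differentiable f x.
Proof. by move=> /(_ [::]); exact. Qed.

Lemma smooth_D i f : smooth f -> smooth (D i f).
Proof. by move=> fs s x; rewrite -pder_rcons; exact: fs. Qed.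

Lemma DD i f g x : differentiable f x -> differentiable g x ->
  D i (fun x => f x + g x) x = D i f x + D i g x.
Proof. by move=> df dg; apply: deriveD; exact: diff_derivable. Qed.

Lemma DM i f g x : differentiable f x -> differentiable g x ->
  D i (fun x => f x * g x) x = f x * D i g x + g x * D i f x.
Proof. by move=> df dg; rewrite /D deriveM//; exact: diff_derivable. Qed.

Lemma Sm_ext n f g : f =1 g -> Sm n f -> Sm n g.
Proof. by move=> /funext ->. Qed.

Lemma SmD n f g : Sm n f -> Sm n g -> Sm n (fun x => f x + g x).
Proof.
elim: n f g => [|n IH] f g [df Hf] [dg Hg]; split => //.
- by move=> x; exact: differentiableD.
- by move=> x; exact: differentiableD.
- move=> i; apply: (@Sm_ext _ (fun x => D i f x + D i g x)); last exact: IH (Hf i) (Hg i).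
  by move=> x; rewrite DD.
Qed.

Lemma SmM n f g : Sm n f -> Sm n g -> Sm n (fun x => f x * g x).
Proof.
elim: n f g => [|n IH] f g [df Hf] [dg Hg]; split => //.
- by move=> x; exact: differentiableM.
- by move=> x; exact: differentiableM.
- move=> i; apply: (@Sm_ext _ (fun x => f x * D i g x + g x * D i f x)).
    by move=> x; rewrite DM.
  apply: SmD; [exact: IH (SmW (conj df Hf)) (Hg i)|exact: IH (SmW (conj dg Hg)) (Hf i)].
Qed.

Lemma smoothM f g : smooth f -> smooth g -> smooth (fun x => f x * g x).
Proof. by move=> /smoothP fs /smoothP gs; apply/smoothP => n; exact: SmM. Qed.

Lemma smoothD f g : smooth f -> smooth g -> smooth (fun x => f x + g x).
Proof. by move=> /smoothP fs /smoothP gs; apply/smoothP => n; exact: SmD. Qed.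

Lemma smooth_cst (c : R) : smooth (fun _ : Rd => c).
Proof.
apply: (smooth_class (P := fun f => exists c, f = cst c)); last by exists c.
move=> _ [k ->]; split=> [x|i]; first exact: differentiable_cst.
by exists 0; apply/funext => x; rewrite /D derive_cst.
Qed.

Lemma smoothZ (c : R) f : smooth f -> smooth (fun x => c * f x).
Proof. by apply: smoothM; exact: smooth_cst. Qed.

Definition sm1 (h : R -> R) := forall n x, derivable (derive1n n h) x 1.

Lemma sm1_derive1 h : sm1 h -> sm1 h^`()%classic.
Proof. by move=> hs n x; rewrite -derive1Sn; exact: hs. Qed.

Lemma D_coord (h : R -> R) i j (x : Rd) : derivable h (x 0 j) 1 ->
  D i (fun x => h (x 0 j)) x = (i == j)%:R * h^`()%classic (x 0 j).
Proof.
move=> dh; have dc := differentiable_coord x 0 j.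
have dh' : differentiable h (x 0 j) by exact/derivable1_diffP.
rewrite /D deriveE; last exact: (differentiable_comp dc dh').
rewrite (diff_comp dc dh')/= diff1E//.
rewrite -(deriveE _ dc) /evec.
have -> : 'D_(delta_mx 0 i) (fun N : Rd => N 0 j) x = (i == j)%:R.
  rewrite deriveE//.
  pose cj : Rd -> R := fun N => N 0 j.
  have -> : (i == j)%:R = 'd cj x (delta_mx 0 i); last by [].
  have lcj : linear cj by move=> a u v; rewrite /cj !mxE.
  pose L : {linear Rd -> R} := HB.pack cj (GRing.isLinear.Build _ _ _ _ cj lcj).
  rewrite (@diff_lin _ _ _ L); last exact: coord_continuous.
  by rewrite /L/= /cj !mxE eqxx eq_sym.
by [].
Qed.

Lemma differentiable_coordM (h : R -> R) j (x : Rd) : derivable h (x 0 j) 1 ->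
  differentiable (fun x : Rd => h (x 0 j)) x.
Proof.
move=> dh; apply: (@differentiable_comp _ _ _ _ (fun x : Rd => x 0 j) h).
  exact: differentiable_coord.
exact/derivable1_diffP.
Qed.

Lemma smooth_coord h j : sm1 h -> smooth (fun x : Rd => h (x 0 j)).
Proof.
move=> hs; apply/smoothP => n; elim: n h hs => [|n IH] h hs.
  by split => // x; apply: differentiable_coordM; exact: (hs 0%N).
split=> [x|i]; first by apply: differentiable_coordM; exact: (hs 0%N).
apply: (@Sm_ext _ (fun x => (i == j)%:R * h^`()%classic (x 0 j))).
  by move=> x; rewrite D_coord//; exact: (hs 0%N).
apply: SmM; last by apply: IH; exact: sm1_derive1.
by have /smoothP := smooth_cst (i == j)%:R; exact.
Qed.

Lemma derivable_line f (x v : Rd) (t : R) : differentiable f (x + t *: v) ->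
  is_derive t 1 (fun t => f (x + t *: v)) ('D_v f (x + t *: v)).
Proof.
move=> df; have := diff_derivable (v := v) df; rewrite /derivable => cf.
have E : (fun h : R => h^-1 *: (((fun t => f (x + t *: v)) \o shift t) (h *: 1) - f (x + t *: v))) =
   (fun h : R => h^-1 *: ((f \o shift (x + t *: v)) (h *: v) - f (x + t *: v))).
  apply/funext => h /=; rewrite [h *: 1]mulr1 scalerDl addrA.
  by rewrite [h *: v + _]addrC addrAC.
split; first by rewrite /derivable E.
by rewrite /derive E.
Qed.

Lemma differentiable_affine f (a : R) (b : Rd) x : (forall x, differentiable f x) ->
  differentiable (fun x => f (a *: x + b)) x.
Proof.
move=> df; pose g : Rd -> Rd := fun x => a *: x + b.
have dg y : differentiable g y by apply: differentiableD.
exact: (@differentiable_comp _ _ _ _ g f).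
Qed.

Lemma D_affine i f (a : R) (b : Rd) x : (forall x, differentiable f x) ->
  D i (fun x => f (a *: x + b)) x = a * D i f (a *: x + b).
Proof.
move=> df; pose g : Rd -> Rd := fun x => a *: x + b.
have dfg y : differentiable (f \o g) y by exact: differentiable_affine.
rewrite /D.
have E : (fun t : R => (f \o g) (x + t *: evec R i)) =
  (fun t : R => f (a *: x + b + t *: (a *: evec R i))).
  apply/funext => t /=; rewrite /g; congr f.
  by rewrite scalerDr addrAC !scalerA [t * a]mulrC.
have := @derivable_line (f \o g) x (evec R i) 0 (dfg _).
rewrite scale0r addr0 => H1.
have := @derivable_line f (a *: x + b) (a *: evec R i) 0 (df _).
rewrite scale0r addr0 => H2.
have -> : 'D_(evec R i) (fun x => f (a *: x + b)) x =
          'D_(a *: evec R i) f (a *: x + b).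
  by have := @derive_val _ _ _ _ _ _ _ H1; rewrite E (@derive_val _ _ _ _ _ _ _ H2) => <-.
by rewrite !deriveE// linearZ.
Qed.

Lemma smooth_affine f (a : R) (b : Rd) : smooth f -> smooth (fun x => f (a *: x + b)).
Proof.
move=> /smoothP fs; apply/smoothP => n; have := fs n; elim: n f {fs} => [|n IH] f [df Hf].
  by split => // x; exact: differentiable_affine.
split=> [x|i]; first exact: differentiable_affine.
apply: (@Sm_ext _ (fun x => a * D i f (a *: x + b))).
  by move=> x; rewrite D_affine.
apply: SmM; last exact: IH (Hf i).
by have /smoothP := smooth_cst a; exact.
Qed.

End smooth.

(** * Integration over R^d of Lipschitz functions of bounded support *)

Section clip.
Context {R : realType} {d : nat}.
Notation Rd := 'rV[R]_d.
Implicit Types (h : Rd -> R) (i : 'I_d).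

Definition clip (A L M : R) h :=
  [/\ forall x, `|h x| <= M,
     forall x i (t : R), `|h (x + t *: evec R i) - h x| <= L * `|t| &
     forall (x : Rd) i, A < `|x 0 i| -> h x = 0].

Definition rowv (v : nat -> R) : Rd := \row_(i < d) v i.

Definition RI h : R := fine (intRd (fun x => (h x)%:E)).

Lemma rowv_upd v i y : rowv (upd v i y) = rowv v + (y - v i) *: evec R i.
Proof.
apply/rowP => j; rewrite !mxE eqxx/= /upd.
case: (eqVneq (j : nat) i) => [/val_inj ->|ji]; first by rewrite eqxx mulr1 addrC subrK.
by rewrite (negbTE (contra_neq (@congr1 _ _ val _ _) ji)) mulr0 addr0.
Qed.

Lemma rowv_upd_ge v k y : (d <= k)%N -> rowv (upd v k y) = rowv v.
Proof.
move=> dk; apply/rowP => j; rewrite !mxE /upd ifF//.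
by apply/eqP => jk; have := ltn_ord j; rewrite jk ltnNge dk.
Qed.

Lemma clip_LC A L M h : 0 <= L -> clip A L M h ->
  LC 0 d A L M (fun v => h (rowv v)).
Proof.
move=> L0 [hM hL hA]; split => [v|v k y|v k /= kd Ak].
- exact: hM.
- have [kd|dk] := ltnP k d; last by rewrite rowv_upd_ge// subrr normr0 mulr_ge0.
  by rewrite -[k]/(nat_of_ord (Ordinal kd)) rowv_upd hL.
- by apply: (hA _ (Ordinal kd)); rewrite mxE.
Qed.

Lemma RIE h : RI h = rint d (fun v => h (rowv v)) (fun _ => 0).
Proof. by []. Qed.

Lemma clip_le A L M A' L' M' h : A <= A' -> L <= L' -> M <= M' ->
  clip A L M h -> clip A' L' M' h.
Proof.
move=> AA LL MM [hM hL hA]; split => [x|x i t|x i Ax].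
- exact: le_trans (hM x) _.
- by apply: le_trans (hL x i t) _; rewrite ler_wpM2r.
- by apply: hA; exact: le_lt_trans Ax.
Qed.

Lemma clip_ge0 A L M h : clip A L M h -> 0 <= M.
Proof. by move=> [hM _ _]; exact: le_trans (hM 0). Qed.

Lemma clip_norm A L M h : clip A L M h -> clip `|A| `|L| M h.
Proof. by apply: clip_le => //; exact: ler_norm. Qed.

Lemma RI_le A L M h : 0 <= A -> clip A L M h -> `|RI h| <= (2 * A) ^+ d * M.
Proof.
move=> A0 /(clip_le (lexx A) (ler_norm L) (lexx M)) hc; rewrite RIE.
by have [_ [+ _ _]] := rint_spec A0 (clip_LC (normr_ge0 L) hc) (leqnn d); exact.
Qed.

Lemma RI_lin A L M A' L' M' h g (c : R) : clip A L M h -> clip A' L' M' g ->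
  RI (fun x => c * h x + g x) = c * RI h + RI g.
Proof.
move=> hc gc; rewrite !RIE.
have B0 : 0 <= `|A| + `|A'| by rewrite addr_ge0.
have h1 : clip (`|A| + `|A'|) `|L| M h.
  apply: clip_le hc; rewrite ?ler_norm//.
  by rewrite (le_trans (ler_norm _))// lerDl.
have g1 : clip (`|A| + `|A'|) `|L'| M' g.
  apply: clip_le gc; rewrite ?ler_norm//.
  by rewrite (le_trans (ler_norm _))// lerDr.
exact: (rint_lin c _ B0 (clip_LC (normr_ge0 _) h1) (clip_LC (normr_ge0 _) g1)).
Qed.

Lemma norm_coord (x : Rd) i : `|x 0 i| <= `|x|.
Proof.
rewrite [leRHS]/Num.norm/= mx_normrE; apply/bigmax_geP; right.
by exists (0, i).
Qed.

Lemma norm_le_coord (x : Rd) (B : R) : 0 <= B -> (forall i, `|x 0 i| <= B) -> `|x| <= B.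
Proof.
move=> B0 xB; rewrite [leLHS]/Num.norm/= mx_normrE; apply: bigmax_le => //.
by move=> [j i] _ /=; rewrite ord1.
Qed.

Definition cl h := exists A L M, clip A L M h.

Lemma clip_bound A M h : (forall x, `|h x| <= M) ->
  (forall (x : Rd) i, A < `|x 0 i| -> h x = 0) -> cl h -> exists L, clip A L M h.
Proof. by move=> hM hA [_ [L [_ [_ hL _]]]]; exists L. Qed.

Lemma RI_bound A M h : 0 <= A -> (forall x, `|h x| <= M) ->
  (forall (x : Rd) i, A < `|x 0 i| -> h x = 0) -> cl h ->
  `|RI h| <= (2 * A) ^+ d * M.
Proof. by move=> A0 hM hA /(clip_bound hM hA)[L]; exact: RI_le. Qed.

Lemma RI_linear h g (c : R) : cl h -> cl g ->
  RI (fun x => c * h x + g x) = c * RI h + RI g.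
Proof. by move=> [A [L [M hc]]] [A' [L' [M' gc]]]; exact: RI_lin hc gc. Qed.

Definition dscale (s : 'I_d -> R) (x : Rd) : Rd := \row_i (s i * x 0 i).

Lemma cl_dscale s c h : (forall i, 0 < s i) -> cl h ->
  cl (fun x => h (dscale s x + c)).
Proof.
move=> s0 [A [L [M /clip_norm [hM hL hA]]]].
exists (\sum_i ((s i)^-1 * (`|A| + `|c|))), (`|L| * \sum_i s i), M.
split=> [x|x i t|x i Ax]; first exact: hM.
- have -> : dscale s (x + t *: evec R i) + c = (dscale s x + c) + (s i * t) *: evec R i.
    apply/rowP => j; rewrite !mxE eqxx/=.
    have [->|_] := eqVneq j i; last by rewrite !mulr0 !addr0.
    by rewrite !mulr1; ring.
  apply: le_trans (hL _ _ _) _; rewrite -mulrA ler_wpM2l// normrM ler_wpM2r//.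
  rewrite (gtr0_norm (s0 i)) (bigD1 i)//= lerDl sumr_ge0// => j _.
  exact: ltW.
- apply: (hA _ i); rewrite !mxE.
  have : (s i)^-1 * (`|A| + `|c|) < `|x 0 i|.
    apply: le_lt_trans Ax; rewrite (bigD1 i)//= lerDl sumr_ge0// => j _.
    by rewrite mulr_ge0 ?invr_ge0 ?addr_ge0// ltW.
  rewrite mulrC ltr_pdivrMr// => H.
  have := lerB_normD (s i * x 0 i) (c 0 i); apply: lt_le_trans.
  rewrite normrM (gtr0_norm (s0 i)) mulrC ltrBrDr.
  by apply: le_lt_trans H; rewrite lerD2l norm_coord.
Qed.

Definition ext (e : R) (s : 'I_d -> R) (k : nat) : R :=
  if insub k is Some i then s i else e.

Lemma extE e s i : ext e s i = s i.
Proof. by rewrite /ext valK. Qed.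

Lemma rowv_aff (s : 'I_d -> R) (c : Rd) v :
  rowv (aff (ext 1 s) (ext 0 (c 0)) v) = dscale s (rowv v) + c.
Proof. by apply/rowP => i; rewrite !mxE /aff !extE. Qed.

Lemma ext_gt0 s k : (forall i, 0 < s i) -> 0 < ext 1 s k.
Proof. by move=> s0; rewrite /ext; case: insubP. Qed.

Lemma cl_ge0 h : cl h -> exists A L M, [/\ 0 <= A, 0 <= L & clip A L M h].
Proof.
by move=> [A [L [M /clip_norm hc]]]; exists `|A|, `|L|, M; split.
Qed.

(* The base point of [intRd] is moved by the affine map; a rint over all
   variables does not depend on it. *)
Lemma rint_base h u v : rint d (fun v => h (rowv v)) u = rint d (fun v => h (rowv v)) v.
Proof.
rewrite /rint; congr fine.
suff H n u' v' : (n <= d)%N -> (forall k, (n <= k < d)%N -> u' k = v' k) ->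
    iint n (fun v => (h (rowv v))%:E) u' = iint n (fun v => (h (rowv v))%:E) v'.
  by apply: H => // k /andP[dk kd]; move: dk; rewrite leqNgt kd.
elim: n u' v' => [|n IH] u' v' nd uv /=.
  by congr EFin; congr h; apply/rowP => i; rewrite !mxE uv/=.
apply: eq_integral => y _; apply: IH; first exact: ltnW.
move=> k /andP[nk kd]; case: eqP => // /eqP kn.
by rewrite uv// kd andbT ltn_neqAle eq_sym kn.
Qed.

Lemma RI_affine s c h : (forall i, 0 < s i) -> cl h ->
  RI (fun x => h (dscale s x + c)) = (\prod_i (s i)^-1) * RI h.
Proof.
move=> s0 hc; rewrite !RIE.
have [A' [L' [M' [A'0 L'0 hc']]]] := cl_ge0 (cl_dscale c s0 hc).
have [A [L [M [A0 L0 {}hc]]]] := cl_ge0 hc.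
have E : (fun v => h (dscale s (rowv v) + c)) =
  (fun v => (fun v => h (rowv v)) (aff (ext 1 s) (ext 0 (c 0)) v)).
  by apply/funext => v; rewrite rowv_aff.
have hc'' := clip_LC L'0 hc'.
rewrite E in hc'' *.
rewrite (rint_aff _ A0 (clip_LC L0 hc) (leqnn d) (fun k => ext_gt0 k s0) A'0 hc'').
rewrite (rint_base _ _ (fun=> 0)); congr (_ * _).
by apply: eq_bigr => i _; rewrite extE.
Qed.

Lemma cl_shift c h : cl h -> cl (fun x => h (x + c)).
Proof.
move=> /(cl_dscale c (s := fun=> 1) (fun=> ltr01)).
by congr cl; apply/funext => x; congr h; congr (_ + _); apply/rowP => i; rewrite !mxE mul1r.
Qed.

Lemma RI_shift c h : cl h -> RI (fun x => h (x + c)) = RI h.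
Proof.
move=> /(RI_affine c (s := fun=> 1) (fun=> ltr01)).
rewrite big1 ?mul1r => [<-|i _]; last by rewrite invr1.
by congr RI; apply/funext => x; congr h; congr (_ + _); apply/rowP => i; rewrite !mxE mul1r.
Qed.

Lemma cl_lin h g (c : R) : cl h -> cl g -> cl (fun x => c * h x + g x).
Proof.
move=> [A [L [M hc]]] [A' [L' [M' gc]]].
have {hc} [hM hL hA] : clip (`|A| + `|A'|) L M h.
  by apply: clip_le hc => //; rewrite (le_trans (ler_norm _))// lerDl.
have {gc} [gM gL gA] : clip (`|A| + `|A'|) L' M' g.
  by apply: clip_le gc => //; rewrite (le_trans (ler_norm _))// lerDr.
exists (`|A| + `|A'|), (`|c| * L + L'), (`|c| * M + M'); split => [x|x i t|x i Ax].
- by rewrite (le_trans (ler_normD _ _))// lerD// normrM ler_wpM2l.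
- rewrite opprD addrACA -mulrBr (le_trans (ler_normD _ _))// mulrDl lerD// normrM.
  by rewrite -mulrA ler_wpM2l.
- by rewrite (hA _ _ Ax) (gA _ _ Ax) mulr0 addr0.
Qed.

Definition ccs (psi : Rd -> R) := smooth psi /\
  exists A : R, forall (x : Rd) i, A < `|x 0 i| -> psi x = 0.

Lemma ccs_bounded psi : ccs psi -> exists M, forall x, `|psi x| <= M.
Proof.
move=> [ps [A pA]].
have cK : compact [set v : Rd | forall i, v ord0 i \in `[- A, A]].
  by apply: (@rV_compact _ _ (fun=> `[- A, A]%classic)) => i; exact: segment_compact.
have pc : continuous psi.
  by move=> x; apply: differentiable_continuous; exact: smooth_diff.
have /compact_bounded [M [Mr HM]] := continuous_compact (continuous_subspaceT pc) cK.
exists (`|M| + 1) => x.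
have [H|H] := pselect (forall i, `|x 0 i| <= A).
  apply: HM; first by rewrite (le_lt_trans (ler_norm _))// ltrDl.
  by exists x => //= i; rewrite in_itv/= -ler_norml.
move: H => /existsNP[i /negP]; rewrite -ltNge => /pA ->.
by rewrite normr0 addr_ge0.
Qed.

Lemma D_supp A i j psi (x : Rd) : (forall x : Rd, A < `|x 0 j| -> psi x = 0) ->
  A < `|x 0 j| -> D i psi x = 0.
Proof.
move=> pA Aj; rewrite /D (@near_eq_derive _ _ _ _ (cst 0)) ?derive_cst//.
have cc : {for x, continuous (fun y : Rd => `|y 0 j|)}.
  by apply: continuous_comp; [exact: coord_continuous|exact: norm_continuous].
have /cvgr_gt/(_ _ Aj) := cc; apply: filterS => y /= Ay.
exact: pA Ay.
Qed.

Lemma ccs_D i psi : ccs psi -> ccs (D i psi).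
Proof.
move=> [ps [A pA]]; split; first exact: smooth_D.
by exists A => x j; apply: D_supp => y; exact: pA.
Qed.

Lemma line_lip i psi (L : R) : (forall x, differentiable psi x) ->
  (forall x, `|D i psi x| <= L) ->
  forall x (t : R), `|psi (x + t *: evec R i) - psi x| <= L * `|t|.
Proof.
move=> dp dL x t.
have := @mvt_le _ (fun t => psi (x + t *: evec R i))
  (fun t => D i psi (x + t *: evec R i)) L 0 t.
rewrite scale0r addr0 subr0; apply => // s.
exact: derivable_line.
Qed.

Lemma ccs_cl psi : ccs psi -> cl psi.
Proof.
move=> pc; have [M pM] := ccs_bounded pc.
have H i : exists L, forall x, `|D i psi x| <= L by exact/ccs_bounded/ccs_D.
have [L HL] := choice H.
have [ps [A pA]] := pc.
exists A, (\sum_i `|L i|), M; split => // x i t.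
apply: le_trans (line_lip (i := i) (fun x => smooth_diff x ps) (HL i) _ _) _.
rewrite ler_wpM2r// (le_trans (ler_norm _))// (bigD1 i)//= lerDl.
by rewrite sumr_ge0.
Qed.

Lemma ccsM (s : Rd -> R) psi : smooth s -> ccs psi -> ccs (fun x => s x * psi x).
Proof.
move=> ss [ps [A pA]]; split; first exact: smoothM.
by exists A => x i Ai; rewrite (pA _ _ Ai) mulr0.
Qed.

Lemma ccs_lin (c : R) psi psi' : ccs psi -> ccs psi' ->
  ccs (fun x => c * psi x + psi' x).
Proof.
move=> [ps [A pA]] [ps' [A' pA']]; split.
  by apply: smoothD => //; exact: smoothZ.
exists (`|A| + `|A'|) => x i Ax.
rewrite (pA x i) ?(pA' x i) ?mulr0 ?addr0//.
  by apply: le_lt_trans Ax; rewrite (le_trans (ler_norm _))// lerDr.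
by apply: le_lt_trans Ax; rewrite (le_trans (ler_norm _))// lerDl.
Qed.

(** Translation invariance replaces the fundamental theorem of calculus: [psi (x + t e_i) - psi x]
    has integral zero and differs from [t * D i psi x] by at most [L * t ^ 2], so the integral of
    the derivative is O(t) for every [t] in (0, 1]. *)
Lemma RI_D0 i psi : ccs psi -> RI (D i psi) = 0.
Proof.
move=> pc; have [ps [A0 pA0]] := pc.
pose A := `|A0|; have pA (x : Rd) j : A < `|x 0 j| -> psi x = 0.
  by move=> Ax; apply: (pA0 _ j); apply: le_lt_trans Ax; exact: ler_norm.
have [L HL] := ccs_bounded (ccs_D i (ccs_D i pc)).
have cD := ccs_cl (ccs_D i pc); have cp := ccs_cl pc.
have dp x : differentiable psi x by exact: smooth_diff.
have dDp x : differentiable (D i psi) x by apply: smooth_diff; exact: smooth_D.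
have DA (x : Rd) j : A < `|x 0 j| -> D i psi x = 0.
  by apply: D_supp => y; exact: pA.
have key (t : R) : 0 < t -> t <= 1 -> `|RI (D i psi)| <= (2 * (A + 1)) ^+ d * L * t.
  move=> t0 t1.
  pose H x := (-1) * psi x + psi (x + t *: evec R i).
  pose G x := (- t) * D i psi x + H x.
  have cH : cl H by apply: cl_lin => //; exact: cl_shift.
  have cG : cl G by apply: cl_lin.
  have EG : RI G = - t * RI (D i psi).
    rewrite /G RI_linear// /H RI_linear//; last exact: cl_shift.
    by rewrite RI_shift// mulN1r addNr addr0.
  (* As [t <= 1], the translate is supported within [A + 1]. *)
  have A1 : 0 <= A + 1 by rewrite addr_ge0 ?normr_ge0.
  have : `|RI G| <= (2 * (A + 1)) ^+ d * (L * t ^+ 2).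
    apply: RI_bound => //.
      move=> x.
      have [c ct E] := @mvt _ (fun t => psi (x + t *: evec R i))
        (fun t => D i psi (x + t *: evec R i)) 0 t (fun s => derivable_line (dp _)).
      rewrite /G /H; move: E ct; rewrite scale0r addr0 !subr0 (gtr0_norm t0) => E ct.
      rewrite mulN1r [- psi x + _]addrC E mulNr mulrC addrC -mulrBl normrM (gtr0_norm t0).
      rewrite expr2 mulrA ler_pM2r//.
      apply: le_trans (line_lip (i := i) dDp HL _ _) _.
      by rewrite ler_wpM2l// (le_trans _ (HL 0)).
    move=> x j Ax; rewrite /G /H (DA _ j) ?(pA x j); last 2 first.
      by apply: lt_trans Ax; rewrite ltrDl.
      by apply: lt_trans Ax; rewrite ltrDl.
    rewrite !mulr0 !add0r; apply: (pA _ j); rewrite !mxE eqxx/=.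
    apply: lt_le_trans (lerB_normD _ _); rewrite ltrBrDr.
    apply: le_lt_trans Ax; rewrite lerD2l normrM (gtr0_norm t0).
    by case: eqP => _; rewrite ?normr1 ?mulr1 ?normr0 ?mulr0.
  rewrite EG normrM normrN (gtr0_norm t0) expr2 mulrA [leRHS]mulrA [leLHS]mulrC.
  by rewrite ler_pM2r.
apply/eqP; rewrite -normr_eq0 eq_le normr_ge0 andbT.
apply/ler_addgt0Pl => e e0; rewrite addr0.
set C := (2 * (A + 1)) ^+ d * L in key.
have C0 : 0 <= C.
  have := key 1 ltr01 (lexx _); rewrite mulr1; exact: le_trans.
pose t := Num.min 1 (e / (C + 1)).
have t0 : 0 < t by rewrite lt_min ltr01 divr_gt0// ltr_pwDr.
apply: (le_trans (key t t0 _)); first by rewrite ge_min lexx.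
apply: (@le_trans _ _ ((C + 1) * t)); first by rewrite ler_pM2r// lerDl.
by rewrite mulrC -ler_pdivlMr ?ltr_pwDr// ge_min lexx orbT.
Qed.

End clip.

Section quadratic_diff.
Context {R : realType} {V W : normedModType R}.

(** Explicit quadratic remainders are available for cosines of a scalar product and for integrals of
    them; this turns such remainders into differentials. *)
Lemma diff_of_quadratic (f : V -> W) (df : {linear V -> W}) (x : V) (C : R) :
  (forall h, `|df h| <= C * `|h|) ->
  (forall h, `|f (x + h) - f x - df h| <= C * `|h| ^+ 2) ->
  differentiable f x /\ 'd f x = df :> (V -> W).
Proof.
move=> dC fC.
have cdf : continuous df.
  apply: bounded_linear_continuous; apply/linear_boundedP.
  have := nbhs_pinfty_ge (num_real C); apply: filterS => r Cr h.
  by apply: le_trans (dC h) _; rewrite ler_wpM2r.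
have E : f \o shift x = cst (f x) + df +o_ 0 id.
  apply/eqaddoP => e e0; near=> h.
  have -> : (f \o shift x - (cst (f x) + df)) h = f (x + h) - f x - df h.
    by rewrite !fctE /= [h + x]addrC opprD addrA.
  apply: le_trans (fC h) _; rewrite expr2 mulrA ler_wpM2r//.
  apply: (@le_trans _ _ ((`|C| + 1) * `|h|)).
    by rewrite ler_wpM2r// (le_trans (ler_norm _))// lerDl.
  rewrite mulrC -ler_pdivlMr ?ltr_pwDr//.
  by near: h; apply/nbhs0_le; rewrite divr_gt0// ltr_pwDr.
have dE := diff_unique cdf E; split => //.
apply/diff_locallyP; split; first by rewrite dE.
by rewrite dE; exact: E.
Unshelve. all: by end_near. Qed.

End quadratic_diff.

(** * Calculus of smooth functions of one variable *)

Section sm1_theory.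
Context {R : realType}.
Implicit Types h g : R -> R.

Fixpoint S1 n h : Prop :=
  (forall x, derivable h x 1) /\ (if n is n'.+1 then S1 n' h^`()%classic else True).

Lemma sm1P h : sm1 h <-> forall n, S1 n h.
Proof.
split.
  move=> hs n; elim: n h hs => [|n IH] h hs.
    by split => // x; exact: (hs 0%N).
  split=> [x|]; first exact: (hs 0%N).
  by apply: IH; exact: sm1_derive1.
move=> hn n; have := hn n; elim: n h {hn} => [|n IH] h [dh H] x; first exact: dh.
by rewrite derive1Sn; exact: IH.
Qed.

Lemma S1W n h : S1 n.+1 h -> S1 n h.
Proof.
elim: n h => [|n IH] h [dh H]; first by split.
by split => //; exact: IH.
Qed.

Lemma S1D n h g : S1 n h -> S1 n g -> S1 n (fun x => h x + g x).
Proof.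
elim: n h g => [|n IH] h g [dh Hh] [dg Hg].
  by split; last by []; move=> x; exact: derivableD.
split=> [x|]; first exact: derivableD.
rewrite (_ : _^`()%classic = (fun x => h^`()%classic x + g^`()%classic x)).
  exact: IH.
by apply/funext => x; rewrite !derive1E deriveD.
Qed.

Lemma S1M n h g : S1 n h -> S1 n g -> S1 n (fun x => h x * g x).
Proof.
elim: n h g => [|n IH] h g [dh Hh] [dg Hg].
  by split; last by []; move=> x; exact: derivableM.
split=> [x|]; first exact: derivableM.
rewrite (_ : _^`()%classic = (fun x => h x * g^`()%classic x + g x * h^`()%classic x)).
  apply: S1D; [exact: IH (S1W (conj dh Hh)) Hg|exact: IH (S1W (conj dg Hg)) Hh].
by apply/funext => x; rewrite !derive1E deriveM.
Qed.

Lemma sm1D h g : sm1 h -> sm1 g -> sm1 (fun x => h x + g x).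
Proof. by move=> /sm1P hs /sm1P gs; apply/sm1P => n; exact: S1D. Qed.

Lemma sm1M h g : sm1 h -> sm1 g -> sm1 (fun x => h x * g x).
Proof. by move=> /sm1P hs /sm1P gs; apply/sm1P => n; exact: S1M. Qed.

Lemma sm1_class (P : (R -> R) -> Prop) :
  (forall f, P f -> (forall x, derivable f x 1) /\ P f^`()%classic) ->
  forall f, P f -> sm1 f.
Proof.
move=> H f Pf; apply/sm1P => n; elim: n f Pf => [|n IH] f /H[df Pi].
  by split.
by split => //; exact: IH.
Qed.

Lemma sm1_cst (c : R) : sm1 (fun=> c).
Proof.
apply: (sm1_class (P := fun f => exists c, f = cst c)); last by exists c.
move=> _ [k ->]; split=> [x|]; first exact: derivable_cst.
by exists 0; apply/funext => x; rewrite derive1_cst.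
Qed.

Lemma sm1_id : sm1 (id : R -> R).
Proof.
apply/sm1P => -[|n]; first by split => // x; exact: derivable_id.
split=> [x|]; first exact: derivable_id.
rewrite (_ : (id : R -> R)^`()%classic = fun=> (1 : R)); first by have /sm1P := @sm1_cst 1; exact.
by apply/funext => x; rewrite derive1_id.
Qed.

Lemma sm1Z (c : R) h : sm1 h -> sm1 (fun x => c * h x).
Proof. by apply: sm1M; exact: sm1_cst. Qed.

Lemma derive1_affine h (a b x : R) : (forall x, derivable h x 1) ->
  is_derive x 1 (fun x => h (a * x + b)) (a * h^`()%classic (a * x + b)).
Proof.
move=> dh; have := @is_derive1_comp _ h (fun x => a * x + b) x (h^`()%classic (a * x + b)) a.
rewrite [_ * a]mulrC; apply.
  by rewrite derive1E; exact: derivableP.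
by apply: is_derive_eq; rewrite addr0 /GRing.scale/= mulr1.
Qed.

Lemma sm1_affine h (a b : R) : sm1 h -> sm1 (fun x => h (a * x + b)).
Proof.
move=> hs; apply/sm1P => n; elim: n h hs => [|n IH] h hs.
  by split => // x; have [] := derive1_affine a b x (hs 0%N).
split=> [x|]; first by have [] := derive1_affine a b x (hs 0%N).
rewrite (_ : _^`()%classic = (fun x => a * h^`()%classic (a * x + b))).
  apply: S1M; last by apply: IH; exact: sm1_derive1.
  by have /sm1P := @sm1_cst a; exact.
by apply/funext => x; rewrite derive1E; have [_ ->] := derive1_affine a b x (hs 0%N).
Qed.

Lemma sm1V h : (forall x, h x != 0) -> sm1 h -> sm1 (fun x => (h x)^-1).
Proof.
move=> h0 hs; apply/sm1P => n.
have dV x : derivable (fun x => (h x)^-1) x 1 by apply: derivableV => //; exact: (hs 0%N).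
have E : (fun x => (h x)^-1)^`()%classic =
    (fun x => (h x)^-1 * ((h x)^-1 * (-1 * h^`()%classic x))).
  apply/funext => x; rewrite !derive1E deriveV//; last exact: (hs 0%N).
  by rewrite /GRing.scale/= expr2 invfM; ring.
elim: n => [|n IH]; first by split.
split => //; rewrite E; apply: S1M => //; apply: S1M => //.
by have /sm1P := @sm1Z (-1) _ (sm1_derive1 hs); exact.
Qed.

Lemma sm1_trig (a b : R) : sm1 (fun x => a * cos x + b * sin x).
Proof.
apply: (sm1_class (P := fun f => exists a b, f = fun x => a * cos x + b * sin x)).
  move=> _ [c [e ->]]; split=> [x|].
    by apply: derivableD; apply: derivableM.
  exists e, (- c); apply/funext => y; rewrite derive1E.
  rewrite (@derive_val _ _ _ _ _ _ _ (_ : is_derive y (1 : R) (fun x => c * cos x + e * sin x) (e * cos y + (- c) * sin y)))//.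
  apply: is_derive_eq.
  by rewrite /GRing.scale/= mulrN addrC mulNr.
by exists a, b.
Qed.

Lemma sm1_cos (a b : R) : sm1 (fun x => cos (a * x + b)).
Proof.
apply: (@sm1_affine cos a b); have := @sm1_trig 1 0; congr sm1.
by apply/funext => x; rewrite mul1r mul0r addr0.
Qed.

Lemma sm1_sin (a b : R) : sm1 (fun x => sin (a * x + b)).
Proof.
apply: (@sm1_affine sin a b); have := @sm1_trig 0 1; congr sm1.
by apply/funext => x; rewrite mul1r mul0r add0r.
Qed.

End sm1_theory.

Section RI_more.
Context {R : realType} {d : nat}.
Notation Rd := 'rV[R]_d.
Implicit Types h g : Rd -> R.

Lemma cl0 : cl (fun _ : Rd => 0 : R).
Proof. by exists 0, 0, 0; split => *; rewrite ?subrr ?normr0 ?mul0r. Qed.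

Lemma RI0 : RI (fun _ : Rd => 0 : R) = 0.
Proof.
have E : (fun _ : Rd => 0 : R) = (fun _ : Rd => -1 * 0 + 0).
  by apply/funext => x; rewrite mulr0 addr0.
by rewrite E RI_linear ?mulN1r ?addNr//; exact: cl0.
Qed.

Lemma clZ (c : R) h : cl h -> cl (fun x => c * h x).
Proof.
move=> /(cl_lin c) /(_ cl0); congr cl.
by apply/funext => x; rewrite addr0.
Qed.

Lemma RIZ (c : R) h : cl h -> RI (fun x => c * h x) = c * RI h.
Proof.
move=> /(RI_linear c) /(_ cl0); rewrite RI0 addr0 => <-.
by congr RI; apply/funext => x; rewrite addr0.
Qed.

Lemma RID h g : cl h -> cl g -> RI (fun x => h x + g x) = RI h + RI g.
Proof.
move=> ch cg; have := RI_linear 1 ch cg; rewrite mul1r => <-.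
by congr RI; apply/funext => x; rewrite mul1r.
Qed.

Lemma clD h g : cl h -> cl g -> cl (fun x => h x + g x).
Proof.
move=> ch cg; have := cl_lin 1 ch cg; congr cl.
by apply/funext => x; rewrite mul1r.
Qed.

Lemma clB h g : cl h -> cl g -> cl (fun x => h x - g x).
Proof.
move=> ch cg; have := cl_lin (-1) cg ch; congr cl.
by apply/funext => x; rewrite mulN1r addrC.
Qed.

Lemma RIB h g : cl h -> cl g -> RI (fun x => h x - g x) = RI h - RI g.
Proof.
move=> ch cg; have := RI_linear (-1) cg ch; rewrite mulN1r addrC => <-.
by congr RI; apply/funext => x; rewrite mulN1r addrC.
Qed.

End RI_more.

(** * Oscillatory integrals with a phase *)

Section Jint.
Context {R : realType} {d : nat}.
Notation Rd := 'rV[R]_d.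
Implicit Types (psi : Rd -> R) (i : 'I_d) (z xi : Rd) (w : R).

Lemma dotRdDl z z' xi : dotRd (z + z') xi = dotRd z xi + dotRd z' xi.
Proof. by rewrite /dotRd -big_split/=; apply: eq_bigr => i _; rewrite mxE mulrDl. Qed.

Lemma dotRdZl (a : R) z xi : dotRd (a *: z) xi = a * dotRd z xi.
Proof. by rewrite /dotRd big_distrr/=; apply: eq_bigr => i _; rewrite mxE mulrA. Qed.

Lemma dotRdC z xi : dotRd z xi = dotRd xi z.
Proof. by apply: eq_bigr => i _; rewrite mulrC. Qed.

Lemma dotRdDr z xi xi' : dotRd z (xi + xi') = dotRd z xi + dotRd z xi'.
Proof. by rewrite dotRdC dotRdDl !(dotRdC z). Qed.

Lemma dotRd_evec i xi : dotRd (evec R i) xi = xi 0 i.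
Proof.
rewrite /dotRd (bigD1 i)//= big1 ?addr0; last first.
  by move=> j ji; rewrite mxE eqxx (negbTE ji) mul0r.
by rewrite mxE !eqxx mul1r.
Qed.

Lemma dotRd_le z xi : `|dotRd z xi| <= d%:R * (`|z| * `|xi|).
Proof.
rewrite (le_trans (ler_norm_sum _ _ _))//.
rewrite (@le_trans _ _ (\sum_(i < d) `|z| * `|xi|))//.
  by apply: ler_sum => i _; rewrite normrM ler_pM// norm_coord.
by rewrite sumr_const card_ord mulr_natl.
Qed.

Lemma smooth_dot z : smooth (fun xi => dotRd z xi).
Proof.
rewrite /dotRd; elim: (index_enum _) => [|i s IH].
  by under eq_fun do rewrite big_nil; exact: smooth_cst.
under eq_fun do rewrite big_cons.
apply: smoothD => //; apply: smoothZ.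
exact: (@smooth_coord R d id i (@sm1_id R)).
Qed.

Lemma cos_dot_diff z w xi : differentiable (fun xi => cos (dotRd z xi + w)) xi /\
  forall i, D i (fun xi => cos (dotRd z xi + w)) xi = z 0 i * cos (dotRd z xi + (w + pi / 2)).
Proof.
have ldot : linear (dotRd z : Rd -> R).
  by move=> a u v; rewrite dotRdDr [dotRd z (a *: u)]dotRdC dotRdZl dotRdC.
pose df : Rd -> R := fun h => dotRd z h * (- sin (dotRd z xi + w)).
have ldf : linear df.
  by move=> a u v; rewrite /df ldot mulrDl scalerAl.
pose Ldf : {linear Rd -> R} := HB.pack df (GRing.isLinear.Build _ _ _ _ df ldf).
have [] := @diff_of_quadratic _ _ _ (fun xi => cos (dotRd z xi + w)) Ldf xi
  (d%:R * `|z| + (d%:R * `|z|) ^+ 2).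
- move=> h; rewrite /= /df normrM normrN.
  apply: (@le_trans _ _ (d%:R * `|z| * `|h|)).
    rewrite -[leRHS]mulr1; apply: ler_pM => //; last exact: sin_max.
    by rewrite -mulrA dotRd_le.
  by rewrite ler_wpM2r// lerDl sqr_ge0.
- move=> h /=; rewrite /df dotRdDr [_ + w]addrAC mulrN opprK.
  apply: le_trans (cos_taylor _ _) _.
  apply: (@le_trans _ _ ((d%:R * `|z|) ^+ 2 * `|h| ^+ 2)).
    by rewrite -exprMn -[leLHS]real_normK ?num_real// lerXn2r ?nnegrE ?mulr_ge0// -mulrA dotRd_le.
  by rewrite ler_wpM2r ?sqr_ge0// lerDr mulr_ge0.
move=> dc dE; split => // i; rewrite /D deriveE// dE /= /df.
by rewrite dotRdC dotRd_evec addrA cosDpihalf.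
Qed.

Lemma smooth_cos_dot z w : smooth (fun xi => cos (dotRd z xi + w)).
Proof.
apply: (smooth_class (P := fun f => exists (c : R) w, f = fun xi => c * cos (dotRd z xi + w))).
  move=> _ [c [w' ->]].
  have dc x := (cos_dot_diff z w' x).1; split=> [x|i].
    exact: differentiableM.
  exists (c * z 0 i), (w' + pi / 2); apply/funext => x.
  rewrite (@DM _ _ _ (fun=> c)) => [|//|//].
  by rewrite (cos_dot_diff z w' x).2 /D derive_cst mulr0 addr0 mulrA.
by exists 1, w; apply/funext => x; rewrite mul1r.
Qed.

(** Real part of [e^{iw}] times the integral of [psi(xi) e^{i z.xi}]; the phases 0 and [- (pi / 2)]
    give the real and the imaginary part, so one real quantity carries the complex kernel. *)
Definition J psi z w : R := RI (fun xi => psi xi * cos (dotRd z xi + w)).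

Lemma cl_cos psi z w : ccs psi -> cl (fun xi => psi xi * cos (dotRd z xi + w)).
Proof.
move=> pc; apply: ccs_cl; under eq_fun do rewrite mulrC.
by apply: ccsM => //; exact: smooth_cos_dot.
Qed.

Lemma J_lin (c : R) psi psi' z w : ccs psi -> ccs psi' ->
  J (fun xi => c * psi xi + psi' xi) z w = c * J psi z w + J psi' z w.
Proof.
move=> pc pc'; rewrite /J -RI_linear; [|exact: cl_cos|exact: cl_cos].
by congr RI; apply/funext => xi; rewrite mulrDl mulrA.
Qed.

Lemma J_ext psi psi' z w : psi =1 psi' -> J psi z w = J psi' z w.
Proof. by move=> /funext ->. Qed.

Lemma J_le psi A M z w : 0 <= A -> ccs psi -> (forall xi, `|psi xi| <= M) ->
  (forall xi i, A < `|xi 0 i| -> psi xi = 0) -> `|J psi z w| <= (2 * A) ^+ d * M.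
Proof.
move=> A0 pc pM pA; apply: RI_bound => //.
- move=> x; rewrite normrM -[leRHS]mulr1 ler_pM// ?pM//; exact: cos_max.
- by move=> x i Ax; rewrite (pA _ _ Ax) mul0r.
- exact: cl_cos.
Qed.

Lemma J_phase psi z w : ccs psi ->
  J psi z w = cos w * J psi z 0 - sin w * J psi z (- (pi / 2)).
Proof.
move=> pc; rewrite /J -mulNr -(RIZ (cos w) (cl_cos z 0 pc)) -(RIZ _ (cl_cos z _ pc)).
rewrite -RID; [|exact/clZ/cl_cos|exact/clZ/cl_cos].
congr RI; apply/funext => xi; rewrite addr0 cosD cosB cos_pihalf sin_pihalf; ring.
Qed.

(** The product formula for cosines; the phase shift [b] enters with opposite signs in the two
    translates. *)
Lemma J_mod psi i z w (t b : R) : ccs psi ->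
  J (fun xi => cos (t * xi 0 i + b) * psi xi) z w =
  (J psi (z + t *: evec R i) (w + b) + J psi (z - t *: evec R i) (w - b)) / 2.
Proof.
move=> pc; rewrite /J -RID; [|exact: cl_cos|exact: cl_cos].
rewrite [RHS]mulrC -RIZ; last by apply: clD; exact: cl_cos.
congr RI; apply/funext => xi; rewrite !dotRdDl -scaleNr !dotRdZl !dotRd_evec.
have -> : dotRd z xi + t * xi 0 i + (w + b) = (dotRd z xi + w) + (t * xi 0 i + b) by ring.
have -> : dotRd z xi + - t * xi 0 i + (w - b) = (dotRd z xi + w) - (t * xi 0 i + b) by ring.
by rewrite [cos (_ + _ + (_ + _))]cosD [cos (_ + _ - _)]cosB; field.
Qed.

Lemma J_translate psi (l : Rd) z w : ccs psi ->
  J (fun xi => psi (xi - l)) z w = J psi z (w + dotRd z l).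
Proof.
move=> pc; rewrite /J -(RI_shift (- l) (cl_cos z (w + dotRd z l) pc)).
congr RI; apply/funext => xi; congr (_ * cos _).
by rewrite dotRdDr -(scaleN1r l) (dotRdC z (_ *: _)) dotRdZl (dotRdC l); ring.
Qed.

Lemma dotRd_dscale (s : 'I_d -> R) z xi : dotRd (dscale s z) xi = dotRd z (dscale s xi).
Proof. by apply: eq_bigr => i _; rewrite !mxE; ring. Qed.

Lemma J_dscale (s : 'I_d -> R) psi z w : (forall i, 0 < s i) -> ccs psi ->
  J (fun xi => psi (dscale s xi)) (dscale s z) w = (\prod_i (s i)^-1) * J psi z w.
Proof.
move=> s0 pc; rewrite /J -(RI_affine 0 s0 (cl_cos z w pc)).
by congr RI; apply/funext => xi; rewrite addr0 dotRd_dscale.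
Qed.

Lemma ccs_coord (h : R -> R) i psi : sm1 h -> ccs psi -> ccs (fun xi => h (xi 0 i) * psi xi).
Proof. by move=> hs; apply: ccsM; exact: smooth_coord. Qed.

(** The integral of the derivative of [cos(z.xi + w - pi / 2) * psi] vanishes; the quarter turn put
    in beforehand cancels the one made by differentiating the cosine. *)
Lemma J_ibp psi i z w : ccs psi -> z 0 i * J psi z w = J (D i psi) z (w + pi / 2).
Proof.
move=> pc; have [ps _] := pc.
have := RI_D0 i (ccsM (smooth_cos_dot z (w - pi / 2)) pc).
have -> : D i (fun x => cos (dotRd z x + (w - pi / 2)) * psi x) =
   (fun x => -1 * (D i psi x * cos (dotRd z x + (w + pi / 2))) + z 0 i * (psi x * cos (dotRd z x + w))).
  apply/funext => x; rewrite DM; last 2 first.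
  - exact: (cos_dot_diff _ _ _).1.
  - exact: smooth_diff.
  rewrite (cos_dot_diff _ _ _).2 subrK !addrA cosDpihalf.
  rewrite cosB cos_pihalf sin_pihalf; ring.
rewrite RI_linear; [|exact/cl_cos/ccs_D|exact/clZ/cl_cos].
rewrite RIZ; last exact: cl_cos.
by rewrite -!/(J _ _ _) mulN1r addrC => /eqP; rewrite subr_eq0 => /eqP.
Qed.

(** Differentiation under the integral sign: the remainder of [cos_taylor] is uniform on the bounded
    support of [psi]. *)
Lemma J_diff psi z w : ccs psi -> differentiable (fun z => J psi z w) z /\
  forall i, D i (fun z => J psi z w) z = J (fun xi => xi 0 i * psi xi) z (w + pi / 2).
Proof.
move=> pc; have [A0 [L [M cp]]] := ccs_cl pc.
pose A := `|A0|; have A0' : 0 <= A by exact: normr_ge0.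
have [pM _ pA] : clip A `|L| M psi by exact: clip_norm.
have M0 : 0 <= M by exact: le_trans (pM 0).
have ch h : ccs (fun xi => dotRd h xi * psi xi) by apply: ccsM => //; exact: smooth_dot.
pose df : Rd -> R := fun h => J (fun xi => dotRd h xi * psi xi) z (w + pi / 2).
have ldf : linear df.
  move=> a u v; rewrite /df -[RHS]/(a * _ + _) -J_lin//.
  by apply: J_ext => xi; rewrite dotRdDl dotRdZl mulrDl mulrA.
pose Ldf : {linear Rd -> R} := HB.pack df (GRing.isLinear.Build _ _ _ _ df ldf).
have xiA xi h : psi xi != 0 -> `|dotRd h xi| <= d%:R * A * `|h|.
  move=> p0; rewrite (le_trans (dotRd_le _ _))// -mulrA ler_wpM2l// mulrC ler_wpM2r//.
  apply: norm_le_coord => // i; rewrite leNgt; apply/negP => /pA E.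
  by move: p0; rewrite E eqxx.
pose C := (2 * A) ^+ d * (d%:R * A * M) + (2 * A) ^+ d * ((d%:R * A) ^+ 2 * M).
have C1 : 0 <= (2 * A) ^+ d * (d%:R * A * M) by rewrite !mulr_ge0// exprn_ge0// mulr_ge0.
have C2 : 0 <= (2 * A) ^+ d * ((d%:R * A) ^+ 2 * M).
  by rewrite !mulr_ge0// ?exprn_ge0// ?mulr_ge0.
have [] := @diff_of_quadratic _ _ _ (fun z => J psi z w) Ldf z C.
- move=> h /=; apply: (@le_trans _ _ ((2 * A) ^+ d * (d%:R * A * M) * `|h|)); last first.
    by rewrite ler_wpM2r// lerDl.
  rewrite -mulrA /df; apply: J_le => //.
    move=> xi; have [->|p0] := eqVneq (psi xi) 0.
      by rewrite mulr0 normr0 !mulr_ge0.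
    by rewrite normrM [leRHS]mulrAC ler_pM// xiA.
  by move=> xi i Ai; rewrite (pA _ _ Ai) mulr0.
- move=> h /=; apply: (@le_trans _ _ ((2 * A) ^+ d * ((d%:R * A) ^+ 2 * M) * `|h| ^+ 2)); last first.
    by rewrite ler_wpM2r ?sqr_ge0// lerDr.
  rewrite -mulrA /df.
  have -> : J psi (z + h) w - J psi z w - J (fun xi => dotRd h xi * psi xi) z (w + pi / 2) =
     RI (fun xi => psi xi * cos (dotRd (z + h) xi + w) - psi xi * cos (dotRd z xi + w) -
      dotRd h xi * psi xi * cos (dotRd z xi + (w + pi / 2))).
    by rewrite RIB; [rewrite RIB//; exact: cl_cos|apply: clB; exact: cl_cos|exact: cl_cos].
  apply: RI_bound => //.
  + move=> xi.
    have -> : psi xi * cos (dotRd (z + h) xi + w) - psi xi * cos (dotRd z xi + w) -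
      dotRd h xi * psi xi * cos (dotRd z xi + (w + pi / 2)) =
      psi xi * (cos ((dotRd z xi + w) + dotRd h xi) - cos (dotRd z xi + w) + dotRd h xi * sin (dotRd z xi + w)).
      have -> : dotRd (z + h) xi + w = (dotRd z xi + w) + dotRd h xi by rewrite dotRdDl; ring.
      have -> : cos (dotRd z xi + (w + pi / 2)) = - sin (dotRd z xi + w).
        by rewrite addrA cosDpihalf.
      by ring.
    have [->|p0] := eqVneq (psi xi) 0.
      by rewrite mul0r normr0 !mulr_ge0// sqr_ge0.
    rewrite normrM -[leRHS]mulrA [leRHS]mulrCA; apply: ler_pM => //.
    apply: le_trans (cos_taylor _ _) _.
    rewrite -exprMn -[leLHS]real_normK ?num_real// lerXn2r ?nnegrE ?mulr_ge0//; exact: xiA.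
  + by move=> xi i Ai; rewrite (pA _ _ Ai) mulr0 !mul0r !subr0.
  + by apply: clB; [apply: clB; exact: cl_cos|exact: cl_cos].
move=> dJ dE; split => // i; rewrite /D deriveE// dE /= /df.
by apply: J_ext => xi; rewrite dotRd_evec.
Qed.

End Jint.

(** * Decay of kernels and tempered bounds *)

Section decay.
Context {R : realType} {d : nat}.
Notation Rd := 'rV[R]_d.
Implicit Types (psi : Rd -> R) (i : 'I_d) (z xi x y : Rd) (w : R).

Lemma ccs_iter_D N i psi : ccs psi -> ccs (iter N (D i) psi).
Proof. by move=> pc; elim: N => [//|N IH] /=; exact: ccs_D. Qed.

Lemma J_ibpn N psi i z w : ccs psi ->
  z 0 i ^+ N * J psi z w = J (iter N (D i) psi) z (w + N%:R * (pi / 2)).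
Proof.
move=> pc; elim: N => [|N IH]; first by rewrite expr0 mul1r mul0r addr0.
rewrite exprS -mulrA IH J_ibp; last exact: ccs_iter_D.
by congr J; rewrite -[N.+1%:R]natr1; ring.
Qed.

Lemma J_bounded psi : ccs psi -> exists2 B, 0 <= B & forall z w, `|J psi z w| <= B.
Proof.
move=> pc; have [A [L [M [A0 L0 cp]]]] := cl_ge0 (ccs_cl pc).
exists ((2 * A) ^+ d * M).
  by rewrite mulr_ge0 ?exprn_ge0 ?mulr_ge0//; exact: clip_ge0 cp.
by case: cp => pM _ pA z w; apply: J_le.
Qed.

(** For [|z| > 1] integrate by parts [N] times in a coordinate that realizes the maximum norm;
    otherwise boundedness suffices. *)
Lemma J_decay N psi : ccs psi ->
  exists2 M, 0 <= M & forall z w, (1 + `|z|) ^+ N * `|J psi z w| <= M.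
Proof.
move=> pc; have [B0 B00 HB0] := J_bounded pc.
have H i : exists B, 0 <= B /\ forall z w, `|J (iter N (D i) psi) z w| <= B.
  by have [B ? ?] := J_bounded (ccs_iter_D N i pc); exists B.
have [B HB] := choice H.
have SB0 : 0 <= \sum_i B i by apply: sumr_ge0 => i _; exact: (HB i).1.
exists (2 ^+ N * (B0 + (B0 + \sum_i B i))).
  by rewrite mulr_ge0 ?exprn_ge0// !addr_ge0.
move=> z w.
have zN : `|z| ^+ N * `|J psi z w| <= B0 + \sum_i B i.
  have [z1|z1] := leP `|z| 1.
    apply: (@le_trans _ _ B0); last by rewrite lerDl.
    rewrite -[leRHS]mul1r ler_pM// ?exprn_ge0// exprn_ile1//.
  have z0 : mx_norm z != 0 by rewrite -[mx_norm z]/(`|z|) gt_eqF// (lt_trans _ z1).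
  have [[j i]/= zi] := mx_norm_neq0 z0.
  have -> : `|z| = `|z 0 i| by rewrite -(ord1 j).
  rewrite -normrX -normrM J_ibpn// (le_trans ((HB i).2 _ _))//.
  rewrite (@le_trans _ _ (\sum_i B i))// ?lerDr//.
  by rewrite (bigD1 i)//= lerDl sumr_ge0// => k _; exact: (HB k).1.
apply: (@le_trans _ _ (2 ^+ N * (1 + `|z| ^+ N) * `|J psi z w|)).
  rewrite ler_wpM2r//.
  have [z1|z1] := leP `|z| 1.
    apply: (@le_trans _ _ (2 ^+ N)); first by rewrite lerXn2r ?nnegrE ?addr_ge0//; lra.
    by rewrite ler_peMr ?exprn_ge0// lerDl exprn_ge0.
  apply: (@le_trans _ _ ((2 * `|z|) ^+ N)).
    by rewrite lerXn2r ?nnegrE ?addr_ge0 ?mulr_ge0//; lra.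
  by rewrite exprMn ler_wpM2l ?exprn_ge0// lerDr.
rewrite -mulrA ler_wpM2l ?exprn_ge0// mulrDl mul1r lerD//.
Qed.

(** The symbol [xi^s * psi]: each derivative of a kernel brings down a factor [xi_i] together with a
    quarter turn of the phase. *)
Definition mono (s : seq 'I_d) psi : Rd -> R :=
  foldr (fun i (f : Rd -> R) xi => xi 0 i * f xi) psi s.

Lemma ccs_mono s psi : ccs psi -> ccs (mono s psi).
Proof.
move=> pc; elim: s => [//|i s IH] /=.
exact: (@ccs_coord _ _ id i _ (@sm1_id R) IH).
Qed.

Lemma monoE s psi xi : mono s psi xi = (\prod_(i <- s) xi 0 i) * psi xi.
Proof.
elim: s => [|i s IH] /=; first by rewrite big_nil mul1r.
by rewrite IH big_cons mulrA.
Qed.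

Lemma J_shift_affine psi x w : (fun y => J psi (x - y) w) = (fun y => J psi (-1 *: y + x) w).
Proof. by apply/funext => y; rewrite scaleN1r addrC. Qed.

Lemma differentiable_J (c : R) psi x w y : ccs psi ->
  differentiable (fun y => c * J psi (x - y) w) y.
Proof.
move=> pc; apply: (@differentiableM _ _ (cst c) (fun y => J psi (x - y) w)) => //.
rewrite J_shift_affine; apply: (@differentiable_affine _ _ (fun z => J psi z w)) => z.
exact: (J_diff z w pc).1.
Qed.

Lemma D_J (c : R) psi i x w : ccs psi ->
  D i (fun y => c * J psi (x - y) w) =
  (fun y => - c * J (fun xi => xi 0 i * psi xi) (x - y) (w + pi / 2)).
Proof.
move=> pc; have dJ y := (J_diff y w pc).1.
have dJ' y : differentiable (fun y => J psi (x - y) w) y.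
  rewrite J_shift_affine; exact: (@differentiable_affine _ _ (fun z => J psi z w)).
apply/funext => y; rewrite (@DM _ _ _ (cst c)) => [|//|//].
rewrite J_shift_affine (@D_affine _ _ i (fun z => J psi z w))//.
rewrite (J_diff _ w pc).2 /D derive_cst mulr0 addr0 scaleN1r [- y + x]addrC /cst.
by ring.
Qed.

Lemma pder_J s (c : R) psi x w : ccs psi ->
  pder s (fun y => c * J psi (x - y) w) =
  (fun y => ((-1) ^+ size s * c) * J (mono s psi) (x - y) (w + (size s)%:R * (pi / 2))).
Proof.
move=> pc; elim: s => [|i s IH].
  by apply/funext => y; rewrite /= mul1r mul0r addr0.
rewrite [LHS]/= IH -/(D i _) (D_J _ _ _ _ (ccs_mono s pc)).
apply/funext => y; rewrite exprS mulN1r mulNr; congr (- _ * J _ _ _).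
by rewrite /= -[(size s).+1%:R]natr1; ring.
Qed.

Lemma norm_shift_le N x y : (1 + `|y|) ^+ N <= (1 + `|x|) ^+ N * (1 + `|x - y|) ^+ N.
Proof.
rewrite -exprMn lerXn2r ?nnegrE ?mulr_ge0 ?addr_ge0//.
have : `|y| <= `|x| + `|x - y|.
  by rewrite -{1}(subKr x y) (le_trans (ler_normB _ _)).
have := normr_ge0 x; have := normr_ge0 (x - y); nra.
Qed.

Lemma schwartz_J (c : R) psi x w : ccs psi -> schwartz (fun y => c * J psi (x - y) w).
Proof.
move=> pc; split.
  apply: (smooth_class (P := fun f => exists c psi w,
    ccs psi /\ f = fun y => c * J psi (x - y) w)); last by exists c, psi, w.
  move=> _ [c' [psi' [w' [pc' ->]]]]; split.
    by move=> y; exact: differentiable_J.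
  move=> i; rewrite (D_J _ _ _ _ pc').
  exists (- c'), (fun xi => xi 0 i * psi' xi), (w' + pi / 2); split => //.
  exact: (@ccs_coord _ _ id i _ (@sm1_id R) pc').
move=> s N; have [M M0 HM] := J_decay N (ccs_mono s pc).
exists (`|c| * (1 + `|x|) ^+ N * M) => y; rewrite pder_J// !normrM normrX normrN1 expr1n mul1r.
rewrite mulrCA -mulrA ler_wpM2l//.
apply: le_trans (ler_wpM2r (normr_ge0 _) (norm_shift_le N x y)) _.
by rewrite -mulrA ler_wpM2l// exprn_ge0// addr_ge0.
Qed.

(** The function [K(x - .)], turned by the phase [w], against which a distribution is tested. *)
Definition Kf psi x w : Rd -> R := fun y => (2 * pi) ^- d * J psi (x - y) w.

Lemma schwartz_Kf psi x w : ccs psi -> schwartz (Kf psi x w).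
Proof. exact: schwartz_J. Qed.

Lemma pi2_gt0 : 0 < (2 * pi : R) ^- d.
Proof. by rewrite invr_gt0 exprn_gt0// mulr_gt0// pi_gt0. Qed.

(* The seminorms of [K(x - .)] are controlled by the decay of the kernels with symbols [xi^s psi]. *)
Lemma tempered_Kf (u : (Rd -> R) -> R) : tempered u ->
  exists (C : R) (N : nat), 0 <= C /\ forall psi x w M, ccs psi -> 0 <= M ->
    (forall s z w, (size s <= N)%N -> (1 + `|z|) ^+ N * `|J (mono s psi) z w| <= M) ->
    `|u (Kf psi x w)| <= C * (1 + `|x|) ^+ N * M.
Proof.
move=> [_ [C [N uC]]].
exists (`|C| * (2 * pi) ^- d), N; split.
  by rewrite mulr_ge0// ltW// pi2_gt0.
move=> psi x w M pc M0 HM.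
have -> : `|C| * (2 * pi) ^- d * (1 + `|x|) ^+ N * M =
   `|C| * ((2 * pi) ^- d * ((1 + `|x|) ^+ N * M)) by ring.
apply: le_trans (uC _ ((2 * pi) ^- d * ((1 + `|x|) ^+ N * M)) (schwartz_Kf x w pc) _) _.
  move=> s y sN; rewrite /Kf pder_J// !normrM normrX normrN1 expr1n mul1r.
  rewrite (gtr0_norm pi2_gt0) mulrCA ler_pM2l ?pi2_gt0//.
  apply: le_trans (ler_wpM2r (normr_ge0 _) (norm_shift_le N x y)) _.
  rewrite -mulrA ler_wpM2l// ?exprn_ge0// ?addr_ge0//; exact: HM.
by rewrite ler_wpM2r ?ler_norm// !mulr_ge0 ?exprn_ge0 ?addr_ge0// ltW// pi2_gt0.
Qed.

End decay.

(** * Pieces of a distribution and their phases *)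

Section W.
Context {R : realType} {d : nat}.
Notation Rd := 'rV[R]_d.
Implicit Types (psi : Rd -> R) (i : 'I_d) (z xi x y : Rd) (w : R) (f : tdist R d).

(* [W f psi x w] is the real part of [e^{iw} F^{-1}[psi F f](x)]. *)
Definition W f psi x w : R := f.1 (Kf psi x w) - f.2 (Kf psi x (w - pi / 2)).

Lemma Kf_phase psi x w : ccs psi ->
  Kf psi x w = (fun y => cos w * Kf psi x 0 y + (- sin w) * Kf psi x (- (pi / 2)) y).
Proof. by move=> pc; apply/funext => y; rewrite /Kf J_phase//; ring. Qed.

Lemma temperedZ (u : (Rd -> R) -> R) (a : R) (g : Rd -> R) : tempered u -> schwartz g ->
  u (fun x => a * g x) = a * u g.
Proof.
move=> [ul _] sg.
have s0 : schwartz (fun _ : Rd => 0 : R).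
  have := @schwartz_J R d 0 (fun=> 0) 0 0 _; rewrite /=.
  have c0 : ccs (fun _ : Rd => 0 : R) by split; [exact: smooth_cst|exists 0].
  by move=> /(_ c0); congr schwartz; apply/funext => x; rewrite mul0r.
have u0 : u (fun=> 0) = 0.
  have E : (fun _ : Rd => 0 : R) = (fun _ : Rd => -1 * 0 + 0).
    by apply/funext => x; rewrite mulr0 addr0.
  by rewrite {1}E ul//; ring.
have := ul a _ _ sg s0; rewrite u0 addr0 => <-.
by congr u; apply/funext => x; rewrite addr0.
Qed.

Lemma schwartz_KfZ (a : R) psi x w : ccs psi -> schwartz (fun y => a * Kf psi x w y).
Proof.
move=> pc; have := @schwartz_J _ _ (a * (2 * pi) ^- d) _ x w pc; congr schwartz.
by apply/funext => y; rewrite /Kf mulrA.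
Qed.

Lemma tempered_phase (u : (Rd -> R) -> R) psi x w : tempered u -> ccs psi ->
  u (Kf psi x w) = cos w * u (Kf psi x 0) - sin w * u (Kf psi x (- (pi / 2))).
Proof.
move=> ut pc; rewrite Kf_phase//; have [ul _] := ut.
rewrite (ul (cos w) (Kf psi x 0)); [|exact: schwartz_Kf|exact: schwartz_KfZ].
by rewrite (temperedZ (- sin w) ut (schwartz_Kf x (- (pi / 2)) pc)) mulNr.
Qed.

Lemma W_phase f psi x w : ctempered f -> ccs psi ->
  W f psi x w = cos w * W f psi x 0 - sin w * W f psi x (- (pi / 2)).
Proof.
move=> [t1 t2] pc; rewrite /W.
rewrite (tempered_phase _ w t1 pc) (tempered_phase _ (w - pi / 2) t2 pc).
rewrite sub0r (tempered_phase _ (- (pi / 2) - pi / 2) t2 pc).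
have -> : - (pi / 2) - pi / 2 = - pi :> R by field.
rewrite cosN sinN cospi sinpi cosB sinB cos_pihalf sin_pihalf; ring.
Qed.

Lemma absDeltaE psi f x : ctempered f -> ccs psi ->
  absDelta psi f x = Num.sqrt (W f psi x 0 ^+ 2 + W f psi x (- (pi / 2)) ^+ 2).
Proof.
move=> [_ t2] pc; rewrite /absDelta /W.
have re y : Kre psi y = (2 * pi) ^- d * J psi y 0.
  rewrite /Kre /J /RI; congr (_ * fine (intRd _)); apply/funext => xi.
  by rewrite addr0.
have im y : Kim psi y = (2 * pi) ^- d * J psi y (- (pi / 2)).
  rewrite /Kim /J /RI; congr (_ * fine (intRd _)); apply/funext => xi.
  by rewrite cosB cos_pihalf sin_pihalf mulr0 add0r mulr1.
have -> : (fun y => Kre psi (x - y)) = Kf psi x 0 by apply/funext => y; rewrite re.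
have -> : (fun y => Kim psi (x - y)) = Kf psi x (- (pi / 2)) by apply/funext => y; rewrite im.
rewrite sub0r (tempered_phase _ (- (pi / 2) - pi / 2) t2 pc).
have -> : - (pi / 2) - pi / 2 = - pi :> R by field.
rewrite cosN sinN cospi sinpi; congr (Num.sqrt (_ + _ ^+ 2)); ring.
Qed.

Lemma absDelta_ge0 psi f x : 0 <= absDelta psi f x.
Proof. exact: sqrtr_ge0. Qed.

Lemma W_le f psi x w : ctempered f -> ccs psi -> `|W f psi x w| <= absDelta psi f x.
Proof.
move=> ft pc; rewrite absDeltaE// W_phase//.
move: (W f psi x 0) (W f psi x (- (pi / 2))) => a b.
rewrite -sqrtr_sqr ler_sqrt ?addr_ge0 ?sqr_ge0//.
have := cos2Dsin2 w; move: (cos w) (sin w) => c s cs.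
rewrite -subr_ge0 (_ : _ - _ = (s * a + c * b) ^+ 2) ?sqr_ge0//.
rewrite -[X in X - _]mul1r -cs; ring.
Qed.

(** A complex modulus is the largest real part among all rotations, so estimates that are linear in
    the symbol need only be shown for [W], with every phase. *)
Lemma absDelta_leP psi f x (M : R) : ctempered f -> ccs psi ->
  (forall w, `|W f psi x w| <= M) -> absDelta psi f x <= M.
Proof.
move=> ft pc H; rewrite absDeltaE//.
set a := W f psi x 0; set b := W f psi x _.
set r := Num.sqrt _.
have r0 : 0 <= r by exact: sqrtr_ge0.
have M0 : 0 <= M by exact: le_trans (H 0).
have [->//|rn] := eqVneq r 0.
have rp : 0 < r by rewrite lt_def rn.
have r2 : r ^+ 2 = a ^+ 2 + b ^+ 2 by rewrite sqr_sqrtr// addr_ge0// sqr_ge0.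
(* The maximizing phase is [acos (a / r)] up to a sign, which is dictated by the sign of
   [- b / r]. *)
have [w [cw sw]] : exists w, cos w = a / r /\ sin w = - b / r.
  have E : (a / r) ^+ 2 + (- b / r) ^+ 2 = 1.
    by rewrite !exprMn sqrrN -mulrDl -r2 -exprMn divff// expr1n.
  have a1 : -1 <= a / r <= 1.
    by rewrite -ler_norml -(expr_le1 (n := 2))// real_normK ?num_real// -E lerDl sqr_ge0.
  have s2 : `|sin (acos (a / r))| = `|- b / r|.
    apply/eqP; rewrite -(eqrXn2 (n := 2))// !real_normK ?num_real//.
    by rewrite sin2cos2 acosK// -E addrC addKr.
  have s0 : 0 <= sin (acos (a / r)).
    by rewrite sin_ge0_pi// acos_ge0//= acos_lepi.
  have [b0|b0] := leP 0 (- b / r).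
    exists (acos (a / r)); rewrite acosK//; split => //.
    by rewrite -(ger0_norm s0) s2 ger0_norm.
  exists (- acos (a / r)); rewrite cosN acosK// sinN; split => //.
  by rewrite -(ger0_norm s0) s2 ltr0_norm// opprK.
have := H w; rewrite W_phase// -/a -/b cw sw.
have -> : a / r * a - - b / r * b = r.
  have -> : a / r * a - - b / r * b = (a ^+ 2 + b ^+ 2) / r by ring.
  by rewrite -r2 expr2 mulfK.
by rewrite ger0_norm.
Qed.

Lemma Kf_lin (c : R) psi psi' x w : ccs psi -> ccs psi' ->
  Kf (fun xi => c * psi xi + psi' xi) x w = (fun y => c * Kf psi x w y + Kf psi' x w y).
Proof. by move=> pc pc'; apply/funext => y; rewrite /Kf J_lin//; ring. Qed.

Lemma W_lin f (c : R) psi psi' x w : ctempered f -> ccs psi -> ccs psi' ->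
  W f (fun xi => c * psi xi + psi' xi) x w = c * W f psi x w + W f psi' x w.
Proof.
move=> [[l1 _] [l2 _]] pc pc'; rewrite /W !Kf_lin//.
rewrite l1 ?l2; [ring|exact: schwartz_Kf..].
Qed.

Lemma ccs0 : ccs (fun _ : Rd => 0 : R).
Proof. by split; [exact: smooth_cst|exists 0]. Qed.

Lemma WD f psi psi' x w : ctempered f -> ccs psi -> ccs psi' ->
  W f (fun xi => psi xi + psi' xi) x w = W f psi x w + W f psi' x w.
Proof.
move=> ft pc pc'; have := W_lin 1 x w ft pc pc'; rewrite mul1r => <-.
by congr W; apply/funext => xi; rewrite mul1r.
Qed.

Lemma Kf_mod psi i x w (t b : R) : ccs psi ->
  Kf (fun xi => cos (t * xi 0 i + b) * psi xi) x w =
  (fun y => 2^-1 * Kf psi (x + t *: evec R i) (w + b) y +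
            2^-1 * Kf psi (x - t *: evec R i) (w - b) y).
Proof.
move=> pc; apply/funext => y; rewrite /Kf J_mod//.
have -> : x + t *: evec R i - y = x - y + t *: evec R i by rewrite addrAC.
have -> : x - t *: evec R i - y = x - y - t *: evec R i by rewrite addrAC.
by ring.
Qed.

Lemma W_mod f psi i x w (t b : R) : ctempered f -> ccs psi ->
  W f (fun xi => cos (t * xi 0 i + b) * psi xi) x w =
  (W f psi (x + t *: evec R i) (w + b) + W f psi (x - t *: evec R i) (w - b)) / 2.
Proof.
move=> [t1 t2] pc; rewrite /W !Kf_mod//.
have [l1 _] := t1; have [l2 _] := t2.
rewrite l1; [|exact: schwartz_Kf|exact: schwartz_KfZ].
rewrite l2; [|exact: schwartz_Kf|exact: schwartz_KfZ].
rewrite (temperedZ _ t1 (schwartz_Kf _ _ pc)) (temperedZ _ t2 (schwartz_Kf _ _ pc)).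
have -> : w - pi / 2 + b = w + b - pi / 2 by rewrite addrAC.
have -> : w - pi / 2 - b = w - b - pi / 2 by rewrite addrAC.
by ring.
Qed.

End W.

(** * Fourier multipliers in one coordinate *)

Section fejer.
Context {R : realType}.
Implicit Types (u x y t : R) (g h : R -> R).
Local Notation mu := (@lebesgue_measure R).

(** Multiplicity with which the frequencies [k] and [- k] enter the cosine form of the Dirichlet
    kernel. *)
Definition e2 (k : nat) : R := if k == 0%N then 1 else 2.
Definition dirichlet n u : R := \sum_(k < n.+1) e2 k * cos (k%:R * u).
(** Unnormalized: the sum, not the mean, of the Dirichlet kernels. *)
Definition fejer N u : R := \sum_(n < N) dirichlet n u.

(** The right-hand side is the squared modulus of a sum of exponentials; its increment from [N] to
    [N.+1] is one Dirichlet kernel. Positivity of the Fejer kernel is read off from it. *)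
Lemma fejerE N u :
  fejer N u = (\sum_(k < N) cos (k%:R * u)) ^+ 2 + (\sum_(k < N) sin (k%:R * u)) ^+ 2.
Proof.
elim: N => [|N IH]; first by rewrite /fejer !big_ord0 !expr0n addr0.
rewrite /fejer big_ord_recr/= -/(fejer N u) IH !big_ord_recr/=.
set C := \sum_(i < N) cos _; set S := \sum_(i < N) sin _.
set c := cos (N%:R * u); set s := sin (N%:R * u).
have -> : dirichlet N u = 1 + 2 * (c * C + s * S).
  rewrite /dirichlet big_ord_recl /e2 /= mul0r cos0 mulr1; congr (_ + _).
  rewrite /C /S !mulr_sumr -big_split/= mulr_sumr.
  rewrite (reindex_inj rev_ord_inj)/=; apply: eq_bigr => i _.
  rewrite /c /s -cosB -mulrBl /bump/= add1n; congr (_ * cos (_ * _)).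
  by rewrite subnSK// natrB// ltnW.
have := cos2Dsin2 (N%:R * u); rewrite -/c -/s => cs.
have -> : (C + c) ^+ 2 + (S + s) ^+ 2 = C ^+ 2 + S ^+ 2 + (c ^+ 2 + s ^+ 2) + 2 * (c * C + s * S) by ring.
by rewrite cs addrA.
Qed.

Lemma fejer_ge0 N u : 0 <= fejer N u.
Proof. by rewrite fejerE addr_ge0// sqr_ge0. Qed.

Definition I g : R := \int[mu]_(x in `[- pi, pi]) g x.

Lemma I_integrable g : continuous g -> mu.-integrable `[- pi, pi]%classic (EFin \o g).
Proof.
move=> cg; apply: continuous_compact_integrable; first exact: segment_compact.
exact: continuous_subspaceT.
Qed.

Lemma ID g h : continuous g -> continuous h -> I (fun x => g x + h x) = I g + I h.
Proof. by move=> cg ch; rewrite /I RintegralD//; exact: I_integrable. Qed.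

Lemma IZ (c : R) g : continuous g -> I (fun x => c * g x) = c * I g.
Proof. by move=> cg; rewrite /I RintegralZl//; exact: I_integrable. Qed.

Lemma I_le g h : continuous g -> continuous h ->
  (forall x, -pi <= x <= pi -> g x <= h x) -> I g <= I h.
Proof.
move=> cg ch gh; apply: le_Rintegral; [by []|exact: I_integrable|exact: I_integrable|].
by move=> x /=; rewrite in_itv/= => /gh.
Qed.

Lemma continuous_cosM (k t : R) : continuous (fun x => cos (k * (t - x))).
Proof.
move=> x; apply: continuous_comp; last exact: continuous_cos.
apply: cvgM; first exact: cvg_cst.
by apply: cvgB; [exact: cvg_cst|exact: cvg_id].
Qed.

Lemma I_cos (k : nat) t : I (fun x => cos (k%:R * (t - x))) = if k == 0%N then 2 * pi else 0.
Proof.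
have pp : - pi < pi :> R by rewrite gtrN// pi_gt0.
have [->|k0] := eqVneq k 0%N.
  have -> : (fun x => cos (0 * (t - x))) = cst (1 : R).
    by apply/funext => x; rewrite mul0r cos0.
  rewrite /I Rintegral_cst// mul1r [X in fine X]lebesgue_measure_itv/= lte_fin pp.
  by rewrite -EFinB/= opprK mulr_natl.
rewrite /I /Rintegral.
have kn : k%:R != 0 :> R by rewrite pnatr_eq0.
pose F (x : R) : R := - (k%:R^-1 * sin (k%:R * (t - x))).
have dF (x : R) : is_derive x 1 F (cos (k%:R * (t - x))).
  rewrite /F; apply: is_derive_eq; rewrite /GRing.scale/=.
  by move: (k%:R : R) kn => K Kn; field.
rewrite (@continuous_FTC2 _ _ F)//.
- rewrite -EFinB/= /F.
  have -> : sin (k%:R * (t - pi)) = sin (k%:R * (t - - pi)).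
    have := periodicn (@sinD2pi R) k (k%:R * (t - pi)) => <-; congr sin.
    by rewrite -[pi *+ 2]mulr_natl -[_ *+ k]mulr_natl; ring.
  by rewrite subrr.
- exact/continuous_subspaceT/continuous_cosM.
- have cF : continuous F by exact: is_derive_continuous dF.
  split=> [x _|a|b]; first by have [] := dF x.
  + exact/cvg_at_right_filter/cF.
  + exact/cvg_at_left_filter/cF.
- by move=> x _; rewrite derive1E; have [_ ->] := dF x.
Qed.

Lemma I_sum n (F : nat -> R -> R) : (forall k, continuous (F k)) ->
  continuous (fun x => \sum_(k < n) F k x) /\
  I (fun x => \sum_(k < n) F k x) = \sum_(k < n) I (F k).
Proof.
move=> cF; elim: n => [|n [c IH]].
  split; first by under eq_fun do rewrite big_ord0; move=> x; exact: cvg_cst.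
  under [in LHS]eq_fun do rewrite big_ord0.
  by rewrite big_ord0 /I Rintegral_cst// mul0r.
split; last first.
  under [in LHS]eq_fun do rewrite big_ord_recr/=.
  by rewrite ID// IH big_ord_recr.
under eq_fun do rewrite big_ord_recr/=.
by move=> x; apply: cvgD; [exact: c|exact: cF].
Qed.

Lemma continuous_dirichlet n t : continuous (fun x => dirichlet n (t - x)).
Proof.
apply: (I_sum n.+1 (F := fun k x => e2 k * cos (k%:R * (t - x))) _).1 => k x.
by apply: cvgM; [exact: cvg_cst|exact: continuous_cosM].
Qed.

Lemma continuous_fejer N t : continuous (fun x => fejer N (t - x)).
Proof.
by apply: (I_sum N (F := fun n x => dirichlet n (t - x)) _).1 => k; exact: continuous_dirichlet.
Qed.

Lemma I_dirichlet n t : I (fun x => dirichlet n (t - x)) = 2 * pi.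
Proof.
rewrite (I_sum n.+1 (F := fun k x => e2 k * cos (k%:R * (t - x))) _).2; last first.
  by move=> k x; apply: cvgM; [exact: cvg_cst|exact: continuous_cosM].
rewrite big_ord_recl big1 ?addr0 => [|k _]; rewrite IZ ?I_cos; try exact: continuous_cosM.
  by rewrite /e2 /= mul1r.
by rewrite /= mulr0.
Qed.

Lemma I_dirichlet_cos n t :
  I (fun x => cos (t - x) * dirichlet n (t - x)) = if n == 0%N then 0 else 2 * pi.
Proof.
(* The absolute value of [k - 1] is harmless as cosine is even; after integration only [k = 1]
   contributes. *)
have E x : cos (t - x) * dirichlet n (t - x) =
    \sum_(k < n.+1) (e2 k / 2) * (cos (k.+1%:R * (t - x)) + cos (`|k%:Z - 1|%N%:R * (t - x))).
  rewrite /dirichlet mulr_sumr; apply: eq_bigr => k _.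
  have -> : cos (`|k%:Z - 1|%N%:R * (t - x)) = cos ((k%:R - 1) * (t - x)).
    case: k => [[|k] kn] /=.
      by rewrite mul1r sub0r mulN1r cosN.
    by rewrite subn1/= -natr1 addrK.
  have -> : k.+1%:R * (t - x) = k%:R * (t - x) + (t - x) by rewrite -natr1 mulrDl mul1r.
  have -> : (k%:R - 1) * (t - x) = k%:R * (t - x) - (t - x) by rewrite mulrBl mul1r.
  by rewrite (cosD (k%:R * (t - x))) (cosB (k%:R * (t - x))); field.
have cc (k k' : nat) : continuous (fun x => cos (k%:R * (t - x)) + cos (k'%:R * (t - x))).
  by move=> x; apply: cvgD; exact: continuous_cosM.
under [in LHS]eq_fun do rewrite E.
rewrite (I_sum n.+1 (F := fun k x => (e2 k / 2) * (cos (k.+1%:R * (t - x)) + cos (`|k%:Z - 1|%N%:R * (t - x)))) _).2; last first.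
  by move=> k x; apply: cvgM; [exact: cvg_cst|exact: cc].
have H k : I (fun x => (e2 k / 2) * (cos (k.+1%:R * (t - x)) + cos (`|k%:Z - 1|%N%:R * (t - x)))) =
    if k == 1%N then 2 * pi else 0.
  rewrite IZ// ID; [|exact: continuous_cosM|exact: continuous_cosM].
  rewrite !I_cos/= add0r /e2; case: k => [|[|k]]//=; first by rewrite mulr0.
    by rewrite divff// mul1r.
  by rewrite mulr0.
under eq_bigr do rewrite H.
case: n {E} => [|n]; first by rewrite big_ord_recl big_ord0 addr0.
rewrite !big_ord_recl/= add0r big1 ?addr0// => k _.
Qed.

Lemma I_fejer N t : I (fun x => fejer N (t - x)) = N%:R * (2 * pi).
Proof.
rewrite (I_sum N (F := fun n x => dirichlet n (t - x)) _).2; last by move=> k; exact: continuous_dirichlet.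
under eq_bigr do rewrite I_dirichlet.
by rewrite sumr_const card_ord [RHS]mulr_natl.
Qed.

(** The value does not grow with [N], whereas the mass of the kernel does: relative to the mass, the
    moment of [1 - cos] tends to zero. This is the one test function that Korovkin's argument asks
    for. *)
Lemma I_fejer_cos N t :
  I (fun x => (1 - cos (t - x)) * fejer N.+1 (t - x)) = 2 * pi.
Proof.
have c1 k : continuous (fun x => cos (t - x) * dirichlet k (t - x)).
  move=> x; apply: cvgM; last exact: continuous_dirichlet.
  by have := @continuous_cosM 1 t x; under eq_fun do rewrite mul1r.
have -> : (fun x => (1 - cos (t - x)) * fejer N.+1 (t - x)) =
    (fun x => fejer N.+1 (t - x) + -1 * \sum_(n < N.+1) cos (t - x) * dirichlet n (t - x)).
  by apply/funext => x; rewrite /fejer -mulr_sumr; ring.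
have [cs Is] := I_sum N.+1 c1.
rewrite ID; [|exact: continuous_fejer|by move=> x; apply: cvgM; [exact: cvg_cst|exact: cs]].
rewrite IZ// I_fejer Is.
under eq_bigr do rewrite I_dirichlet_cos.
rewrite big_ord_recl/= add0r sumr_const card_ord -natr1.
by rewrite -[_ *+ N]mulr_natl; move: (pi : R) => P; ring.
Qed.

End fejer.

(** * Pointwise convergence of cosine series *)

Section fourier.
Context {R : realType}.
Variables (m : R -> R) (L : R).
Hypotheses (mL : forall x y, `|m x - m y| <= L * `|x - y|)
  (mA : forall x, 3 / 2 < `|x| -> m x = 0).
Implicit Types (t x y e : R).

Let L0 : 0 <= L.
Proof. by have := mL 1 0; rewrite subr0 normr1 mulr1; exact: le_trans. Qed.

Let m_bound x : `|m x| <= 4 * L.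
Proof.
have [|xA] := ltP (3 / 2) `|x|; first by move=> /mA ->; rewrite normr0 mulr_ge0.
have := mL x 2; rewrite [m 2]mA ?subr0; last by rewrite ger0_norm//; lra.
move=> /le_trans; apply; rewrite mulrC ler_wpM2r//.
by rewrite (le_trans (ler_normB _ _))// [`|2|]ger0_norm//; lra.
Qed.

Let mc : continuous m.
Proof. exact: lipschitz_continuous mL. Qed.

Lemma cos_far (r u : R) : 0 < r -> r <= pi -> r <= `|u| -> `|u| <= 2 * pi - r -> cos u <= cos r.
Proof.
move=> r0 rp ru ur; have p0 := pi_gt0 R.
have mono (a : R) : r <= a -> a <= pi -> cos a <= cos r.
  rewrite le_eqVlt => /predU1P[->//|ra] ap; apply/ltW.
  by rewrite ltr_cos ?in_itv/= ?(ltW r0)// ap andbT (le_trans (ltW r0))// ltW.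
rewrite -(cos_norm u); have [up|up] := leP `|u| pi; first exact: mono.
have -> : cos `|u| = cos (2 * pi - `|u|).
  rewrite -[RHS]cosN opprB -(cosD2pi (`|u| - 2 * pi)); congr cos.
  by rewrite -[pi *+ 2]mulr_natl subrK.
by apply: mono; lra.
Qed.

(** Near the diagonal the Lipschitz bound gives [e]; where [1 - cos] is at least [1 - cos r] the
    crude bound [8 * L] is absorbed by [C]. In the remaining corners [x] and [t] lie near opposite
    ends of the period, where [m] vanishes. *)
Lemma korovkin e : 0 < e -> exists2 C, 0 <= C & forall x t,
  - pi <= x <= pi -> - pi <= t <= pi -> `|m x - m t| <= e + C * (1 - cos (t - x)).
Proof.
move=> e0; have p2 := pi_ge2 R.
(* The bound [1 / 2] puts the corners outside [[-3 / 2, 3 / 2]], as [pi >= 2]; the other one serves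
   the diagonal. *)
pose r := Num.min (1 / 2) (e / (L + 1)).
have r0 : 0 < r by rewrite lt_min divr_gt0//= divr_gt0// ltr_wpDl.
have r1 : r <= 1 / 2 by rewrite ge_min lexx.
have re : L * r <= e.
  apply: (@le_trans _ _ ((L + 1) * r)); first by rewrite ler_pM2r// lerDl.
  by rewrite mulrC -ler_pdivlMr ?ltr_wpDl// ge_min lexx orbT.
have k0 : 0 < 1 - cos r.
  rewrite subr_gt0 -[ltRHS]cos0 ltr_cos ?in_itv/= ?lexx ?pi_ge0//.
  by rewrite (ltW r0)/=; lra.
exists (8 * L / (1 - cos r)); first by rewrite divr_ge0 ?mulr_ge0// ltW.
move=> x t xp tp.
have c0 : 0 <= 8 * L / (1 - cos r) * (1 - cos (t - x)).
  by rewrite mulr_ge0 ?divr_ge0 ?mulr_ge0 ?(ltW k0)// subr_ge0 cos_le1.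
have [xr|xr] := leP `|t - x| r.
  apply: (@le_trans _ _ e); last by rewrite lerDl.
  apply: le_trans (mL _ _) _; rewrite distrC (le_trans _ re)//.
  by rewrite ler_wpM2l.
have [xr'|xr'] := leP `|t - x| (2 * pi - r); last first.
  have : 3 / 2 < `|x| /\ 3 / 2 < `|t|.
    have [tx|tx] := leP x t.
      rewrite ger0_norm ?subr_ge0// in xr'; split; last by rewrite ltr_normr; apply/orP; left; lra.
      by rewrite ltr_normr; apply/orP; right; lra.
    rewrite ltr0_norm ?subr_lt0// in xr'; split; first by rewrite ltr_normr; apply/orP; left; lra.
    by rewrite ltr_normr; apply/orP; right; lra.
  by move=> [/mA -> /mA ->]; rewrite subrr normr0 addr_ge0// ltW.
apply: (@le_trans _ _ (8 * L)).
  by rewrite (le_trans (ler_normB _ _))//; have := m_bound x; have := m_bound t; lra.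
apply: (@le_trans _ _ (8 * L / (1 - cos r) * (1 - cos (t - x)))); last first.
  by rewrite lerDr ltW.
rewrite mulrAC ler_pdivlMr// ler_wpM2l ?mulr_ge0//.
by rewrite lerD2l lerN2 cos_far//; [lra|rewrite ltW].
Qed.

Let cm (g : R -> R) : continuous g -> continuous (fun x => m x * g x).
Proof. by move=> cg x; apply: cvgM; [exact: mc|exact: cg]. Qed.

Lemma fejer_mean t e : - pi <= t <= pi -> 0 < e -> exists2 C, 0 <= C &
  forall N, `|I (fun x => m x * fejer N.+1 (t - x)) / (2 * pi * N.+1%:R) - m t| <= e + C / N.+1%:R.
Proof.
move=> tp e0; have [C C0 H] := korovkin e0; exists C => // N.
have p0 := pi_gt0 R.
have N0 : 0 < N.+1%:R :> R by rewrite ltr0n.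
have cf := @continuous_fejer R N.+1 t.
have cg : continuous (fun x => (1 - cos (t - x)) * fejer N.+1 (t - x)).
  move=> x; apply: cvgM; last exact: cf.
  apply: cvgB; first exact: cvg_cst.
  by have := @continuous_cosM R 1 t x; under eq_fun do rewrite mul1r.
have cmt : continuous (fun x => - m t * fejer N.+1 (t - x)).
  by move=> x; apply: cvgM; [exact: cvg_cst|exact: cf].
have E : I (fun x => m x * fejer N.+1 (t - x)) / (2 * pi * N.+1%:R) - m t =
    I (fun x => (m x - m t) * fejer N.+1 (t - x)) / (2 * pi * N.+1%:R).
  have -> : (fun x => (m x - m t) * fejer N.+1 (t - x)) =
    (fun x => m x * fejer N.+1 (t - x) + - m t * fejer N.+1 (t - x)).
    by apply/funext => x; ring.
  rewrite ID//; last exact: cm.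
  rewrite IZ// I_fejer.
  have Nn : N.+1%:R != 0 :> R by rewrite gt_eqF.
  have pn : pi != 0 :> R by rewrite gt_eqF.
  by move: (pi : R) (N.+1%:R : R) (I _) pn Nn => P K X pn Nn; field; rewrite pn Nn.
have cM : continuous (fun x => (m x - m t) * fejer N.+1 (t - x)).
  move=> x; apply: cvgM; last exact: cf.
  by apply: cvgB; [exact: mc|exact: cvg_cst].
have ce : continuous (fun x => e * fejer N.+1 (t - x)).
  by move=> x; apply: cvgM; [exact: cvg_cst|exact: cf].
have cC : continuous (fun x => C * ((1 - cos (t - x)) * fejer N.+1 (t - x))).
  by move=> x; apply: cvgM; [exact: cvg_cst|exact: cg].
have ceC : continuous (fun x => e * fejer N.+1 (t - x) + C * ((1 - cos (t - x)) * fejer N.+1 (t - x))).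
  by move=> x; apply: cvgD; [exact: ce|exact: cC].
have IE : I (fun x => e * fejer N.+1 (t - x) + C * ((1 - cos (t - x)) * fejer N.+1 (t - x))) =
   e * (N.+1%:R * (2 * pi)) + C * (2 * pi).
  by rewrite ID// !IZ// I_fejer I_fejer_cos.
have HA : `|I (fun x => (m x - m t) * fejer N.+1 (t - x))| <= e * (N.+1%:R * (2 * pi)) + C * (2 * pi).
  rewrite -IE ler_norml; apply/andP; split; last first.
    apply: I_le => // x xp; have := H x t xp tp; rewrite ler_norml => /andP[_ h].
    by have := ler_wpM2r (fejer_ge0 N.+1 (t - x)) h; lra.
  rewrite -mulN1r -IZ//; apply: I_le => //.
    by move=> x; apply: cvgM; [exact: cvg_cst|exact: ceC].
  move=> x xp; have := H x t xp tp; rewrite ler_norml => /andP[h _].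
  by have := ler_wpM2r (fejer_ge0 N.+1 (t - x)) h; lra.
rewrite E normrM normfV [`|2 * _ * _|]gtr0_norm ?mulr_gt0// ler_pdivrMr ?mulr_gt0//.
rewrite (le_trans HA)// le_eqVlt; apply/orP; left; apply/eqP.
have Nn : N.+1%:R != 0 :> R by rewrite gt_eqF.
by move: (pi : R) (N.+1%:R : R) Nn => P K Nn; field.
Qed.

(** The whole [k]-th term of the Fourier series at the point [t], not just a coefficient. *)
Definition fcoef t (k : nat) : R := e2 k / (2 * pi) * I (fun x => m x * cos (k%:R * (t - x))).

Lemma series_fcoef t n :
  series (fcoef t) n.+1 = I (fun x => m x * dirichlet n (t - x)) / (2 * pi).
Proof.
have -> : (fun x => m x * dirichlet n (t - x)) =
   (fun x => \sum_(k < n.+1) e2 k * (m x * cos (k%:R * (t - x)))).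
  by apply/funext => x; rewrite /dirichlet mulr_sumr; apply: eq_bigr => k _; ring.
have cF k : continuous (fun x => e2 k * (m x * cos (k%:R * (t - x)))).
  by move=> x; apply: cvgM; [exact: cvg_cst|apply: cm; exact: continuous_cosM].
rewrite (I_sum n.+1 cF).2 /series/= big_mkord mulr_suml; apply: eq_bigr => k _.
by rewrite IZ /fcoef; [ring|apply: cm; exact: continuous_cosM].
Qed.

(** Convergence is supplied later by the decay of the coefficients. Given it, the Cesaro means have
    the same limit, and they are the Fejer means, which tend to [m t]. *)
Lemma fourier_series t : - pi <= t <= pi -> cvgn (series (fcoef t)) ->
  series (fcoef t) @ \oo --> m t.
Proof.
move=> tp cs; have cs' := cs.
suff -> : m t = limn (series (fcoef t)) by [].
set l := limn _.
have cS : (fun n => series (fcoef t) n.+1) @ \oo --> l by rewrite cvg_shiftS.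
have := cesaro cS => cM.
have p0 := pi_gt0 R.
have ME N : arithmetic_mean (fun n => series (fcoef t) n.+1) N =
    I (fun x => m x * fejer N.+1 (t - x)) / (2 * pi * N.+1%:R).
  have -> : (fun x => m x * fejer N.+1 (t - x)) =
     (fun x => \sum_(n < N.+1) m x * dirichlet n (t - x)).
    by apply/funext => x; rewrite /fejer mulr_sumr.
  have cF n : continuous (fun x => m x * dirichlet n (t - x)).
    exact/cm/continuous_dirichlet.
  rewrite (I_sum N.+1 cF).2 /arithmetic_mean /series/= big_mkord mulr_suml mulr_sumr.
  apply: eq_bigr => n _.
  have := series_fcoef t n; rewrite /series/= => ->.
  by move: (2 * pi : R) (N.+1%:R : R) (I _) => P K X; rewrite (invfM P K); ring.
apply/eqP; rewrite -subr_eq0 -normr_eq0 eq_le normr_ge0 andbT.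
apply/ler_addgt0Pl => e e0; rewrite addr0.
have e40 : 0 < e / 4 by rewrite divr_gt0.
have [C C0 HC] := fejer_mean tp e40.
have N1 : \forall N \near \oo, `|l - arithmetic_mean (fun n => series (fcoef t) n.+1) N| <= e / 4.
  by have /cvgrPdist_le/(_ _ e40) := cM.
have N2 : \forall N \near \oo, N.+1%:R^-1 < e / 4 / (C + 1) :> R.
  apply: near_infty_natSinv_lt (PosNum _); by rewrite divr_gt0// ltr_wpDl.
have [N [h1 h2]] : exists N, `|l - arithmetic_mean (fun n => series (fcoef t) n.+1) N| <= e / 4 /\
    N.+1%:R^-1 < e / 4 / (C + 1) :> R.
  have [N _ HN] := filterI N1 N2; exists N; exact: (HN N (leqnn N)).
have h3 := HC N; rewrite -ME in h3.
have h4 : C / N.+1%:R <= e / 4.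
  apply: (@le_trans _ _ ((C + 1) / N.+1%:R)); first by rewrite ler_pM2r ?invr_gt0 ?ltr0n// lerDl.
  by rewrite mulrC -ler_pdivlMr ?ltr_wpDl// ltW.
have -> : m t - l = - (l - arithmetic_mean (fun n => series (fcoef t) n.+1) N) -
   (arithmetic_mean (fun n => series (fcoef t) n.+1) N - m t) by ring.
rewrite (le_trans (ler_normB _ _))// normrN (le_trans (lerD h1 h3))//.
by move: (C / _) h4 => q h4; lra.
Qed.

End fourier.

(** * Cosine series acting on tempered distributions *)

Section modulation_series.
Context {R : realType} {d : nat}.
Notation Rd := 'rV[R]_d.
Implicit Types (psi chi : Rd -> R) (i : 'I_d) (z xi x y : Rd) (w : R) (f : tdist R d).

(** Only finitely many multi-indices have length at most [N], so their constants can be merged into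
    one. *)
Lemma seq_unif (P : seq 'I_d -> R -> Prop) :
  (forall s M M', M <= M' -> P s M -> P s M') ->
  (forall s, exists2 M, 0 <= M & P s M) ->
  forall N, exists2 M, 0 <= M & forall s, (size s <= N)%N -> P s M.
Proof.
move=> + + N; elim: N P => [|N IH] P Pmon PM.
  by have [M M0 HM] := PM [::]; exists M => // -[].
have H i : exists M, 0 <= M /\ forall s, (size s <= N)%N -> P (i :: s) M.
  have [|i'|M M0 HM] := IH (fun s => P (i :: s)); last by exists M.
    by move=> s M M'; exact: Pmon.
  exact: PM.
have [M HM] := choice H.
have [M1 M10 HM1] := PM [::].
have S0 : 0 <= \sum_i M i by apply: sumr_ge0 => i _; exact: (HM i).1.
exists (M1 + \sum_i M i); first by rewrite addr_ge0.
move=> [|i s]; first by move=> _; apply: Pmon HM1; rewrite lerDl.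
rewrite ltnS => sN; apply: Pmon ((HM i).2 s sN).
rewrite (@le_trans _ _ (\sum_i M i)) ?lerDr//.
by rewrite (bigD1 i)//= lerDl sumr_ge0// => j _; exact: (HM j).1.
Qed.

Lemma mono_mul (g : Rd -> R) s psi : mono s (fun xi => g xi * psi xi) = (fun xi => g xi * mono s psi xi).
Proof. by apply/funext => xi; rewrite !monoE mulrCA. Qed.

Lemma mono_lin (c : R) s psi psi' :
  mono s (fun xi => c * psi xi + psi' xi) = (fun xi => c * mono s psi xi + mono s psi' xi).
Proof. by apply/funext => xi; rewrite !monoE; ring. Qed.

Lemma J_unif_decay N psi : ccs psi -> exists2 M, 0 <= M & forall s, (size s <= N)%N ->
  forall z w, (1 + `|z|) ^+ N * `|J (mono s psi) z w| <= M.
Proof.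
move=> pc; apply: (seq_unif (P := fun s M => forall z w, (1 + `|z|) ^+ N * `|J (mono s psi) z w| <= M)).
  by move=> s M M' MM H z w; exact: le_trans (H z w) MM.
by move=> s; apply: J_decay; exact: ccs_mono.
Qed.

Lemma norm_evec_le (t : R) i : `|t *: evec R i| <= `|t|.
Proof.
apply: norm_le_coord => // j; rewrite !mxE eqxx/= normrM.
by case: eqP => _; rewrite ?normr1 ?mulr1 ?normr0 ?mulr0.
Qed.

Lemma decay_shift N psi (M : R) z (t : R) i w : 0 <= M ->
  (forall z w, (1 + `|z|) ^+ N * `|J psi z w| <= M) ->
  (1 + `|z|) ^+ N * `|J psi (z + t *: evec R i) w| <= (1 + `|t|) ^+ N * M.
Proof.
move=> M0 HM; apply: (@le_trans _ _ ((1 + `|t|) ^+ N * ((1 + `|z + t *: evec R i|) ^+ N *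
   `|J psi (z + t *: evec R i) w|))).
  rewrite mulrA ler_wpM2r// -exprMn lerXn2r ?nnegrE ?mulr_ge0 ?addr_ge0//.
  have := norm_evec_le t i.
  have : `|z| <= `|z + t *: evec R i| + `|t *: evec R i|.
    by rewrite -{1}(addrK (t *: evec R i) z) (le_trans (ler_normB _ _)).
  by have := normr_ge0 t; have := normr_ge0 (z + t *: evec R i); nra.
by rewrite ler_wpM2l ?exprn_ge0 ?addr_ge0.
Qed.

Section series.
Variables (chi : Rd -> R) (l : 'I_d) (M : Rd -> R) (a t b : nat -> R).
Hypotheses (chic : ccs chi) (Mc : ccs (fun xi => M xi * chi xi)).
Hypothesis asum : forall N, cvgn (series (fun k => `|a k| * (1 + `|t k|) ^+ N)).
Hypothesis Mlim : forall xi, chi xi != 0 ->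
  series (fun k => a k * cos (t k * xi 0 l + b k)) @ \oo --> M xi.

Let md k xi := cos (t k * xi 0 l + b k) * chi xi.
Let mdc k : ccs (md k).
Proof. exact: (ccs_coord l (@sm1_cos R (t k) (b k)) chic). Qed.

Definition rem n xi : R := (M xi - series (fun k => a k * cos (t k * xi 0 l + b k)) n) * chi xi.

Let rem0 : rem 0 = (fun xi => M xi * chi xi).
Proof. by apply/funext => xi; rewrite /rem /series/= big_geq// subr0. Qed.

Let remS n : rem n.+1 = (fun xi => (- a n) * md n xi + rem n xi).
Proof.
by apply/funext => xi; rewrite /rem /md seriesSr; ring.
Qed.

Let remc n : ccs (rem n).
Proof. by elim: n => [|n IH]; rewrite ?rem0// remS; exact: ccs_lin. Qed.

Let u N k := `|a k| * (1 + `|t k|) ^+ N.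
Let tail N n := limn (series (u N)) - series (u N) n.

Let u_ge0 N k : 0 <= u N k.
Proof. by rewrite mulr_ge0// exprn_ge0// addr_ge0. Qed.

Let tail_ge N n p : \sum_(n <= k < n + p) u N k <= tail N n.
Proof.
rewrite lerBrDr.
have -> : \sum_(n <= k < n + p) u N k + series (u N) n = series (u N) (n + p).
  by rewrite addrC /series/= -big_cat_nat// leq_addr.
apply: limr_ge; first exact: asum.
near=> q; apply: nondecreasing_series => //; near: q; exact: nbhs_infty_ge.
Unshelve. all: by end_near. Qed.

Let tail_ge0 N n : 0 <= tail N n.
Proof. by have := tail_ge N n 0; rewrite addn0 big_geq. Qed.

Let tail_cvg N : tail N n @[n --> \oo] --> 0.
Proof.
rewrite -(subrr (limn (series (u N)))); apply: cvgB; first exact: cvg_cst.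
exact: asum.
Qed.

Let rem_le n xi : `|rem n xi| <= tail 0 n * `|chi xi|.
Proof.
rewrite /rem; have [->|c0] := eqVneq (chi xi) 0; first by rewrite mulr0 normr0 mulr0.
rewrite normrM ler_wpM2r//.
have c1 := Mlim c0.
set v := (fun k => a k * cos (t k * xi 0 l + b k)) in c1 *.
have -> : M xi = limn (series v) by apply/esym/cvg_lim.
have H : (fun p => `|series v p - series v n|) @ \oo --> `|limn (series v) - series v n|.
  apply: cvg_norm; apply: cvgB; last exact: cvg_cst.
  by apply/cvg_ex; exists (M xi).
rewrite -(cvg_lim _ H)//; apply: limr_le; first by apply/cvg_ex; eexists; exact: H.
near=> p.
have np : (n <= p)%N by near: p; exact: nbhs_infty_ge.
have -> : series v p - series v n = \sum_(n <= k < n + (p - n)) v k.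
  by rewrite subnKC// /series/= (big_cat_nat _ np)//= addrAC subrr add0r.
apply: le_trans (ler_norm_sum _ _ _) _; apply: le_trans (tail_ge 0 n (p - n)).
apply: ler_sum => k _; rewrite /u expr0 mulr1 normrM -[leRHS]mulr1 ler_wpM2l//.
exact: cos_max.
Unshelve. all: by end_near. Qed.

Let Jrem_step N s K n z w : 0 <= K ->
  (forall z w, (1 + `|z|) ^+ N * `|J (mono s chi) z w| <= K) ->
  (1 + `|z|) ^+ N * `|J (mono s (rem n)) z w| <=
  K * u N n + (1 + `|z|) ^+ N * `|J (mono s (rem n.+1)) z w|.
Proof.
move=> K0 HK.
have E : J (mono s (rem n)) z w = a n * J (mono s (md n)) z w + J (mono s (rem n.+1)) z w.
  rewrite -J_lin; [|exact: ccs_mono|exact: ccs_mono].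
  rewrite -mono_lin; apply: J_ext => xi; rewrite !monoE remS; ring.
rewrite E; apply: (@le_trans _ _ ((1 + `|z|) ^+ N * (`|a n| * `|J (mono s (md n)) z w| + `|J (mono s (rem n.+1)) z w|))).
  by rewrite ler_wpM2l ?exprn_ge0 ?addr_ge0// -normrM ler_normD.
rewrite mulrDr lerD2r [leLHS]mulrCA /u [leRHS]mulrCA ler_wpM2l// /md mono_mul J_mod; last exact: ccs_mono.
rewrite normrM [`|2^-1|]gtr0_norm ?invr_gt0// mulrA ler_pdivrMr//.
apply: (@le_trans _ _ ((1 + `|z|) ^+ N * (`|J (mono s chi) (z + t n *: evec R l) (w + b n)| +
   `|J (mono s chi) (z - t n *: evec R l) (w - b n)|))).
  by rewrite ler_wpM2l ?exprn_ge0 ?addr_ge0// ler_normD.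
have := decay_shift z (t n) l (w + b n) K0 HK.
have := decay_shift z (- t n) l (w - b n) K0 HK.
by rewrite scaleNr normrN mulrDr; lra.
Qed.

(** Iterating the one-term step [p] times leaves the kernel of [rem (n + p)], which is known to be
    small only without the weight; at fixed [z] the weight is a constant, so [p] may tend to
    infinity. *)
Let Jrem N s K n z w : 0 <= K ->
  (forall z w, (1 + `|z|) ^+ N * `|J (mono s chi) z w| <= K) ->
  (1 + `|z|) ^+ N * `|J (mono s (rem n)) z w| <= K * tail N n.
Proof.
move=> K0 HK.
have step p : (1 + `|z|) ^+ N * `|J (mono s (rem n)) z w| <=
   K * tail N n + (1 + `|z|) ^+ N * `|J (mono s (rem (n + p))) z w|.
  apply: (@le_trans _ _ (K * (\sum_(n <= k < n + p) u N k) +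
     (1 + `|z|) ^+ N * `|J (mono s (rem (n + p))) z w|)); last by rewrite lerD2r ler_wpM2l.
  elim: p => [|p IH]; first by rewrite addn0 big_geq// mulr0 add0r.
  apply: le_trans IH _; rewrite addnS big_nat_recr ?leq_addr//= mulrDr -addrA lerD2l.
  exact: Jrem_step.
have [A [Lc [Mc' [A0 _ [cM _ cA]]]]] := cl_ge0 (ccs_cl (ccs_mono s chic)).
have bnd p : `|J (mono s (rem p)) z w| <= (2 * A) ^+ d * (tail 0 p * Mc').
  apply: J_le => //.
  - exact: ccs_mono.
  - move=> xi; rewrite monoE normrM.
    apply: (@le_trans _ _ (`|\prod_(j <- s) xi 0 j| * (tail 0 p * `|chi xi|))).
      by rewrite ler_wpM2l.
    by rewrite mulrCA -normrM -monoE ler_wpM2l.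
  - move=> xi j Aj; have := cA _ _ Aj; rewrite !monoE => E.
    have [c0|c0] := eqVneq (chi xi) 0; first by rewrite /rem c0 !mulr0.
    by move/eqP: E; rewrite mulf_eq0 (negbTE c0) orbF => /eqP ->; rewrite mul0r.
have cv : (fun p => K * tail N n + (1 + `|z|) ^+ N * ((2 * A) ^+ d * (tail 0 (n + p) * Mc'))) @ \oo -->
    K * tail N n + (1 + `|z|) ^+ N * ((2 * A) ^+ d * (0 * Mc')).
  apply: cvgD; first exact: cvg_cst.
  apply: cvgM; first exact: cvg_cst.
  apply: cvgM; first exact: cvg_cst.
  apply: cvgM; last exact: cvg_cst.
  rewrite (_ : (fun p => tail 0 (n + p)) = (fun p => tail 0 (p + n)%N)).
    by rewrite cvg_shiftn; exact: tail_cvg.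
  by apply/funext => p; rewrite addnC.
rewrite mul0r mulr0 mulr0 addr0 in cv.
have cv' : cvgn (fun p => K * tail N n + (1 + `|z|) ^+ N * ((2 * A) ^+ d * (tail 0 (n + p) * Mc'))).
  by apply/cvg_ex; eexists; exact: cv.
rewrite -(cvg_lim _ cv)//; apply: limr_ge => //.
near=> p; apply: le_trans (step p) _; rewrite lerD2l.
by rewrite ler_wpM2l ?exprn_ge0 ?addr_ge0.
Unshelve. all: by end_near. Qed.

Lemma W_rem n f x w : ctempered f ->
  W f (fun xi => M xi * chi xi) x w = series (fun k =>
    a k * ((W f chi (x + t k *: evec R l) (w + b k) + W f chi (x - t k *: evec R l) (w - b k)) / 2)) n
  + W f (rem n) x w.
Proof.
move=> ft; elim: n => [|n ->]; first by rewrite /series/= big_geq// add0r rem0.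
rewrite seriesSr remS W_lin// /md W_mod//; ring.
Qed.

(** A tempered functional is bounded on the kernel of [rem n] by finitely many weighted norms, each
    at most a multiple of a tail of the series in [asum]; hence its values tend to zero. *)
Lemma W_series f x w : ctempered f ->
  series (fun k =>
    a k * ((W f chi (x + t k *: evec R l) (w + b k) + W f chi (x - t k *: evec R l) (w - b k)) / 2))
  @ \oo --> W f (fun xi => M xi * chi xi) x w.
Proof.
move=> ft; set v := (v in series v).
have E n : series v n = W f (fun xi => M xi * chi xi) x w - W f (rem n) x w.
  by rewrite (W_rem n)// addrK.
rewrite (_ : series v = (fun n => W f (fun xi => M xi * chi xi) x w - W f (rem n) x w)); last first.
  exact/funext/E.
rewrite -[X in _ --> X]subr0; apply: cvgB; first exact: cvg_cst.
have [t1 t2] := ft.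
have [C1 [N1 [C10 H1]]] := tempered_Kf t1.
have [C2 [N2 [C20 H2]]] := tempered_Kf t2.
have [K1 K10 HK1] := J_unif_decay N1 chic.
have [K2 K20 HK2] := J_unif_decay N2 chic.
have B n : `|W f (rem n) x w| <= C1 * (1 + `|x|) ^+ N1 * (K1 * tail N1 n) +
    C2 * (1 + `|x|) ^+ N2 * (K2 * tail N2 n).
  rewrite /W (le_trans (ler_normB _ _))// lerD//.
    by apply: H1 => //; [rewrite mulr_ge0|move=> s z w' sN; apply: Jrem => //; exact: HK1].
  by apply: H2 => //; [rewrite mulr_ge0|move=> s z w' sN; apply: Jrem => //; exact: HK2].
have c0 : (fun n => C1 * (1 + `|x|) ^+ N1 * (K1 * tail N1 n) +
    C2 * (1 + `|x|) ^+ N2 * (K2 * tail N2 n)) @ \oo -->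
    C1 * (1 + `|x|) ^+ N1 * (K1 * 0) + C2 * (1 + `|x|) ^+ N2 * (K2 * 0).
  by apply: cvgD; apply: cvgM; [exact: cvg_cst| |exact: cvg_cst|];
    apply: cvgM; [exact: cvg_cst|exact: tail_cvg|exact: cvg_cst|exact: tail_cvg].
rewrite !mulr0 addr0 in c0.
apply/norm_cvg0P.
apply: (squeeze_cvgr _ (cvg_cst (0 : R)) c0).
by near=> n; rewrite normr_ge0 B.
Unshelve. all: by end_near. Qed.

End series.
End modulation_series.

(** * Cosine expansion of a dilated bump *)

Section one_dim.
Context {R : realType}.
Implicit Types (m g : R -> R) (t w y : R).
Local Notation mu := (@lebesgue_measure R).

(** Functions of one variable become functions on row vectors of length one, so that the theory of
    [J] applies to them. *)
Definition emb1 m : 'rV[R]_1 -> R := fun X => m (X 0 0).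

Definition j1 m y w : R := J (emb1 m) (const_mx y) w.

Lemma RI1 g : RI (emb1 g) = fine (\int[mu]_y (g y)%:E).
Proof.
rewrite /RI /intRd /=; congr fine; apply: eq_integral => y _.
by rewrite /emb1 mxE.
Qed.

Lemma dot1 y (X : 'rV[R]_1) : dotRd (const_mx y) X = y * X 0 0.
Proof. by rewrite /dotRd big_ord1 mxE. Qed.

(** The radius 3 is that of the support of [phij phi0 1]. *)
Definition cs1 m := sm1 m /\ forall x, 3 < `|x| -> m x = 0.

Lemma cs1_ccs m : cs1 m -> ccs (emb1 m).
Proof.
move=> [ms m3]; split; first exact: smooth_coord.
by exists 3 => X i; rewrite (ord1 i) => /m3.
Qed.

Lemma I_j1 m (k : nat) t : cs1 m -> (forall x, 3 / 2 < `|x| -> m x = 0) ->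
  I (fun x => m x * cos (k%:R * (t - x))) =
  cos (k%:R * t) * j1 m k%:R 0 + sin (k%:R * t) * j1 m k%:R (- (pi / 2)).
Proof.
move=> mc mA.
have -> : I (fun x => m x * cos (k%:R * (t - x))) = RI (emb1 (fun x => m x * cos (k%:R * (t - x)))).
  rewrite RI1 /I /Rintegral integral_mkcond; congr fine; apply: eq_integral => x _.
  rewrite patchE; case: ifPn => //; rewrite notin_setE/= in_itv/= => /negP xp.
  rewrite mA ?mul0r//; have := pi_ge2 R; move: xp; rewrite -ler_norml -ltNge.
  by move=> *; lra.
rewrite /j1 /J -RIZ; last exact/cl_cos/cs1_ccs.
rewrite -RIZ; last exact/cl_cos/cs1_ccs.
rewrite -RID; [|exact/clZ/cl_cos/cs1_ccs|exact/clZ/cl_cos/cs1_ccs].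
congr RI; apply/funext => X; rewrite /emb1 !dot1 addr0 mulrBr !cosB cos_pihalf sin_pihalf.
by ring.
Qed.

Lemma sm1_scale m (s : R) : sm1 m -> sm1 (fun x => m (s * x)).
Proof.
move=> /(@sm1_affine _ _ s 0); congr sm1.
by apply/funext => x; rewrite addr0.
Qed.

Lemma j1_scale m (s y w : R) : 0 < s -> cs1 m ->
  j1 (fun x => m (s^-1 * x)) y w = s * j1 m (s * y) w.
Proof.
move=> s0 mc; rewrite /j1.
have := @J_dscale R 1 (fun=> s^-1) (emb1 m) (const_mx (s * y)) w (fun=> _) (cs1_ccs mc).
rewrite big_ord1 invrK => <-; last by rewrite invr_gt0.
have -> : dscale (fun=> s^-1) (const_mx (s * y)) = const_mx y :> 'rV[R]_1.
  by apply/rowP => i; rewrite !mxE mulrA mulVf ?mul1r// gt_eqF.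
by apply: J_ext => X; rewrite /emb1 mxE.
Qed.

Definition dec N (B : R) m := forall y w, (1 + `|y|) ^+ N * `|j1 m y w| <= B.

Lemma norm_const1 y : `|const_mx y : 'rV[R]_1| = `|y|.
Proof.
apply/eqP; rewrite eq_le; apply/andP; split.
  by apply: norm_le_coord => // i; rewrite mxE.
by have := norm_coord (const_mx y : 'rV[R]_1) 0; rewrite mxE.
Qed.

Lemma cs1_dec N m : cs1 m -> exists2 B, 0 <= B & dec N B m.
Proof.
move=> /cs1_ccs /(J_decay N)[B B0 H]; exists B => // y w.
by have := H (const_mx y) w; rewrite norm_const1.
Qed.

Lemma polar (a b : R) : exists r w, 0 <= r <= `|a| + `|b| /\
  forall x, a * cos x + b * sin x = r * cos (x + w).
Proof.
pose r := Num.sqrt (a ^+ 2 + b ^+ 2).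
have r0 : 0 <= r by exact: sqrtr_ge0.
have r2 : r ^+ 2 = a ^+ 2 + b ^+ 2 by rewrite sqr_sqrtr// addr_ge0// sqr_ge0.
have rab : r <= `|a| + `|b|.
  rewrite -(@ler_pXn2r _ 2)// ?nnegrE ?addr_ge0// r2 -(real_normK (num_real a)) -(real_normK (num_real b)).
  by have := normr_ge0 a; have := normr_ge0 b; nra.
have [rn|rn] := eqVneq r 0.
  exists 0, 0; rewrite lexx addr_ge0//; split => // x.
  move: r2; rewrite rn expr0n/= => /esym/eqP.
  rewrite paddr_eq0 ?sqr_ge0// !sqrf_eq0 => /andP[/eqP -> /eqP ->].
  by rewrite !mul0r addr0.
have [w [cw sw]] : exists w, cos w = a / r /\ sin w = - b / r.
  have E : (a / r) ^+ 2 + (- b / r) ^+ 2 = 1.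
    by rewrite !exprMn sqrrN -mulrDl -r2 -exprMn divff// expr1n.
  have a1 : -1 <= a / r <= 1.
    by rewrite -ler_norml -(expr_le1 (n := 2))// real_normK ?num_real// -E lerDl sqr_ge0.
  have s2 : `|sin (acos (a / r))| = `|- b / r|.
    apply/eqP; rewrite -(eqrXn2 (n := 2))// !real_normK ?num_real//.
    by rewrite sin2cos2 acosK// -E addrC addKr.
  have s0 : 0 <= sin (acos (a / r)).
    by rewrite sin_ge0_pi// acos_ge0//= acos_lepi.
  have [b0|b0] := leP 0 (- b / r).
    exists (acos (a / r)); rewrite acosK//; split => //.
    by rewrite -(ger0_norm s0) s2 ger0_norm.
  exists (- acos (a / r)); rewrite cosN acosK// sinN; split => //.
  by rewrite -(ger0_norm s0) s2 ltr0_norm// opprK.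
exists r, w; rewrite r0 rab; split => // x.
by rewrite cosD cw sw; field.
Qed.

(** A Riemann sum of mesh [s] for the integral of [(1 + y) ^ -2], which is 1; the terms with
    [k >= 1] are bounded by a telescoping difference. *)
Lemma sum_decay (s : R) n : 0 < s -> \sum_(k < n) s / (1 + s * k%:R) ^+ 2 <= s + 1.
Proof.
move=> s0.
have q (k : nat) : 0 < 1 + s * k%:R by rewrite ltr_pwDl// mulr_ge0// ltW.
have H p : \sum_(k < p.+1) s / (1 + s * k%:R) ^+ 2 <= s + (1 - (1 + s * p%:R)^-1).
  elim: p => [|p IH].
    by rewrite big_ord_recl big_ord0 mulr0 !addr0 expr1n invr1 subrr mulr1 addr0.
  rewrite big_ord_recr/=; apply: (le_trans (lerD IH (lexx _))).
  rewrite -!addrA lerD2l lerD2l.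
  have E : 1 + s * p.+1%:R = (1 + s * p%:R) + s by rewrite -natr1; ring.
  have := q p; have := q p.+1; rewrite E; move: (1 + s * p%:R) => v vs v0.
  rewrite -subr_ge0.
  have -> : - (v + s)^-1 - (- v^-1 + s / (v + s) ^+ 2) = s ^+ 2 / (v * (v + s) ^+ 2).
    by field; rewrite !gt_eqF.
  by rewrite divr_ge0 ?mulr_ge0 ?sqr_ge0// ltW.
case: n => [|n]; first by rewrite big_ord0 addr_ge0// ltW.
by apply: le_trans (H n) _; rewrite lerD2l gerBl invr_ge0 ltW.
Qed.

Lemma cvg_decay (s : R) (u : nat -> R) (C : R) : 0 < s -> 0 <= C -> (forall k, 0 <= u k) ->
  (forall k, u k <= C * (s / (1 + s * k%:R) ^+ 2)) ->
  cvgn (series u) /\ limn (series u) <= C * (s + 1).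
Proof.
move=> s0 C0 u0 uC.
have B n : series u n <= C * (s + 1).
  rewrite /series/= big_mkord (@le_trans _ _ (\sum_(k < n) C * (s / (1 + s * k%:R) ^+ 2)))//.
    by apply: ler_sum => k _; exact: uC.
  by rewrite -mulr_sumr ler_wpM2l// sum_decay.
have cu : cvgn (series u).
  apply: nondecreasing_is_cvgn.
    by apply: nondecreasing_series => k _ _; exact: u0.
  by exists (C * (s + 1)) => _ [n _ <-].
by split => //; apply: limr_le => //; near=> n.
Unshelve. all: by end_near. Qed.

(** The dilated bump [m(t / s)] lives in [[- 3 s, 3 s]], well inside one period as [s <= 1 / 2]; its
    [k]-th coefficient is a multiple of [s] times the transform of [m] at [s * k]. *)
Lemma fourier_expansion m (s : R) : cs1 m -> 0 < s -> s <= 1 / 2 ->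
  exists a b : nat -> R,
    (forall N B, 0 <= B -> dec N B m -> forall k, `|a k| <= B * (s / (1 + s * k%:R) ^+ N)) /\
    (forall t, `|t| <= pi -> series (fun k => a k * cos (k%:R * t + b k)) @ \oo --> m (s^-1 * t)).
Proof.
move=> mc s0 s2.
pose ms x := m (s^-1 * x).
have [msm m3] := mc.
have msA x : 3 / 2 < `|x| -> ms x = 0.
  move=> x3; apply: m3; rewrite normrM gtr0_norm ?invr_gt0// mulrC ltr_pdivlMr//.
  by nra.
have msc : cs1 ms.
  split; first exact: sm1_scale.
  by move=> x x3; apply: msA; lra.
have [L HL] : exists L, forall x y, `|ms x - ms y| <= L * `|x - y|.
  have [_ [L [_ [_ cL _]]]] := ccs_cl (cs1_ccs msc).
  exists L => x y; have := cL (const_mx y) 0 (x - y).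
  by rewrite /emb1 !mxE !eqxx mulr1 addrC subrK.
have H k : exists rb : R * R, 0 <= rb.1 <= `|e2 k / (2 * pi) * (s * j1 m (s * k%:R) 0)| +
     `|e2 k / (2 * pi) * (s * j1 m (s * k%:R) (- (pi / 2)))| /\
   forall x, e2 k / (2 * pi) * (s * j1 m (s * k%:R) 0) * cos x +
      e2 k / (2 * pi) * (s * j1 m (s * k%:R) (- (pi / 2))) * sin x = rb.1 * cos (x + rb.2).
  by have [r [w ?]] := polar (e2 k / (2 * pi) * (s * j1 m (s * k%:R) 0))
    (e2 k / (2 * pi) * (s * j1 m (s * k%:R) (- (pi / 2)))); exists (r, w).
have [rb Hrb] := choice H.
exists (fun k => (rb k).1), (fun k => (rb k).2).
have p0 := pi_gt0 R.
have dB N B : 0 <= B -> dec N B m -> forall k, `|(rb k).1| <= B * (s / (1 + s * k%:R) ^+ N).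
  move=> B0 HB k; have [/andP[r0 +] _] := Hrb k.
  rewrite (ger0_norm r0) => /le_trans; apply.
  have q : 0 < (1 + s * k%:R) ^+ N by rewrite exprn_gt0// ltr_pwDl// mulr_ge0// ltW.
  have jb w : `|j1 m (s * k%:R) w| <= B / (1 + s * k%:R) ^+ N.
    rewrite ler_pdivlMr// mulrC; have := HB (s * k%:R) w.
    by rewrite [`|s * _|]ger0_norm// mulr_ge0// ltW.
  (* The factor 1 / 2 makes up for adding the cosine and the sine amplitude. *)
  have ek : 0 <= (e2 k / (2 * pi) : R) <= 1 / 2.
    have := pi_ge2 R => pi2.
    have e0 : 0 <= e2 k :> R by rewrite /e2; case: eqP => _.
    have e2' : e2 k <= 2 :> R by rewrite /e2; case: eqP => _; lra.
    have pp : 0 < 2 * pi :> R by rewrite mulr_gt0.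
    apply/andP; split; first by rewrite divr_ge0// ltW.
    by rewrite ler_pdivrMr//; lra.
  rewrite !normrM (gtr0_norm s0) -[`|e2 k| * _]normrM; case/andP: ek => ek0 ek2.
  rewrite (ger0_norm ek0).
  have := jb 0; have := jb (- (pi / 2)).
  rewrite [B * (s / _)]mulrCA.
  set j := `|_|; set j' := `|_|; set c := B / _; move=> hj hj'.
  have c0 : 0 <= c by rewrite divr_ge0// ltW.
  rewrite -mulrDr -mulrDr mulrCA ler_pM2l//.
  have j0 : 0 <= j' + j by rewrite addr_ge0 ?normr_ge0.
  by nra.
split => // t tp.
have tp' : - pi <= t <= pi by rewrite -ler_norml.
have E k : fcoef ms t k = (rb k).1 * cos (k%:R * t + (rb k).2).
  rewrite -(Hrb k).2 /fcoef I_j1// !j1_scale//.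
  by move: (e2 k / _) => e; ring.
have -> : (fun k => (rb k).1 * cos (k%:R * t + (rb k).2)) = fcoef ms t.
  by apply/funext => k; rewrite E.
have := fourier_series HL msA tp'; apply.
have [B B0 HB] := cs1_dec 2 mc.
apply: normed_cvg; rewrite /normed_series_of/=.
have [] := @cvg_decay s (fun k => `|fcoef ms t k|) B s0 B0 _ _ => //.
move=> k; rewrite E normrM (le_trans _ (dB _ _ B0 HB k))//.
by rewrite -[leRHS]mulr1 ler_wpM2l// cos_max.
Qed.

End one_dim.

(** * Continuity of the pieces in the space variable *)

Section kernel_continuity.
Context {R : realType} {d : nat}.
Notation Rd := 'rV[R]_d.
Implicit Types (psi chi : Rd -> R) (i : 'I_d) (z xi x y h : Rd) (w : R) (f : tdist R d).

Lemma J_modv psi h z w (b : R) : ccs psi ->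
  J (fun xi => cos (dotRd h xi + b) * psi xi) z w = (J psi (z + h) (w + b) + J psi (z - h) (w - b)) / 2.
Proof.
move=> pc; rewrite /J -RID; [|exact: cl_cos|exact: cl_cos].
rewrite [RHS]mulrC -RIZ; last by apply: clD; exact: cl_cos.
congr RI; apply/funext => xi; rewrite !dotRdDl -scaleN1r !dotRdZl.
have -> : dotRd z xi + dotRd h xi + (w + b) = (dotRd z xi + w) + (dotRd h xi + b) by ring.
have -> : dotRd z xi + -1 * dotRd h xi + (w - b) = (dotRd z xi + w) - (dotRd h xi + b) by ring.
by rewrite [cos (_ + _ + (_ + _))]cosD [cos (_ + _ - _)]cosB; field.
Qed.

Lemma J_opp psi z w : ccs psi -> J psi z (w + pi) = - J psi z w.
Proof.
move=> pc; rewrite J_phase// [J psi z w]J_phase// cosD sinD cospi sinpi; ring.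
Qed.

Lemma derive_sum (g : Rd -> R) z h : differentiable g z -> 'D_h g z = \sum_i h 0 i * D i g z.
Proof.
move=> dg; rewrite deriveE// {1}(row_sum_delta h) linear_sum; apply: eq_bigr => i _.
by rewrite linearZ /D deriveE.
Qed.

Lemma J_lip N psi : ccs psi -> exists2 M, 0 <= M & forall z h w,
  (1 + `|z|) ^+ N * `|J psi (z + h) w - J psi z w| <= M * ((1 + `|h|) ^+ N * `|h|).
Proof.
move=> pc.
have H i : exists M, 0 <= M /\ forall z w, (1 + `|z|) ^+ N * `|J (fun xi => xi 0 i * psi xi) z w| <= M.
  have [M M0 HM] := J_decay N (@ccs_coord _ _ id i _ (@sm1_id R) pc).
  by exists M.
have [M HM] := choice H.
exists (\sum_i M i); first by apply: sumr_ge0 => i _; have [] := HM i.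
move=> z h w.
have dJ z' := (J_diff z' w pc).1.
have fd (t : R) : is_derive t 1 (fun t => J psi (z + t *: h) w) ('D_h (fun z => J psi z w) (z + t *: h)).
  exact: derivable_line.
have [c c1 E] := mvt 0 1 fd.
move: E; rewrite scale1r scale0r addr0 subr0 mulr1 => ->.
rewrite derive_sum//; move: c1; rewrite !subr0 normr1 => c1.
set z' := z + c *: h.
have zz : (1 + `|z|) ^+ N <= (1 + `|h|) ^+ N * (1 + `|z'|) ^+ N.
  apply: le_trans (norm_shift_le N z' z) _; rewrite mulrC ler_wpM2r ?exprn_ge0 ?addr_ge0//.
  rewrite lerXn2r ?nnegrE ?addr_ge0// lerD2l /z' addrAC subrr add0r normrZ.
  by rewrite ler_piMl.
apply: le_trans (ler_wpM2r (normr_ge0 _) zz) _.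
rewrite -mulrA [leRHS]mulrCA ler_wpM2l ?exprn_ge0 ?addr_ge0//.
apply: le_trans (ler_wpM2l _ (ler_norm_sum _ _ _)) _.
  by rewrite exprn_ge0// addr_ge0.
rewrite mulr_sumr mulr_suml; apply: ler_sum => i _.
rewrite [leRHS]mulrC (J_diff z' w pc).2 normrM mulrCA ler_pM ?norm_coord ?mulr_ge0 ?exprn_ge0 ?addr_ge0//.
by have [_] := HM i; exact.
Qed.

Lemma J_lip2 N psi : ccs psi -> exists2 M, 0 <= M & forall s, (size s <= N)%N -> forall z h w,
  (1 + `|z|) ^+ N * `|J (mono s psi) (z + h) w - J (mono s psi) z w| <= M * ((1 + `|h|) ^+ N * `|h|).
Proof.
move=> pc; apply: (seq_unif (P := fun s M => forall z h w, (1 + `|z|) ^+ N * `|J (mono s psi) (z + h) w - J (mono s psi) z w| <= M * ((1 + `|h|) ^+ N * `|h|))).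
  move=> s M M' MM H z h w; apply: le_trans (H z h w) _.
  by rewrite ler_wpM2r// mulr_ge0 ?exprn_ge0 ?addr_ge0.
by move=> s; apply: J_lip; exact: ccs_mono.
Qed.

Lemma Kf_modv psi h x w (b : R) : ccs psi ->
  Kf (fun xi => cos (dotRd h xi + b) * psi xi) x w =
  (fun y => 2^-1 * Kf psi (x + h) (w + b) y + 2^-1 * Kf psi (x - h) (w - b) y).
Proof.
move=> pc; apply/funext => y; rewrite /Kf J_modv//.
have -> : x + h - y = x - y + h by rewrite addrAC.
have -> : x - h - y = x - y - h by rewrite addrAC.
by ring.
Qed.

(** Up to a phase, the difference of the two translates is the kernel of [2 sin(h.xi) psi]. The
    tempered bound applies to this symbol, whose seminorms carry the factor [|h|]. *)
Lemma tempered_Kf_lip (u : (Rd -> R) -> R) psi w : tempered u -> ccs psi ->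
  exists (C : R) (N : nat), 0 <= C /\ forall x h,
    `|u (Kf psi (x + h) w) - u (Kf psi (x - h) w)| <= C * (1 + `|x|) ^+ N * ((1 + `|h|) ^+ N * `|h|).
Proof.
move=> ut pc; have [C [N [C0 HC]]] := tempered_Kf ut.
have [M M0 HM] := J_lip2 N pc.
exists (2 * (C * M)), N; split; first by rewrite !mulr_ge0.
move=> x h; have [ul _] := ut.
pose ph xi := cos (dotRd h xi + - (pi / 2)) * psi xi.
have pch : ccs ph by exact: (ccsM (smooth_cos_dot _ _)).
have E : u (Kf psi (x + h) w) - u (Kf psi (x - h) w) = 2 * u (Kf ph x (w + pi / 2)).
  rewrite Kf_modv// ul; [|exact: schwartz_Kf|exact: schwartz_KfZ].
  rewrite (temperedZ _ ut (schwartz_Kf _ _ pc)) addrK opprK.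
  have -> : w + pi / 2 + pi / 2 = w + pi by rewrite -addrA -splitr.
  have -> : Kf psi (x - h) (w + pi) = (fun y => - 1 * Kf psi (x - h) w y).
    by apply/funext => y; rewrite /Kf J_opp//; ring.
  rewrite (temperedZ _ ut (schwartz_Kf _ _ pc)).
  by field.
rewrite E normrM ger0_norm//.
have -> : 2 * (C * M) * (1 + `|x|) ^+ N * ((1 + `|h|) ^+ N * `|h|) =
  2 * (C * (1 + `|x|) ^+ N * (M * ((1 + `|h|) ^+ N * `|h|))) by ring.
rewrite ler_pM2l//; apply: HC => //.
  by rewrite !mulr_ge0// exprn_ge0// addr_ge0.
move=> s z w' sN; rewrite /ph mono_mul J_modv; last exact: ccs_mono.
have -> : w' - - (pi / 2) = w' - pi / 2 + pi by rewrite opprK -addrA; congr (_ + _); field.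
rewrite J_opp; last exact: ccs_mono.
have h1 := HM s sN z h (w' - pi / 2); have h2 := HM s sN z (- h) (w' - pi / 2).
rewrite normrN in h2.
set a := J _ (z + h) _ in h1 *; set b := J _ (z - h) _ in h2 *; set c := J _ z _ in h1 h2.
have -> : (a - b) / 2 = 2^-1 * (a - c) + 2^-1 * (c - b) by field.
apply: le_trans (ler_wpM2l _ (ler_normD _ _)) _; first by rewrite exprn_ge0// addr_ge0.
rewrite !normrM (ger0_norm (_ : 0 <= 2^-1))// [`|c - b|]distrC.
rewrite mulrDr !(mulrCA _ 2^-1).
by move: h1 h2; set X := _ * `|a - c|; set Y := _ * `|b - c|; set Z := M * _; lra.
Qed.

Lemma rowv_cvg (v : nat -> nat -> R) v0 (e : R) : (forall k, v m k @[m --> \oo] --> v0 k) -> 0 < e ->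
  \forall m \near \oo, `|rowv v0 - rowv (v m) : Rd| <= e.
Proof.
move=> vv e0.
have : \forall m \near \oo, forall i : 'I_d, `|v0 i - v m i| <= e.
  apply: filter_forall => i; have /cvgrPdist_le/(_ _ e0) := vv i.
  exact.
apply: filterS => m H; apply: norm_le_coord; first exact: ltW.
by move=> i; rewrite !mxE.
Qed.

(** Continuity in the sequential, coordinatewise form that matches [slsc]. *)
Definition ct (g : Rd -> R) := scont (fun v => g (rowv v)).

Lemma ct_tempered_Kf (u : (Rd -> R) -> R) psi w : tempered u -> ccs psi -> ct (fun x => u (Kf psi x w)).
Proof.
move=> ut pc v v0 vv; have [C [N [C0 HC]]] := tempered_Kf_lip w ut pc.
apply/cvgrPdist_le => e e0; set x := rowv v0.
pose K := C * (2 + `|x|) ^+ N * 2 ^+ N + 1.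
have K0 : 0 < K by rewrite ltr_wpDl// !mulr_ge0// exprn_ge0// addr_ge0.
have eK : 0 < Num.min 1 (e / K) by rewrite lt_min ltr01 divr_gt0.
have := rowv_cvg vv eK; apply: filterS => m; set y := rowv (v m).
rewrite le_min => /andP[xy1 xyK].
pose h := 2^-1 *: (x - y).
have yhh : y + h + h = x by rewrite -addrA /h -scalerDl -[2^-1]mul1r -splitr scale1r addrC subrK.
have := HC (y + h) h.
rewrite yhh addrK => /le_trans; apply.
have hn : `|h| <= `|x - y|.
  by rewrite normrZ ger0_norm// ler_piMl//; lra.
have h1 : `|h| <= 1 by apply: le_trans hn xy1.
have yh : `|y + h| <= 1 + `|x|.
  have -> : y + h = x - h by rewrite -yhh addrK.
  by rewrite (le_trans (ler_normB _ _))// addrC lerD2r.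
apply: (@le_trans _ _ (K * `|x - y|)); last by rewrite mulrC -ler_pdivlMr.
rewrite mulrA; apply: ler_pM => //.
  by rewrite !mulr_ge0 ?exprn_ge0 ?addr_ge0.
apply: (@le_trans _ _ (C * (2 + `|x|) ^+ N * 2 ^+ N)); last by rewrite /K lerDl.
apply: ler_pM; rewrite ?mulr_ge0 ?exprn_ge0 ?addr_ge0//.
  by rewrite ler_wpM2l// lerXn2r ?nnegrE ?addr_ge0//; move: yh; lra.
by rewrite lerXn2r ?nnegrE ?addr_ge0//; move: h1; lra.
Qed.

Lemma ct_W f psi w : ctempered f -> ccs psi -> ct (fun x => W f psi x w).
Proof.
by move=> [t1 t2] pc v v0 vv; apply: cvgB; exact: ct_tempered_Kf.
Qed.

Lemma ctD g1 g2 : ct g1 -> ct g2 -> ct (fun x => g1 x + g2 x).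
Proof. by move=> c1 c2 v v0 vv; apply: cvgD; [exact: c1|exact: c2]. Qed.

Lemma ctM g1 g2 : ct g1 -> ct g2 -> ct (fun x => g1 x * g2 x).
Proof. by move=> c1 c2 v v0 vv; apply: cvgM; [exact: c1|exact: c2]. Qed.

Lemma ctZ (c : R) g : ct g -> ct (fun x => c * g x).
Proof. by move=> cg v v0 vv; apply: cvgM; [exact: cvg_cst|exact: cg]. Qed.

Lemma ct_comp (F : R -> R) g : continuous F -> ct g -> ct (fun x => F (g x)).
Proof. by move=> cF cg v v0 vv; apply: continuous_cvg; [exact: cF|exact: cg]. Qed.

Lemma ct_shift g a : ct g -> ct (fun x => g (x + a)).
Proof.
move=> cg v v0 vv.
have E u : rowv u + a = rowv (fun k => u k + (if insub k is Some i then a 0 (i : 'I_d) else 0)).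
  by apply/rowP => i; rewrite !mxE valK.
rewrite E; under eq_fun do rewrite E.
by apply: cg => k; apply: cvgD => //; exact: cvg_cst.
Qed.

Lemma ct_absDelta f psi : ctempered f -> ccs psi -> ct (absDelta psi f).
Proof.
move=> ft pc.
have -> : absDelta psi f = fun x => Num.sqrt (W f psi x 0 * W f psi x 0 + W f psi x (- (pi / 2)) * W f psi x (- (pi / 2))).
  by apply/funext => y; rewrite absDeltaE.
apply: ct_comp; first exact: sqrt_continuous.
by apply: ctD; apply: ctM; exact: ct_W.
Qed.

End kernel_continuity.

(** * Lebesgue quasi-norms *)

Section power_inequalities.
Context {R : realType}.
Implicit Types (a b t r : R).

(** Young's inequality for the factors [(1 + t) ^ r] and 1 with exponents [1 / r] and
    [1 / (1 - r)]. *)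
Lemma bernoulli_le r t : 0 <= r <= 1 -> -1 <= t -> (1 + t) `^ r <= 1 + r * t.
Proof.
move=> /andP[r0 r1] t1; have t0 : 0 <= 1 + t by lra.
move: r0; rewrite le_eqVlt => /predU1P[<-|r0].
  by rewrite powRr0 mul0r addr0.
move: r1; rewrite le_eqVlt => /predU1P[->|r1]; first by rewrite powRr1// mul1r.
have r1' : 0 < 1 - r by lra.
have := @conjugate_powR R ((1 + t) `^ r) 1 r^-1 (1 - r)^-1 (powR_ge0 _ _) ler01.
rewrite !invr_gt0 !invrK => /(_ r0 r1'); rewrite mulr1 => H; apply: le_trans (H _) _; first by ring.
by rewrite powR1 mul1r -powRrM mulfV ?gt_eqF// powRr1//; lra.
Qed.

Lemma powRK a r : 0 <= a -> 0 < r -> (a `^ r) `^ r^-1 = a.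
Proof. by move=> a0 r0; rewrite -powRrM mulfV ?gt_eqF// powRr1. Qed.

Lemma powRVK a r : 0 <= a -> 0 < r -> (a `^ r^-1) `^ r = a.
Proof. by move=> a0 r0; rewrite -powRrM mulVf ?gt_eqF// powRr1. Qed.

Lemma powR_le a b r : 0 <= r -> 0 <= a -> a <= b -> a `^ r <= b `^ r.
Proof. by move=> r0 a0 ab; apply: ge0_ler_powR; rewrite ?nnegrE// (le_trans a0). Qed.

Lemma powR_lep a b r : 0 < r -> 0 <= a -> 0 <= b -> (a `^ r <= b `^ r) = (a <= b).
Proof.
move=> r0 a0 b0; apply/idP/idP; last exact: powR_le (ltW r0) a0.
move=> /(powR_le (r := r^-1)); rewrite !powRK//; apply; rewrite ?invr_ge0 ?powR_ge0//.
exact: ltW.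
Qed.

Lemma bernoulli_ge r t : 1 <= r -> -1 <= t -> 1 + r * t <= (1 + t) `^ r.
Proof.
move=> r1 t1; have r0 : 0 < r by lra.
have [/le_trans|rt] := leP (1 + r * t) 0; first by apply; exact: powR_ge0.
have t0 : 0 <= 1 + t by lra.
have := @bernoulli_le r^-1 (r * t).
rewrite invr_ge0 (ltW r0) invf_le1// r1 mulKf ?gt_eqF// => /(_ isT) H.
have : (1 + r * t) `^ r^-1 <= 1 + t by apply: H; lra.
move=> /(powR_le (ltW r0) (powR_ge0 _ _)); rewrite powRVK//; exact: ltW.
Qed.

(** For [u] in [0, 1] one has [u <= u ^ r]; add this for [u = a / (a + b)] and [u = b / (a + b)]. *)
Lemma powR_sub a b r : 0 < r <= 1 -> 0 <= a -> 0 <= b -> (a + b) `^ r <= a `^ r + b `^ r.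
Proof.
move=> /andP[r0 r1] a0 b0.
have := addr_ge0 a0 b0; rewrite le_eqVlt => /predU1P[ab|ab].
  by rewrite -ab powR0 ?gt_eqF// addr_ge0 ?powR_ge0.
have K x : 0 <= x -> x <= a + b -> x / (a + b) * (a + b) `^ r <= x `^ r.
  move=> x0 xab; have := @bernoulli_ge r^-1 (x / (a + b) - 1).
  have xq : 0 <= x / (a + b) by rewrite divr_ge0// ltW.
  have -> : x `^ r = (x / (a + b)) `^ r * (a + b) `^ r.
    by rewrite -powRM// ?(ltW ab)// divfK// gt_eqF.
  move=> _; rewrite ler_wpM2r ?powR_ge0//.
  move: xq; rewrite le_eqVlt => /predU1P[<-|xq]; first exact: powR_ge0.
  rewrite -{1}[_ / _]powRr1 ?(ltW xq)// ger_powR// xq/=.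
  by rewrite ler_pdivrMr// mul1r.
have := lerD (K a a0 _) (K b b0 _); rewrite -mulrDl -mulrDl mulfV ?gt_eqF// mul1r; apply.
- by rewrite lerDl.
- by rewrite lerDr.
Qed.

Lemma sum_powR_le1 r (c a : nat -> R) n : 0 < r <= 1 -> (forall k, 0 <= c k) -> (forall k, 0 <= a k) ->
  (\sum_(k < n) c k * a k) `^ r <= \sum_(k < n) c k `^ r * a k `^ r.
Proof.
move=> r01 c0 a0; have /andP[r0 _] := r01; elim: n => [|n IH]; first by rewrite !big_ord0 powR0// gt_eqF.
rewrite !big_ord_recr/=; apply: le_trans (powR_sub r01 _ _) _; rewrite ?mulr_ge0//.
  by apply: sumr_ge0 => k _; rewrite mulr_ge0.
by rewrite powRM// lerD2r.
Qed.

(* Jensen's inequality, from the tangent of [x ^ r] at the mean. *)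
Lemma sum_powR_ge1 r S (c a : nat -> R) n : 1 <= r -> (forall k, 0 <= c k) -> (forall k, 0 <= a k) ->
  \sum_(k < n) c k <= S ->
  (\sum_(k < n) c k * a k) `^ r <= \sum_(k < n) (S `^ (r - 1) * c k) * a k `^ r.
Proof.
move=> r1 c0 a0 cS; set m := \sum_(k < n) c k * a k.
have r0 : 0 < r by lra.
have S0 : 0 <= S by apply: le_trans cS; exact: sumr_ge0.
have m0 : 0 <= m by apply: sumr_ge0 => k _; rewrite mulr_ge0.
have RH : 0 <= \sum_(k < n) (S `^ (r - 1) * c k) * a k `^ r.
  by apply: sumr_ge0 => k _; rewrite !mulr_ge0 ?powR_ge0.
move: m0; rewrite le_eqVlt => /predU1P[m0|m0]; first by rewrite -m0 powR0// gt_eqF.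
have {}S0 : 0 < S.
  move: S0; rewrite le_eqVlt => /predU1P[S0|//].
  have c00 k : (k < n)%N -> c k = 0.
    move=> kn; apply/eqP; rewrite eq_le c0 andbT; rewrite {1}S0; apply: le_trans cS.
    by rewrite (bigD1 (Ordinal kn))//= lerDl sumr_ge0.
  by move: m0; rewrite /m big1 ?ltxx// => k _; rewrite c00 ?mul0r.
have mS : 0 < m / S by rewrite divr_gt0.
have T k : (m / S) `^ r * (1 + r * (a k / (m / S) - 1)) <= a k `^ r.
  have ak : -1 <= a k / (m / S) - 1 by rewrite lerBrDr addNr divr_ge0// ltW.
  have -> : a k `^ r = (a k / (m / S)) `^ r * (m / S) `^ r.
    have q0 : 0 <= a k / (m / S) by rewrite divr_ge0// ltW.
    by rewrite -powRM ?(ltW mS)// divfK// gt_eqF.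
  rewrite mulrC ler_wpM2r ?powR_ge0//; apply: le_trans (bernoulli_ge r1 ak) _.
  by rewrite addrC subrK.
have : \sum_(k < n) c k * ((m / S) `^ r * (1 + r * (a k / (m / S) - 1))) <= \sum_(k < n) c k * a k `^ r.
  by apply: ler_sum => k _; rewrite ler_wpM2l.
have -> : \sum_(k < n) c k * ((m / S) `^ r * (1 + r * (a k / (m / S) - 1))) =
   (m / S) `^ r * ((1 - r) * (\sum_(k < n) c k) + r * S).
  have -> : r * S = r / (m / S) * m.
    by field; rewrite !gt_eqF.
  rewrite /m !mulr_sumr -big_split/= mulr_sumr; apply: eq_bigr => k _.
  by move: (m / S)^-1 ((m / S) `^ r) => u v; ring.
move=> H.
have : S * (m / S) `^ r <= \sum_(k < n) c k * a k `^ r.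
  apply: le_trans H; rewrite mulrC ler_wpM2l ?powR_ge0//.
  by move: cS; set Z := \sum_(k < n) c k; nra.
have -> : \sum_(k < n) (S `^ (r - 1) * c k) * a k `^ r = S `^ (r - 1) * \sum_(k < n) c k * a k `^ r.
  by rewrite mulr_sumr; apply: eq_bigr => k _; rewrite mulrA.
move=> /(ler_wpM2l (powR_ge0 S (r - 1))); rewrite mulrA [S `^ _ * S]mulrC mulr_powRB1 ?(ltW S0)//.
by rewrite -powRM ?(ltW S0) ?(ltW mS)// mulrC divfK// gt_eqF.
Qed.

(* The exponent for which the power [rho p] of the [L_p] quasi-norm is subadditive. *)
Definition rho (p : \bar R) : R := match p with r%:E => Num.min 1 r | _ => 1 end.

Lemma rho_gt0 p : (0 < p)%E -> 0 < rho p.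
Proof. by case: p => [r| |]//=; rewrite lte_fin => r0; rewrite lt_min ltr01. Qed.

Lemma rho_le1 p : rho p <= 1.
Proof. by case: p => [r| |]//=; rewrite ge_min lexx. Qed.

(** Common form of the two regimes: for [r < 1] the power is subadditive, for [r >= 1] Jensen
    applies, and in both the new weights sum to at most [S ^ r]. *)
Lemma powR_weights r S (c : nat -> R) : 0 < r -> 0 <= S -> (forall k, 0 <= c k) ->
  (forall n, \sum_(k < n) c k `^ (Num.min 1 r) <= S `^ (Num.min 1 r)) ->
  exists D : nat -> R, [/\ forall k, 0 <= D k, forall n, \sum_(k < n) D k <= S `^ r &
    forall (a : nat -> R) n, (forall k, 0 <= a k) -> (\sum_(k < n) c k * a k) `^ r <= \sum_(k < n) D k * a k `^ r].
Proof.
move=> r0 S0 c0; have [r1|r1] := leP 1 r => cS; last first.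
  exists (fun k => c k `^ r); split => //.
    by move=> k; exact: powR_ge0.
  by move=> a n a0; apply: sum_powR_le1 => //; rewrite r0 ltW.
have {}cS n : \sum_(k < n) c k <= S.
  have := cS n; rewrite powRr1//; apply: le_trans; apply: ler_sum => k _.
  by rewrite powRr1.
exists (fun k => S `^ (r - 1) * c k); split.
- by move=> k; rewrite mulr_ge0 ?powR_ge0.
- move=> n; rewrite -mulr_sumr; apply: le_trans (ler_wpM2l (powR_ge0 _ _) (cS n)) _.
  by rewrite mulrC mulr_powRB1.
- by move=> a n a0; exact: sum_powR_ge1.
Qed.

End power_inequalities.

(** * Integrals of nonnegative functions over R^d *)

Section integrals.
Context {R : realType} {d : nat}.
Notation Rd := 'rV[R]_d.
Implicit Types (H : Rd -> \bar R) (g : Rd -> R).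

Lemma iint_base n (G : (nat -> R) -> \bar R) v v' : (forall k, (n <= k)%N -> v k = v' k) ->
  iint n G v = iint n G v'.
Proof.
elim: n v v' => [|n IH] v v' vv; first by congr G; apply/funext => k; exact: vv.
rewrite !iintS; apply: eq_integral => y _; apply: IH => k nk; rewrite /upd.
by case: eqP => // /eqP kn; apply: vv; rewrite ltn_neqAle eq_sym kn.
Qed.

(** By lower semicontinuity a positive value at one point persists on an interval and would make the
    integral positive; so vanishing holds at every point, not just almost everywhere. *)
Lemma iint_eq0 n (G : (nat -> R) -> \bar R) v u : nneg G -> slsc G -> iint n G v = 0%E ->
  (forall k, (n <= k)%N -> u k = v k) -> G u = 0%E.
Proof.
move=> G0 sG; elim: n v u => [|n IH] v u.
  by move=> Gv uv; rewrite -Gv; congr G; apply/funext => k; exact: uv.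
rewrite iintS => E uv.
pose F y := iint n G (upd v n y).
have F0 y : (0 <= F y)%E by exact: nneg_iint.
have mF : measurable_fun setT F by exact: iint_measurable.
have Fz y : F y = 0%E.
  apply: contrapT => /eqP Fy.
  have [a a0 aF] : exists2 a : R, 0 < a & (a%:E < F y)%E.
    have : (0 < F y)%E by rewrite lt0e Fy F0.
    case: (F y) => [r| |]//.
      by rewrite lte_fin => r0; exists (r / 2); rewrite ?lte_fin; lra.
    by move=> _; exists 1; rewrite ?ltry.
  have [V /nbhs_ballP[e /= e0 eV] VF] := @slsc_lsc _ _ v n (slsc_iint G0 sG) _ _ aF.
  have mb : measurable (ball y e) by exact: measurable_ball.
  have : (\int[lebesgue_measure]_(z in ball y e) cst a%:E z <= 0)%E.
    rewrite -E; apply: (@le_trans _ _ (\int[lebesgue_measure]_(z in ball y e) F z)%E); last first.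
      by apply: ge0_subset_integral.
    apply: ge0_le_integral => //.
    - by move=> z _; rewrite lee_fin ltW.
    - exact: measurable_funTS.
    - by move=> z /eV /VF /ltW.
  rewrite integral_cst// [X in (_ * X)%E](lebesgue_measure_ball y (ltW e0)) -EFinM lee_fin leNgt.
  by rewrite mulr_gt0// mulr2n addr_gt0.
apply: (IH (upd v n (u n))); first exact: Fz.
move=> k nk; rewrite /upd; case: eqP => [->//|/eqP kn]; apply: uv.
by rewrite ltn_neqAle eq_sym kn.
Qed.

Definition rl H := (forall x, 0 <= H x)%E /\ slsc (fun v => H (rowv v)).

Lemma rl_nneg H : rl H -> nneg (fun v => H (rowv v)).
Proof. by move=> [H0 _] v. Qed.

Lemma rl_ct g : (forall x, 0 <= g x) -> ct g -> rl (fun x => (g x)%:E).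
Proof. by move=> g0 cg; split=> [x|]; [rewrite lee_fin|exact: scont_slsc]. Qed.

Lemma rl_pow g (r : R) : 0 < r -> (forall x, 0 <= g x) -> ct g -> rl (fun x => (g x `^ r)%:E).
Proof.
move=> r0 g0 cg; split=> [x|]; first by rewrite lee_fin powR_ge0.
move=> w v wv a; rewrite lte_fin => ag.
have [a0|a0] := ltP a 0.
  by near=> m; rewrite lte_fin (lt_le_trans a0)// powR_ge0.
have : a `^ r^-1 < g (rowv v).
  by rewrite ltNge -(powR_lep r0) ?powR_ge0// powRVK// -ltNge.
move=> ag'; have := cg _ _ wv => /cvgr_gt/(_ _ ag'); apply: filterS => m agm.
by rewrite lte_fin ltNge -(powRVK a0 r0) powR_lep ?powR_ge0// -ltNge.
Unshelve. all: by end_near.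
Qed.

Lemma rlD H1 H2 : rl H1 -> rl H2 -> rl (fun x => H1 x + H2 x)%E.
Proof.
move=> [p1 s1] [p2 s2]; split=> [x|]; first by rewrite adde_ge0.
by apply: slscD => // v.
Qed.

Lemma rlZ (c : R) H : 0 <= c -> rl H -> rl (fun x => c%:E * H x)%E.
Proof.
move=> c0 [p1 s1]; split=> [x|]; first by rewrite mule_ge0.
by apply: slscZ => // v.
Qed.

Lemma rl_series (F : nat -> Rd -> \bar R) : (forall i, rl (F i)) -> rl (fun x => \sum_(0 <= i <oo) F i x)%E.
Proof.
move=> rF; split=> [x|]; first by apply: nneseries_ge0 => k _ _; exact: (rF k).1.
by apply: slsc_series => [i v|i]; [exact: (rF i).1|exact: (rF i).2].
Qed.

Lemma intRd_ge0 H : rl H -> (0 <= intRd H)%E.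
Proof. by move=> rH; exact: (nneg_iint _ (rl_nneg rH)). Qed.

Lemma intRd_le H1 H2 : rl H1 -> rl H2 -> (forall x, H1 x <= H2 x)%E -> (intRd H1 <= intRd H2)%E.
Proof. by move=> [p1 s1] [p2 s2] H12; apply: iint_le => // v. Qed.

Lemma intRdD H1 H2 : rl H1 -> rl H2 -> (intRd (fun x => H1 x + H2 x) = intRd H1 + intRd H2)%E.
Proof. by move=> [p1 s1] [p2 s2]; apply: iintD => // v. Qed.

Lemma intRdZ (c : R) H : 0 <= c -> rl H -> (intRd (fun x => c%:E * H x) = c%:E * intRd H)%E.
Proof. by move=> c0 [p1 s1]; apply: iintZ => // v. Qed.

Lemma intRd_series (F : nat -> Rd -> \bar R) : (forall i, rl (F i)) ->
  (intRd (fun x => \sum_(0 <= i <oo) F i x) = \sum_(0 <= i <oo) intRd (F i))%E.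
Proof.
by move=> rF; apply: iint_series => [i v|i]; [exact: (rF i).1|exact: (rF i).2].
Qed.

Lemma intRd_eq0 H x : rl H -> intRd H = 0%E -> H x = 0%E.
Proof.
move=> rH /(iint_eq0 (u := ext 0 (x 0)) (rl_nneg rH) rH.2) HE.
have -> : x = rowv (ext 0 (x 0)) by apply/rowP => i; rewrite !mxE extE.
by apply: HE => k dk; rewrite /ext; case: insubP => // i; rewrite ltnNge dk.
Qed.

Lemma rl_aff H (s : 'I_d -> R) (a : Rd) : rl H -> rl (fun x => H (dscale s x + a)).
Proof.
move=> [H0 sH]; split=> // w v wv b; rewrite -rowv_aff => bH.
have wv' k : aff (ext 1 s) (ext 0 (a 0)) (w m) k @[m --> \oo] --> aff (ext 1 s) (ext 0 (a 0)) v k.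
  by rewrite /aff; apply: cvgD; [apply: cvgM => //; exact: cvg_cst|exact: cvg_cst].
by have := sH _ _ wv' _ bH; apply: filterS => m; rewrite -rowv_aff.
Qed.

Lemma intRd_aff H (s : 'I_d -> R) (a : Rd) : (forall i, 0 < s i) -> rl H ->
  (intRd (fun x => H (dscale s x + a)%R) = (\prod_i (s i)^-1)%:E * intRd H)%E.
Proof.
move=> s0 rH; rewrite /intRd.
have E : (fun v => H (dscale s (rowv v) + a)) = (fun v => (fun v => H (rowv v)) (aff (ext 1 s) (ext 0 (a 0)) v)).
  by apply/funext => v; rewrite rowv_aff.
have := iint_aff (ext 0 (a 0)) d (fun=> 0) (fun k => ext_gt0 k s0) (rl_nneg rH) rH.2.
rewrite -E /rowv => ->; congr (_%:E * _)%E.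
  by apply: eq_bigr => i _; rewrite extE.
apply: iint_base => k dk; rewrite /aff /ext; case: insubP => [i|_]; first by rewrite ltnNge dk.
by rewrite mulr0 addr0.
Qed.

Lemma dscale1 (x : Rd) : dscale (fun=> 1) x = x.
Proof. by apply/rowP => i; rewrite mxE mul1r. Qed.

Lemma rl_shift H a : rl H -> rl (fun x => H (x + a)).
Proof. by move=> /(rl_aff (fun=> 1) a); under eq_fun do rewrite dscale1. Qed.

Lemma intRd_shift H a : rl H -> intRd (fun x => H (x + a)) = intRd H.
Proof.
move=> rH; have := intRd_aff a (fun _ : 'I_d => ltr01) rH.
under eq_fun do rewrite dscale1.
by move=> ->; rewrite big1 ?mul1e// => i _; rewrite invr1.
Qed.

(** Products of this density are majorants on R^d with the computable integral [pi ^ d]. *)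
Definition cauchy1 (y : R) : R := (1 + y ^+ 2)^-1.

Lemma cauchy1_gt0 y : 0 < cauchy1 y.
Proof. by rewrite invr_gt0 ltr_pwDl// sqr_ge0. Qed.

Lemma cauchy1_continuous : continuous cauchy1.
Proof.
move=> y; apply: cvgV; first by rewrite gt_eqF// ltr_pwDl// sqr_ge0.
by apply: cvgD; [exact: cvg_cst|exact: exprn_continuous].
Qed.

Lemma integral_cauchy1 : (\int[lebesgue_measure]_y (cauchy1 y)%:E)%E = (pi : R)%:E.
Proof.
rewrite ge0_symfun_integralT.
- have := integral0y_oneDsqr R; rewrite set_itvE.
  have -> : [set x | 0 <= x] = [set x : R | true && (0 <= x)] by apply/seteqP; split.
  rewrite /oneDsqr /cauchy1 => E.
  rewrite (_ : (\int[_]_(x in _) _)%E = (pi / 2)%:E); last by rewrite -E; congr integral; apply/seteqP; split => x /=; rewrite ?andbT.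
  by rewrite -EFinM; congr EFin; field.
- by move=> y; exact/ltW/cauchy1_gt0.
- exact: cauchy1_continuous.
- by move=> y /=; rewrite /cauchy1 sqrrN.
Qed.

Lemma iint_cauchy (M : R) n v : 0 <= M -> (n <= d)%N ->
  iint n (fun v => (M * \prod_(0 <= k < d) cauchy1 (v k))%:E) v =
  (M * \prod_(n <= k < d) cauchy1 (v k) * pi ^+ n)%:E.
Proof.
move=> M0; elim: n v => [|n IH] v nd; first by rewrite expr0 mulr1.
rewrite iintS; under eq_integral do rewrite (IH _ (ltnW nd)).
have E y : (M * \prod_(n <= k < d) cauchy1 (upd v n y k) * pi ^+ n) =
   M * \prod_(n.+1 <= k < d) cauchy1 (v k) * pi ^+ n * cauchy1 y.
  rewrite big_ltn// {1}/upd eqxx.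
  rewrite (eq_big_nat _ _ (F2 := fun k => cauchy1 (v k))); first by move: (pi ^+ n) => P; ring.
  by move=> k /andP[nk _]; rewrite /upd gtn_eqF.
under eq_integral do rewrite E EFinM.
rewrite ge0_integralZl//=.
- by rewrite integral_cauchy1 -EFinM exprSr mulrA.
- apply/measurable_EFinP; apply: continuous_measurable_fun; exact: cauchy1_continuous.
- by move=> y _; rewrite lee_fin ltW// cauchy1_gt0.
- rewrite lee_fin !mulr_ge0 ?exprn_ge0 ?pi_ge0//.
  by apply: prodr_ge0 => k _; exact/ltW/cauchy1_gt0.
Qed.

(** The exponent [d + d] comes from [prod_i (1 + x_i ^ 2) <= (1 + |x|) ^ (2 d)] for the maximum
    norm. *)
Lemma intRd_decay H (M : R) : rl H -> 0 <= M ->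
  (forall x, H x <= (M / (1 + `|x|) ^+ (d + d))%:E)%E -> (intRd H < +oo)%E.
Proof.
move=> rH M0 HM.
have sc : scont (fun v : nat -> R => M * \prod_(0 <= k < d) cauchy1 (v k)).
  move=> w v wv; apply: cvgM; first exact: cvg_cst.
  elim: d => [|n IH]; first by rewrite big_geq//; under eq_fun do rewrite big_geq//; exact: cvg_cst.
  rewrite big_nat_recr//=; under eq_fun do rewrite big_nat_recr//=.
  apply: cvgM => //; apply: continuous_cvg; [exact: cauchy1_continuous|exact: wv].
apply: (@le_lt_trans _ _ (iint d (fun v => (M * \prod_(0 <= k < d) cauchy1 (v k))%:E) (fun=> 0))); last first.
  by rewrite iint_cauchy// ltry.
apply: iint_le.
- exact: (rl_nneg rH).
- exact: rH.2.
- exact: scont_slsc.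
move=> v; apply: le_trans (HM _) _; rewrite lee_fin ler_wpM2l//.
have -> : \prod_(0 <= k < d) cauchy1 (v k) = (\prod_(k < d) (1 + v k ^+ 2))^-1.
  by rewrite big_mkord prodfV.
set x := rowv v : Rd.
have q0 (k : 'I_d) : 0 < 1 + v k ^+ 2 by rewrite ltr_pwDl// sqr_ge0.
have x0 : 0 < (1 + `|x|) ^+ (d + d) by rewrite exprn_gt0// ltr_pwDl.
have P0 : 0 < \prod_(k < d) (1 + v k ^+ 2) by exact: prodr_gt0.
rewrite lef_pV2//.
apply: (@le_trans _ _ (\prod_(k < d) (1 + `|x|) ^+ 2)); last first.
  by rewrite prodr_const card_ord -exprM mul2n addnn.
apply: ler_prod => k _; rewrite (ltW (q0 k))/= sqrrD expr1n mul1r.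
have : `|v k| <= `|x| by have := norm_coord x k; rewrite mxE.
rewrite -(real_normK (num_real (v k))).
by have := normr_ge0 (v k); rewrite -mulr_natl; nra.
Qed.

End integrals.

(** * Series of translates and the quasi-triangle inequality *)

Section lp.
Context {R : realType} {d : nat}.
Notation Rd := 'rV[R]_d.
Implicit Types (g h : Rd -> R) (p : \bar R) (r : R).
Local Open Scope ereal_scope.

Lemma ct_norm g : ct g -> ct (fun x => `|g x|%R).
Proof. by move=> cg; apply: ct_comp cg => y; exact: norm_continuous. Qed.

Lemma rl_normpow g r : (0 < r)%R -> ct g -> rl (fun x => (`|g x| `^ r)%:E).
Proof. by move=> r0 cg; apply: rl_pow => //; exact: ct_norm. Qed.

(** For continuous [g] the set where [|g|] exceeds a constant is open, so it is empty as soon as it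
    is null. *)
Lemma esssup_leP g (M : R) : ct g -> esssupRd g <= M%:E <-> forall x, (`|g x| <= M)%R.
Proof.
move=> cg; have rM (m : R) : rl (fun x => (if (m < `|g x|)%R then 1 else 0)%:E : \bar R).
  split=> [x|]; first by case: ifP.
  apply: (@scont_slsc_gt _ (fun v => `|g (rowv v)|%R)); exact: ct_norm.
split=> [gM x|gM].
  apply/ler_addgt0Pl => e e0.
  have : esssupRd g < (e + M)%:E by apply: le_lt_trans gM _; rewrite lte_fin ltrDr.
  move=> /ereal_inf_lt[_ [m /= im <-]]; rewrite lte_fin => mM.
  have := intRd_eq0 x (rM m) im; case: ltP => [_ [/eqP]|gm _]; first by rewrite oner_eq0.
  by rewrite (le_trans gm)// ltW.
apply: ereal_inf_lbound; exists M => //=.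
have -> : (fun x => (if (M < `|g x|)%R then 1 else 0)%:E) = fun x => 0%R%:E * (0 : \bar R).
  by apply/funext => x; rewrite ltNge gM/= mule0.
rewrite intRdZ//; first by rewrite mul0e.
by apply: (@rl_ct _ _ (fun=> 0%R)) => // v v0 _; exact: cvg_cst.
Qed.

Lemma Lpnorm_ge0 p g : ct g -> 0 <= Lpnorm p g.
Proof.
move=> cg; case: p => [r| |]//=; first exact: poweR_ge0.
case E : (esssupRd g) => [M| |]//.
  have /(esssup_leP _ cg) H : esssupRd g <= M%:E by rewrite E.
  by rewrite lee_fin (le_trans _ (H 0%R)).
have /(esssup_leP _ cg)/(_ 0%R) : esssupRd g <= (-1)%:E by rewrite E leNye.
by rewrite leNgt (lt_le_trans _ (normr_ge0 _)).
Qed.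

Lemma poweR_le (x y : \bar R) r : (0 <= r)%R -> 0 <= x -> x <= y -> x `^ r <= y `^ r.
Proof.
move=> r0 x0 xy; apply: gt0_ler_poweR => //; rewrite in_itv/= leey andbT//.
exact: le_trans xy.
Qed.

Lemma poweRK (x : \bar R) r : 0 <= x -> (0 < r)%R -> (x `^ r) `^ r^-1 = x.
Proof. by move=> x0 r0; rewrite -poweRrM mulfV ?gt_eqF// poweRe1. Qed.

Lemma poweRVK (x : \bar R) r : 0 <= x -> (0 < r)%R -> (x `^ r^-1) `^ r = x.
Proof. by move=> x0 r0; rewrite -poweRrM mulVf ?gt_eqF// poweRe1. Qed.

(** Domination of [|g|] by a series of translates of [|h|] is phrased with upper bounds [T] of the
    partial sums, so that it says nothing where the series diverges. The constant is the l^rho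
    quasi-norm of the weights. *)
Lemma Lp_series p (S : R) (c : nat -> R) (y : nat -> Rd) g h : 0 < p -> (0 <= S)%R ->
  (forall k, 0 <= c k)%R -> ct g -> ct h ->
  (forall n, \sum_(k < n) c k `^ rho p <= S `^ rho p)%R ->
  (forall x (T : R), (forall n, \sum_(k < n) c k * `|h (x + y k)| <= T)%R -> (`|g x| <= T)%R) ->
  Lpnorm p g <= S%:E * Lpnorm p h.
Proof.
case: p => [r| |]//=.
  rewrite lte_fin => r0 S0 c0 cg ch cS gh.
  have [D [D0 DS Dc]] := powR_weights r0 S0 c0 cS.
  have rF i : rl (fun x => (D i)%:E * (`|h (x + y i)| `^ r)%:E).
    by apply: rlZ => //; apply: (rl_shift (y i) (rl_normpow r0 ch)).
  have : intRd (fun x => (`|g x| `^ r)%:E) <= (S `^ r)%:E * intRd (fun x => (`|h x| `^ r)%:E).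
    apply: (@le_trans _ _ (intRd (fun x => \sum_(0 <= i <oo) (D i)%:E * (`|h (x + y i)| `^ r)%:E))).
      apply: intRd_le; [exact: rl_normpow|exact: rl_series|move=> x].
      case E : (\sum_(0 <= i <oo) _) => [T| |]; rewrite ?leey//.
      - rewrite lee_fin; have T0 : (0 <= T)%R by rewrite -lee_fin -E; apply: nneseries_ge0 => k _ _; exact: (rF k).1.
        rewrite -(powRVK T0 r0) powR_lep ?powR_ge0//; apply: gh => n.
        rewrite -(powR_lep r0) ?powR_ge0// ?powRVK//; last by apply: sumr_ge0 => k _; rewrite mulr_ge0.
        apply: le_trans (Dc (fun k => `|h (x + y k)|%R) n (fun k => normr_ge0 _)) _.
        rewrite -lee_fin -E -sumEFin -(big_mkord xpredT (fun k => (D k * `|h (x + y k)| `^ r)%:E)).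
        by apply: nneseries_lim_ge => k _ _; exact: (rF k).1.
      - by have : 0 <= \sum_(0 <= i <oo) (D i)%:E * (`|h (x + y i)| `^ r)%:E;
          [apply: nneseries_ge0 => k _ _; exact: (rF k).1|rewrite E].
    rewrite intRd_series//.
    apply: lime_le; first by apply: is_cvg_nneseries => k _ _; apply: intRd_ge0.
    near=> n; rewrite big_mkord.
    under eq_bigr => k _ do rewrite (intRdZ (D0 k) (rl_shift (y k) (rl_normpow r0 ch))) (intRd_shift (y k) (rl_normpow r0 ch)).
    rewrite -ge0_sume_distrl; last by move=> k _; rewrite lee_fin.
    rewrite sumEFin lee_wpmul2r// ?lee_fin//; exact: (intRd_ge0 (rl_normpow r0 ch)).
  move=> /(poweR_le (r := r^-1)); rewrite invr_ge0 (ltW r0) => /(_ isT (intRd_ge0 (rl_normpow r0 cg))) /le_trans; apply.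
  rewrite poweRM; [|by rewrite lee_fin powR_ge0|exact: (intRd_ge0 (rl_normpow r0 ch))].
  by rewrite poweR_EFin powRK.
move=> _ S0 c0 cg ch cS gh.
have {}cS n : (\sum_(k < n) c k <= S)%R.
  have := cS n; rewrite powRr1//; apply: le_trans; apply: ler_sum => k _.
  by rewrite powRr1.
have := Lpnorm_ge0 +oo ch => /=; case E : (esssupRd h) => [M| |]//= M0.
  have hM : forall x, (`|h x| <= M)%R by apply/(esssup_leP _ ch); rewrite E.
  rewrite -EFinM; apply/(esssup_leP _ cg) => x; apply: gh => n.
  apply: (@le_trans _ _ (\sum_(k < n) c k * M)%R); last first.
    by rewrite -mulr_suml ler_wpM2r.
  by apply: ler_sum => k _; rewrite ler_wpM2l.
move: S0; rewrite le_eqVlt => /predU1P[S0|S0]; last by rewrite gt0_muley ?leey.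
rewrite -S0 mul0e; apply/(esssup_leP _ cg) => x; apply: gh => n; rewrite big1// => k _.
suff -> : c k = 0%R by rewrite mul0r.
apply/eqP; rewrite eq_le c0 andbT; have := cS k.+1; rewrite -S0; apply: le_trans.
by rewrite big_ord_recr/= lerDr sumr_ge0.
Unshelve. all: by end_near.
Qed.

(** A crude quasi-triangle constant for all [p > 0]: the factor 2 stems from
    [(a + b) ^ r <= 2 ^ r (a ^ r + b ^ r)], the other one from the outer power [1 / r]. *)
Definition quasi p : R := match p with r%:E => 2 * 2 `^ r^-1 | _ => 2 end%R.

Lemma quasi_gt0 p : (0 < quasi p)%R.
Proof. by case: p => [r| |]//=; rewrite mulr_gt0// powR_gt0. Qed.

Lemma Lp_add p g h1 h2 : 0 < p -> ct g -> ct h1 -> ct h2 ->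
  (forall x, `|g x| <= `|h1 x| + `|h2 x|)%R ->
  Lpnorm p g <= (quasi p)%:E * (Lpnorm p h1 + Lpnorm p h2).
Proof.
case: p => [r| |]//=; last first.
  move=> _ cg c1 c2 gh.
  have := Lpnorm_ge0 +oo c1; have := Lpnorm_ge0 +oo c2 => /=.
  case E2 : (esssupRd h2) => [M2| |]//= p2; last first.
    by case: (esssupRd h1) => [M| |]//= _; rewrite ?addey// gt0_muley ?leey// ltey.
  case E1 : (esssupRd h1) => [M1| |]//= p1; last by rewrite gt0_muley ?leey.
  rewrite -EFinD -EFinM; apply/(esssup_leP _ cg) => x; apply: le_trans (gh x) _.
  have /(_ x) : forall x, (`|h1 x| <= M1)%R by apply/(esssup_leP _ c1); rewrite E1.
  have /(_ x) : forall x, (`|h2 x| <= M2)%R by apply/(esssup_leP _ c2); rewrite E2.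
  rewrite !lee_fin in p1 p2; lra.
rewrite lte_fin => r0 cg c1 c2 gh.
set A := intRd (fun x => (`|h1 x| `^ r)%:E); set B := intRd (fun x => (`|h2 x| `^ r)%:E).
have A0 : 0 <= A by exact: (intRd_ge0 (rl_normpow r0 c1)).
have B0 : 0 <= B by exact: (intRd_ge0 (rl_normpow r0 c2)).
have : intRd (fun x => (`|g x| `^ r)%:E) <= (2 `^ r)%:E * (A + B).
  rewrite /A /B -intRdD; [|exact: rl_normpow|exact: rl_normpow].
  rewrite -intRdZ ?powR_ge0//; last by apply: rlD; exact: rl_normpow.
  apply: intRd_le; [exact: rl_normpow|by apply: rlZ; [exact: powR_ge0|apply: rlD; exact: rl_normpow]|].
  move=> x; rewrite -EFinD -EFinM lee_fin.
  wlog h12 : h1 h2 c1 c2 gh {A B A0 B0} / (`|h1 x| <= `|h2 x|)%R.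
    move=> K; have [h12|/ltW h12] := leP `|h1 x|%R `|h2 x|%R; first exact: K.
    by rewrite addrC; apply: K => // z; rewrite addrC.
  apply: (@le_trans _ _ ((2 * `|h2 x|) `^ r)%R).
    by apply: powR_le; rewrite ?(ltW r0)//; have := gh x; lra.
  by rewrite powRM// ler_wpM2l ?powR_ge0// lerDr powR_ge0.
move=> /(poweR_le (r := r^-1)); rewrite invr_ge0 (ltW r0) => /(_ isT (intRd_ge0 (rl_normpow r0 cg))) /le_trans; apply.
have r20 : 0 <= (2 `^ r)%:E by rewrite lee_fin powR_ge0.
rewrite poweRM ?adde_ge0//.
rewrite poweR_EFin powRK// EFinM -muleA lee_wpmul2l// ?lee_fin//.
wlog AB : A B A0 B0 / A <= B.
  move=> K; have [AB|/ltW AB] := leP A B; first exact: K.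
  by rewrite addeC [X in _ <= _ * X]addeC; apply: K.
apply: (@le_trans _ _ ((2%:E * B) `^ r^-1)).
  apply: poweR_le; rewrite ?invr_ge0 ?(ltW r0) ?adde_ge0//.
  have -> : 2%:E * B = B + B by rewrite (_ : 2%R = 1 + 1)%R// EFinD ge0_muleDl// !mul1e.
  by rewrite leeD2r.
rewrite poweRM// poweR_EFin lee_wpmul2l ?lee_fin ?powR_ge0//.
by rewrite leeDr// poweR_ge0.
Qed.

End lp.

(** * L_p bounds for multipliers in one coordinate *)

Section multipliers.
Context {R : realType} {d : nat}.
Notation Rd := 'rV[R]_d.
Implicit Types (psi chi : Rd -> R) (l : 'I_d) (z xi x y : Rd) (w : R) (f : tdist R d) (p : \bar R).

Lemma cvg_norm_le (u : nat -> R) (a T : R) : u @ \oo --> a -> (forall n, `|u n| <= T) -> `|a| <= T.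
Proof.
move=> ua uT; have cn : `|u n| @[n --> \oo] --> `|a| by exact: cvg_norm.
rewrite -(cvg_lim _ cn)//; apply: limr_le; first by apply/cvg_ex; exists `|a|.
by near=> n.
Unshelve. all: by end_near.
Qed.

(* The translations [+- t_k] of the cosine series are enumerated as [2k] and [2k+1]. *)
Definition alt (t : nat -> R) (n : nat) : R := if odd n then - t n./2 else t n./2.

Lemma sum_alt (c : nat -> R) (F : R -> R) (t : nat -> R) n :
  \sum_(k < n.*2) c k./2 * F (alt t k) = \sum_(k < n) c k * (F (t k) + F (- t k)).
Proof.
elim: n => [|n IH]; first by rewrite !big_ord0.
have E1 : alt t n.*2 = t n by rewrite /alt odd_double doubleK.
have E2 : alt t n.*2.+1 = - t n by rewrite /alt /= odd_double /= uphalf_double.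
rewrite doubleS !big_ord_recr IH [alt _ _]E1 [alt _ _]E2 /= doubleK uphalf_double mulrDr addrA.
by [].
Qed.

Lemma sum_double_ge (c : nat -> R) n : (forall k, 0 <= c k) ->
  \sum_(k < n) c k./2 <= \sum_(k < n) c k * 2.
Proof.
move=> c0; apply: (@le_trans _ _ (\sum_(k < n.*2) c k./2)).
  rewrite -addnn big_split_ord/= lerDl; exact: sumr_ge0.
have := sum_alt c (fun=> 1) (fun=> 0) n.
under eq_bigr do rewrite mulr1.
by move=> ->.
Qed.

Lemma half_succ (s : R) : s <= 1 / 2 -> s + 1 <= 2.
Proof. by lra. Qed.

Section multiplier.
Variables (f : tdist R d) (chi : Rd -> R) (l : 'I_d) (m : R -> R) (s lam : R).
Hypotheses (ft : ctempered f) (chic : ccs chi) (mc : cs1 m) (s0 : 0 < s) (s2 : s <= 1 / 2).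
Hypotheses (lam0 : 0 < lam) (chil : forall xi, pi * lam < `|xi 0 l| -> chi xi = 0).

Let M xi := m ((s * lam)^-1 * xi 0 l) * chi xi.

Lemma ccs_scale : ccs M.
Proof. exact (@ccs_coord R d (fun u : R => m ((s * lam)^-1 * u)) l chi (@sm1_scale R m (s * lam)^-1 (proj1 mc)) chic). Qed.

(** The symbol [chi] lives where [|xi_l| <= pi * lam], so the expansion, rescaled to the period
    [2 * pi * lam] in [xi_l], is exact on it. *)
Lemma multiplier_series (a b : nat -> R) :
  (forall N B, 0 <= B -> dec N B m -> forall k, `|a k| <= B * (s / (1 + s * k%:R) ^+ N)) ->
  (forall t, `|t| <= pi -> series (fun k => a k * cos (k%:R * t + b k)) @ \oo --> m (s^-1 * t)) ->
  forall x w, series (fun k => a k * ((W f chi (x + (k%:R / lam) *: evec R l) (w + b k) +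
     W f chi (x - (k%:R / lam) *: evec R l) (w - b k)) / 2)) @ \oo --> W f M x w.
Proof.
move=> aB ab x w.
apply: (@W_series _ _ _ _ (fun xi => m ((s * lam)^-1 * xi 0 l))) => //.
- exact: ccs_scale.
- move=> N; have [B B0 HB] := cs1_dec (N + 2) mc.
  pose K := 1 + (s * lam)^-1.
  have sl : 0 < s * lam by rewrite mulr_gt0.
  have K0 : 0 <= K by rewrite addr_ge0// invr_ge0 ltW.
  apply: (@cvg_decay _ s _ (B * K ^+ N) s0 _ _ _).1.
  + by rewrite mulr_ge0// exprn_ge0.
  + by move=> k; rewrite mulr_ge0 ?exprn_ge0 ?addr_ge0.
  + move=> k; have q : 0 < 1 + s * k%:R by rewrite ltr_pwDl// mulr_ge0// ltW.
    have kl : 0 <= k%:R / lam by rewrite divr_ge0// ltW.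
    have le1 : (1 + `|k%:R / lam|) ^+ N <= (K * (1 + s * k%:R)) ^+ N.
      rewrite lerXn2r ?nnegrE ?addr_ge0 ?mulr_ge0// ?(ltW q)// ger0_norm//.
      have -> : k%:R / lam = (s * lam)^-1 * (s * k%:R).
        by field; rewrite !gt_eqF.
      have := ltW q; have : 0 < (s * lam)^-1 by rewrite invr_gt0.
      have : 0 <= s * k%:R by rewrite mulr_ge0// ltW.
      by rewrite /K; move: (s * lam)^-1 (s * k%:R) => u v; nra.
    apply: le_trans (ler_pM _ _ (aB _ _ B0 HB k) le1) _; rewrite ?exprn_ge0 ?addr_ge0//.
    rewrite exprMn exprD le_eqVlt; apply/orP; left; apply/eqP.
    have uN : (1 + s * k%:R) ^+ N != 0 by rewrite expf_neq0// gt_eqF.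
    have vN : (1 + s * k%:R) ^+ 2 != 0 by rewrite expf_neq0// gt_eqF.
    move: uN vN; set u := _ ^+ N; set v := _ ^+ 2 => uN vN.
    by field; rewrite uN vN.
- move=> xi xi0.
  have xl : `|xi 0 l / lam| <= pi.
    rewrite normrM normfV (gtr0_norm lam0) ler_pdivrMr// leNgt; apply/negP => /chil /eqP.
    by rewrite (negbTE xi0).
  have := ab _ xl; have -> : s^-1 * (xi 0 l / lam) = (s * lam)^-1 * xi 0 l.
    by field; rewrite !gt_eqF.
  have -> // : (fun k => a k * cos (k%:R / lam * xi 0 l + b k)) = (fun k => a k * cos (k%:R * (xi 0 l / lam) + b k)).
  by apply/funext => k; congr (_ * cos (_ + _)); rewrite mulrA mulrAC.
Qed.

(** As [N * rho p >= 2], the rho-th powers of the coefficients add up to at most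
    [B ^ rho * s ^ (rho - 1)] times a sum bounded uniformly in [s]; the root gives the exponent
    [1 - 1 / rho]. The 4 is two translates per term times [s + 1 <= 2]. *)
Lemma multiplier_Lp p N B : (0 < p)%E -> 2 <= N%:R * rho p -> 0 <= B -> dec N B m ->
  (Lpnorm p (absDelta M f) <= (4 `^ (rho p)^-1 * B * s `^ (1 - (rho p)^-1))%:E * Lpnorm p (absDelta chi f))%E.
Proof.
move=> p0 Np B0 HB; have r0 := rho_gt0 p0; set r := rho p in r0 Np *.
have [a [b [aB /(multiplier_series aB) ab]]] := fourier_expansion mc s0 s2.
pose c k := `|a k| / 2.
have c0 k : 0 <= c k by rewrite divr_ge0.
apply: (@Lp_series _ _ p _ (fun k => c k./2) (fun k => alt (fun k => k%:R / lam) k *: evec R l)) => //.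
- by rewrite !mulr_ge0 ?powR_ge0.
- by apply: ct_absDelta => //; exact: ccs_scale.
- exact: ct_absDelta.
- move=> n; apply: le_trans (sum_double_ge n (fun k => powR_ge0 (c k) r)) _.
  have -> : (4 `^ r^-1 * B * s `^ (1 - r^-1)) `^ r = 4 * (B `^ r * s `^ (r - 1)).
    rewrite !powRM ?mulr_ge0 ?powR_ge0// powRVK// -powRrM mulrBl mul1r mulVf ?gt_eqF// mulrA//.
  have ck k : c k `^ r <= B `^ r * s `^ (r - 1) * (s / (1 + s * k%:R) ^+ 2).
    have q : 0 < 1 + s * k%:R by rewrite ltr_pwDl// mulr_ge0// ltW.
    have q1 : 1 <= 1 + s * k%:R by rewrite lerDl mulr_ge0// ltW.
    apply: (@le_trans _ _ ((B * (s / (1 + s * k%:R) ^+ N)) `^ r)).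
      apply: powR_le; rewrite ?(ltW r0)//; apply: le_trans (aB _ _ B0 HB k).
      by rewrite /c ler_piMr//; lra.
    rewrite powRM// ?divr_ge0 ?exprn_ge0 ?(ltW s0) ?(ltW q)//.
    rewrite -mulrA ler_wpM2l ?powR_ge0// mulrA [s `^ _ * s]mulrC mulr_powRB1 ?(ltW s0)//.
    rewrite powRM ?invr_ge0 ?exprn_ge0 ?(ltW s0) ?(ltW q)// ler_wpM2l ?powR_ge0//.
    rewrite -powR_inv1 ?exprn_ge0 ?(ltW q)// -powRrM mulN1r powRN lef_pV2 ?posrE ?powR_gt0 ?exprn_gt0//.
    rewrite -(powR_mulrn N) ?(ltW q)// -powRrM -(powR_mulrn 2) ?(ltW q)//.
    exact: ler_powR.
  apply: (@le_trans _ _ (\sum_(k < n) B `^ r * s `^ (r - 1) * (s / (1 + s * k%:R) ^+ 2) * 2)).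
    by apply: ler_sum => k _; rewrite ler_wpM2r.
  have X0 : 0 <= B `^ r * s `^ (r - 1) by rewrite mulr_ge0 ?powR_ge0.
  rewrite -mulr_suml -mulr_sumr.
  set Z := \sum_(k < n) s / (1 + s * k%:R) ^+ 2; set X := B `^ r * _ in X0 *.
  have HZ : Z <= s + 1 by exact: sum_decay.
  have -> : 4 * X = X * 2 * 2 by rewrite -mulrA mulrC -natrM.
  rewrite ler_wpM2r// ler_wpM2l//; apply: le_trans HZ _.
  exact: half_succ.
- move=> x T HT; rewrite ger0_norm ?absDelta_ge0//.
  apply: absDelta_leP => //; first exact: ccs_scale.
  move=> w; apply: (cvg_norm_le (ab x w)) => n.
  apply: le_trans (HT n.*2).
  rewrite (sum_alt c (fun u : R => `|absDelta chi f (x + u *: evec R l)|)) /series/= big_mkord.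
  apply: le_trans (ler_norm_sum _ _ _) _; apply: ler_sum => k _.
  have e : `|2^-1| = 2^-1 :> R by rewrite gtr0_norm.
  rewrite normrM /c -mulrA; apply: ler_wpM2l => //.
  rewrite normrM e mulrC; apply: ler_wpM2l => //.
  rewrite scaleNr !(ger0_norm (absDelta_ge0 _ _ _)).
  by apply: le_trans (ler_normD _ _) _; apply: lerD; exact: W_le.
Qed.

End multiplier.

Lemma phijS (phi0 : R -> R) i (x : R) : phij phi0 i.+1 x = phij phi0 1 (2 ^- i * x).
Proof.
rewrite /phij/= expr0 invr1 mul1r mulrA; congr (phi0 (_ * x) - _).
by rewrite -invfM exprS expr1.
Qed.

Lemma admissible_cs1 (phi0 : R -> R) : admissible_phi0 phi0 -> cs1 phi0 /\ cs1 (phij phi0 1).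
Proof.
move=> [ps [_ p0]]; have p32 (x : R) : 3 < `|x| -> phi0 x = 0 by move=> x3; apply: p0; lra.
split; split; [exact: ps|exact: p32| |].
- have := @sm1D R _ _ (sm1_scale (s := 2 ^- 1) ps) (@sm1Z R (-1) _ ps); congr sm1.
  by apply/funext => x /=; rewrite expr0 invr1 mul1r mulN1r.
- move=> x x3 /=; rewrite expr0 invr1 mul1r (p32 x)// subr0; apply: p0.
  by rewrite expr1 normrM ger0_norm//; lra.
Qed.

Lemma sm1_phij (phi0 : R -> R) k : admissible_phi0 phi0 -> sm1 (phij phi0 k).
Proof.
move=> ad; have [[h0 _] [h1 _]] := admissible_cs1 ad; case: k => [|k]; first exact: h0.
have := sm1_scale (s := 2 ^- k) h1; congr sm1.
by apply/funext => x; rewrite [RHS]phijS.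
Qed.

Lemma pow2 (n : nat) : 2 ^+ n = 2 `^ n%:R :> R.
Proof. by rewrite powR_mulrn. Qed.

Definition sigp p : R := (rho p)^-1 - 1.

Lemma sigp_ge0 p : (0 < p)%E -> 0 <= sigp p.
Proof. by move=> p0; rewrite subr_ge0 invf_ge1 ?rho_gt0// rho_le1. Qed.

(** For [k = i.+1] the multiplier is [phij phi0 1] dilated by [2 ^ i]. With [lam = 2 ^ j.+1], large
    enough for the support of [chi], this means [s = 2 ^ (i - j - 1)], and the loss
    [s ^ (1 - 1 / rho)] is [2 ^ ((j - k) * sigp p)] up to a constant. *)
Lemma multiplier_phi p (phi0 : R -> R) : (0 < p)%E -> admissible_phi0 phi0 ->
  exists2 C, 0 <= C & forall f chi l j k, ctempered f -> ccs chi ->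
    (forall xi, 3 / 2 * 2 ^+ j < `|xi 0 l| -> chi xi = 0) -> (k <= j.+1)%N ->
    (Lpnorm p (absDelta (fun xi => phij phi0 k (xi 0 l) * chi xi)%R f) <=
      (C * 2 `^ ((j%:R - k%:R) * sigp p))%:E * Lpnorm p (absDelta chi f))%E.
Proof.
move=> p0 ad; have [c0 c1] := admissible_cs1 ad; have r0 := rho_gt0 p0; have sp := sigp_ge0 p0.
have [N HN] : exists N, 2 <= N%:R * rho p.
  exists (Num.truncn (2 / rho p)).+1; rewrite -ler_pdivrMr//; apply/ltW/truncnS_gt.
have [B0 B00 HB0] := cs1_dec N c0; have [B1 B10 HB1] := cs1_dec N c1.
pose B := B0 + B1.
have wk m B' : B' <= B -> dec N B' m -> dec N B m by move=> BB H y w; apply: le_trans (H y w) BB.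
have {}HB0 : dec N B phi0 by apply: wk HB0; rewrite lerDl.
have {}HB1 : dec N B (phij phi0 1) by apply: wk HB1; rewrite lerDr.
have BB : 0 <= B by rewrite addr_ge0.
exists (4 `^ (rho p)^-1 * B * 2 `^ (2 * sigp p)); first by rewrite !mulr_ge0 ?powR_ge0.
move=> f chi l j k ft cc cl kj.
have pi2 := pi_ge2 R.
have J0 : 0 < 2 ^+ j.+1 :> R by rewrite exprn_gt0.
have cl' xi : pi * 2 ^+ j.+1 < `|xi 0 l| -> chi xi = 0.
  move=> H; apply: cl; apply: le_lt_trans H; rewrite exprS.
  have : 0 < 2 ^+ j :> R by rewrite exprn_gt0.
  by move: (2 ^+ j : R) (pi : R) pi2 => u P; nra.
have main m i : cs1 m -> dec N B m -> (i <= j)%N ->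
    (k <= i.+1)%N ->
  (Lpnorm p (absDelta (fun xi => m (2 ^- i * xi 0 l) * chi xi)%R f) <=
      (4 `^ (rho p)^-1 * B * 2 `^ (2 * sigp p) * 2 `^ ((j%:R - k%:R) * sigp p))%:E * Lpnorm p (absDelta chi f))%E.
  move=> mc mB ij ki.
  pose s : R := 2 ^- (j.+1 - i).
  have s0 : 0 < s by rewrite invr_gt0 exprn_gt0.
  have s2 : s <= 1 / 2.
    rewrite mul1r /s lef_pV2 ?posrE ?exprn_gt0//.
    by rewrite -{1}(expr1 2) ler_eXn2l ?ltr1n// subn_gt0 ltnS.
  have sl : s * 2 ^+ j.+1 = 2 ^+ i.
    by rewrite /s -{2}(subnK (leq_trans ij (leqnSn j))) exprD mulKf// expf_neq0.
  have := @multiplier_Lp f chi l m s (2 ^+ j.+1) ft cc mc s0 s2 J0 cl' p N B p0 HN BB mB.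
  rewrite sl => /le_trans; apply; apply: lee_wpmul2r; first by apply: Lpnorm_ge0; exact: ct_absDelta.
  rewrite lee_fin -!mulrA ler_wpM2l ?powR_ge0// ler_wpM2l// -powRD ?pnatr_eq0 ?implybT//.
  rewrite /s pow2 -powRN -powRrM; apply: ler_powR; first by rewrite ler1n.
  have -> : - (j.+1 - i)%:R * (1 - (rho p)^-1) = (j.+1%:R - i%:R) * sigp p.
    by rewrite natrB; [rewrite /sigp; ring|exact: leq_trans ij (leqnSn j)].
  rewrite -mulrDl ler_wpM2r// -natr1; have : k%:R <= i%:R + 1 :> R by rewrite natr1 ler_nat.
  lra.
case: k kj main => [|i] kj main.
  have := main phi0 0%N c0 HB0 (leq0n _) isT.
  by under [X in absDelta X]eq_fun do rewrite expr0 invr1 mul1r.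
have := main _ i c1 HB1 _ (leqnn _).
under [X in absDelta X]eq_fun do rewrite -phijS.
by apply; rewrite -ltnS.
Qed.

End multipliers.

(** * Square-function bound for one coordinate *)

Section two_point.
Context {R : realType}.
Implicit Types (p r a b t u v : R).

Lemma powR_super u a b : 1 <= u -> 0 <= a -> 0 <= b -> a `^ u + b `^ u <= (a + b) `^ u.
Proof.
move=> u1 a0 b0; have u0 : 0 < u by lra.
have := @powR_sub R (a `^ u) (b `^ u) u^-1; rewrite !powRK// => /(_ _ _ _)/(powR_le (r := u)).
rewrite invr_gt0 u0 invf_le1// u1 !powR_ge0 => /(_ (ltW u0) isT isT isT isT).
by rewrite powRVK// addr_ge0 ?powR_ge0.
Qed.

Lemma sqr_powR a r : 0 <= a -> (a ^+ 2) `^ (r / 2) = a `^ r.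
Proof. by move=> a0; rewrite -powR_mulrn// -powRrM mulrCA mulfV ?mulr1. Qed.

(* The factor [(1 + t) ^ (2 - p) <= 1 + (2 - p) t] is divided out of [(1 + t) ^ 2]. *)
Lemma bernoulli2 p t : 1 < p <= 2 -> -1 <= t <= 1 -> 1 + p * t + (p - 1) ^+ 2 / 2 * t ^+ 2 <= (1 + t) `^ p.
Proof.
move=> /andP[p1 p2] /andP[]; rewrite le_eqVlt => /predU1P[<-|t1] t2.
  by rewrite subrr powR0 ?gt_eqF//; [nra|lra].
have t0 : 0 < 1 + t by lra.
have H : (1 + t) `^ (2 - p) <= 1 + (2 - p) * t by apply: bernoulli_le; rewrite ?(ltW t1)//; apply/andP; split; lra.
have q0 : 0 < (1 + t) `^ (2 - p) by exact: powR_gt0.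
have E : (1 + t) `^ p * (1 + t) `^ (2 - p) = (1 + t) ^+ 2.
  have pe : p + (2 - p) = 2%:R by ring.
  have nz : (p + (2 - p) == 0) ==> (1 + t != 0) by rewrite (lt0r_neq0 t0) implybT.
  by rewrite -(powRD nz) pe powR_mulrn// ltW.
have P0 : 0 < (1 + t) `^ p by exact: powR_gt0.
have L : (1 + p * t + (p - 1) ^+ 2 / 2 * t ^+ 2) * (1 + (2 - p) * t) <= (1 + t) ^+ 2.
  have -> : (1 + t) ^+ 2 = (1 + p * t + (p - 1) ^+ 2 / 2 * t ^+ 2) * (1 + (2 - p) * t) +
    (p - 1) ^+ 2 / 2 * t ^+ 2 * (1 - (2 - p) * t) by field.
  rewrite lerDl; apply: mulr_ge0; first by rewrite mulr_ge0 ?divr_ge0 ?sqr_ge0.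
  have : 0 <= (2 - p) * (1 - t) by rewrite mulr_ge0// subr_ge0.
  by lra.
rewrite leNgt; apply/negP => C.
have c0 : 0 < 1 + (2 - p) * t by apply: lt_le_trans H.
have : (1 + t) ^+ 2 < (1 + p * t + (p - 1) ^+ 2 / 2 * t ^+ 2) * (1 + (2 - p) * t).
  by rewrite -E; apply: (lt_le_trans (y := (1 + p * t + (p - 1) ^+ 2 / 2 * t ^+ 2) * (1 + t) `^ (2 - p)));
    [rewrite ltr_pM2r|rewrite ler_wpM2l// ltW// (lt_trans P0)].
by rewrite ltNge L.
Qed.

(** Uniform convexity constant of [L_p], of power type [max 2 p]: below 2 the second-order
    coefficient of [bernoulli2], from 2 on the constant in Clarkson's inequality. *)
Definition uc p : R := if p < 2 then (p - 1) ^+ 2 / 2 else 1.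

Lemma uc_gt0 p : 1 < p -> 0 < uc p.
Proof. rewrite /uc => p1; case: ifP => _ //; apply: divr_gt0 => //; apply: exprn_gt0; rewrite subr_gt0//. Qed.

(** Since the constant is at most 1, replacing [A], [B] by the half sum [s] and the half difference
    [t] of [G], [H] can only increase the left side; what remains is [bernoulli2] at [t / s] and at
    [- t / s]. *)
Lemma two_point_lt2 p (A B G H : R) : 1 < p < 2 -> 0 <= A -> 0 <= B -> 0 <= G -> 0 <= H ->
  A ^+ 2 + B ^+ 2 = (G ^+ 2 + H ^+ 2) / 2 -> (G - H) ^+ 2 <= 4 * B ^+ 2 ->
  (A ^+ 2 + uc p * B ^+ 2) `^ (p / 2) <= (G `^ p + H `^ p) / 2.
Proof.
move=> /andP[p1 p2] A0 B0 G0 H0 E GH; rewrite /uc p2; set c := _ / 2.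
have c0 : 0 < c by rewrite divr_gt0// exprn_gt0// subr_gt0.
have c1 : c <= 1 by rewrite /c; nra.
pose s := (G + H) / 2; pose t := (G - H) / 2.
have s0 : 0 <= s by rewrite divr_ge0 ?addr_ge0.
have p0 : 0 < p by lra.
have AB : A ^+ 2 + c * B ^+ 2 <= s ^+ 2 + c * t ^+ 2.
  have tB : t ^+ 2 <= B ^+ 2 by rewrite /t; nra.
  have -> : s ^+ 2 + c * t ^+ 2 = A ^+ 2 + B ^+ 2 - (1 - c) * t ^+ 2 by rewrite E /s /t; field.
  by nra.
apply: le_trans (powR_le _ _ AB) _.
- by rewrite divr_ge0// ltW.
- by rewrite addr_ge0 ?sqr_ge0// mulr_ge0 ?sqr_ge0// ltW.
have {}s0 := s0; move: (s0); rewrite le_eqVlt => /predU1P[s00|sp].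
  have G00 : G = 0 by move: s00; rewrite /s; lra.
  have H00 : H = 0 by move: s00; rewrite /s; lra.
  by rewrite -s00 /t G00 H00 subrr mul0r !expr0n/= mulr0 addr0 !powR0 ?gt_eqF ?divr_gt0//; lra.
pose x := t / s.
have x1 : -1 <= x <= 1.
  rewrite /x ler_pdivlMr// ler_pdivrMr// /s /t; apply/andP; split; lra.
have x1' : -1 <= - x <= 1 by case/andP: x1 => *; apply/andP; split; lra.
have p12 : 1 < p <= 2 by rewrite p1 ltW.
have b1 := bernoulli2 p12 x1; have b2 := bernoulli2 p12 x1'.
have -> : s ^+ 2 + c * t ^+ 2 = s ^+ 2 * (1 + c * x ^+ 2) by rewrite /x; field; rewrite gt_eqF.
have -> : G = s * (1 + x) by rewrite /x mulrDr mulr1 mulrC divfK ?gt_eqF// /s /t; field.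
have -> : H = s * (1 - x) by rewrite /x mulrBr mulr1 mulrC divfK ?gt_eqF// /s /t; field.
have cx : 0 <= c * x ^+ 2 by rewrite mulr_ge0 ?sqr_ge0// ltW.
rewrite powRM ?sqr_ge0 ?addr_ge0// sqr_powR//.
case/andP: x1 => x1 x2.
have e1 : 0 <= 1 + x by lra.
have e2 : 0 <= 1 - x by lra.
rewrite (powRM _ s0 e1) (powRM _ s0 e2).
rewrite -mulrDr -mulrA ler_wpM2l ?powR_ge0//.
apply: le_trans (bernoulli_le _ _) _.
- by apply/andP; split; lra.
- by lra.
have : p / 2 * (c * x ^+ 2) <= c * x ^+ 2 by rewrite ler_piMl//; lra.
move: b1 b2; rewrite sqrrN -/c; lra.
Qed.

(** Clarkson's inequality: the power [p / 2 >= 1] is superadditive for [A ^ 2], [B ^ 2] and convex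
    for [G ^ 2], [H ^ 2]. *)
Lemma two_point_ge2 p (A B G H : R) : 2 <= p -> 0 <= A -> 0 <= B -> 0 <= G -> 0 <= H ->
  A ^+ 2 + B ^+ 2 = (G ^+ 2 + H ^+ 2) / 2 -> A `^ p + B `^ p <= (G `^ p + H `^ p) / 2.
Proof.
move=> p2 A0 B0 G0 H0 E; have u1 : 1 <= p / 2 by lra.
rewrite -(sqr_powR p A0) -(sqr_powR p B0); apply: le_trans (powR_super u1 (sqr_ge0 _) (sqr_ge0 _)) _.
rewrite E -(sqr_powR p G0) -(sqr_powR p H0).
pose a (k : nat) : R := if k == 0%N then G ^+ 2 else H ^+ 2.
have := @sum_powR_ge1 R (p / 2) 1 (fun=> 1 / 2) a 2 u1 _ _ _.
rewrite !big_ord_recl !big_ord0 /a /= powR1; set X := _ `^ _; set Y := _ `^ _; set Z := _ `^ _.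
rewrite (_ : (G ^+ 2 + H ^+ 2) / 2 = 1 / 2 * G ^+ 2 + (1 / 2 * H ^+ 2 + 0)); last by field.
move=> K; apply: le_trans (K _ _ _) _.
- by move=> k.
- by move=> k; case: ifP => _; exact: sqr_ge0.
- by rewrite addr0 -splitr.
- by rewrite !mul1r addr0 -mulrDr mulrC.
Qed.

(** Hoelder for two terms. It linearizes a concave power, so that one can integrate with fixed [u],
    [v] and choose them afterwards. *)
Lemma concave_split r a b u v : 0 < r < 1 -> 0 <= a -> 0 <= b -> 0 <= u -> 0 <= v -> u + v = 1 ->
  u `^ (1 - r) * a `^ r + v `^ (1 - r) * b `^ r <= (a + b) `^ r.
Proof.
move=> /andP[r0 r1] a0 b0 u0 v0 uv; have r1' : 0 < 1 - r by lra.
have := @hoelder2 R (a `^ r) (b `^ r) (u `^ (1 - r)) (v `^ (1 - r)) r^-1 (1 - r)^-1.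
rewrite !powR_ge0 !invr_gt0 r0 r1' !invrK !powRK// uv powR1 mulr1 addrCA subrr addr0.
by rewrite ![_ `^ (1 - r) * _]mulrC; apply.
Qed.

End two_point.

(** * Uniform convexity of L_p applied to pieces *)

Section uniform_convexity.
Context {R : realType} {d : nat}.
Notation Rd := 'rV[R]_d.
Implicit Types (psi chi : Rd -> R) (l : 'I_d) (z xi x y : Rd) (w : R) (f : tdist R d) (p : R).

Lemma W_opp f psi x w : ctempered f -> ccs psi -> W f psi x (w + pi) = - W f psi x w.
Proof.
move=> ft pc; rewrite W_phase// [W f psi x w]W_phase// cosD sinD cospi sinpi; ring.
Qed.

Definition symS (tau : R) l chi : Rd -> R := fun xi => cos (tau * xi 0 l + 0) * chi xi.
Definition symR (tau : R) l chi : Rd -> R := fun xi => cos (tau * xi 0 l + - (pi / 2)) * chi xi.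

Lemma ccs_symS tau l chi : ccs chi -> ccs (symS tau l chi).
Proof. exact: (ccs_coord l (@sm1_cos R tau 0)). Qed.

Lemma ccs_symR tau l chi : ccs chi -> ccs (symR tau l chi).
Proof. exact: (ccs_coord l (@sm1_cos R tau _)). Qed.

Lemma absDelta_sqr f psi x : ctempered f -> ccs psi ->
  absDelta psi f x ^+ 2 = W f psi x 0 ^+ 2 + W f psi x (- (pi / 2)) ^+ 2.
Proof. by move=> ft pc; rewrite absDeltaE// sqr_sqrtr// addr_ge0 ?sqr_ge0. Qed.

(** Up to phase, the pieces of [symS] and [symR] are half the sum and half the difference of the
    translates by [tau] and [- tau]; the second claim is the reverse triangle inequality. *)
Lemma parallelogram f chi l (tau : R) x : ctempered f -> ccs chi ->
  let G := absDelta chi f (x + tau *: evec R l) in let H := absDelta chi f (x - tau *: evec R l) in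
  let A := absDelta (symS tau l chi) f x in let B := absDelta (symR tau l chi) f x in
  A ^+ 2 + B ^+ 2 = (G ^+ 2 + H ^+ 2) / 2 /\ (G - H) ^+ 2 <= 4 * B ^+ 2.
Proof.
move=> ft cc G H A B.
have cS := ccs_symS tau l cc; have cR := ccs_symR tau l cc.
rewrite /A /B !absDelta_sqr// !W_mod//.
have h1 y : W f chi y (0 - - (pi / 2)) = - W f chi y (- (pi / 2)).
  by rewrite -W_opp//; congr W; rewrite sub0r opprK; move: (pi : R) => P; field.
have h2 y : W f chi y (- (pi / 2) + - (pi / 2)) = - W f chi y 0.
  have := W_opp y (- (pi / 2) + - (pi / 2)) ft cc.
  rewrite (_ : - (pi / 2) + - (pi / 2) + pi = 0); first by move=> ->; rewrite opprK.
  by move: (pi : R) => P; field.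
have h3 y : W f chi y (- (pi / 2) - - (pi / 2)) = W f chi y 0 by rewrite subrr.
rewrite !addr0 !subr0 add0r h1 h2 h3.
have G2 : G ^+ 2 = W f chi (x + tau *: evec R l) 0 ^+ 2 + W f chi (x + tau *: evec R l) (- (pi / 2)) ^+ 2 by exact: absDelta_sqr.
have H2 : H ^+ 2 = W f chi (x - tau *: evec R l) 0 ^+ 2 + W f chi (x - tau *: evec R l) (- (pi / 2)) ^+ 2 by exact: absDelta_sqr.
have G0 : 0 <= G by exact: absDelta_ge0.
have H0 : 0 <= H by exact: absDelta_ge0.
move: G2 H2 G0 H0.
set a := W f chi (x + _) 0; set b := W f chi (x - _) 0; set c := W f chi (x + _) _; set e := W f chi (x - _) _.
move: a b c e => a b c e.
move: (G) (H) => g h G2 H2 G0 H0; split; first by field.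
rewrite sqrrB G2 H2.
suff : a * b + c * e <= g * h by lra.
have [/le_trans|/ltW pos] := leP (a * b + c * e) 0; first by apply; rewrite mulr_ge0.
rewrite -(@ler_pXn2r _ 2) ?nnegrE ?mulr_ge0// exprMn G2 H2.
by have := sqr_ge0 (a * e - b * c); lra.
Qed.

Local Open Scope ereal_scope.

Lemma poweR_fin (x : \bar R) (r : R) : 0 <= x -> x < +oo -> exists2 a : R, (0 <= a)%R & x = a%:E.
Proof. by case: x => [a| |]//; rewrite lee_fin => a0 _; exists a. Qed.

Lemma Lp_uniform_convexity p (g A B : Rd -> R) (a : Rd) : (1 < p)%R -> ct g -> ct A -> ct B ->
  (forall x, 0 <= g x)%R -> (forall x, 0 <= A x)%R -> (forall x, 0 <= B x)%R ->
  (forall x, A x ^+ 2 + B x ^+ 2 = (g (x + a) ^+ 2 + g (x - a) ^+ 2) / 2)%R ->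
  (forall x, (g (x + a) - g (x - a)) ^+ 2 <= 4 * B x ^+ 2)%R ->
  Lpnorm p%:E A `^ (Num.max 2 p)%R + (uc p)%:E * Lpnorm p%:E B `^ (Num.max 2 p)%R <=
  Lpnorm p%:E g `^ (Num.max 2 p)%R.
Proof.
move=> p1 cg cA cB g0 A0 B0 par1 par2; have p0 : (0 < p)%R by lra.
have rg := rl_normpow p0 cg; have rA := rl_normpow p0 cA; have rB := rl_normpow p0 cB.
have rG := rl_shift a rg; have rH := rl_shift (- a) rg.
pose X := intRd (fun x => (`|g x| `^ p)%:E).
pose P := intRd (fun x => (`|A x| `^ p)%:E).
pose Q := intRd (fun x => (`|B x| `^ p)%:E).
have X0 : 0 <= X by exact: intRd_ge0.
have P0 : 0 <= P by exact: intRd_ge0.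
have Q0 : 0 <= Q by exact: intRd_ge0.
have rhs : rl (fun x => (2^-1)%:E * ((`|g (x + a)| `^ p)%:E + (`|g (x - a)| `^ p)%:E)).
  by apply: rlZ => //; exact: rlD.
have XE : X = intRd (fun x => (2^-1)%:E * ((`|g (x + a)| `^ p)%:E + (`|g (x - a)| `^ p)%:E)).
  symmetry; etransitivity; first by apply: intRdZ => //; exact: rlD rG rH.
  have -> : intRd (fun x => (`|g (x + a)| `^ p)%:E + (`|g (x - a)| `^ p)%:E) = X + X.
    etransitivity; first exact: (intRdD rG rH).
    by congr (_ + _); exact: (intRd_shift _ rg).
  rewrite -[X in X + _](mul1e X) -[X in _ + X](mul1e X) -ge0_muleDl// muleA -EFinD -EFinM.
  by rewrite (_ : 2^-1 * (1 + 1) = 1)%R ?mul1e//; field.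
have ng x : `|g x|%R = g x by rewrite ger0_norm.
have nA x : `|A x|%R = A x by rewrite ger0_norm.
have nB x : `|B x|%R = B x by rewrite ger0_norm.
have [p2|p2] := leP 2%R p.
  rewrite /Lpnorm -/X -/P -/Q !poweRVK// /uc ltNge p2/= mul1e XE.
  rewrite /P /Q; apply: le_trans (intRd_le (rlD rA rB) rhs _); first by rewrite (intRdD rA rB).
  move=> x; rewrite -!EFinD -EFinM lee_fin mulrC nA nB !ng.
  exact: two_point_ge2.
have th : (0 < p / 2 < 1)%R by apply/andP; split; lra.
have /andP[th0 th1] := th.
have c0 := uc_gt0 p1.
rewrite /Lpnorm -/X -/P -/Q -!poweRrM.
have -> : (p^-1 * 2)%R = (p / 2)^-1%R by field; rewrite gt_eqF.
(* For [p < 2] the reverse Minkowski inequality in [L_{p / 2}] is needed; this is its linearized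
   form with free weights. *)
have ineq (u v : R) : (0 <= u)%R -> (0 <= v)%R -> (u + v = 1)%R ->
    (u `^ (1 - p / 2))%:E * P + (v `^ (1 - p / 2) * uc p `^ (p / 2))%:E * Q <= X.
  move=> u0 v0 uv.
  rewrite /P /Q -intRdZ ?powR_ge0// -intRdZ ?mulr_ge0 ?powR_ge0//.
  have rP : rl (fun x => (u `^ (1 - p / 2))%:E * (`|A x| `^ p)%:E) by apply: rlZ => //; exact: powR_ge0.
  have rQ : rl (fun x => (v `^ (1 - p / 2) * uc p `^ (p / 2))%:E * (`|B x| `^ p)%:E).
    by apply: rlZ => //; rewrite mulr_ge0 ?powR_ge0.
  rewrite XE; apply: le_trans (intRd_le (rlD rP rQ) rhs _); first by rewrite (intRdD rP rQ).
  move=> x; suff h : (u `^ (1 - p / 2) * `|A x| `^ p + v `^ (1 - p / 2) * uc p `^ (p / 2) * `|B x| `^ p <=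
      2^-1 * (`|g (x + a)| `^ p + `|g (x - a)| `^ p))%R by rewrite -lee_fin in h; exact: h.
  rewrite nA nB !ng [leRHS]mulrC.
  have p12 : (1 < p < 2)%R by rewrite p1.
  apply: le_trans (two_point_lt2 p12 (A0 x) (B0 x) (g0 _) (g0 _) (par1 x) (par2 x)).
  rewrite -(sqr_powR p (A0 x)) -(sqr_powR p (B0 x)) -[X in (_ + X <= _)%R]mulrA.
  rewrite -powRM ?sqr_ge0 ?(ltW c0)//.
  by apply: concave_split; rewrite ?sqr_ge0// mulr_ge0 ?sqr_ge0// ltW.
have [Xy|Xy] := eqVneq X +oo; first by rewrite Xy poweRyr ?leey// gt_eqF// invr_gt0.
have {}Xy : X < +oo by rewrite ltey.
have PX : P <= X.
  have := ineq 1%R 0%R ler01 (lexx _) (addr0 _); rewrite powR1 powR0 ?mul0r ?mul0e ?adde0 ?mul1e//.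
  by rewrite gt_eqF// subr_gt0.
have QX : (uc p `^ (p / 2))%:E * Q <= X.
  have := ineq 0%R 1%R (lexx _) ler01 (add0r _); rewrite powR1 powR0 ?mul1r ?mul0e ?add0e//.
  by rewrite gt_eqF// subr_gt0.
have Qy : Q < +oo.
  rewrite ltey; apply/eqP => QE; move: QX; rewrite QE gt0_muley ?lte_fin ?powR_gt0//.
  by rewrite leye_eq => /eqP XE'; move: Xy; rewrite XE'.
have [x x0 xE] := poweR_fin 0%R X0 Xy; have [a' a0 aE] := poweR_fin 0%R P0 (le_lt_trans PX Xy).
have [b b0 bE] := poweR_fin 0%R Q0 Qy.
move: ineq; rewrite xE aE bE => ineq.
rewrite !poweR_EFin -EFinM -EFinD lee_fin.
set ca := (a' `^ _)%R; set cb := (uc p * _)%R.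
have ca0 : (0 <= ca)%R by exact: powR_ge0.
have cb0 : (0 <= cb)%R by rewrite mulr_ge0 ?powR_ge0// ltW.
have := addr_ge0 ca0 cb0; rewrite le_eqVlt => /predU1P[<-|S0]; first exact: powR_ge0.
(* The optimal weights are proportional to the two terms. *)
have := ineq (ca / (ca + cb))%R (cb / (ca + cb))%R.
rewrite !divr_ge0 ?(ltW S0)// -mulrDl mulfV ?gt_eqF// -!EFinM -EFinD lee_fin => /(_ isT isT erefl).
have aE' : a' = (ca `^ (p / 2))%R by rewrite /ca powRVK.
have bE' : (uc p `^ (p / 2) * b = cb `^ (p / 2))%R.
  by rewrite /cb powRM ?powR_ge0 ?(ltW c0)// powRVK.
rewrite -mulrA bE' aE'.
have K (y : R) : (0 <= y)%R -> ((y / (ca + cb)) `^ (1 - p / 2) * y `^ (p / 2) = y * (ca + cb) `^ (p / 2 - 1))%R.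
  move=> y0; rewrite powRM// ?invr_ge0 ?(ltW S0)// mulrAC -powRD; last first.
    by rewrite addrNK oner_eq0.
  rewrite addrNK powRr1//; congr (_ * _)%R.
  have e : ((ca + cb)^-1 = (ca + cb) `^ (-1))%R by rewrite powR_inv1// ltW.
  by rewrite e -powRrM mulN1r opprB.
rewrite !K// -mulrDl mulr_powRB1 ?(ltW S0)// => H.
rewrite -(powRK (ltW S0) th0); apply: powR_le => //; rewrite ?powR_ge0// invr_ge0 ltW//.
Qed.

Lemma uniform_convexity p f chi l (tau : R) : (1 < p)%R -> ctempered f -> ccs chi ->
  Lpnorm p%:E (absDelta (symS tau l chi) f) `^ (Num.max 2 p)%R +
  (uc p)%:E * Lpnorm p%:E (absDelta (symR tau l chi) f) `^ (Num.max 2 p)%R <=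
  Lpnorm p%:E (absDelta chi f) `^ (Num.max 2 p)%R.
Proof.
move=> p1 ft cc; have par x := parallelogram l tau x ft cc.
apply: (Lp_uniform_convexity (a := tau *: evec R l)) => //.
- exact: ct_absDelta.
- by apply: ct_absDelta => //; exact: ccs_symS.
- by apply: ct_absDelta => //; exact: ccs_symR.
- by move=> x; exact: absDelta_ge0.
- by move=> x; exact: absDelta_ge0.
- by move=> x; exact: absDelta_ge0.
- by move=> x; exact: (par x).1.
- by move=> x; exact: (par x).2.
Qed.

End uniform_convexity.

(** * Summation over the dyadic shells of one coordinate *)

Section coordinate.
Context {R : realType} {d : nat}.
Notation Rd := 'rV[R]_d.
Implicit Types (psi chi : Rd -> R) (l : 'I_d) (xi : Rd) (f : tdist R d).
Variable phi0 : R -> R.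
Hypothesis ad : admissible_phi0 phi0.

Lemma cos_sin_shift (x : R) : cos (x + - (pi / 2)) = sin x.
Proof. by rewrite cosB cos_pihalf sin_pihalf mulr0 mulr1 add0r. Qed.

Fixpoint chain (tau : R) l chi n : Rd -> R :=
  match n with 0 => chi | n'.+1 => symS (2 ^+ n' * tau) l (chain tau l chi n') end.

Lemma ccs_chain tau l chi n : ccs chi -> ccs (chain tau l chi n).
Proof. by move=> cc; elim: n => // n IH; exact: ccs_symS. Qed.

Lemma chain_supp tau l chi n xi : chi xi = 0 -> chain tau l chi n xi = 0.
Proof. by move=> c0; elim: n => // n IH; rewrite /= /symS IH mulr0. Qed.

(** Viete's product formula: [sin 2u = 2 sin u cos u] is used once per cosine of the chain. *)
Lemma chain_sin tau l chi n xi :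
  chain tau l chi n xi * (2 ^+ n * sin (tau * xi 0 l)) = sin (2 ^+ n * tau * xi 0 l) * chi xi.
Proof.
elim: n => [|n IH]; first by rewrite expr0 !mul1r mulrC.
rewrite /= /symS addr0 exprS.
have -> : cos (2 ^+ n * tau * xi 0 l) * chain tau l chi n xi * (2 * 2 ^+ n * sin (tau * xi 0 l)) =
  2 * cos (2 ^+ n * tau * xi 0 l) * (chain tau l chi n xi * (2 ^+ n * sin (tau * xi 0 l))) by ring.
rewrite IH.
have -> : 2 * 2 ^+ n * tau * xi 0 l = 2 ^+ n * tau * xi 0 l + 2 ^+ n * tau * xi 0 l by ring.
rewrite sinD; ring.
Qed.

(** Each step splits the current symbol into its cosine part, which is split further, and its sine
    part, which is kept; the convexity inequalities telescope. *)
Lemma chain_sum (p : R) f chi l tau n : 1 < p -> ctempered f -> ccs chi ->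
  (Lpnorm p%:E (absDelta (chain tau l chi n) f) `^ (Num.max 2 p)%R +
   (uc p)%:E * \sum_(k < n) Lpnorm p%:E (absDelta (symR (2 ^+ k * tau)%R l (chain tau l chi k)) f) `^ (Num.max 2 p)%R <=
   Lpnorm p%:E (absDelta chi f) `^ (Num.max 2 p)%R)%E.
Proof.
move=> p1 ft cc; elim: n => [|n IH]; first by rewrite big_ord0 mule0 adde0.
have UC := uniform_convexity l (2 ^+ n * tau) p1 ft (ccs_chain tau l n cc).
apply: le_trans IH; rewrite big_ord_recr ge0_muleDr; [|by apply: sume_ge0 => k _; exact: poweR_ge0|exact: poweR_ge0].
by rewrite addeA addeAC; apply: leeD2r; exact: UC.
Qed.

Definition sinmult (n : nat) (m : R -> R) : R -> R :=
  fun y => 2 ^+ n * (cos (2 ^- n / 4 * y + - (pi / 2)) * m y).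

Lemma cs1_sinmult n m : cs1 m -> cs1 (sinmult n m).
Proof.
move=> [ms m3]; split; last by move=> x /m3 mx; rewrite /sinmult mx !mulr0.
exact: (@sm1Z R (2 ^+ n) _ (@sm1M R _ _ (@sm1_cos R _ _) ms)).
Qed.

(* [2^n sin(2^-n y / 4)] acts on the kernel as a difference quotient, hence boundedly in [n]. *)
Lemma dec_sinmult N m : cs1 m -> exists2 B : R, 0 <= B & forall n, dec N B (sinmult n m).
Proof.
move=> mc; have cm := cs1_ccs mc; have [M M0 HM] := J_lip N cm.
exists (M * 2 ^+ N); first by rewrite mulr_ge0// exprn_ge0.
move=> n y w; rewrite /j1; set e : R := 2 ^- n / 4.
have n0 : 0 < 2 ^- n :> R by rewrite invr_gt0 exprn_gt0.
have n1 : 2 ^- n <= 1 :> R by rewrite invf_le1 ?exprn_gt0// exprn_ege1// ler1n.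
have e0 : 0 < e by rewrite divr_gt0.
have e1 : e <= 1 by rewrite /e; lra.
have -> : emb1 (sinmult n m) = fun X => 2 ^+ n * (cos (e * X 0 0 + - (pi / 2)) * emb1 m X) by [].
have cc : ccs (fun X : 'rV[R]_1 => cos (e * X 0 0 + - (pi / 2)) * emb1 m X).
  exact: (ccs_coord 0 (@sm1_cos R e _) cm).
have -> : J (fun X => 2 ^+ n * (cos (e * X 0 0 + - (pi / 2)) * emb1 m X)) (const_mx y) w =
  2 ^+ n * J (fun X => cos (e * X 0 0 + - (pi / 2)) * emb1 m X) (const_mx y) w.
  have := J_lin (2 ^+ n) (const_mx y) w cc ccs0.
  have -> : J (fun=> 0) (const_mx y : 'rV[R]_1) w = 0.
    by rewrite /J; under eq_fun do rewrite mul0r; exact: RI0.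
  by rewrite addr0 => <-; apply: J_ext => X; rewrite addr0.
rewrite J_mod//.
have -> : w - - (pi / 2) = w + - (pi / 2) + pi by move: (pi : R) => P; field.
rewrite J_opp//; set z := const_mx y; set v := e *: evec R 0.
have vn : `|v| <= e by apply: le_trans (norm_evec_le _ _) _; rewrite gtr0_norm.
have h1 := HM z v (w + - (pi / 2)); have h2 := HM z (- v) (w + - (pi / 2)).
have zn : `|z| = `|y| by exact: norm_const1.
rewrite zn normrN in h1 h2.
have vb : (1 + `|v|) ^+ N * `|v| <= 2 ^+ N * e.
  apply: ler_pM => //.
  by rewrite lerXn2r ?nnegrE ?addr_ge0//; lra.
have {}h1 := le_trans h1 (ler_wpM2l M0 vb); have {}h2 := le_trans h2 (ler_wpM2l M0 vb).
set a := J _ (z + v) _ in h1 *; set b := J _ (z - v) _ in h2 *; set c := J _ z _ in h1 h2.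
have -> : 2 ^+ n * ((a - b) / 2) = 2 ^+ n / 2 * (a - c) - 2 ^+ n / 2 * (b - c) by field.
have c2 : 0 <= 2 ^+ n / 2 :> R by rewrite divr_ge0// exprn_ge0.
apply: le_trans (ler_wpM2l _ (ler_normB _ _)) _; first by rewrite exprn_ge0// addr_ge0.
rewrite [`|2 ^+ n / 2 * (a - c)|]normrM [`|2 ^+ n / 2 * (b - c)|]normrM (ger0_norm c2) mulrDr !(mulrCA _ (2 ^+ n / 2)) -mulrDr.
apply: (@le_trans _ _ (2 ^+ n / 2 * (M * (2 ^+ N * e) + M * (2 ^+ N * e)))).
  by rewrite ler_wpM2l// lerD.
have -> : 2 ^+ n / 2 * (M * (2 ^+ N * e) + M * (2 ^+ N * e)) = (2 ^+ n * e) * (M * 2 ^+ N) by field.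
have -> : 2 ^+ n * e = 4^-1 by rewrite /e mulrA mulfV ?mul1r// expf_neq0.
by rewrite ler_piMl ?mulr_ge0 ?exprn_ge0//; lra.
Qed.

(** A smooth function without zeros that equals [sin(y / 4) ^ 2] for [1 <= |y| <= 3], where
    [phij phi0 1] lives. The second square vanishes from [|y| = 1] on and removes the zero at the
    origin; the third vanishes up to 3 and removes the zeros at large [|y|]. *)
Let den (y : R) := sin (1 / 4 * y + 0) * sin (1 / 4 * y + 0) + (phi0 (3 / 2 * y + 0) * phi0 (3 / 2 * y + 0) +
  (1 + -1 * phi0 (1 / 3 * y + 0)) * (1 + -1 * phi0 (1 / 3 * y + 0))).

Let den_neq0 y : den y != 0.
Proof.
have [_ [p1 _]] := ad; rewrite /den !addr0 -!expr2.
have Z (a b c : R) : (a != 0 \/ b != 0 \/ c != 0) -> a ^+ 2 + (b ^+ 2 + c ^+ 2) != 0.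
  move=> H; rewrite !paddr_eq0 ?addr_ge0 ?sqr_ge0// !sqrf_eq0.
  by apply/negP => /andP[/eqP a0 /andP[/eqP b0 /eqP c0]]; move: H; rewrite a0 b0 c0 eqxx => -[|[|]].
apply: Z.
have [y1|y1] := leP `|y| (2 / 3).
  right; left; rewrite p1 ?oner_neq0// normrM ger0_norm//; lra.
have [y2|y2] := ltP `|y| 8.
  left.
  have S z : 0 < z -> z < 2 -> sin z != 0 :> R by move=> z0 z2; rewrite gt_eqF// sin2_gt0// z0.
  have [y0|y0] := leP 0 y.
    by rewrite ger0_norm// in y1 y2; apply: S; lra.
  rewrite ltr0_norm// in y1 y2.
  by rewrite -[_ * y]opprK sinN oppr_eq0; apply: S; lra.
right; right; have [_ [_ p0]] := ad; rewrite p0 ?mulr0 ?addr0 ?oner_neq0//.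
rewrite normrM ger0_norm//; lra.
Qed.

Definition mbump (y : R) := phij phi0 1 y * (den y)^-1.

Lemma cs1_mbump : cs1 mbump.
Proof.
have [ps _] := ad; have [_ [q1 q3]] := admissible_cs1 ad; split; last by move=> x /q3 qx; rewrite /mbump qx mul0r.
apply: (@sm1M R _ _ q1); apply: (@sm1V R _ den_neq0).
have aff a := @sm1_affine R phi0 a 0 ps.
have c3 := @sm1D R _ _ (@sm1_cst R 1) (@sm1Z R (-1) _ (aff (1 / 3))).
exact: (@sm1D R _ _ (@sm1M R _ _ (@sm1_sin R _ _) (@sm1_sin R _ _))
  (@sm1D R _ _ (@sm1M R _ _ (aff _) (aff _)) (@sm1M R _ _ c3 c3))).
Qed.

Lemma phij_supp k (y : R) : phij phi0 k y != 0 -> `|y| < 3 / 2 * 2 ^+ k /\ ((0 < k)%N -> 2 ^+ k.-1 < `|y|).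
Proof.
have [_ [p1 p0]] := ad; case: k => [|k] /=.
  move=> H; split=> //; rewrite expr0 mulr1 ltNge; apply/negP => /p0 E; move: H; by rewrite E eqxx.
have k0 : 0 < 2 ^+ k :> R by rewrite exprn_gt0.
have nE n : `|2 ^- n * y| = `|y| / 2 ^+ n by rewrite normrM mulrC [`|2 ^- n|]ger0_norm// invr_ge0 exprn_ge0.
move=> H; split => [|_].
  rewrite ltNge; apply/negP => y3; move: H; rewrite !p0 ?subrr ?eqxx// nE ler_pdivlMr ?exprn_gt0//.
  by move: y3; rewrite exprS; lra.
rewrite ltNge; apply/negP => yk; move: H; rewrite !p1 ?subrr ?eqxx// nE ler_pdivrMr ?exprn_gt0// ?mul1r//.
by rewrite exprS; lra.
Qed.

Lemma mbump_sin y : mbump y * sin (1 / 4 * y) ^+ 2 = phij phi0 1 y.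
Proof.
rewrite /mbump; have [->|H] := eqVneq (phij phi0 1 y) 0; first by rewrite !mul0r.
have [_ [p1 p0]] := ad; have := phij_supp H; rewrite /= expr0 expr1 => -[y3 /(_ isT) y1].
have E : den y = sin (1 / 4 * y) ^+ 2.
  rewrite /den !addr0 (p0 (3 / 2 * y)) ?(p1 (1 / 3 * y)) ?mulr1 ?subrr ?mulr0 ?addr0 ?expr2//.
    rewrite normrM ger0_norm//; lra.
  rewrite normrM ger0_norm//; lra.
by rewrite -E divfK ?den_neq0.
Qed.

(** In [phij phi0 1 = mbump * sin(y / 4) ^ 2] one sine is the one kept in [symR]. The other equals
    the chain times [2 ^ n sin(tau xi_l)] by [chain_sin], and this small sine goes into the
    multiplier [sinmult]. *)
Lemma phij_factor l chi j i xi : (i <= j)%N ->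
  phij phi0 i.+1 (xi 0 l) * chi xi =
  sinmult (j - i) mbump (2 ^- i * xi 0 l) * symR (2 ^+ (j - i) * 2 ^- j.+2) l (chain (2 ^- j.+2) l chi (j - i)) xi.
Proof.
move=> ij; set n := (j - i)%N; set tau : R := 2 ^- j.+2; set y := 2 ^- i * xi 0 l.
have nz k : 2 ^+ k != 0 :> R by rewrite expf_neq0.
have E1 : 2 ^- n / 4 * y = tau * xi 0 l.
  have -> : tau = (4 * (2 ^+ n * 2 ^+ i))^-1 by rewrite /tau -exprD subnK// !exprS mulrA -natrM.
  rewrite /y; move: (nz n) (nz i) => n0 i0.
  by field; rewrite n0 i0.
have E2 : 2 ^+ n * tau * xi 0 l = 1 / 4 * y.
  rewrite -mulrA -E1; move: (nz n) => n0; by field.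
rewrite /symR /sinmult !cos_sin_shift E1 E2.
have := chain_sin tau l chi n xi; rewrite E2 => CE.
have -> : 2 ^+ n * (sin (tau * xi 0 l) * mbump y) * (sin (1 / 4 * y) * chain tau l chi n xi) =
  mbump y * sin (1 / 4 * y) * (chain tau l chi n xi * (2 ^+ n * sin (tau * xi 0 l))) by ring.
rewrite CE phijS -mbump_sin -/y; ring.
Qed.

(** The form that is iterated over the coordinates. The index runs up to [j.+1] because [phi_{j+1}]
    still meets the support [|xi_l| <= (3 / 2) 2 ^ j]. *)
Definition coord_bound (p : \bar R) (q t : R) := exists2 C : R, 0 <= C &
  forall f chi l j, ctempered f -> ccs chi -> (forall xi, 3 / 2 * 2 ^+ j < `|xi 0 l| -> chi xi = 0) ->
  (\sum_(k < j.+2) (2 `^ (k%:R * t * q))%:E * Lpnorm p (absDelta (fun xi => phij phi0 k (xi 0 l) * chi xi)%R f) `^ q <=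
   (C * 2 `^ (j%:R * t * q))%:E * Lpnorm p (absDelta chi f) `^ q)%E.

Lemma powR2_gt1 (s : R) : 0 < s -> 1 < 2 `^ s.
Proof.
move=> s0; rewrite ltNge; apply/negP => h.
have : (2 `^ s) `^ s^-1 <= 1 `^ s^-1 by apply: powR_le; rewrite ?invr_ge0 ?powR_ge0// ltW.
by rewrite powRK// powR1 leNgt ltr1n.
Qed.

Lemma geo_sum (x : R) n : 1 < x -> \sum_(k < n) x ^+ k <= x ^+ n / (x - 1).
Proof.
move=> x1; have x0 : 0 < x - 1 by lra.
rewrite ler_pdivlMr// mulrC -subrX1 lerBlDr lerDl//.
Qed.

Lemma powR_nat (x : R) (n : nat) : 2 `^ (n%:R * x) = (2 `^ x) ^+ n.
Proof. by rewrite mulrC powRrM powR_mulrn ?powR_ge0. Qed.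

(** The bounds for the single terms grow geometrically with ratio [x = 2 ^ ((t - sigp p) * q) > 1],
    so the top index controls the sum. *)
Lemma coord_bound_gt p (q t : R) : (0 < p)%E -> 0 < q -> sigp p < t -> coord_bound p q t.
Proof.
move=> p0 q0 st; have [C C0 HC] := @multiplier_phi R d p phi0 p0 ad.
pose x : R := 2 `^ ((t - sigp p) * q).
have x1 : 1 < x.
  by apply: powR2_gt1; rewrite mulr_gt0// subr_gt0.
pose K := C `^ q * (x ^+ 2 / (x - 1)).
exists K; first by rewrite mulr_ge0 ?powR_ge0// divr_ge0 ?exprn_ge0//; lra.
move=> f chi l j ft cc cl; set N := Lpnorm p (absDelta chi f).
have N0 : (0 <= N)%E by apply: Lpnorm_ge0; exact: ct_absDelta.
apply: (@le_trans _ _ (\sum_(k < j.+2) (C `^ q * 2 `^ (j%:R * sigp p * q) * x ^+ k)%:E * N `^ q)%E).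
  apply: lee_sum => k _.
  have kj : (k <= j.+1)%N by rewrite -ltnS.
  have ck : ccs (fun xi => phij phi0 k (xi 0 l) * chi xi) by exact: (ccs_coord l (@sm1_phij R phi0 k ad) cc).
  have h := HC f chi l j k ft cc cl kj.
  have := poweR_le (ltW q0) (Lpnorm_ge0 p (ct_absDelta ft ck)) h.
  have w0 : (0 <= (2 `^ (k%:R * t * q))%:E)%E by rewrite lee_fin powR_ge0.
  have c0 : (0 <= (C * 2 `^ ((j%:R - k%:R) * sigp p))%:E)%E by rewrite lee_fin mulr_ge0 ?powR_ge0.
  rewrite poweRM// poweR_EFin => {}h.
  apply: le_trans (lee_wpmul2l w0 h) _; rewrite muleA -EFinM le_eqVlt; apply/orP; left; apply/eqP.
  congr (_%:E * _)%E; rewrite powRM ?powR_ge0// -powRrM mulrCA -!mulrA; congr (_ * _).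
  rewrite /x -powR_nat -!powRD ?pnatr_eq0 ?implybT//; congr (_ `^ _); ring.
rewrite -ge0_sume_distrl; last first.
  by move=> k _; rewrite lee_fin !mulr_ge0 ?powR_ge0// exprn_ge0// ltW// (lt_trans ltr01).
rewrite sumEFin; apply: lee_wpmul2r; first exact: poweR_ge0.
rewrite lee_fin -mulr_sumr /K -!mulrA ler_wpM2l ?powR_ge0//.
apply: le_trans (ler_wpM2l (powR_ge0 _ _) (geo_sum j.+2 x1)) _.
have -> : x ^+ j.+2 = x ^+ j * x ^+ 2 by rewrite -exprD addn2.
rewrite le_eqVlt; apply/orP; left; apply/eqP.
have -> : 2 `^ (j%:R * (t * q)) = 2 `^ (j%:R * (sigp p * q)) * x ^+ j.
  by rewrite /x -powR_nat -powRD ?pnatr_eq0 ?implybT//; congr (_ `^ _); ring.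
have x0 : x - 1 != 0 by rewrite gt_eqF// subr_gt0.
by move: (_ `^ _) (x ^+ j) => u v; field.
Qed.

Lemma poweR_super (x y : \bar R) (u : R) : 1 <= u -> (0 <= x)%E -> (0 <= y)%E ->
  (x `^ u + y `^ u <= (x + y) `^ u)%E.
Proof.
move=> u1; have u0 : u != 0 by rewrite gt_eqF//; lra.
case: x => [a| |]//; case: y => [b| |]// => a0 b0; rewrite ?addye ?addey// ?poweRyr// ?leey//.
by have h := powR_super u1 a0 b0; rewrite -lee_fin in h; exact: h.
Qed.

Lemma sum_poweR_super n (x : nat -> \bar R) (u : R) : 1 <= u -> (forall k, 0 <= x k)%E ->
  (\sum_(k < n) x k `^ u <= (\sum_(k < n) x k) `^ u)%E.
Proof.
move=> u1 x0; elim: n => [|n IH]; first by rewrite !big_ord0 poweR_ge0.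
rewrite !big_ord_recr/=; apply: le_trans (poweR_super u1 _ (x0 n)); last exact: sume_ge0.
by rewrite leeD2r.
Qed.

(** By [phij_factor] each shell [k >= 1] is dominated by one sine part of the chain, with no loss in
    [s] since [rho = 1]; the sine parts have a bounded l^r sum, [r = max 2 p]. Passing from [r] to
    [q] is superadditivity, and [k = 0] is treated apart. *)
Lemma coord_bound_eq0 (p q : R) : 1 < p -> Num.max 2 p <= q -> coord_bound p%:E q 0.
Proof.
move=> p1 rq; set r := Num.max 2 p in rq *.
have r2 : 2 <= r by rewrite le_max lexx.
have q0 : 0 < q by lra.
have p0 : (0 < p%:E)%E by rewrite lte_fin; lra.
have rho1 : rho p%:E = 1 by rewrite /= min_l// ltW.
have [C0 C00 HC0] := @multiplier_phi R d p%:E phi0 p0 ad.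
have [B B0 HB] := dec_sinmult 2 cs1_mbump.
have c0 := uc_gt0 p1.
exists (C0 `^ q + (4 * B) `^ q * (uc p)^-1 `^ (q / r)).
  by rewrite addr_ge0 ?mulr_ge0 ?powR_ge0.
move=> f chi l j ft cc cl; set N := Lpnorm p%:E (absDelta chi f).
have N0 : (0 <= N)%E by apply: Lpnorm_ge0; exact: ct_absDelta.
pose tau : R := 2 ^- j.+2.
pose y k := Lpnorm p%:E (absDelta (symR (2 ^+ k * tau)%R l (chain tau l chi k)) f).
have cR k : ccs (symR (2 ^+ k * tau)%R l (chain tau l chi k)) by apply: ccs_symR; exact: ccs_chain.
have y0 k : (0 <= y k)%E by apply: Lpnorm_ge0; exact: ct_absDelta.
have yi i : (i <= j)%N -> (Lpnorm p%:E (absDelta (fun xi => phij phi0 i.+1 (xi 0 l) * chi xi)%R f) <= (4 * B)%:E * y (j - i)%N)%E.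
  move=> ij.
  have -> : (fun xi => phij phi0 i.+1 (xi 0 l) * chi xi) = (fun xi => sinmult (j - i) mbump (2 ^- i * xi 0 l) *
      symR (2 ^+ (j - i) * tau) l (chain tau l chi (j - i)) xi).
    by apply/funext => xi; exact: phij_factor.
  pose s : R := 2 ^- (j.+1 - i).
  have s0 : 0 < s by rewrite invr_gt0 exprn_gt0.
  have s2 : s <= 1 / 2.
    rewrite mul1r /s lef_pV2 ?posrE ?exprn_gt0//.
    by rewrite -{1}(expr1 2) ler_eXn2l ?ltr1n// subn_gt0 ltnS.
  have sl : s * 2 ^+ j.+1 = 2 ^+ i.
    by rewrite /s -{2}(subnK (leq_trans ij (leqnSn j))) exprD mulKf// expf_neq0.
  have J0 : 0 < 2 ^+ j.+1 :> R by rewrite exprn_gt0.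
  have cl' xi : pi * 2 ^+ j.+1 < `|xi 0 l| -> symR (2 ^+ (j - i) * tau) l (chain tau l chi (j - i)) xi = 0.
    move=> H; rewrite /symR chain_supp ?mulr0//; apply: cl; apply: le_lt_trans H; rewrite exprS.
    have : 0 < 2 ^+ j :> R by rewrite exprn_gt0.
    by move: (2 ^+ j : R) (pi : R) (pi_ge2 R) => u P; nra.
  have N2 : 2 <= 2%:R * rho p%:E :> R by rewrite rho1 mulr1.
  have := @multiplier_Lp R d f _ l _ s (2 ^+ j.+1) ft (cR _) (cs1_sinmult (j - i) cs1_mbump) s0 s2 J0 cl' p%:E 2 B p0 N2 B0 (HB _).
  by rewrite sl rho1 invr1 subrr powRr0 powRr1// mulr1.
have S1 : ((uc p)%:E * \sum_(k < j.+1) y k `^ r <= N `^ r)%E.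
  have := chain_sum l tau j.+1 p1 ft cc; apply: le_trans.
  by rewrite leeDr// poweR_ge0.
have S2 : (\sum_(k < j.+1) y k `^ r <= (uc p)^-1%:E * N `^ r)%E.
  have cV : (0 <= (uc p)^-1%:E)%E by rewrite lee_fin invr_ge0 ltW.
  by have := lee_wpmul2l cV S1; rewrite muleA -EFinM mulVf ?gt_eqF// mul1e.
have rqr : r * (q / r) = q by rewrite mulrC divfK// gt_eqF//; lra.
have qr : 1 <= q / r by rewrite ler_pdivlMr ?mul1r//; lra.
have S3 : (\sum_(k < j.+1) y k `^ q <= ((uc p)^-1 `^ (q / r))%:E * N `^ q)%E.
  have -> : (\sum_(k < j.+1) y k `^ q = \sum_(k < j.+1) (y k `^ r) `^ (q / r))%E.
    by apply: eq_bigr => k _; rewrite -poweRrM rqr.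
  apply: le_trans (@sum_poweR_super _ (fun k => y k `^ r)%E _ qr (fun k => poweR_ge0 _ _)) _.
  apply: le_trans (poweR_le _ _ S2) _; first by lra.
    by apply: sume_ge0 => k _; exact: poweR_ge0.
  rewrite poweRM ?poweR_ge0//; last by rewrite lee_fin invr_ge0 ltW.
  by rewrite poweR_EFin -poweRrM rqr.
under eq_bigr do rewrite mulr0 mul0r powRr0 mul1e.
rewrite mulr0 mul0r powRr0 mulr1 big_ord_recl EFinD ge0_muleDl ?lee_fin ?mulr_ge0 ?powR_ge0//.
apply: leeD.
  have ck : ccs (fun xi => phij phi0 0 (xi 0 l) * chi xi) by exact: (ccs_coord l (@sm1_phij R phi0 0 ad) cc).
  have h := HC0 f chi l j 0%N ft cc cl isT.
  have s00 : sigp p%:E = 0 by rewrite /sigp rho1 invr1 subrr.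
  rewrite s00 mulr0 powRr0 mulr1 in h.
  have := poweR_le (ltW q0) (Lpnorm_ge0 _ (ct_absDelta ft ck)) h.
  by rewrite poweRM// ?lee_fin// poweR_EFin.
rewrite EFinM -muleA.
apply: (@le_trans _ _ (\sum_(k < j.+1) ((4 * B) `^ q)%:E * y (j - k)%N `^ q)%E).
  apply: lee_sum => k _; have kj : (k <= j)%N by rewrite -ltnS.
  have ck : ccs (fun xi => phij phi0 k.+1 (xi 0 l) * chi xi) by exact: (ccs_coord l (@sm1_phij R phi0 k.+1 ad) cc).
  have := poweR_le (ltW q0) (Lpnorm_ge0 _ (ct_absDelta ft ck)) (yi _ kj).
  have b4 : (0 <= (4 * B)%:E)%E by rewrite lee_fin mulr_ge0.
  by rewrite (poweRM q b4 (y0 _)) poweR_EFin.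
rewrite -ge0_sume_distrr; last by move=> k _; exact: poweR_ge0.
apply: lee_wpmul2l; first by rewrite lee_fin powR_ge0.
apply: le_trans S3; rewrite [leRHS](reindex_inj rev_ord_inj).
apply: lee_sum => k _; rewrite (_ : nat_of_ord (rev_ord k) = (j - k)%N)//.
Qed.

End coordinate.

(** * Sufficiency *)

Section symbols.
Context {R : realType} {d : nat}.
Notation Rd := 'rV[R]_d.
Implicit Types (psi chi : Rd -> R) (l : 'I_d) (xi : Rd) (f : tdist R d) (k : {ffun 'I_d -> nat}).
Variables (psi0 : Rd -> R) (phi0 : R -> R).
Hypotheses (apsi : admissible_psi0 psi0) (aphi : admissible_phi0 phi0).

Lemma psi0_supp n xi l : 3 / 2 * 2 ^+ n <= `|xi 0 l| -> psi0 (2 ^- n *: xi) = 0.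
Proof.
have [_ [_ p0]] := apsi; move=> H; apply: p0; exists l; rewrite mxE normrM.
by rewrite [`|2 ^- n|]gtr0_norm ?invr_gt0 ?exprn_gt0// [leRHS]mulrC ler_pdivlMr ?exprn_gt0.
Qed.

Lemma psi0_one n xi : (forall l, `|xi 0 l| <= 2 ^+ n) -> psi0 (2 ^- n *: xi) = 1.
Proof.
have [_ [p1 _]] := apsi; move=> H; apply: p1 => l; rewrite mxE normrM.
by rewrite [`|2 ^- n|]gtr0_norm ?invr_gt0 ?exprn_gt0// mulrC ler_pdivrMr ?exprn_gt0// mul1r.
Qed.

Lemma psij0 xi : psij psi0 0 xi = psi0 (2 ^- 0 *: xi).
Proof. by rewrite expr0 invr1 scale1r. Qed.

Lemma psij_supp j xi l : 3 / 2 * 2 ^+ j <= `|xi 0 l| -> psij psi0 j xi = 0.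
Proof.
case: j => [|j] H; first by rewrite psij0 (psi0_supp H).
rewrite /psij (psi0_supp H) (@psi0_supp j _ l) ?subrr//; apply: le_trans H.
by rewrite ler_wpM2l// exprS ler_peMl ?exprn_ge0// ler1n.
Qed.

Lemma smooth_psi0 n : smooth (fun xi => psi0 (2 ^- n *: xi)).
Proof.
have [ps _] := apsi; have := smooth_affine (2 ^- n) 0 ps; congr smooth.
by apply/funext => xi; rewrite addr0.
Qed.

Lemma ccs_psij j : ccs (psij psi0 j).
Proof.
split; last by exists (3 / 2 * 2 ^+ j) => xi l /ltW /psij_supp.
case: j => [|j].
  have := smooth_psi0 0; congr smooth; apply/funext => xi; by rewrite psij0.
have := smoothD (smooth_psi0 j.+1) (smoothZ (-1) (smooth_psi0 j)); congr smooth.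
by apply/funext => xi; rewrite mulN1r.
Qed.

Definition psym (P : pred 'I_d) k chi : Rd -> R := fun xi => (\prod_(i | P i) phij phi0 (k i) (xi 0 i)) * chi xi.

Lemma smooth_prod (P : pred 'I_d) k : smooth (fun xi => \prod_(i | P i) phij phi0 (k i) (xi 0 i)).
Proof.
elim: (index_enum _) => [|i s IH]; first by under eq_fun do rewrite big_nil; exact: smooth_cst.
under eq_fun do rewrite big_cons; case: (P i) => //.
by apply: smoothM => //; apply: smooth_coord; exact: sm1_phij.
Qed.

Lemma ccs_psym P k chi : ccs chi -> ccs (psym P k chi).
Proof. by move=> cc; exact: (ccsM (smooth_prod P k) cc). Qed.

Definition kmax k := \max_(i < d) k i.

Lemma kmax_ge k i : (k i <= kmax k)%N.
Proof. exact: (@leq_bigmax _ (fun i => k i)). Qed.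

Lemma phik_neq0 k xi i : phik phi0 k xi != 0 -> phij phi0 (k i) (xi 0 i) != 0.
Proof.
apply: contra => /eqP H; rewrite /phik (bigD1 i)//= H mul0r//.
Qed.

Lemma ccs_phik k : ccs (phik phi0 k).
Proof.
split; first exact: smooth_prod xpredT k.
exists (3 / 2 * 2 ^+ kmax k) => xi i H; apply/eqP; apply/negPn/negP => /(phik_neq0 i) /(phij_supp aphi)[H' _].
move: H; rewrite ltNge (le_trans (ltW H'))// ler_wpM2l// ler_eXn2l ?ltr1n//; exact: kmax_ge.
Qed.

(** On the support of [phi_k] all coordinates are at most [2 ^ (kmax k).+1], and if [kmax k > 0] one
    of them exceeds [2 ^ (kmax k).-1]; so the neighbouring [psi_j] sum to 1 there. For [kmax k = 0]
    there is no lower neighbour. *)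
Lemma phik_split k xi : phik phi0 k xi =
  phik phi0 k xi * psij psi0 (kmax k) xi + phik phi0 k xi * psij psi0 (kmax k).+1 xi +
  (if kmax k is J.+1 then phik phi0 k xi * psij psi0 J xi else 0).
Proof.
have [->|H] := eqVneq (phik phi0 k xi) 0; first by rewrite !mul0r; case: (kmax k) => [|J]; rewrite ?mul0r !addr0.
have le i : `|xi 0 i| <= 3 / 2 * 2 ^+ kmax k.
  have [H' _] := phij_supp aphi (phik_neq0 i H); apply: le_trans (ltW H') _.
  rewrite ler_wpM2l// ler_eXn2l ?ltr1n//; exact: kmax_ge.
have one : psi0 (2 ^- (kmax k).+1 *: xi) = 1.
  apply: psi0_one => i; apply: le_trans (le i) _; rewrite exprS.
  by have : 0 < 2 ^+ kmax k :> R; [rewrite exprn_gt0|lra].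
have J0 : (0 < kmax k)%N -> exists i, k i = kmax k.
  move=> J0; have d0 : (0 < #|'I_d|)%N.
    rewrite card_ord; case: (posnP d) J0 => // d0; rewrite /kmax.
    by rewrite big1// => i _; move: (ltn_ord i); rewrite [X in (_ < X)%N]d0.
  by have [i Ei] := @bigop.eq_bigmax _ (fun i : 'I_d => k i) d0; exists i.
case E : (kmax k) J0 one => [|[|J]] J0 one.
- by rewrite addr0 -mulrDr psij0 /psij [X in _ * X]addrC subrK one mulr1.
- rewrite -!mulrDr (psij0 xi) /psij one; rewrite -[LHS]mulr1; congr (_ * _); ring.
- rewrite -!mulrDr /psij one.
  have [i Ei] := J0 isT.
  have := phij_supp aphi (phik_neq0 i H); rewrite Ei => -[_ /(_ isT) /= Hi].
  have -> : psi0 (2 ^- J *: xi) = 0.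
    apply: (@psi0_supp J _ i); apply: le_trans (ltW Hi); rewrite exprS ler_wpM2r ?exprn_ge0//; lra.
  rewrite -[LHS]mulr1; congr (_ * _); ring.
Qed.

Lemma absDelta_add f psi psi' x : ctempered f -> ccs psi -> ccs psi' ->
  absDelta (fun xi => psi xi + psi' xi) f x <= absDelta psi f x + absDelta psi' f x.
Proof.
move=> ft pc pc'; apply: absDelta_leP => //.
  by have := ccs_lin 1 pc pc'; congr ccs; apply/funext => xi; rewrite mul1r.
move=> w; rewrite WD//; apply: le_trans (ler_normD _ _) _.
by apply: lerD; exact: W_le.
Qed.

Lemma ccsD psi psi' : ccs psi -> ccs psi' -> ccs (fun xi => psi xi + psi' xi).
Proof.
by move=> pc pc'; have := ccs_lin 1 pc pc'; congr ccs; apply/funext => xi; rewrite mul1r.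
Qed.

Lemma Lp_absDelta_add (p : \bar R) f psi psi' : (0 < p)%E -> ctempered f -> ccs psi -> ccs psi' ->
  (Lpnorm p (absDelta (fun xi => psi xi + psi' xi)%R f) <=
   (quasi p)%:E * (Lpnorm p (absDelta psi f) + Lpnorm p (absDelta psi' f)))%E.
Proof.
move=> p0 ft pc pc'; apply: Lp_add => //.
- by apply: ct_absDelta => //; exact: ccsD.
- exact: ct_absDelta.
- exact: ct_absDelta.
- by move=> x; rewrite !ger0_norm ?absDelta_ge0//; exact: absDelta_add.
Qed.

Let phipsi k j : Rd -> R := fun xi => phik phi0 k xi * psij psi0 j xi.

Let ccs_phipsi k j : ccs (phipsi k j).
Proof. exact: (ccsM (smooth_prod xpredT k) (ccs_psij j)). Qed.

Lemma quasi_ge1 (p : \bar R) : (0 < p)%E -> 1 <= quasi p.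
Proof.
case: p => [r| |]//=; rewrite ?ler1n// lte_fin => r0.
have rV : 0 <= r^-1 by rewrite invr_ge0 ltW.
have := @ler_powR R 2 (ler1n _ 2) 0 _ rV; rewrite powRr0; lra.
Qed.

(** Among the at most three pieces of [phik_split] the largest is selected, so that a single [j]
    serves for every [q]. *)
Lemma piece (p : \bar R) : (0 < p)%E -> exists2 C : R, 0 <= C & forall f k, ctempered f ->
  exists j, [/\ (kmax k <= j.+1)%N, (j <= (kmax k).+1)%N &
   (Lpnorm p (absDelta (phik phi0 k) f) <= C%:E * Lpnorm p (absDelta (fun xi => phik phi0 k xi * psij psi0 j xi)%R f))%E].
Proof.
move=> p0; set K := quasi p; have K0 : 0 < K by exact: quasi_gt0.
exists (K * (2 * (K + 1))); first by rewrite !mulr_ge0 ?addr_ge0// ltW.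
move=> f k ft; pose N j := Lpnorm p (absDelta (phipsi k j) f).
have N0 j : (0 <= N j)%E by apply: Lpnorm_ge0; exact: ct_absDelta.
have add2 (x y : \bar R) : (0 <= x)%E -> (0 <= y)%E -> (x <= y)%E -> (x + y <= 2%:E * y)%E.
  move=> x0 y0 xy; have -> : (2%:E * y = y + y)%E by rewrite (_ : 2 = 1 + 1)// EFinD ge0_muleDl// !mul1e.
  by rewrite leeD2r.
have main J0 J1 J2 : (Lpnorm p (absDelta (phik phi0 k) f) <= K%:E * (N J0 + K%:E * (N J1 + N J2)))%E ->
    exists j, [/\ j \in [:: J0; J1; J2] & (Lpnorm p (absDelta (phik phi0 k) f) <= (K * (2 * (K + 1)))%:E * N j)%E].
  move=> H.
  have [j [jJ jm]] : exists j, j \in [:: J0; J1; J2] /\ forall i, i \in [:: J0; J1; J2] -> (N i <= N j)%E.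
    have [h01|/ltW h01] := leP (N J0) (N J1).
      have [h12|/ltW h12] := leP (N J1) (N J2).
        exists J2; split; first by rewrite !inE eqxx !orbT.
        move=> i; rewrite !inE => /or3P[] /eqP ->//; exact: le_trans h12.
      exists J1; split; first by rewrite !inE eqxx !orbT.
      by move=> i; rewrite !inE => /or3P[] /eqP ->.
    have [h02|/ltW h02] := leP (N J0) (N J2).
      exists J2; split; first by rewrite !inE eqxx !orbT.
      move=> i; rewrite !inE => /or3P[] /eqP ->//; exact: le_trans h02.
    exists J0; split; first by rewrite !inE eqxx.
    by move=> i; rewrite !inE => /or3P[] /eqP ->.
  exists j; split => //; apply: le_trans H _; rewrite EFinM -muleA.
  have KE : (0 <= K%:E)%E by rewrite lee_fin ltW.
  apply: lee_wpmul2l => //.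
  have h0 : (N J0 <= N j)%E by apply: jm; rewrite !inE eqxx.
  have h1 : (N J1 <= N j)%E by apply: jm; rewrite !inE eqxx orbT.
  have h2 : (N J2 <= N j)%E by apply: jm; rewrite !inE eqxx !orbT.
  apply: (@le_trans _ _ (2%:E * N j + K%:E * (2%:E * N j))%E).
    apply: leeD.
      apply: le_trans h0 _; have := add2 0%E (N j) (lexx _) (N0 j) (N0 j); rewrite add0e//.
    apply: lee_wpmul2l => //; apply: (@le_trans _ _ (N j + N j)%E); first exact: leeD.
    by apply: add2.
  rewrite !muleA -EFinM -ge0_muleDl ?lee_fin ?mulr_ge0 ?(ltW K0)// -EFinD.
  rewrite le_eqVlt; apply/orP; left; apply/eqP; congr (_%:E * _)%E; ring.
have A3 J0 J1 J2 : phik phi0 k = (fun xi => phipsi k J0 xi + (phipsi k J1 xi + phipsi k J2 xi)) ->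
    (Lpnorm p (absDelta (phik phi0 k) f) <= K%:E * (N J0 + K%:E * (N J1 + N J2)))%E.
  move=> ->; have KE : (0 <= K%:E)%E by rewrite lee_fin ltW.
  apply: le_trans (Lp_absDelta_add p0 ft (ccs_phipsi k J0) (ccsD (ccs_phipsi k J1) (ccs_phipsi k J2))) _.
  apply: lee_wpmul2l => //; apply: leeD2l; exact: Lp_absDelta_add.
case E : (kmax k) => [|J].
  have [j [jJ H]] : exists j, [/\ j \in [:: 0; 1; 1]%N &
      (Lpnorm p (absDelta (phik phi0 k) f) <= (K * (2 * (K + 1)))%:E * N j)%E].
    apply: main.
    have -> : phik phi0 k = (fun xi => phipsi k 0 xi + phipsi k 1 xi).
      by apply/funext => xi; rewrite {1}phik_split E addr0.
    have KE : (0 <= K%:E)%E by rewrite lee_fin ltW.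
    apply: le_trans (Lp_absDelta_add p0 ft (ccs_phipsi k 0) (ccs_phipsi k 1)) _.
    apply: lee_wpmul2l => //; apply: leeD2l.
    have K1 : (1%:E <= K%:E)%E by rewrite lee_fin; exact: quasi_ge1.
    have n11 : (N 1%N <= N 1%N + N 1%N)%E by rewrite leeDl.
    by apply: le_trans n11 _; rewrite -[leLHS]mul1e; apply: lee_wpmul2r => //; exact: adde_ge0.
  exists j; split => //; first by move: jJ; rewrite !inE => /or3P[] /eqP ->.
have E3 : phik phi0 k = (fun xi => phipsi k J.+1 xi + (phipsi k J.+2 xi + phipsi k J xi)).
  by apply/funext => xi; rewrite {1}phik_split E addrA.
have [j [jJ H]] := main J.+1 J.+2 J (A3 J.+1 J.+2 J E3).
by exists j; split => //; move: jJ; rewrite !inE => /or3P[] /eqP ->; rewrite ?ltnS;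
  do ?[exact: leqnn|exact: leqnSn|exact/leqW/leqnSn].
Qed.

Section assembly.
Variables (p : \bar R) (t : R) (f : tdist R d) (chi : Rd -> R) (j : nat).
Hypotheses (ft : ctempered f) (cc : ccs chi).
Hypothesis cl : forall xi l, 3 / 2 * 2 ^+ j < `|xi 0 l| -> chi xi = 0.

Let nrm psi := Lpnorm p (absDelta psi f).

Definition setk k l i : {ffun 'I_d -> nat} := [ffun x => if x == l then i else k x].

Fixpoint enumk (m : nat) (s : seq 'I_d) k : seq {ffun 'I_d -> nat} :=
  match s with
  | [::] => [:: k]
  | l :: s' => flatten [seq enumk m s' (setk k l i) | i <- iota 0 m]
  end.

Lemma enumk_mem m s k k' : (forall x, x \notin s -> k' x = k x) -> (forall x, x \in s -> (k' x < m)%N) ->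
  k' \in enumk m s k.
Proof.
elim: s k => [|l s IH] k H1 H2 /=.
  by rewrite inE; apply/eqP/ffunP => x; exact: H1.
apply/flattenP; exists (enumk m s (setk k l (k' l))).
  by apply/mapP; exists (k' l) => //; rewrite mem_iota/= add0n H2// mem_head.
apply: IH => x xs; last by apply: H2; rewrite inE xs orbT.
rewrite ffunE; case: eqP => [->//|/eqP xl]; apply: H1.
by rewrite inE negb_or xl.
Qed.

Lemma psym_setk l s k i : l \notin s ->
  psym (fun x => x \notin s) (setk k l i) chi =
  (fun xi => phij phi0 i (xi 0 l) * psym (fun x => x \notin l :: s) k chi xi).
Proof.
move=> ls; apply/funext => xi; rewrite /psym (bigD1 l)//= ffunE eqxx -mulrA; congr (_ * (_ * _)).
apply: eq_big => [x|x /andP[_ xl]]; first by rewrite inE negb_or andbC.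
by rewrite ffunE (negbTE xl).
Qed.

Lemma sum_setk l s k i : l \notin s ->
  (\sum_(x | x \notin s) setk k l i x = i + \sum_(x | x \notin l :: s) k x)%N.
Proof.
move=> ls; rewrite (bigD1 l)//= ffunE eqxx; congr (_ + _)%N.
apply: eq_big => [x|x /andP[_ xl]]; first by rewrite inE negb_or andbC.
by rewrite ffunE (negbTE xl).
Qed.

(** Each coordinate summed contributes a factor [C * 2 ^ (j t q)]; all [d] of them together build up
    the smoothness [t d] of the isotropic space. *)
Lemma enumk_sum (q C : R) s k : 0 <= C ->
  (forall f chi l j, ctempered f -> ccs chi -> (forall xi, 3 / 2 * 2 ^+ j < `|xi 0 l| -> chi xi = 0) ->
   (\sum_(k < j.+2) (2 `^ (k%:R * t * q))%:E * Lpnorm p (absDelta (fun xi => phij phi0 k (xi 0 l) * chi xi)%R f) `^ q <=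
    (C * 2 `^ (j%:R * t * q))%:E * Lpnorm p (absDelta chi f) `^ q)%E) ->
  uniq s ->
  (\sum_(k' <- enumk j.+2 s k) (2 `^ ((\sum_x k' x)%:R * t * q))%:E * nrm (psym xpredT k' chi) `^ q <=
   ((C * 2 `^ (j%:R * t * q)) ^+ size s)%:E *
   ((2 `^ ((\sum_(x | x \notin s) k x)%N%:R * t * q))%:E * nrm (psym (fun x => x \notin s) k chi) `^ q))%E.
Proof.
move=> C0 HC; set K := C * _; have K0 : 0 <= K by rewrite mulr_ge0 ?powR_ge0.
elim: s k => [|l s IH] k; first by move=> _; rewrite big_seq1 expr0 mul1e.
rewrite cons_uniq => /andP[ls us].
have -> : enumk j.+2 (l :: s) k = flatten [seq enumk j.+2 s (setk k l i) | i <- iota 0 j.+2] by [].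
rewrite big_flatten big_map -{1}(subn0 j.+2) -/(index_iota 0 j.+2) big_mkord.
apply: (@le_trans _ _ (\sum_(i < j.+2) (K ^+ size s * 2 `^ ((\sum_(x | x \notin l :: s) k x)%N%:R * t * q))%:E *
   ((2 `^ (i%:R * t * q))%:E * nrm (fun xi => phij phi0 i (xi 0 l) * psym (fun x => x \notin l :: s) k chi xi)%R `^ q))%E).
  apply: lee_sum => i _; apply: le_trans (IH _ us) _; rewrite psym_setk// sum_setk// !muleA -!EFinM.
  rewrite le_eqVlt; apply/orP; left; apply/eqP; congr (_%:E * _)%E.
  by rewrite natrD !mulrDl powRD ?pnatr_eq0 ?implybT//; ring.
rewrite -ge0_sume_distrr; last by move=> i _; rewrite mule_ge0 ?poweR_ge0// lee_fin powR_ge0.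
have cs : ccs (psym (fun x => x \notin l :: s) k chi) by exact: ccs_psym.
have sl xi : 3 / 2 * 2 ^+ j < `|xi 0 l| -> psym (fun x => x \notin l :: s) k chi xi = 0.
  by move=> /cl H; rewrite /psym H mulr0.
have w0 : (0 <= (K ^+ size s * 2 `^ ((\sum_(x | x \notin l :: s) k x)%N%:R * t * q))%:E)%E.
  by rewrite lee_fin mulr_ge0 ?exprn_ge0 ?powR_ge0.
apply: le_trans (lee_wpmul2l w0 (HC f _ l j ft cs sl)) _.
rewrite !muleA -!EFinM le_eqVlt; apply/orP; left; apply/eqP; congr (_%:E * _)%E.
by rewrite -/K exprS; ring.
Qed.

(** Counterpart for [q = +oo]: one multi-index is followed coordinate by coordinate, without
    summation. *)
Lemma enumk_sup (C : R) (s : seq 'I_d) k : 0 <= C ->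
  (forall f chi l j (k : nat), ctempered f -> ccs chi -> (forall xi, 3 / 2 * 2 ^+ j < `|xi 0 l| -> chi xi = 0) ->
   (k <= j.+1)%N -> ((2 `^ (k%:R * t))%:E * Lpnorm p (absDelta (fun xi => phij phi0 k (xi 0 l) * chi xi)%R f) <=
    (C * 2 `^ (j%:R * t))%:E * Lpnorm p (absDelta chi f))%E) ->
  (forall x, (k x <= j.+1)%N) -> uniq s ->
  ((2 `^ ((\sum_(x | x \in s) k x)%N%:R * t))%:E * nrm (psym (fun x => x \in s) k chi) <=
   ((C * 2 `^ (j%:R * t)) ^+ size s)%:E * nrm chi)%E.
Proof.
move=> C0 HC kj; set K := C * _; have K0 : 0 <= K by rewrite mulr_ge0 ?powR_ge0.
elim: s => [|l s IH].
  move=> _; rewrite big_pred0// mul0r powRr0 expr0 !mul1e.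
  by rewrite (_ : psym _ k chi = chi)//; apply/funext => xi; rewrite /psym big_pred0// mul1r.
move=> /= /andP[ls us].
have E1 : (\sum_(x | x \in l :: s) k x = k l + \sum_(x | x \in s) k x)%N.
  rewrite (bigD1 l) ?mem_head//=; congr (_ + _)%N; apply: eq_bigl => x.
  rewrite inE; case: eqP => [->|]/=; by rewrite ?andbF ?(negbTE ls) ?andbT.
have E2 : psym (fun x => x \in l :: s) k chi = (fun xi => phij phi0 (k l) (xi 0 l) * psym (fun x => x \in s) k chi xi).
  apply/funext => xi; rewrite /psym (bigD1 l) ?mem_head//= -mulrA; congr (_ * (_ * _)); apply: eq_bigl => x.
  rewrite inE; case: eqP => [->|]/=; by rewrite ?andbF ?(negbTE ls) ?andbT.
have cs : ccs (psym (fun x => x \in s) k chi) by exact: ccs_psym.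
have sl xi : 3 / 2 * 2 ^+ j < `|xi 0 l| -> psym (fun x => x \in s) k chi xi = 0.
  by move=> /cl H; rewrite /psym H mulr0.
rewrite E1 E2 natrD mulrDl powRD ?pnatr_eq0 ?implybT// [X in X%:E]mulrC EFinM -muleA.
have w0 : (0 <= (2 `^ ((\sum_(x | x \in s) k x)%N%:R * t))%:E)%E by rewrite lee_fin powR_ge0.
apply: le_trans (lee_wpmul2l w0 (HC f _ l j (k l) ft cs sl (kj l))) _.
rewrite -/K muleCA exprS (EFinM K) -muleA; apply: lee_wpmul2l; first by rewrite lee_fin.
exact: IH.
Qed.

End assembly.

Lemma esum_seq_le (T : choiceType) (a : T -> \bar R) (B : \bar R) :
  (forall s : seq T, uniq s -> (\sum_(x <- s) a x <= B)%E) -> (\esum_(x in [set: T]) a x <= B)%E.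
Proof.
move=> H; apply: ub_ereal_sup => _ [A [finA _] <-]; rewrite fsbig_finite//=.
by apply: H; exact: finmap.fset_uniq.
Qed.

Lemma sum_subset_le (T : eqType) (a : T -> \bar R) (s s' : seq T) : (forall x, 0 <= a x)%E ->
  uniq s -> {subset s <= s'} -> (\sum_(x <- s) a x <= \sum_(x <- s') a x)%E.
Proof.
move=> a0; elim: s s' => [|x s IH] s' us ss; first by rewrite big_nil; apply: sume_ge0.
have xs' : x \in s' by apply: ss; rewrite mem_head.
case/andP: us => xs us; rewrite big_cons (perm_big _ (perm_to_rem xs')) big_cons /=.
apply: leeD2l; apply: IH => // y ys.
have yx : y != x by apply: contraNneq xs => <-.
have : y \in s' by apply: ss; rewrite inE ys orbT.
by rewrite (perm_mem (perm_to_rem xs')) inE (negbTE yx).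
Qed.

Lemma besov_partial (p : \bar R) (q s : R) f n : 0 < q -> ctempered f ->
  (\sum_(j < n) (2 `^ (j%:R * s * q))%:E * Lpnorm p (absDelta (psij psi0 j) f) `^ q <=
   besov_norm psi0 s p q%:E f `^ q)%E.
Proof.
move=> q0 ft; rewrite /besov_norm /lqnorm.
have a0 j : (0 <= ((2 `^ (j%:R * s))%:E * Lpnorm p (absDelta (psij psi0 j) f)) `^ q)%E by exact: poweR_ge0.
rewrite poweRVK//; last by apply: esum_ge0.
rewrite -nneseries_esumT//; apply: le_trans (nneseries_lim_ge n _) => //.
rewrite big_mkord; apply: lee_sum => j _.
have w0 : (0 <= (2 `^ (j%:R * s))%:E)%E by rewrite lee_fin powR_ge0.
have N0 : (0 <= Lpnorm p (absDelta (psij psi0 j) f))%E.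
  by apply: Lpnorm_ge0; apply: ct_absDelta => //; exact: ccs_psij.
by rewrite (poweRM q w0 N0) poweR_EFin -powRrM.
Qed.

Lemma phipsi_psym k j : (fun xi => phik phi0 k xi * psij psi0 j xi) = psym xpredT k (psij psi0 j).
Proof. by []. Qed.

(** Every [k] is charged to one [j] with [kmax k <= j.+1]. After the sums are exchanged, all [k]
    charged to [j] lie in the box of side [j.+2] listed by [enumk]. *)
Lemma sufficiency_fin (p : \bar R) (q t : R) : (0 < p)%E -> 0 < q -> coord_bound (d := d) phi0 p q t ->
  embeds psi0 phi0 (t * d%:R) t p q%:E.
Proof.
move=> p0 q0 [C C0 HC]; have [C1 C10 H1] := piece p0.
exists ((C1 `^ q * C ^+ d) `^ q^-1) => f ft _.
have D0 : 0 <= C1 `^ q * C ^+ d by rewrite mulr_ge0 ?powR_ge0 ?exprn_ge0.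
pose b j k := ((2 `^ ((\sum_x k x)%:R * t * q))%:E * Lpnorm p (absDelta (psym xpredT k (psij psi0 j)) f) `^ q)%E.
have b0 j k : (0 <= b j k)%E by rewrite mule_ge0 ?poweR_ge0// lee_fin powR_ge0.
have cpj j xi l : 3 / 2 * 2 ^+ j < `|xi 0 l| -> psij psi0 j xi = 0 by move=> /ltW /psij_supp.
have B0 : (0 <= besov_norm psi0 (t * d%:R) p q%:E f)%E by exact: poweR_ge0.
rewrite /mixed_norm {1}/lqnorm.
apply: (@le_trans _ _ (((C1 `^ q * C ^+ d)%:E * besov_norm psi0 (t * d%:R) p q%:E f `^ q) `^ q^-1)%E); last first.
  by rewrite poweRM ?poweR_ge0// poweR_EFin poweRK.
apply: poweR_le; [by rewrite invr_ge0 ltW|by apply: esum_ge0 => k _; exact: poweR_ge0|].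
apply: esum_seq_le => s us.
(* Exceeds every [j] that [piece] can return, as [j <= (kmax k).+1]. *)
pose n := (\max_(k <- s) (kmax k).+2)%N.
have kn k : k \in s -> ((kmax k).+2 <= n)%N.
  by move=> ks; rewrite /n (big_rem k)//= leq_maxl.
have ak k : k \in s -> (((2 `^ ((\sum_(i < d) k i)%:R * t))%:E * Lpnorm p (absDelta (phik phi0 k) f)) `^ q <=
    (C1 `^ q)%:E * \sum_(j < n | (kmax k <= j.+1)%N) b j k)%E.
  move=> ks; have [j [kj jk H]] := H1 f k ft.
  have N0 : (0 <= Lpnorm p (absDelta (phik phi0 k) f))%E by apply: Lpnorm_ge0; apply: ct_absDelta => //; exact: ccs_phik.
  have N1 : (0 <= Lpnorm p (absDelta (psym xpredT k (psij psi0 j)) f))%E.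
    by apply: Lpnorm_ge0; apply: ct_absDelta => //; apply: ccs_psym; exact: ccs_psij.
  have w0 : (0 <= (2 `^ ((\sum_(i < d) k i)%:R * t))%:E)%E by rewrite lee_fin powR_ge0.
  rewrite poweRM// poweR_EFin -powRrM.
  have := poweR_le (ltW q0) N0 H; rewrite phipsi_psym (poweRM q _ N1) ?lee_fin// poweR_EFin => {}H.
  have w1 : (0 <= (2 `^ ((\sum_(i < d) k i)%:R * t * q))%:E)%E by rewrite lee_fin powR_ge0.
  apply: le_trans (lee_wpmul2l w1 H) _; rewrite muleCA; apply: lee_wpmul2l; first by rewrite lee_fin powR_ge0.
  have jn : (j < n)%N by apply: leq_trans (kn k ks); rewrite ltnS.
  rewrite (bigD1 (Ordinal jn))//= leeDl//; apply: sume_ge0 => i _; exact: b0.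
apply: (@le_trans _ _ ((C1 `^ q)%:E * \sum_(k <- s) \sum_(j < n | (kmax k <= j.+1)%N) b j k)%E).
  rewrite ge0_sume_distrr; last by move=> k _; apply: sume_ge0.
  by rewrite !big_seq; apply: lee_sum => k ks; exact: ak.
rewrite EFinM -muleA; apply: lee_wpmul2l; first by rewrite lee_fin powR_ge0.
apply: (@le_trans _ _ ((C ^+ d)%:E * \sum_(j < n) (2 `^ (j%:R * (t * d%:R) * q))%:E * Lpnorm p (absDelta (psij psi0 j) f) `^ q)%E); last first.
  by apply: lee_wpmul2l; [rewrite lee_fin exprn_ge0|exact: besov_partial].
rewrite ge0_sume_distrr; last by move=> j _; rewrite mule_ge0 ?poweR_ge0// lee_fin powR_ge0.
have -> : (\sum_(k <- s) \sum_(j < n | (kmax k <= j.+1)%N) b j k =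
   \sum_(j < n) \sum_(k <- s | (kmax k <= j.+1)%N) b j k)%E.
  by rewrite (exchange_big_dep xpredT).
apply: lee_sum => j _.
apply: (@le_trans _ _ (\sum_(k <- enumk j.+2 (enum 'I_d) [ffun=> 0%N]) b j k)%E).
  rewrite -big_filter; apply: sum_subset_le => //; first exact: filter_uniq.
  move=> k; rewrite mem_filter => /andP[kj _]; apply: enumk_mem => x.
    by rewrite mem_enum.
  by move=> _; rewrite ltnS (leq_trans (kmax_ge k x)).
have ES := enumk_sum ft (ccs_psij j) (cpj j) [ffun=> 0%N] C0 HC (enum_uniq 'I_d).
apply: le_trans ES _.
rewrite size_enum_ord big_pred0 ?mul0r ?powRr0 ?mul1e; last by move=> x; rewrite mem_enum.
rewrite (_ : psym _ _ _ = psij psi0 j); last first.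
  by apply/funext => xi; rewrite /psym big_pred0 ?mul1r// => x; rewrite mem_enum.
have e : (2 `^ (j%:R * t * q)) ^+ d = 2 `^ (j%:R * (t * d%:R) * q).
  by rewrite -powR_mulrn ?powR_ge0// -powRrM; congr (_ `^ _); ring.
by rewrite muleA -EFinM exprMn e.
Qed.

(** The limiting case [t = sigp p] is allowed because no geometric sum is taken:
    [2 ^ ((k - j) * (t - sigp p))] is bounded for [k <= j.+1]. *)
Lemma sufficiency_sup (p : \bar R) (t : R) : (0 < p)%E -> sigp p <= t -> embeds psi0 phi0 (t * d%:R) t p +oo.
Proof.
move=> p0 st; have [C0 C00 H0] := @multiplier_phi R d p phi0 p0 aphi.
have [C1 C10 H1] := piece p0.
pose C := C0 * 2 `^ (t - sigp p).
have CC : 0 <= C by rewrite mulr_ge0 ?powR_ge0.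
have HC : forall f chi l j (k : nat), ctempered f -> ccs chi -> (forall xi, 3 / 2 * 2 ^+ j < `|xi 0 l| -> chi xi = 0) ->
   (k <= j.+1)%N -> ((2 `^ (k%:R * t))%:E * Lpnorm p (absDelta (fun xi => phij phi0 k (xi 0 l) * chi xi)%R f) <=
    (C * 2 `^ (j%:R * t))%:E * Lpnorm p (absDelta chi f))%E.
  move=> f chi l j k ft cc cl kj.
  have w0 : (0 <= (2 `^ (k%:R * t))%:E)%E by rewrite lee_fin powR_ge0.
  apply: le_trans (lee_wpmul2l w0 (H0 f chi l j k ft cc cl kj)) _; rewrite muleA -EFinM.
  apply: lee_wpmul2r; first by apply: Lpnorm_ge0; exact: ct_absDelta.
  rewrite lee_fin mulrCA /C -mulrA ler_wpM2l// -!powRD ?pnatr_eq0 ?implybT//.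
  apply: ler_powR; first by rewrite ler1n.
  have : k%:R <= j%:R + 1 :> R by rewrite natr1 ler_nat.
  by nra.
exists (C1 * C ^+ d) => f ft _; rewrite /mixed_norm /besov_norm /lqnorm.
apply: ub_ereal_sup => _ [k _ <-].
have [j [kj jk H]] := H1 f k ft.
have w0 : (0 <= (2 `^ ((\sum_(i < d) k i)%:R * t))%:E)%E by rewrite lee_fin powR_ge0.
apply: le_trans (lee_wpmul2l w0 H) _; rewrite phipsi_psym muleCA EFinM -muleA.
apply: lee_wpmul2l; first by rewrite lee_fin.
have cpj xi l : 3 / 2 * 2 ^+ j < `|xi 0 l| -> psij psi0 j xi = 0 by move=> /ltW /psij_supp.
have kx x : (k x <= j.+1)%N by exact: leq_trans (kmax_ge k x) kj.
have := enumk_sup ft (ccs_psij j) cpj CC HC kx (enum_uniq 'I_d).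
rewrite size_enum_ord.
have -> : (\sum_(x | x \in enum 'I_d) k x = \sum_(i < d) k i)%N.
  by apply: eq_bigl => x; rewrite mem_enum.
have -> : psym (fun x => x \in enum 'I_d) k (psij psi0 j) = psym xpredT k (psij psi0 j).
  by apply/funext => xi; rewrite /psym; congr (_ * _); apply: eq_bigl => x; rewrite mem_enum.
move=> /le_trans; apply.
rewrite exprMn EFinM -muleA; apply: lee_wpmul2l; first by rewrite lee_fin exprn_ge0.
rewrite -powR_mulrn ?powR_ge0// -powRrM -mulrA.
by apply: ereal_sup_ubound; exists j.
Qed.

End symbols.

(** * Test distributions *)

Section generalized_limit.
Context {R : realType}.
Implicit Types (u v : nat -> R).

(** The limit is the supremum of those [x] that lie below [u n] for [U]-almost all [n]; an
    ultrafilter decides each such condition. *)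
Lemma ultra_cvg (U : set_system nat) u (M : R) : UltraFilter U -> (forall n, `|u n| <= M) ->
  exists l : R, u @ U --> l.
Proof.
move=> UU uM; have PU : ProperFilter U by exact: ultra_proper.
pose E := [set x : R | U [set n | x <= u n]].
have uM1 n : - M <= u n by have := uM n; rewrite ler_norml => /andP[].
have uM2 n : u n <= M by have := uM n; rewrite ler_norml => /andP[].
have hE : has_sup E.
  split.
    exists (- M); rewrite /E/=; apply: filterS (@filterT _ U _) => n _; exact: uM1.
  exists M => x /= /filter_ex[n /= xn]; exact: le_trans xn (uM2 n).
exists (sup E); apply/cvgrPdist_le => e e0.
have [x Ex xe] := sup_adherent e0 hE.
have nE : ~ E (sup E + e).
  by move=> Es; have := ub_le_sup hE.2 Es; rewrite gerDl leNgt e0.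
have [//|H] := in_ultra_setVsetC [set n | sup E + e <= u n] UU.
apply: filterS (filterI Ex H) => n /= [xn /negP]; rewrite -ltNge => ne.
rewrite ler_norml; apply/andP; split; lra.
Qed.

(** The limit along an ultrafilter that contains all cofinite sets; linearity is claimed for bounded
    sequences only. *)
Lemma generalized_limit : exists L : (nat -> R) -> R,
  [/\ forall (a : R) u v (M : R), (forall n, `|u n| <= M) -> (forall n, `|v n| <= M) ->
        L (fun n => a * u n + v n) = a * L u + L v,
      forall u (M : R), (forall n, `|u n| <= M) -> `|L u| <= M &
      forall u (l : R), u @ \oo --> l -> L u = l].
Proof.
have [U [UU FU]] := ultraFilterLemma eventually_filter.
have PU : ProperFilter U by exact: ultra_proper.
exists (fun u => lim (u @ U)); split.
- move=> a u v M uM vM.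
  have [lu cu] := ultra_cvg UU uM; have [lv cv] := ultra_cvg UU vM.
  have cl : (fun n => a * u n + v n) @ U --> a * lu + lv.
    by apply: cvgD => //; apply: cvgM => //; exact: cvg_cst.
  by rewrite (cvg_lim _ cu)// (cvg_lim _ cv)// (cvg_lim _ cl).
- move=> u M uM; have [lu cu] := ultra_cvg UU uM; rewrite (cvg_lim _ cu)//.
  have cn : `|u n| @[n --> U] --> `|lu| by exact: cvg_norm.
  rewrite -(cvg_lim _ cn)//; apply: limr_le; first by apply/cvg_ex; exists `|lu|.
  by apply: filterS (@filterT _ U _) => n _.
- move=> u l ul; apply: cvg_lim => //.
  by apply: cvg_trans ul => A /=; exact: FU.
Qed.

End generalized_limit.

(** * Distributions with prescribed Fourier transform *)

Section test_distributions.
Context {R : realType} {d : nat}.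
Notation Rd := 'rV[R]_d.
Implicit Types (psi chi g : Rd -> R) (l i : 'I_d) (x y z xi a : Rd) (w b : R) (f : tdist R d).

Definition seminorm N g (M : R) : Prop := forall (s : seq 'I_d) x, (size s <= N)%N -> (1 + `|x|) ^+ N * `|pder s g x| <= M.

Lemma schwartz_seminorm N g : schwartz g -> exists2 M, 0 <= M & seminorm N g M.
Proof.
move=> [_ gs]; have [M M0 HM] : exists2 M, 0 <= M & forall s, (size s <= N)%N ->
    forall x, (1 + `|x|) ^+ N * `|pder s g x| <= M.
  apply: (seq_unif (P := fun s M => forall x, (1 + `|x|) ^+ N * `|pder s g x| <= M)).
    by move=> s M M' MM H x; exact: le_trans (H x) MM.
  move=> s; have [M HM] := gs s N; exists M => //; apply: le_trans (HM 0).
  by rewrite mulr_ge0// exprn_ge0// addr_ge0.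
by exists M => // s x sN; exact: HM.
Qed.

Lemma seminorm_le N N' g M : (N <= N')%N -> seminorm N' g M -> seminorm N g M.
Proof.
move=> NN H s x sN; apply: le_trans (H s x (leq_trans sN NN)).
by rewrite ler_wpM2r// ler_weXn2l// lerDl.
Qed.

Lemma ctempered_bound f : ctempered f -> exists (C : R) (N : nat), 0 <= C /\
  forall g M, schwartz g -> 0 <= M -> seminorm N g M -> `|f.1 g| <= C * M /\ `|f.2 g| <= C * M.
Proof.
move=> [[_ [C1 [N1 H1]]] [_ [C2 [N2 H2]]]].
exists (`|C1| + `|C2|), (maxn N1 N2); split; first by rewrite addr_ge0.
move=> g M gs M0 sM; split.
  apply: le_trans (H1 g M gs (seminorm_le (leq_maxl _ _) sM)) _.
  by rewrite ler_wpM2r// (le_trans (ler_norm _))// lerDl.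
apply: le_trans (H2 g M gs (seminorm_le (leq_maxr _ _) sM)) _.
by rewrite ler_wpM2r// (le_trans (ler_norm _))// lerDr.
Qed.

Definition shiftf a g : Rd -> R := fun y => g (y - a).

Lemma shiftfE a g : shiftf a g = (fun y => g (1 *: y + (- a))).
Proof. by apply/funext => y; rewrite scale1r. Qed.

Lemma smooth_shiftf a g : smooth g -> smooth (shiftf a g).
Proof. by move=> gs; rewrite shiftfE; exact: smooth_affine. Qed.

Lemma pder_shiftf s a g : smooth g -> pder s (shiftf a g) = shiftf a (pder s g).
Proof.
move=> gs; elim: s => [//|i s IH] /=; rewrite IH; apply/funext => y.
have ds x : differentiable (pder s g) x by exact: gs.
have := D_affine i 1 (- a) y ds; rewrite mul1r -shiftfE /D => ->.
by rewrite /shiftf scale1r.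
Qed.

Lemma seminorm_shiftf N a g M : smooth g -> seminorm N g M -> seminorm N (shiftf a g) ((1 + `|a|) ^+ N * M).
Proof.
move=> gs sM s y sN; rewrite pder_shiftf// /shiftf.
have yy : (1 + `|y|) ^+ N <= (1 + `|a|) ^+ N * (1 + `|y - a|) ^+ N.
  have := norm_shift_le N a y; have -> // : `|a - y| = `|y - a| by rewrite distrC.
apply: le_trans (ler_wpM2r (normr_ge0 _) yy) _; rewrite -mulrA ler_wpM2l ?exprn_ge0 ?addr_ge0//.
exact: sM.
Qed.

Lemma schwartz_shiftf a g : schwartz g -> schwartz (shiftf a g).
Proof.
move=> gS; have [gs _] := gS; split; first exact: smooth_shiftf.
move=> s N.
have [M M0 sM] := schwartz_seminorm (maxn N (size s)) gS.
exists ((1 + `|a|) ^+ (maxn N (size s)) * M) => x.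
apply: le_trans (seminorm_shiftf a gs sM x (leq_maxr _ _)).
by rewrite ler_wpM2r// ler_weXn2l ?lerDl// leq_maxl.
Qed.

(** The distribution multiplied by [e^{ib}] and translated so that its piece at [x] is the turned
    piece of [f] at [x + a]. *)
Definition rotsh a b f : tdist R d :=
  (fun g => cos b * f.1 (shiftf a g) - sin b * f.2 (shiftf a g),
   fun g => sin b * f.1 (shiftf a g) + cos b * f.2 (shiftf a g)).

Lemma Kf_shiftf psi x a w : shiftf a (Kf psi x w) = Kf psi (x + a) w.
Proof. by apply/funext => y; rewrite /shiftf /Kf opprB addrA [x + a - y]addrAC addrAC. Qed.

Lemma W_rotsh a b f psi x w : ctempered f -> ccs psi -> W (rotsh a b f) psi x w = W f psi (x + a) (w + b).
Proof.
move=> [t1 t2] pc; rewrite /W /rotsh/= !Kf_shiftf.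
rewrite (tempered_phase _ w t1 pc) (tempered_phase _ w t2 pc).
rewrite (tempered_phase _ (w - pi / 2) t1 pc) (tempered_phase _ (w - pi / 2) t2 pc).
rewrite (tempered_phase _ (w + b) t1 pc) (tempered_phase _ (w + b - pi / 2) t2 pc).
rewrite !(cosB _ (pi / 2)) !(sinB _ (pi / 2)) cos_pihalf sin_pihalf cosD sinD.
ring.
Qed.

Lemma shiftf_lin a (c : R) g h : shiftf a (fun x => c * g x + h x) = (fun x => c * shiftf a g x + shiftf a h x).
Proof. by []. Qed.

Section multiply.
Variables (f : tdist R d) (l : 'I_d) (m : R -> R) (c : R).
Hypotheses (ft : ctempered f) (mc : cs1 m) (c0 : 0 < c).

Let s n : R := 2 ^- n.+1.
Let s0 n : 0 < s n. Proof. by rewrite invr_gt0 exprn_gt0. Qed.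
Let s2 n : s n <= 1 / 2.
Proof.
by rewrite mul1r /s lef_pV2 ?posrE ?exprn_gt0// exprS ler_peMr// exprn_ege1// ler1n.
Qed.
Let lam n : R := c / s n.
Let lam0 n : 0 < lam n. Proof. by rewrite divr_gt0. Qed.

(* The cosine expansion of [m] converges only on a period growing with [n]; taking a
   generalized limit first in the length of the series and then in [n] gives a functional
   defined on all Schwartz functions. *)
Lemma multiply_dist : exists f' : tdist R d, ctempered f' /\
  forall psi x w, ccs psi -> W f' psi x w = W f (fun xi => m (c^-1 * xi 0 l) * psi xi) x w.
Proof.
have [L [Ll Lb Lc]] := @generalized_limit R.
have ab n : exists ab : (nat -> R) * (nat -> R),
  (forall N B, 0 <= B -> dec N B m -> forall k, `|ab.1 k| <= B * (s n / (1 + s n * k%:R) ^+ N)) /\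
  (forall t, `|t| <= pi -> series (fun k => ab.1 k * cos (k%:R * t + ab.2 k)) @ \oo --> m ((s n)^-1 * t)).
  by have [a [b H]] := fourier_expansion mc (s0 n) (s2 n); exists (a, b).
have [AB HAB] := choice ab.
pose sh n k := (k%:R / lam n) *: evec R l.
(* Half the sum of two rotated translates: multiplication of the Fourier transform by one cosine of
   the expansion. *)
pose D n k : tdist R d :=
  (fun g => ((rotsh (sh n k) ((AB n).2 k) f).1 g + (rotsh (- sh n k) (- (AB n).2 k) f).1 g) / 2,
   fun g => ((rotsh (sh n k) ((AB n).2 k) f).2 g + (rotsh (- sh n k) (- (AB n).2 k) f).2 g) / 2).
pose Fs (i : bool) n K g : R := \sum_(k < K) (AB n).1 k * (if i then (D n k).1 g else (D n k).2 g).
pose f' : tdist R d := (fun g => L (fun n => L (fun K => Fs true n K g)), fun g => L (fun n => L (fun K => Fs false n K g))).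
have [C [N [C0 HC]]] := ctempered_bound ft.
(* [N] powers pay for the translations, [N] being the order of [f]; the other two make the sum over
   [k] converge uniformly in [n]. *)
have [B B0 HB] := cs1_dec (N + 2) mc.
pose Q := B * (1 + c^-1) ^+ N * 2.
have cV : 0 < c^-1 by rewrite invr_gt0.
have Q0 : 0 <= Q by rewrite !mulr_ge0 ?exprn_ge0 ?addr_ge0// ltW.
have shn n k : (1 + `|sh n k|) ^+ N <= (1 + c^-1) ^+ N * (1 + s n * k%:R) ^+ N.
  rewrite -exprMn lerXn2r ?nnegrE ?mulr_ge0 ?addr_ge0 ?mulr_ge0 ?(ltW cV) ?(ltW (s0 n))//.
  have q : 0 <= k%:R / lam n by rewrite divr_ge0// ltW.
  have : `|sh n k| <= k%:R / lam n by apply: le_trans (norm_evec_le _ _) _; rewrite ger0_norm.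
  have -> : k%:R / lam n = c^-1 * (s n * k%:R).
    by rewrite /lam; field; rewrite (lt0r_neq0 c0) (lt0r_neq0 (s0 n)).
  have : 0 <= s n * k%:R by rewrite mulr_ge0// ltW.
  by move: (c^-1) cV (s n * k%:R) => u u0 v v0; nra.
have bD (i : bool) n k g M : schwartz g -> 0 <= M -> seminorm N g M ->
    `|if i then (D n k).1 g else (D n k).2 g| <= (1 + `|sh n k|) ^+ N * (2 * C * M).
  move=> gS M0 sM; have [gs _] := gS.
  have M0' : 0 <= (1 + `|sh n k|) ^+ N * M by rewrite mulr_ge0// exprn_ge0// addr_ge0.
  have [h1 h2] := HC _ _ (schwartz_shiftf (sh n k) gS) M0' (seminorm_shiftf (sh n k) gs sM).
  have sM' := seminorm_shiftf (- sh n k) gs sM; rewrite normrN in sM'.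
  have [h3 h4] := HC _ _ (schwartz_shiftf (- sh n k) gS) M0' sM'.
  have T (p q u v X : R) : `|p| <= 1 -> `|q| <= 1 -> `|u| <= X -> `|v| <= X -> `|p * u + q * v| <= 2 * X.
    move=> p1 q1 uX vX; apply: le_trans (ler_normD _ _) _; rewrite !normrM.
    have := ler_pM (normr_ge0 p) (normr_ge0 u) p1 uX; have := ler_pM (normr_ge0 q) (normr_ge0 v) q1 vX.
    by rewrite !mul1r; lra.
  have T2 (u v X : R) : `|u| <= 2 * X -> `|v| <= 2 * X -> `|(u + v) / 2| <= 2 * X.
    move=> uX vX; rewrite normrM (@ger0_norm _ 2^-1)// ler_pdivrMr//.
    by apply: le_trans (ler_normD _ _) _; lra.
  have -> : (1 + `|sh n k|) ^+ N * (2 * C * M) = 2 * (C * ((1 + `|sh n k|) ^+ N * M)) by ring.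
  have ns (x : R) : `|- sin x| <= 1 by rewrite normrN sin_max.
  by case: i; apply: T2; rewrite /= -?mulNr; apply: T => //; rewrite ?cos_max ?sin_max ?ns.
have sumA n K : \sum_(k < K) `|(AB n).1 k| * (1 + `|sh n k|) ^+ N <= Q.
  apply: (@le_trans _ _ (\sum_(k < K) B * (1 + c^-1) ^+ N * (s n / (1 + s n * k%:R) ^+ 2))).
    apply: ler_sum => k _; have q : 0 < 1 + s n * k%:R by rewrite ltr_pwDl// mulr_ge0// ltW.
    apply: le_trans (ler_pM _ _ ((HAB n).1 _ _ B0 HB k) (shn n k)) _; rewrite ?exprn_ge0 ?addr_ge0//.
    rewrite exprD le_eqVlt; apply/orP; left; apply/eqP.
    have uN : (1 + s n * k%:R) ^+ N != 0 by rewrite expf_neq0// gt_eqF.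
    have vN : (1 + s n * k%:R) ^+ 2 != 0 by rewrite expf_neq0// gt_eqF.
    move: uN vN; set u := _ ^+ N; set v := _ ^+ 2 => uN vN.
    by field; rewrite uN vN.
  rewrite -mulr_sumr /Q ler_wpM2l ?mulr_ge0 ?exprn_ge0 ?addr_ge0 ?(ltW cV)//.
  by apply: le_trans (sum_decay K (s0 n)) _; exact: half_succ.
have bF (i : bool) n K g M : schwartz g -> 0 <= M -> seminorm N g M -> `|Fs i n K g| <= Q * (2 * C * M).
  move=> gS M0 sM; apply: le_trans (ler_norm_sum _ _ _) _.
  have X0 : 0 <= 2 * C * M by rewrite !mulr_ge0.
  apply: le_trans (ler_wpM2r X0 (sumA n K)); rewrite mulr_suml; apply: ler_sum => k _.
  by rewrite normrM -[leRHS]mulrA; apply: ler_wpM2l => //; exact: bD.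
have lD (i : bool) n k (e : R) g h : schwartz g -> schwartz h ->
   (if i then (D n k).1 (fun x => e * g x + h x) else (D n k).2 (fun x => e * g x + h x)) =
   e * (if i then (D n k).1 g else (D n k).2 g) + (if i then (D n k).1 h else (D n k).2 h).
  move=> gS hS; have [[l1 _] [l2 _]] := ft.
  by case: i; rewrite /= !shiftf_lin !l1 ?l2; try exact: schwartz_shiftf; field.
have lF (i : bool) n K (e : R) g h : schwartz g -> schwartz h ->
   Fs i n K (fun x => e * g x + h x) = e * Fs i n K g + Fs i n K h.
  move=> gS hS; rewrite /Fs mulr_sumr -big_split; apply: eq_bigr => k _.
  rewrite (lD i n k e g h gS hS).
  by move: (if i then (D n k).1 g else _) (if i then (D n k).1 h else _) => X Y /=; ring.
have bL (i : bool) n g M : schwartz g -> 0 <= M -> seminorm N g M -> `|L (fun K => Fs i n K g)| <= Q * (2 * C * M).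
  by move=> gS M0 sM; apply: Lb => K; exact: bF.
have lL (i : bool) (e : R) g h : schwartz g -> schwartz h ->
   L (fun n => L (fun K => Fs i n K (fun x => e * g x + h x))) =
   e * L (fun n => L (fun K => Fs i n K g)) + L (fun n => L (fun K => Fs i n K h)).
  move=> gS hS; have [Mg Mg0 sg] := schwartz_seminorm N gS; have [Mh Mh0 sh'] := schwartz_seminorm N hS.
  pose M := Mg + Mh.
  have sg' : seminorm N g M by move=> s' x sN; apply: le_trans (sg s' x sN) _; rewrite lerDl.
  have sh'' : seminorm N h M by move=> s' x sN; apply: le_trans (sh' s' x sN) _; rewrite lerDr.
  have M0 : 0 <= M by rewrite addr_ge0.
  rewrite -(Ll e _ _ (Q * (2 * C * M))); last 2 first.
  - by move=> n; exact: bL.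
  - by move=> n; exact: bL.
  congr L; apply/funext => n; rewrite -(Ll e _ _ (Q * (2 * C * M))); last 2 first.
  - by move=> K; exact: bF.
  - by move=> K; exact: bF.
  by congr L; apply/funext => K; exact: lF.
have tL (i : bool) : tempered (fun g => L (fun n => L (fun K => Fs i n K g))).
  split; first by move=> e g h gS hS; exact: lL.
  exists (Q * (2 * C)), N => g M gS sM.
  have M0 : 0 <= M by apply: le_trans (sM [::] 0 isT); rewrite mulr_ge0// exprn_ge0// addr_ge0.
  by rewrite -mulrA; apply: Lb => n; exact: bL.
exists f'; split; first by split; exact: tL.
move=> psi x w pc.
have Kg := schwartz_Kf x w pc; have Kg' := schwartz_Kf x (w - pi / 2) pc.
have [Mg Mg0 sg] := schwartz_seminorm N Kg; have [Mh Mh0 sh'] := schwartz_seminorm N Kg'.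
pose M := Mg + Mh.
have sg' : seminorm N (Kf psi x w) M by move=> s' y sN; apply: le_trans (sg s' y sN) _; rewrite lerDl.
have sh'' : seminorm N (Kf psi x (w - pi / 2)) M by move=> s' y sN; apply: le_trans (sh' s' y sN) _; rewrite lerDr.
have M0 : 0 <= M by rewrite addr_ge0.
have -> : W f' psi x w = -1 * L (fun n => L (fun K => Fs false n K (Kf psi x (w - pi / 2)))) +
    L (fun n => L (fun K => Fs true n K (Kf psi x w))) by rewrite /W /f'/=; ring.
rewrite -(Ll (-1) _ _ (Q * (2 * C * M))); last 2 first.
- by move=> n; exact: bL.
- by move=> n; exact: bL.
apply: (Lc).
have [_ [A HA]] := pc.
(* Once the period exceeds the support of [psi], the expansion is exact on it and the inner limit no
   longer depends on [n]. *)
have : \forall n \near \oo, -1 * L (fun K => Fs false n K (Kf psi x (w - pi / 2))) + L (fun K => Fs true n K (Kf psi x w)) =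
   W f (fun xi => m (c^-1 * xi 0 l) * psi xi) x w.
  have [n0 Hn0] : exists n0 : nat, A <= n0%:R * c.
    exists (Num.truncn (`|A| / c)).+1; rewrite -ler_pdivrMr//.
    apply: le_trans (ltW (truncnS_gt _)); rewrite ler_wpM2r ?(ltW cV)//; exact: ler_norm.
  exists n0 => // n /= nn.
  rewrite -(Ll (-1) _ _ (Q * (2 * C * M))); last 2 first.
  - by move=> K; exact: bF.
  - by move=> K; exact: bF.
  apply: (Lc).
  have sl : s n * lam n = c by rewrite /lam mulrC divfK// gt_eqF.
  have supp xi : pi * lam n < `|xi 0 l| -> psi xi = 0.
    move=> H; apply: (HA xi l); apply: le_lt_trans H; apply: le_trans Hn0 _.
    rewrite /lam /s invrK mulrCA mulrC ler_wpM2l ?(ltW c0)//.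
    have n2 : n0%:R <= 2 ^+ n.+1 :> R.
      apply: (@le_trans _ _ n.+1%:R); first by rewrite ler_nat leqW.
      by rewrite -natrX ler_nat ltnW// ltn_expl.
    apply: le_trans n2 _; rewrite ler_peMl ?exprn_ge0//; apply: le_trans (pi_ge2 R); by rewrite ler1n.
  have := @multiplier_series R d f psi l m (s n) (lam n) ft pc mc (s0 n) (lam0 n) supp (AB n).1 (AB n).2 (HAB n).1 (HAB n).2 x w.
  rewrite sl.
  suff -> : (fun K => -1 * Fs false n K (Kf psi x (w - pi / 2)) + Fs true n K (Kf psi x w)) =
    series (fun k => (AB n).1 k * ((W f psi (x + (k%:R / lam n) *: evec R l) (w + (AB n).2 k) +
       W f psi (x - (k%:R / lam n) *: evec R l) (w - (AB n).2 k)) / 2)) by [].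
  apply/funext => K; rewrite /series/= big_mkord /Fs mulr_sumr -big_split/=; apply: eq_bigr => k _.
  rewrite -/(sh n k) -(W_rotsh _ _ _ _ ft pc) -(W_rotsh _ _ _ _ ft pc) /W /D/=.
  by ring.
move=> H; apply: cvg_near_cst; apply: filterS H => n ->.
by [].
Qed.

End multiply.

(** Its Fourier transform has constant modulus, so its pieces are translated kernels. *)
Definition dirac_dist a : tdist R d := (fun g => g a, fun=> 0).

Lemma ctempered_dirac a : ctempered (dirac_dist a).
Proof.
split; split=> //=.
- exists 1, 0%N => g M _ H; rewrite mul1r; have := H [::] a isT.
  by rewrite expr0 mul1r.
- by move=> e g h _ _; rewrite mulr0 addr0.
- exists 0, 0%N => g M _ _; by rewrite normr0 mul0r.
Qed.

Lemma W_dirac a psi x w : W (dirac_dist a) psi x w = (2 * pi) ^- d * J psi (x - a) w.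
Proof. by rewrite /W /= subr0. Qed.

Definition cpt1 (h : R -> R) := sm1 h /\ exists A : R, forall x : R, A < `|x| -> h x = 0.

(** [multiply_dist] is applied once per coordinate, starting from a Dirac mass at [a]. *)
Lemma tensor_dist (h : 'I_d -> R -> R) a : (forall i, cpt1 (h i)) ->
  exists f : tdist R d, ctempered f /\ forall psi x w, ccs psi ->
    W f psi x w = (2 * pi) ^- d * J (fun xi => (\prod_i h i (xi 0 i)) * psi xi) (x - a) w.
Proof.
move=> hc; rewrite /index_enum -enumT.
suff : forall s : seq 'I_d, exists f : tdist R d, ctempered f /\ forall psi x w, ccs psi ->
    W f psi x w = (2 * pi) ^- d * J (fun xi => (\prod_(i <- s) h i (xi 0 i)) * psi xi) (x - a) w by exact.
elim=> [|l s [f [ft Hf]]].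
  exists (dirac_dist a); split; first exact: ctempered_dirac.
  move=> psi x w pc; rewrite W_dirac; congr (_ * _); apply: J_ext => xi.
  by rewrite big_nil mul1r.
have [hs [A HA]] := hc l.
(* Rescales the support of [h l] into [[-3, 3]], as [cs1] demands. *)
pose c := `|A| / 3 + 1.
have c0 : 0 < c by rewrite ltr_wpDl// divr_ge0.
pose m (y : R) := h l (c * y).
have mc : cs1 m.
  split; first exact: (@sm1_scale R _ c hs).
  move=> y y3; apply: HA; apply: le_lt_trans (ler_norm A) _.
  rewrite normrM (gtr0_norm c0) /c; have := normr_ge0 A; nra.
have [f' [ft' Hf']] := multiply_dist l ft mc c0.
exists f'; split => // psi x w pc; rewrite Hf'// Hf; last first.
  exact: (@ccs_coord R d (fun u : R => m (c^-1 * u)) l psi (@sm1_scale R m c^-1 mc.1) pc).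
congr (_ * _); apply: J_ext => xi; rewrite big_cons /m (mulVKf (lt0r_neq0 c0)); ring.
Qed.

Definition lin_dist (e : R) (f f' : tdist R d) : tdist R d :=
  (fun g => e * f.1 g + f'.1 g, fun g => e * f.2 g + f'.2 g).

Lemma tempered_lin (e : R) (u v : (Rd -> R) -> R) : tempered u -> tempered v ->
  tempered (fun g => e * u g + v g).
Proof.
move=> [ul [Cu [Nu Hu]]] [vl [Cv [Nv Hv]]]; split.
  by move=> a g h gS hS; rewrite ul// vl//; ring.
exists (`|e| * `|Cu| + `|Cv|), (maxn Nu Nv) => g M gS sM.
have M0 : 0 <= M by apply: le_trans (sM [::] 0 isT); rewrite mulr_ge0// exprn_ge0// addr_ge0.
apply: le_trans (ler_normD _ _) _; rewrite mulrDl; apply: lerD.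
  rewrite normrM -mulrA ler_wpM2l//.
  apply: le_trans (Hu g M gS (seminorm_le (leq_maxl _ _) sM)) _.
  by rewrite ler_wpM2r// ler_norm.
apply: le_trans (Hv g M gS (seminorm_le (leq_maxr _ _) sM)) _.
by rewrite ler_wpM2r// ler_norm.
Qed.

Lemma ctempered_lin (e : R) f f' : ctempered f -> ctempered f' -> ctempered (lin_dist e f f').
Proof. by move=> [f1 f2] [f1' f2']; split; exact: tempered_lin. Qed.

Lemma W_lin_dist (e : R) f f' psi x w : W (lin_dist e f f') psi x w = e * W f psi x w + W f' psi x w.
Proof. by rewrite /W /lin_dist/=; ring. Qed.

End test_distributions.

(** * Norms of kernels of tensor products *)

Section kernel_norms.
Context {R : realType} {d : nat}.
Notation Rd := 'rV[R]_d.
Implicit Types (psi chi g : Rd -> R) (l i : 'I_d) (x y z xi a : Rd) (w : R) (f : tdist R d) (p : \bar R).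

Lemma smooth_ct g : smooth g -> ct g.
Proof.
move=> gs v v0 vv; apply: (@continuous_cvg _ _ _ \oo _ (fun m => rowv (v m)) g (rowv v0)).
  apply: differentiable_continuous; exact: smooth_diff.
apply/cvgrPdist_le => e e0; exact: rowv_cvg.
Qed.

(** Modulus of the kernel [F^-1 chi]. *)
Definition absJ chi x : R := (2 * pi) ^- d * Num.sqrt (J chi x 0 ^+ 2 + J chi x (- (pi / 2)) ^+ 2).

Lemma absJ_ge0 chi x : 0 <= absJ chi x.
Proof. by rewrite mulr_ge0 ?sqrtr_ge0// ltW// pi2_gt0. Qed.

Lemma absJ_sqr chi x : absJ chi x ^+ 2 =
  ((2 * pi) ^- d * J chi x 0) ^+ 2 + ((2 * pi) ^- d * J chi x (- (pi / 2))) ^+ 2.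
Proof. by rewrite /absJ !exprMn sqr_sqrtr ?addr_ge0 ?sqr_ge0// mulrDr. Qed.

Lemma absDelta_absJ f psi chi x a (e : R) : ctempered f -> ccs psi ->
  (forall w, W f psi x w = e * ((2 * pi) ^- d * J chi (x - a) w)) -> absDelta psi f x = `|e| * absJ chi (x - a).
Proof.
move=> ft pc H; rewrite absDeltaE// !H.
have A0 : 0 <= `|e| * absJ chi (x - a) by exact: mulr_ge0 (normr_ge0 _) (absJ_ge0 _ _).
apply/eqP; rewrite -(@eqrXn2 _ 2) ?sqrtr_ge0// sqr_sqrtr ?addr_ge0 ?sqr_ge0//.
have -> : (`|e| * absJ chi (x - a)) ^+ 2 = e ^+ 2 * absJ chi (x - a) ^+ 2 by rewrite exprMn real_normK ?num_real.
rewrite absJ_sqr; apply/eqP; ring.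
Qed.

Lemma absJ_absDelta chi : ccs chi -> absJ chi = absDelta chi (dirac_dist 0).
Proof.
move=> cc; apply/funext => x.
rewrite (@absDelta_absJ _ _ chi _ 0 1) ?normr1 ?mul1r ?subr0//; first exact: ctempered_dirac.
by move=> w; rewrite W_dirac mul1r subr0.
Qed.

Lemma ct_absJ chi : ccs chi -> ct (absJ chi).
Proof. by move=> cc; rewrite absJ_absDelta//; apply: ct_absDelta => //; exact: ctempered_dirac. Qed.

Lemma absJ_decay N chi : ccs chi -> exists2 M, 0 <= M & forall x, absJ chi x <= M / (1 + `|x|) ^+ N.
Proof.
move=> cc; have [M M0 HM] := J_decay N cc.
have c0 := @pi2_gt0 R d.
exists ((2 * pi) ^- d * M); first by rewrite mulr_ge0// ltW.
move=> x; rewrite absJ_absDelta//; apply: absDelta_leP => //; first exact: ctempered_dirac.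
move=> w; rewrite W_dirac subr0 normrM (gtr0_norm c0) -mulrA ler_wpM2l ?(ltW c0)//.
by rewrite ler_pdivlMr ?exprn_gt0 ?ltr_pwDl// mulrC.
Qed.

Lemma absJ_fin p chi : (0 < p)%E -> ccs chi -> (Lpnorm p (absJ chi) < +oo)%E.
Proof.
move=> p0 cc; have cg := ct_absJ cc; case: p p0 => [r| |]//.
  rewrite lte_fin => r0; apply: poweR_lty.
  have [N HN] : exists N, (d + d)%:R <= N%:R * r.
    by exists (Num.truncn ((d + d)%:R / r)).+1; rewrite -ler_pdivrMr//; apply/ltW/truncnS_gt.
  have [M M0 HM] := absJ_decay N cc.
  apply: (@intRd_decay _ _ _ (M `^ r)) => //; [exact: rl_normpow|exact: powR_ge0|].
  move=> x; rewrite lee_fin ger0_norm ?absJ_ge0//.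
  have q1 : 1 <= 1 + `|x| by rewrite lerDl.
  have q0 : 0 < 1 + `|x| by exact: lt_le_trans q1.
  apply: le_trans (powR_le (ltW r0) (absJ_ge0 _ _) (HM x)) _.
  rewrite powRM// ?invr_ge0 ?exprn_ge0 ?(ltW q0)// ler_wpM2l ?powR_ge0//.
  have e : ((1 + `|x|) ^+ N)^-1 = (1 + `|x|) `^ (- N%:R) by rewrite powRN powR_mulrn// ltW.
  have e' : ((1 + `|x|) ^+ (d + d))^-1 = (1 + `|x|) `^ (- (d + d)%:R) by rewrite powRN powR_mulrn// ltW.
  by rewrite e e' -powRrM; apply: ler_powR => //; rewrite mulNr lerN2.
move=> _ /=; have [M M0 HM] := absJ_decay 0 cc.
apply: (@le_lt_trans _ _ M%:E); last exact: ltry.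
by apply/(esssup_leP _ cg) => x; rewrite ger0_norm ?absJ_ge0//; have := HM x; rewrite expr0 invr1 mulr1.
Qed.

(** The kernel of the product is a limit of combinations of translates of the kernel of [chi], all
    of which vanish. This stands in for the uniqueness theorem of the Fourier transform. *)
Lemma J_mult0 chi l (h : R -> R) : ccs chi -> cpt1 h -> (forall z w, J chi z w = 0) ->
  forall z w, J (fun xi => h (xi 0 l) * chi xi) z w = 0.
Proof.
move=> cc [hs [Ah HAh]] J0 z w; have [_ [Ac HAc]] := cc.
pose lam : R := 2 * (`|Ah| + `|Ac| + 1).
have lam0 : 0 < lam by rewrite mulr_gt0// ltr_wpDl// addr_ge0.
pose s : R := 1 / 2.
have s0 : 0 < s by rewrite /s; lra.
have s2 : s <= 1 / 2 by [].
have sl : s * lam = `|Ah| + `|Ac| + 1 by rewrite /s /lam; field.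
have sl0 : 0 < s * lam by rewrite mulr_gt0.
pose m (y : R) := h (s * lam * y).
have mc : cs1 m.
  split; first exact: (@sm1_scale R _ (s * lam) hs).
  move=> y y3; apply: HAh; apply: le_lt_trans (ler_norm Ah) _.
  rewrite normrM (gtr0_norm sl0) sl; have := normr_ge0 Ah; have := normr_ge0 Ac; nra.
have supp xi : pi * lam < `|xi 0 l| -> chi xi = 0.
  move=> H; apply: (HAc xi l); apply: le_lt_trans H; apply: le_trans (ler_norm Ac) _.
  have := normr_ge0 Ah; have := normr_ge0 Ac; have := pi_ge2 R; rewrite /lam; move: (pi : R) => P; nra.
have [a [b [aB /(multiplier_series (ctempered_dirac 0) cc mc s0 lam0 supp aB) ab]]] := fourier_expansion mc s0 s2.
have := ab z w.
have -> : (fun k => a k * ((W (dirac_dist 0) chi (z + (k%:R / lam) *: evec R l) (w + b k) +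
   W (dirac_dist 0) chi (z - (k%:R / lam) *: evec R l) (w - b k)) / 2)) = (fun=> 0).
  by apply/funext => k; rewrite !W_dirac !J0 !mulr0 addr0 mul0r mulr0.
have -> : series (fun=> 0) = (fun=> 0 : R).
  by apply/funext => n; rewrite /series/= big1.
move=> /(cvg_unique (@Rhausdorff R)) /(_ (cvg_cst _)).
rewrite W_dirac subr0 => /eqP; rewrite mulf_eq0 gt_eqF ?pi2_gt0//= => /eqP <-.
by apply: J_ext => xi; rewrite /m mulVKf// gt_eqF.
Qed.

Definition tensor (h : 'I_d -> R -> R) : Rd -> R := fun xi => \prod_i h i (xi 0 i).

Lemma smooth_tensor (h : 'I_d -> R -> R) (s : seq 'I_d) : (forall i, sm1 (h i)) ->
  smooth (fun xi : Rd => \prod_(i <- s) h i (xi 0 i)).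
Proof.
move=> hs; elim: s => [|i s IH]; first by under eq_fun do rewrite big_nil; exact: smooth_cst.
by under eq_fun do rewrite big_cons; apply: smoothM => //; exact: smooth_coord.
Qed.

Lemma ccs_tensor (h : 'I_d -> R -> R) : (forall i, cpt1 (h i)) -> ccs (tensor h).
Proof.
move=> hc; split; first by apply: smooth_tensor => i; have [] := hc i.
have [A HA] := choice (fun i => (hc i).2).
exists (\sum_i `|A i|) => xi i H; rewrite /tensor (bigD1 i)//= HA ?mul0r//.
apply: le_lt_trans H; apply: le_trans (ler_norm _) _.
by rewrite (bigD1 i)//= lerDl sumr_ge0.
Qed.

Lemma RI_gt0 chi x : ccs chi -> (forall x, 0 <= chi x) -> chi x != 0 -> RI chi != 0.
Proof.
move=> cc c0 cx; apply/negP => /eqP RI0'.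
have [cs [A HA]] := cc; have rc : rl (fun x => (chi x)%:E) by apply: rl_ct => //; exact: smooth_ct.
have [B B0 HB] : exists2 B, 0 <= B & forall x, chi x <= B.
  have [A' [L [M [_ _ [hM _ _]]]]] := cl_ge0 (ccs_cl cc).
  by exists M => [|y]; [exact: le_trans (normr_ge0 _) (hM 0)|exact: le_trans (ler_norm _) (hM y)].
have fin : (intRd (fun x => (chi x)%:E) < +oo)%E.
  apply: (@intRd_decay _ _ _ (B * (1 + `|A|) ^+ (d + d))) => //.
    by rewrite mulr_ge0// exprn_ge0// addr_ge0.
  move=> y; rewrite lee_fin ler_pdivlMr ?exprn_gt0 ?ltr_pwDl//.
  have [->|cy] := eqVneq (chi y) 0; first by rewrite mul0r mulr_ge0// exprn_ge0// addr_ge0.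
  apply: ler_pM; rewrite ?exprn_ge0 ?addr_ge0//.
  rewrite lerXn2r ?nnegrE ?addr_ge0// lerD2l; apply: norm_le_coord => // i.
  apply: le_trans (ler_norm A); rewrite leNgt; apply/negP => /HA H; by rewrite H eqxx in cy.
have : intRd (fun x => (chi x)%:E) = 0%E.
  by move: RI0'; rewrite /RI; case: (intRd _) fin (intRd_ge0 rc) => //= r _ _ ->.
by move=> /(intRd_eq0 x rc) [] /eqP; rewrite (negbTE cx).
Qed.

(** If the norm vanished, so would the kernel at every point, and by [J_mult0] also the kernel of
    the squared tensor; but at the origin the latter is the integral of a nonzero square. *)
Lemma absJ_pos p (h : 'I_d -> R -> R) x : (0 < p)%E -> (forall i, cpt1 (h i)) -> tensor h x != 0 ->
  (0 < Lpnorm p (absJ (tensor h)))%E.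
Proof.
move=> p0 hc hx; have cc := ccs_tensor hc; have cg := ct_absJ cc.
rewrite lt0e Lpnorm_ge0// andbT; apply/negP => /eqP L0.
have z0 y : absJ (tensor h) y = 0.
  case: p p0 L0 => [r| |]//.
    rewrite lte_fin => r0 /= /eqP; rewrite poweR_eq0; last exact: (intRd_ge0 (rl_normpow r0 cg)).
    move=> /andP[/eqP H _]; have := intRd_eq0 y (rl_normpow r0 cg) H => -[] /eqP.
    by rewrite powR_eq0 normr_eq0 => /andP[/eqP].
  move=> _ /= E; have /(esssup_leP 0 cg)/(_ y) : (esssupRd (absJ (tensor h)) <= 0%:E)%E by rewrite E.
  by rewrite normr_le0 => /eqP.
have J0 z w : J (tensor h) z w = 0.
  have := absJ_sqr (tensor h) z; rewrite z0 expr0n/= => /esym/eqP.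
  rewrite paddr_eq0 ?sqr_ge0// !sqrf_eq0 !mulf_eq0 !(gt_eqF (@pi2_gt0 R d))/= => /andP[/eqP E1 /eqP E2].
  by rewrite J_phase// E1 E2 !mulr0 subr0.
have Js (s : seq 'I_d) : forall z w, J (fun xi => (\prod_(i <- s) h i (xi 0 i)) * tensor h xi) z w = 0.
  elim: s => [|i s IH] z w.
    by rewrite -[RHS](J0 z w); apply: J_ext => xi; rewrite big_nil mul1r.
  have cs : ccs (fun xi => (\prod_(i <- s) h i (xi 0 i)) * tensor h xi).
    by apply: (ccsM _ cc); apply: smooth_tensor => i'; have [] := hc i'.
  rewrite -[RHS](@J_mult0 _ i (h i) cs (hc i) IH z w); apply: J_ext => xi.
  by rewrite big_cons mulrA.
have ccS : ccs (fun xi => tensor h xi * tensor h xi).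
  by apply: (ccsM _ cc); apply: smooth_tensor => i'; have [] := hc i'.
have : RI (fun xi => tensor h xi * tensor h xi) != 0.
  apply: (@RI_gt0 _ x) => //; first by move=> y; rewrite -expr2 sqr_ge0.
  by rewrite mulf_neq0.
apply/negP/negPn/eqP; rewrite -[RHS](Js (index_enum _) 0 0) /J; congr RI; apply/funext => xi.
have -> : dotRd (0 : Rd) xi = 0 by rewrite /dotRd big1// => i _; rewrite mxE mul0r.
by rewrite addr0 cos0 mulr1.
Qed.

Lemma J_sqr_phase chi z w : ccs chi ->
  J chi z w ^+ 2 + J chi z (- (pi / 2) + w) ^+ 2 = J chi z 0 ^+ 2 + J chi z (- (pi / 2)) ^+ 2.
Proof.
move=> cc; rewrite (J_phase z w cc) (J_phase z (- (pi / 2) + w) cc).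
rewrite cosD sinD cosN sinN cos_pihalf sin_pihalf.
have := cos2Dsin2 w; move: (cos w) (sin w) (J chi z 0) (J chi z (- (pi / 2))) => c s a b H.
have -> : (c * a - s * b) ^+ 2 + ((0 * c - -1 * s) * a - (-1 * c + 0 * s) * b) ^+ 2 =
  (c ^+ 2 + s ^+ 2) * (a ^+ 2 + b ^+ 2) by ring.
by rewrite H mul1r.
Qed.

Lemma absJ_translate chi (om : Rd) : ccs chi -> absJ (fun xi => chi (xi - om)) = absJ chi.
Proof.
move=> cc; apply/funext => x; rewrite /absJ !J_translate// add0r J_sqr_phase//.
Qed.

(** Dilating the symbol multiplies the kernel by [P] and dilates it inversely; the change of
    variables contributes [P ^ (- 1 / r)]. *)
Lemma absJ_dscale (r : R) chi (s : 'I_d -> R) : 0 < r -> (forall i, 0 < s i) -> ccs chi -> ccs (fun xi => chi (dscale s xi)) ->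
  Lpnorm r%:E (absJ (fun xi => chi (dscale s xi))) = (((\prod_i (s i)^-1) `^ (1 - r^-1))%:E * Lpnorm r%:E (absJ chi))%E.
Proof.
move=> r0 s0 cc cs; set P := \prod_i (s i)^-1.
have P0 : 0 < P by apply: prodr_gt0 => i _; rewrite invr_gt0.
have rS := rl_normpow r0 (ct_absJ cs); have rC := rl_normpow r0 (ct_absJ cc).
have E x : absJ (fun xi => chi (dscale s xi)) (dscale s x) = P * absJ chi x.
  rewrite /absJ !J_dscale// -/P !exprMn -mulrDr sqrtrM ?sqr_ge0// sqrtr_sqr gtr0_norm//; ring.
have I1 := intRd_aff 0 s0 rS.
have I2 : intRd (fun x => (`|absJ (fun xi => chi (dscale s xi)) (dscale s x + 0)%R| `^ r)%:E) =
    ((P `^ r)%:E * intRd (fun x => (`|absJ chi x| `^ r)%:E))%E.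
  rewrite -intRdZ ?powR_ge0//; congr intRd; apply/funext => x.
  by rewrite addr0 E normrM powRM// (gtr0_norm P0).
rewrite I2 -/P in I1.
have Y (X Y : \bar R) : ((P `^ r)%:E * X = P%:E * Y)%E -> (Y = (P `^ (r - 1))%:E * X)%E.
  move=> XY; have : ((P^-1)%:E * ((P `^ r)%:E * X) = (P^-1)%:E * (P%:E * Y))%E by rewrite XY.
  rewrite !muleA -!EFinM mulVf ?gt_eqF// mul1e => <-; congr (_%:E * _)%E.
  by rewrite -(mulr_powRB1 (ltW P0) r0) mulKf// gt_eqF.
rewrite /Lpnorm (Y _ _ I1).
rewrite poweRM ?lee_fin ?powR_ge0//; last exact: (intRd_ge0 rC).
rewrite poweR_EFin -powRrM; congr ((_ `^ _)%:E * _)%E.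
by rewrite mulrBl mul1r mulfV// gt_eqF.
Qed.

Lemma Lp_zero p g : (0 < p)%E -> ct g -> (forall x, g x = 0) -> Lpnorm p g = 0%E.
Proof.
move=> p0 cg g0; apply/eqP; rewrite eq_le Lpnorm_ge0// andbT.
rewrite -(mul0e (Lpnorm p g)); apply: (@Lp_series _ _ p 0 (fun=> 0) (fun=> 0)) => //.
  by move=> n; rewrite big1// => k _; rewrite powR0// gt_eqF// rho_gt0.
by move=> x T /(_ 0%N); rewrite big_ord0 g0 normr0.
Qed.

Lemma Lp_shift_le p g a : (0 < p)%E -> ct g -> (Lpnorm p g <= Lpnorm p (fun x => g (x - a)%R))%E.
Proof.
move=> p0 cg; have cs : ct (fun x => g (x - a)) by exact: ct_shift.
rewrite -[leRHS]mul1e; apply: (@Lp_series _ _ p 1 (fun k => (k == 0%N)%:R) (fun=> a)) => //.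
- case=> [|n]; first by rewrite big_ord0 powR1.
  rewrite big_ord_recl powR1 big1 ?addr0// => k _ /=.
  by rewrite powR0// gt_eqF// rho_gt0.
- by move=> x T /(_ 1%N); rewrite big_ord_recl big_ord0 addr0 mul1r addrK.
Qed.

Lemma Lp_scale_le p g (e : R) : (0 < p)%E -> 0 <= e -> ct g -> (Lpnorm p (fun x => (e * g x)%R) <= e%:E * Lpnorm p g)%E.
Proof.
move=> p0 e0 cg; apply: (@Lp_series _ _ p e (fun k => if k == 0%N then e else 0) (fun=> 0)) => //.
- by move=> k; case: ifP.
- exact: ctZ.
- case=> [|n]; first by rewrite big_ord0 powR_ge0.
  rewrite big_ord_recl /= big1 ?addr0// => k _ /=.
  by rewrite powR0// gt_eqF// rho_gt0.
- by move=> x T /(_ 1%N); rewrite big_ord_recl big_ord0 !addr0 normrM (ger0_norm e0).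
Qed.

Lemma comb_dist (h : nat -> 'I_d -> R -> R) (e : nat -> R) (a : nat -> Rd) (s : seq nat) :
  (forall n i, cpt1 (h n i)) -> exists f : tdist R d, ctempered f /\ forall psi x w, ccs psi ->
    W f psi x w = \sum_(n <- s) e n * ((2 * pi) ^- d * J (fun xi => tensor (h n) xi * psi xi) (x - a n) w).
Proof.
move=> hc; elim: s => [|n s [f [ft Hf]]].
  exists (lin_dist (-1) (dirac_dist 0) (dirac_dist 0)); split.
    by apply: ctempered_lin; exact: ctempered_dirac.
  by move=> psi x w pc; rewrite big_nil W_lin_dist; ring.
have [f' [ft' Hf']] := tensor_dist (a n) (hc n).
exists (lin_dist (e n) f' f); split; first exact: ctempered_lin.
by move=> psi x w pc; rewrite W_lin_dist big_cons Hf'// Hf.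
Qed.

End kernel_norms.

(** * Estimates of the two norms and frequency shells *)

Section norms.
Context {R : realType} {d : nat}.
Notation Rd := 'rV[R]_d.
Implicit Types (psi chi g : Rd -> R) (l i : 'I_d) (x y z xi a : Rd) (w : R) (f : tdist R d) (p q : \bar R).
Variables (psi0 : Rd -> R) (phi0 : R -> R).
Hypotheses (apsi : admissible_psi0 psi0) (aphi : admissible_phi0 phi0).

Lemma besov_single p q (s : R) f (j : nat) : (0 < p)%E -> (0 < q)%E -> ctempered f ->
  (forall j', j' != j -> forall x, absDelta (psij psi0 j') f x = 0) ->
  (besov_norm psi0 s p q f <= (2 `^ (j%:R * s))%:E * Lpnorm p (absDelta (psij psi0 j) f))%E.
Proof.
move=> p0 q0 ft H0; rewrite /besov_norm.
have cj (k : nat) : ct (absDelta (psij psi0 k) f) by apply: ct_absDelta => //; exact: ccs_psij.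
have N0 : (0 <= (2 `^ (j%:R * s))%:E * Lpnorm p (absDelta (psij psi0 j) f))%E.
  have Lj := Lpnorm_ge0 p (cj j); have l0 : (0 <= (2 `^ (j%:R * s))%:E)%E by rewrite lee_fin powR_ge0.
  exact: mule_ge0 l0 Lj.
have Z j' : j' != j -> ((2 `^ (j'%:R * s))%:E * Lpnorm p (absDelta (psij psi0 j') f) = 0)%E.
  by move=> jj; rewrite (Lp_zero p0 (cj j') (H0 _ jj)) mule0.
case: q q0 => [r| |]//=.
  rewrite lte_fin => r0.
  apply: (@le_trans _ _ ((((2 `^ (j%:R * s))%:E * Lpnorm p (absDelta (psij psi0 j) f)) `^ r) `^ r^-1)%E); last first.
    by rewrite poweRK.
  apply: poweR_le; [by rewrite invr_ge0 ltW|by apply: esum_ge0 => k _; exact: poweR_ge0|].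
  apply: esum_seq_le => t ut.
  have zr : (0%E `^ r)%E = 0%E :> \bar R by rewrite poweR_EFin powR0// gt_eqF.
  have [jt|jt] := boolP (j \in t).
    rewrite (big_rem j)//= big_seq big1 ?adde0// => k; rewrite mem_rem_uniq// inE => /andP[kj _].
    by rewrite Z.
  rewrite big_seq big1 ?poweR_ge0// => k kt; rewrite Z//.
  by apply: contraNneq jt => <-.
move=> _; apply: ub_ereal_sup => _ [k _ <-].
by have [->//|kj] := eqVneq k j; rewrite Z.
Qed.

Lemma mixed_ge p q (t : R) f (k : {ffun 'I_d -> nat}) : (0 < p)%E -> (0 < q)%E -> ctempered f ->
  ((2 `^ ((\sum_(i < d) k i)%:R * t))%:E * Lpnorm p (absDelta (phik phi0 k) f) <= mixed_norm phi0 t p q f)%E.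
Proof.
move=> p0 q0 ft; rewrite /mixed_norm.
have N0 (k' : {ffun 'I_d -> nat}) : (0 <= (2 `^ ((\sum_(i < d) k' i)%:R * t))%:E * Lpnorm p (absDelta (phik phi0 k') f))%E.
  apply: mule_ge0; [by rewrite lee_fin powR_ge0|apply: Lpnorm_ge0; apply: ct_absDelta => //; exact: ccs_phik].
case: q q0 => [r| |]//=; last by move=> _; apply: ereal_sup_ubound; exists k.
rewrite lte_fin => r0; rewrite -[leLHS](poweRK (N0 k) r0); apply: poweR_le.
- by rewrite invr_ge0 ltW.
- exact: poweR_ge0.
apply: ereal_sup_ubound; exists [set k].
  by split => //; exact: finite_set1.
by rewrite fsbig_set1.
Qed.

Lemma mixed_ge_sum p (q t : R) f (s : seq {ffun 'I_d -> nat}) : 0 < q -> uniq s -> ctempered f ->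
  (\sum_(k <- s) ((2 `^ ((\sum_(i < d) k i)%:R * t))%:E * Lpnorm p (absDelta (phik phi0 k) f)) `^ q <=
   mixed_norm phi0 t p q%:E f `^ q)%E.
Proof.
move=> q0 us ft; rewrite /mixed_norm /lqnorm poweRVK//; last by apply: esum_ge0 => k _; exact: poweR_ge0.
apply: ereal_sup_ubound; exists [set` s].
  by split => //; exact: finite_seq.
by rewrite -fsbig_seq.
Qed.

(** Between [(3 / 4) 2 ^ j] and [2 ^ j] the cut-off at scale [2 ^ j] is 1 and the one at scale
    [2 ^ (j - 1)] is already 0, as [3 / 4 = (3 / 2) / 2]. Test frequencies are placed there so that
    neighbouring pieces do not overlap. *)
Lemma psij_shell j j' xi : (forall i, `|xi 0 i| <= 2 ^+ j) -> (exists i, 3 / 4 * 2 ^+ j <= `|xi 0 i|) ->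
  psij psi0 j' xi = (j' == j)%:R.
Proof.
move=> H1 [i H2].
have k0 n : 0 < 2 ^+ n :> R by rewrite exprn_gt0.
have one n : (j <= n)%N -> psi0 (2 ^- n *: xi) = 1.
  by move=> jn; apply: psi0_one => // l; apply: le_trans (H1 l) _; rewrite ler_eXn2l ?ltr1n.
have zero n : (n < j)%N -> psi0 (2 ^- n *: xi) = 0.
  move=> nj; apply: (psi0_supp apsi (l := i)); apply: le_trans H2.
  have : 2 ^+ n.+1 <= 2 ^+ j :> R by rewrite ler_eXn2l ?ltr1n.
  by rewrite exprS; lra.
case: j' => [|j'].
  rewrite psij0; case: (posnP j) => [j0|j0]; first by rewrite one ?j0.
  by rewrite zero// eq_sym gtn_eqF.
rewrite /psij; case: (ltngtP j'.+1 j) => [lt|lt|E].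
- by rewrite !zero ?subrr// ltnW.
- by rewrite !one ?subrr// ltnW.
- by rewrite one ?zero ?subr0// E.
Qed.

Lemma phij_shell n n' (y : R) : 3 / 4 * 2 ^+ n <= `|y| -> `|y| <= 2 ^+ n -> phij phi0 n' y = (n' == n)%:R.
Proof.
move=> H2 H1; have [_ [p1 p0]] := aphi.
have k0 k : 0 < 2 ^+ k :> R by rewrite exprn_gt0.
have nE k : `|2 ^- k * y| = `|y| / 2 ^+ k by rewrite normrM mulrC [`|2 ^- k|]ger0_norm// invr_ge0 exprn_ge0.
have one k : (n <= k)%N -> phi0 (2 ^- k * y) = 1.
  move=> nk; apply: p1; rewrite nE ler_pdivrMr// mul1r; apply: le_trans H1 _.
  by rewrite ler_eXn2l ?ltr1n.
have zero k : (k < n)%N -> phi0 (2 ^- k * y) = 0.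
  move=> kn; apply: p0; rewrite nE ler_pdivlMr//; apply: le_trans H2.
  have : 2 ^+ k.+1 <= 2 ^+ n :> R by rewrite ler_eXn2l ?ltr1n.
  by rewrite exprS; lra.
case: n' => [|n'].
  have -> : phij phi0 0 y = phi0 (2 ^- 0 * y) by rewrite expr0 invr1 mul1r.
  case: (posnP n) => [n0|n0]; first by rewrite one ?n0.
  by rewrite zero// eq_sym gtn_eqF.
rewrite /phij; case: (ltngtP n'.+1 n) => [lt|lt|E].
- by rewrite !zero ?subrr// ltnW.
- by rewrite !one ?subrr// ltnW.
- by rewrite one ?zero ?subr0// E.
Qed.

Lemma phij_center n' (y : R) : `|y| <= 1 -> phij phi0 n' y = (n' == 0%N)%:R.
Proof.
move=> y1; have [_ [p1 _]] := aphi; case: n' => [|n'] /=; first exact: p1.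
have one k : phi0 (2 ^- k * y) = 1.
  apply: p1; rewrite normrM [`|2 ^- k|]ger0_norm ?invr_ge0 ?exprn_ge0// mulr_ile1// ?invr_ge0 ?exprn_ge0//.
  by rewrite invf_le1 ?exprn_gt0// exprn_ege1// ler1n.
by rewrite !one subrr.
Qed.

(** The factor 16 makes the half-width less than 1 / 8: centred at [(7 / 8) 2 ^ j], the bump stays
    between [(3 / 4) 2 ^ j] and [2 ^ j] for every [j]. *)
Definition bump (y : R) : R := phi0 (16 * y) * phi0 (16 * y).

Lemma sm1_bump : sm1 bump.
Proof. by have [ps _] := aphi; exact: (@sm1M R _ _ (@sm1_scale R phi0 16 ps) (@sm1_scale R phi0 16 ps)). Qed.

Lemma bump_supp (y : R) : bump y != 0 -> `|y| < 1 / 8.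
Proof.
have [_ [_ p0]] := aphi; move=> H; rewrite ltNge; apply/negP => y8; move: H.
by rewrite /bump p0 ?mul0r ?eqxx// normrM ger0_norm//; lra.
Qed.

Lemma bump0 : bump 0 = 1.
Proof. by have [_ [p1 _]] := aphi; rewrite /bump mulr0 p1 ?mulr1// normr0. Qed.

Lemma cpt1_bump (c : R) : cpt1 (fun y : R => bump (y - c)).
Proof.
split.
  have := @sm1_affine R bump 1 (- c) sm1_bump; congr sm1.
  by apply/funext => y; rewrite mul1r.
exists (`|c| + 1) => y H; apply/eqP; apply/negPn/negP => /bump_supp.
have := ler_norm (`|y| - `|c|) ; have := ler_dist_dist y c; lra.
Qed.

End norms.

Lemma sum_kron {R : realType} (n : nat) (s : seq nat) (F : nat -> R) : uniq s -> n \in s ->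
  \sum_(m <- s) (m == n)%:R * F m = F n.
Proof.
move=> us ns; rewrite (big_rem n)//= eqxx mul1r big_seq big1 ?addr0// => m.
by rewrite mem_rem_uniq// inE => /andP[/negbTE-> _]; rewrite mul0r.
Qed.

(** * Necessity *)

Section lacunary.
Context {R : realType} {d : nat}.
Notation Rd := 'rV[R]_d.
Implicit Types (psi chi g : Rd -> R) (l i : 'I_d) (x y z xi : Rd) (w : R) (f : tdist R d).
Variables (psi0 : Rd -> R) (phi0 : R -> R).
Hypotheses (apsi : admissible_psi0 psi0) (aphi : admissible_phi0 phi0).
Variables (i0 i1 : 'I_d).
Hypothesis (i01 : i1 != i0).

Definition freq j n i : R := if i == i0 then 2 ^+ j * (7 / 8) else if i == i1 then 2 ^+ n * (7 / 8) else 0.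
Definition lacbump j n i (y : R) : R := bump phi0 (y - freq j n i).
(* Modulation does not change the modulus of a kernel, so [kap] is the modulus of every building block. *)
Definition kap : Rd -> R := absJ (tensor (fun=> bump phi0)).
Definition lacidx j n : {ffun 'I_d -> nat} := [ffun i => if i == i0 then j else if i == i1 then n else 0%N].

Lemma cpt1_lacbump j n i : cpt1 (lacbump j n i).
Proof. exact: cpt1_bump. Qed.

Lemma cpt1_bump0 : cpt1 (bump phi0).
Proof. by have := cpt1_bump aphi 0; congr cpt1; apply/funext => y; rewrite subr0. Qed.

Lemma ccs_lac j n : ccs (tensor (lacbump j n)).
Proof. by apply: ccs_tensor => i; exact: cpt1_lacbump. Qed.

Lemma ct_kap : ct kap.
Proof. by apply: ct_absJ; apply: ccs_tensor => i; exact: cpt1_bump0. Qed.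

Lemma kap_ge0 x : 0 <= kap x. Proof. exact: absJ_ge0. Qed.

Lemma absJ_lac j n : absJ (tensor (lacbump j n)) = kap.
Proof.
rewrite /kap -(@absJ_translate _ _ (tensor (fun=> bump phi0)) (\row_i freq j n i)); last first.
  by apply: ccs_tensor => i; exact: cpt1_bump0.
congr absJ; apply/funext => xi; rewrite /tensor; apply: eq_bigr => i _.
by rewrite /lacbump !mxE.
Qed.

Lemma kap_fin p : (0 < p)%E -> (Lpnorm p kap < +oo)%E.
Proof. by move=> p0; apply: absJ_fin => //; apply: ccs_tensor => i; exact: cpt1_bump0. Qed.

Lemma kap_pos p : (0 < p)%E -> (0 < Lpnorm p kap)%E.
Proof.
move=> p0; apply: (@absJ_pos _ _ _ _ 0) => //; first by move=> i; exact: cpt1_bump0.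
by rewrite /tensor big1 ?oner_eq0// => i _; rewrite mxE bump0.
Qed.

Lemma kap_norm p : (0 < p)%E -> exists2 K : R, 0 < K & Lpnorm p kap = K%:E.
Proof.
move=> p0; have := kap_fin p0; have := kap_pos p0.
by case: (Lpnorm p kap) => // K; rewrite lte_fin => K0 _; exists K.
Qed.

Lemma lac_loc j n xi : (n <= j)%N -> tensor (lacbump j n) xi != 0 ->
  [/\ 3 / 4 * 2 ^+ j <= `|xi 0 i0|, 3 / 4 * 2 ^+ n <= `|xi 0 i1|, `|xi 0 i1| <= 2 ^+ n,
     forall i, `|xi 0 i| <= 2 ^+ j & forall i, i != i0 -> i != i1 -> `|xi 0 i| <= 1].
Proof.
move=> nj /prodf_neq0 H.
have B i : `|xi 0 i - freq j n i| < 1 / 8 by apply: (bump_supp aphi); exact: (H i isT).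
have k1 k : 1 <= 2 ^+ k :> R by rewrite exprn_ege1// ler1n.
have T (u v : R) : 1 <= v -> `|u - v * (7 / 8)| < 1 / 8 -> 3 / 4 * v <= `|u| /\ `|u| <= v.
  move=> v1; rewrite ltr_norml => /andP[h1 h2].
  have u0 : 0 <= u by lra.
  by rewrite ger0_norm//; lra.
have B0 : 3 / 4 * 2 ^+ j <= `|xi 0 i0| /\ `|xi 0 i0| <= 2 ^+ j.
  by apply: T => //; have := B i0; rewrite /freq eqxx.
have B1 : 3 / 4 * 2 ^+ n <= `|xi 0 i1| /\ `|xi 0 i1| <= 2 ^+ n.
  by apply: T => //; have := B i1; rewrite /freq eqxx (negbTE i01).
have Bi i : i != i0 -> i != i1 -> `|xi 0 i| <= 1.
  move=> /negbTE h0 /negbTE h1; have := B i; rewrite /freq h0 h1 subr0; lra.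
split; [exact: B0.1|exact: B1.1|exact: B1.2| |exact: Bi].
move=> i; have [->|h0] := eqVneq i i0; first exact: B0.2.
have [->|h1] := eqVneq i i1; last exact: le_trans (Bi i h0 h1) _.
by apply: le_trans B1.2 _; rewrite ler_eXn2l ?ltr1n.
Qed.

Lemma lac_psi j n j' xi : (n <= j)%N ->
  tensor (lacbump j n) xi * psij psi0 j' xi = (j' == j)%:R * tensor (lacbump j n) xi.
Proof.
move=> nj; have [->|ne] := eqVneq (tensor (lacbump j n) xi) 0; first by rewrite mul0r mulr0.
have [h0 _ _ hj _] := lac_loc nj ne.
have hi : exists i, 3 / 4 * 2 ^+ j <= `|xi 0 i| by exists i0.
by rewrite (psij_shell apsi j' hj hi) mulrC.
Qed.

Lemma lac_phi j m n xi : (m <= j)%N ->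
  tensor (lacbump j m) xi * phik phi0 (lacidx j n) xi = (m == n)%:R * tensor (lacbump j m) xi.
Proof.
move=> mj; have [->|ne] := eqVneq (tensor (lacbump j m) xi) 0; first by rewrite mul0r mulr0.
have [h0 h1 h1' hj hi] := lac_loc mj ne.
suff -> : phik phi0 (lacidx j n) xi = (m == n)%:R by rewrite mulrC.
rewrite /phik (bigD1 i0)//= (bigD1 i1)//= big1 => [|i /andP[a b]].
  rewrite !ffunE !eqxx (negbTE i01) (phij_shell aphi j h0 (hj i0)) (phij_shell aphi n h1 h1').
  by rewrite eqxx mul1r mulr1 eq_sym.
by rewrite ffunE (negbTE a) (negbTE b) (phij_center aphi _ (hi i a b)).
Qed.

Lemma sum_lacidx j n : (\sum_(i < d) lacidx j n i)%N = (j + n)%N.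
Proof.
rewrite (bigD1 i0)//= (bigD1 i1)//= big1 ?addn0 => [|i /andP[a b]].
  by rewrite !ffunE !eqxx (negbTE i01).
by rewrite ffunE (negbTE a) (negbTE b).
Qed.

Lemma lacidx_inj j : injective (lacidx j).
Proof. by move=> n m /ffunP/(_ i1); rewrite !ffunE eqxx (negbTE i01). Qed.

(** All blocks share the isotropic shell [j] because [n <= j], while the second frequency separates
    them in the mixed decomposition; the coefficients [e] and the centres [a] stay at disposal. *)
Lemma lac_dist p q (sg : R) j (s : seq nat) (e : nat -> R) (a : nat -> Rd) :
  (0 < p)%E -> (0 < q)%E -> uniq s -> (forall n, n \in s -> (n <= j)%N) ->
  exists f : tdist R d, [/\ ctempered f,
    (besov_norm psi0 sg p q f <= (2 `^ (j%:R * sg))%:E * Lpnorm p (absDelta (psij psi0 j) f))%E,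
    forall x w, W f (psij psi0 j) x w =
      \sum_(n <- s) e n * ((2 * pi) ^- d * J (tensor (lacbump j n)) (x - a n) w) &
    forall n, n \in s -> forall x, absDelta (phik phi0 (lacidx j n)) f x = `|e n| * kap (x - a n)].
Proof.
move=> p0 q0 us sj.
have [f [ft Hf]] := @comb_dist R d (lacbump j) e a s (cpt1_lacbump j).
have cn n := ccs_lac j n.
have JZ n (b : bool) z w : J (fun xi => b%:R * tensor (lacbump j n) xi) z w = b%:R * J (tensor (lacbump j n)) z w.
  case: b; first by rewrite mul1r; apply: J_ext => xi; rewrite mul1r.
  have := J_lin (-1) z w (cn n) (cn n); rewrite mulN1r addNr mul0r => <-.
  by apply: J_ext => xi; rewrite mul0r mulN1r addNr.
exists f; split => //.
- apply: (besov_single apsi) => // j' jj x.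
  have cj := ccs_psij apsi j'.
  rewrite (@absDelta_absJ _ _ _ _ (tensor (lacbump j 0)) _ 0 0)// ?normr0 ?mul0r// => w.
  rewrite Hf// big_seq big1 ?mul0r// => n ns.
  under J_ext do rewrite (lac_psi _ _ (sj n ns)).
  by rewrite JZ (negbTE jj) mul0r !mulr0.
- move=> x w; rewrite Hf; last exact: ccs_psij.
  apply: eq_big_seq => n ns; congr (_ * (_ * _)); apply: J_ext => xi.
  by rewrite lac_psi ?sj// eqxx mul1r.
- move=> n ns x; have ck := ccs_phik aphi (lacidx j n).
  rewrite -(absJ_lac j n); apply: absDelta_absJ => // w.
  rewrite Hf// -[RHS](@sum_kron _ n s (fun m => e m * ((2 * pi) ^- d * J (tensor (lacbump j m)) (x - a m) w)))//.
  apply: eq_big_seq => m ms.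
  under J_ext do rewrite (lac_phi _ _ (sj m ms)).
  by rewrite JZ; ring.
Qed.

End lacunary.

Lemma expr_unbounded {R : realType} (u C : R) : 1 < u -> ~ (forall n : nat, u ^+ n <= C).
Proof.
move=> u1 H.
have B n : n%:R * (u - 1) <= u ^+ n.
  elim: n => [|n IH]; first by rewrite mul0r expr0.
  have : 1 <= u ^+ n by rewrite exprn_ege1// ltW.
  by rewrite exprS -natr1; nra.
have v0 : 0 < u - 1 by rewrite subr_gt0.
have := le_trans (B (Num.truncn (C / (u - 1))).+1) (H _).
by rewrite leNgt -ltr_pdivrMr// truncnS_gt.
Qed.

(** The triangle inequality for complex numbers with parts [A n], [B n]; the cross terms are bounded
    by Cauchy-Schwarz. *)
Lemma sqr_sum_le {R : realType} (s : seq nat) (A B k : nat -> R) :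
  (forall n, 0 <= k n) -> (forall n, A n ^+ 2 + B n ^+ 2 <= k n ^+ 2) ->
  (\sum_(n <- s) A n) ^+ 2 + (\sum_(n <- s) B n) ^+ 2 <= (\sum_(n <- s) k n) ^+ 2.
Proof.
move=> k0 H; elim: s => [|n s IH]; first by rewrite !big_nil !expr0n/= addr0.
have S0 : 0 <= \sum_(m <- s) k m by apply: sumr_ge0.
rewrite !big_cons; move: (H n) (k0 n) IH S0.
move: (A n) (B n) (k n) (\sum_(m <- s) A m) (\sum_(m <- s) B m) (\sum_(m <- s) k m).
move=> a b c x y z abc c0 xyz z0.
have cz0 : 0 <= c * z by exact: mulr_ge0.
have Q : (a * x + b * y) ^+ 2 <= (c * z) ^+ 2.
  apply: (@le_trans _ _ ((a ^+ 2 + b ^+ 2) * (x ^+ 2 + y ^+ 2))).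
    have := sqr_ge0 (a * y - b * x); lra.
  by rewrite exprMn; apply: ler_pM => //; rewrite addr_ge0 ?sqr_ge0.
have : a * x + b * y <= c * z.
  apply: le_trans (ler_norm _) _; rewrite -(ger0_norm cz0).
  by rewrite -(@ler_pXn2r _ 2) ?nnegrE// !real_normK ?num_real.
lra.
Qed.

(** * Tests with bumps of fixed shape *)

Section sequence_tests.
Context {R : realType} {d : nat}.
Notation Rd := 'rV[R]_d.
Implicit Types (psi chi g : Rd -> R) (l i : 'I_d) (x y z xi : Rd) (w : R) (f : tdist R d) (p q : \bar R).
Variables (psi0 : Rd -> R) (phi0 : R -> R).
Hypotheses (apsi : admissible_psi0 psi0) (aphi : admissible_phi0 phi0).
Variables (i0 i1 : 'I_d).
Hypothesis (i01 : i1 != i0).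

Lemma besov_ge0 p q (s : R) f : (0 < p)%E -> (0 < q)%E -> ctempered f -> (0 <= besov_norm psi0 s p q f)%E.
Proof.
move=> p0 q0 ft; case: q q0 => [r| |]// q0; first exact: poweR_ge0.
have cj : ct (absDelta (psij psi0 0) f) by apply: ct_absDelta => //; exact: ccs_psij.
have L0 := Lpnorm_ge0 p cj; have l0 : (0 <= (2 `^ (0%:R * s))%:E :> \bar R)%E by rewrite lee_fin powR_ge0.
apply: le_trans (mule_ge0 l0 L0) _; apply: ereal_sup_ubound; by exists 0%N.
Qed.

Lemma embeds_le p q (s t : R) : (0 < p)%E -> (0 < q)%E -> embeds psi0 phi0 s t p q ->
  exists2 C : R, 0 <= C & forall f (X : R), ctempered f ->
    (besov_norm psi0 s p q f <= X%:E)%E -> (mixed_norm phi0 t p q f <= (C * X)%:E)%E.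
Proof.
move=> p0 q0 [C H]; exists `|C| => // f X ft bX.
have b0 := besov_ge0 s p0 q0 ft.
have bf : (besov_norm psi0 s p q f < +oo)%E by exact: le_lt_trans bX (ltry _).
apply: le_trans (H f ft bf) _; rewrite EFinM.
apply: (@le_trans _ _ (`|C|%:E * besov_norm psi0 s p q f)%E).
  by apply: lee_wpmul2r => //; rewrite lee_fin ler_norm.
by apply: lee_wpmul2l => //; rewrite lee_fin.
Qed.

(** A bump with [n = 0] has mixed weight [2 ^ (j t)] and isotropic weight [2 ^ (j t d)]; since
    [d >= 2], their quotient is unbounded in [j] when [t < 0]. *)
Lemma embeds_t_ge0 p q (t : R) : (2 <= d)%N -> (0 < p)%E -> (0 < q)%E ->
  embeds psi0 phi0 (t * d%:R) t p q -> 0 <= t.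
Proof.
move=> d2 p0 q0 /(embeds_le p0 q0)[C C0 H]; rewrite leNgt; apply/negP => t0.
have [K K0 HK] := @kap_norm _ d _ aphi _ p0.
have u1 : 1 < 2 `^ (- t) :> R by apply: powR2_gt1; rewrite oppr_gt0.
apply: (@expr_unbounded _ _ C u1) => j.
have [f [ft fb fW fm]] := @lac_dist R d psi0 phi0 apsi aphi i0 i1 i01 p q (t * d%:R) j [:: 0%N] (fun=> 1) (fun=> 0) p0 q0 isT
  (fun n => ltac:(by rewrite inE => /eqP->)).
have E : absDelta (psij psi0 j) f = kap phi0.
  apply/funext => x; rewrite (@absDelta_absJ _ _ _ _ (tensor (lacbump phi0 i0 i1 j 0)) _ 0 1)//.
  - by rewrite normr1 mul1r absJ_lac// subr0.
  - exact: ccs_psij.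
  - by move=> w; rewrite fW big_seq1.
rewrite E HK -EFinM in fb.
have E2 : absDelta (phik phi0 (lacidx i0 i1 j 0)) f = kap phi0.
  by apply/funext => x; rewrite fm ?inE// normr1 mul1r subr0.
have := le_trans (mixed_ge aphi t (lacidx i0 i1 j 0) p0 q0 ft) (H f _ ft fb).
rewrite E2 HK sum_lacidx// addn0 -EFinM lee_fin [C * _]mulrA ler_pM2r//.
rewrite -powR_nat => G.
have p20 : 0 < 2 `^ (j%:R * (t * d%:R)) :> R by rewrite powR_gt0.
rewrite -(ler_pM2r p20); apply: le_trans G; rewrite -powRD; last by rewrite pnatr_eq0 implybT.
rewrite ler_powR ?ler1n// mulrN -mulrN -mulrDr ler_wpM2l//.
have : 2 <= d%:R :> R by rewrite ler_nat.
nra.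
Qed.

Definition lacsum N (e : nat -> R) (a : nat -> Rd) x w : R :=
  \sum_(n <- iota 0 N) e n * ((2 * pi) ^- d * J (tensor (lacbump phi0 i0 i1 N n)) (x - a n) w).

(** [N] mixed pieces of equal norm give [N ^ (1 / q)] against [N ^ th] for the isotropic piece;
    large [N = 2 ^ m] compares the exponents. The hypothesis on [g] abstracts the choice of signs
    and centres, which differs between the two applications. *)
Lemma lac_necessity p (q th C1 : R) : (0 < p)%E -> 0 < q -> 0 <= C1 ->
  embeds psi0 phi0 0 0 p q%:E ->
  (forall N, (0 < N)%N -> exists (e : nat -> R) (a : nat -> Rd), (forall n, `|e n| = 1) /\
    forall g, ct g -> (forall x, 0 <= g x) ->
      (forall x, g x ^+ 2 = lacsum N e a x 0 ^+ 2 + lacsum N e a x (- (pi / 2)) ^+ 2) ->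
      (Lpnorm p g <= (C1 * N%:R `^ th)%:E)%E) ->
  q^-1 <= th.
Proof.
move=> p0 q0 C10; have q0' : (0 < q%:E)%E by rewrite lte_fin.
move=> /(embeds_le p0 q0')[C C0 H] HN.
have [K K0 HK] := @kap_norm _ d _ aphi _ p0.
have Kq0 : 0 < K `^ q by exact: powR_gt0.
pose D := (C * C1) `^ q / K `^ q.
have main N : (0 < N)%N -> N%:R <= D * N%:R `^ (th * q).
  move=> N0; have [e [a [e1 He]]] := HN _ N0.
  have [f [ft fb fW fm]] := @lac_dist R d psi0 phi0 apsi aphi i0 i1 i01 p q%:E 0 N (iota 0 N) e a p0 q0' (iota_uniq _ _)
    (fun n => ltac:(by rewrite mem_iota add0n => /ltnW)).
  have cp := ccs_psij apsi N.
  have G : (besov_norm psi0 0 p q%:E f <= (C1 * N%:R `^ th)%:E)%E.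
    apply: le_trans fb _; rewrite mulr0 powRr0 mul1e; apply: He.
    - exact: ct_absDelta.
    - by move=> x; rewrite absDeltaE// sqrtr_ge0.
    - by move=> x; rewrite absDeltaE// sqr_sqrtr ?addr_ge0 ?sqr_ge0// !fW.
  have M := H f _ ft G.
  have m0 : (0 <= mixed_norm phi0 0 p q%:E f)%E by exact: poweR_ge0.
  have Mq := poweR_le (ltW q0) m0 M.
  have us : uniq (map (lacidx i0 i1 N) (iota 0 N)).
    by rewrite map_inj_uniq ?iota_uniq//; exact: lacidx_inj.
  have := le_trans (@mixed_ge_sum _ _ phi0 p q 0 f _ q0 us ft) Mq.
  rewrite big_map => S.
  have : (\sum_(n <- iota 0 N) (K `^ q)%:E <= ((C * (C1 * N%:R `^ th)) `^ q)%:E)%E.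
    have -> : ((C * (C1 * N%:R `^ th)) `^ q)%:E = ((C * (C1 * N%:R `^ th))%:E `^ q)%E by rewrite poweR_EFin.
    apply: le_trans S; rewrite big_seq [leRHS]big_seq; apply: lee_sum => n nN.
    rewrite mulr0 powRr0 mul1e -poweR_EFin; apply: poweR_le; [exact: ltW|by rewrite lee_fin ltW|].
    have -> : absDelta (phik phi0 (lacidx i0 i1 N n)) f = (fun x => kap phi0 (x - a n)).
      by apply/funext => x; rewrite fm// e1 mul1r.
    by rewrite -HK; apply: Lp_shift_le => //; exact: ct_kap.
  rewrite sumEFin lee_fin big_const_seq count_predT size_iota iter_addr_0 -[_ *+ N]mulr_natl.
  move=> L.
  have E : (C * (C1 * N%:R `^ th)) `^ q = (C * C1) `^ q * N%:R `^ (th * q).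
    by rewrite mulrA (@powRM _ (C * C1)) ?mulr_ge0 ?powR_ge0// -powRrM.
  clear -E L Kq0.
  by rewrite E in L; rewrite /D mulrAC ler_pdivlMr.
rewrite leNgt; apply/negP => thq.
have dl0 : 0 < 1 - th * q.
  by rewrite subr_gt0 -ltr_pdivlMr// mul1r.
apply: (@expr_unbounded _ _ D (powR2_gt1 dl0)) => m.
have := main (2 ^ m)%N (expn_gt0 2 m); rewrite natrX.
have -> : (2 ^+ m) = 2 `^ m%:R :> R by rewrite powR_mulrn.
rewrite -powRrM -powR_nat => L.
have p20 : 0 < 2 `^ (m%:R * (th * q)) :> R by rewrite powR_gt0.
rewrite -(ler_pM2r p20) -powRD; last by rewrite pnatr_eq0 implybT.
by apply: le_trans L; rewrite le_eqVlt; apply/orP; left; apply/eqP; congr (_ `^ _); ring.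
Qed.

End sequence_tests.

Lemma midpoint_powR {R : realType} (r a b : R) : 0 < r -> r <= 1 -> 0 <= a -> 0 <= b ->
  a `^ r + b `^ r <= 2 * ((a + b) / 2) `^ r.
Proof.
move=> r0 r1 a0 b0; have [E|r1'] := eqVneq r 1.
  by rewrite E !powRr1 ?divr_ge0 ?addr_ge0//; lra.
have r01 : 0 < r < 1 by rewrite r0 lt_neqAle r1' r1.
have h0 : 0 <= 2^-1 :> R by [].
have h1 : 2^-1 + 2^-1 = 1 :> R by lra.
have := concave_split r01 a0 b0 h0 h0 h1; rewrite -mulrDr powRM ?addr_ge0// => H.
have p0 : 0 < 2^-1 `^ r :> R by rewrite powR_gt0.
have E : 2^-1 `^ (1 - r) * 2^-1 `^ r = 2^-1 :> R.
  by rewrite -powRD ?subrK ?powRr1// invr_eq0 pnatr_eq0 implybT.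
move: H; rewrite -(ler_pM2r p0) mulrAC E => H.
lra.
Qed.

Lemma le_of_sum {R : realType} (x y z : \bar R) : (0 <= z)%E -> (x + y <= 2%:E * z)%E ->
  (x <= z)%E \/ (y <= z)%E.
Proof.
move=> z0 H; have [h|h] := leP x z; [by left|right]; rewrite leNgt; apply/negP => h'.
move: H; rewrite leNgt => /negP; apply.
case: z z0 h h' => [u| |] z0 h h'; [|by rewrite ltNge leey in h|by []].
have -> : (2%:E * u%:E = u%:E + u%:E)%E by rewrite -EFinM -EFinD; congr EFin; ring.
exact: lteD.
Qed.

(** * Far apart centres and well chosen signs *)

Section bounds.
Context {R : realType} {d : nat}.
Notation Rd := 'rV[R]_d.
Implicit Types (psi chi g : Rd -> R) (l i : 'I_d) (x y z xi : Rd) (w : R) (f : tdist R d) (p q : \bar R).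
Variables (phi0 : R -> R).
Hypotheses (aphi : admissible_phi0 phi0).
Variables (i0 i1 : 'I_d).
Hypothesis (i01 : i1 != i0).

Let kp : Rd -> R := kap phi0.

Lemma intRd_sum (a : nat -> Rd) (s : seq nat) :
  ct (fun x => \sum_(n <- s) kp (x - a n)) /\
  intRd (fun x => (\sum_(n <- s) kp (x - a n))%:E) = ((size s)%:R%:E * intRd (fun x => (kp x)%:E))%E.
Proof.
have ck : ct kp by exact: ct_kap.
have cs n : ct (fun x => kp (x - a n)) by exact: (@ct_shift _ _ kp (- a n)).
have rk : rl (fun x => (kp x)%:E) by apply: rl_ct => // x; exact: kap_ge0.
have I0 : (0 <= intRd (fun x => (kp x)%:E))%E by exact: intRd_ge0.
elim: s => [|n s [IH1 IH2]].
  split.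
    by have := @ctZ R d 0 kp ck; congr ct; apply/funext => x; rewrite big_nil mul0r.
  have -> : (fun x => (\sum_(n <- [::]) kp (x - a n))%:E) = (fun x => (0%:E * (kp x)%:E)%E).
    by apply/funext => x; rewrite big_nil mul0e.
  by rewrite intRdZ.
have c1 : ct (fun x => \sum_(m <- n :: s) kp (x - a m)).
  by have := @ctD R d _ _ (cs n) IH1; congr ct; apply/funext => x; rewrite big_cons.
split => //.
have -> : (fun x => (\sum_(m <- n :: s) kp (x - a m))%:E) =
   ((fun x => (kp (x - a n))%:E) \+ (fun x => (\sum_(m <- s) kp (x - a m))%:E))%E.
  by apply/funext => x; rewrite big_cons EFinD.
rewrite intRdD; [|by apply: rl_ct => // x; exact: kap_ge0|by apply: rl_ct => // x; apply: sumr_ge0 => m _; exact: kap_ge0].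
rewrite IH2 (@intRd_shift _ _ (fun x => (kp x)%:E) (- a n))//.
by rewrite /= -[in RHS]natr1 addrC EFinD ge0_muleDl ?mul1e ?lee_fin.
Qed.

Lemma lac_le_sum N e (a : nat -> Rd) g : (forall n, `|e n| = 1) -> (forall x, 0 <= g x) ->
  (forall x, g x ^+ 2 = lacsum phi0 i0 i1 N e a x 0 ^+ 2 + lacsum phi0 i0 i1 N e a x (- (pi / 2)) ^+ 2) ->
  forall x, g x <= \sum_(n <- iota 0 N) kp (x - a n).
Proof.
move=> e1 g0 Hg x.
have S0 : 0 <= \sum_(n <- iota 0 N) kp (x - a n) by apply: sumr_ge0 => n _; exact: kap_ge0.
rewrite -(@ler_pXn2r _ 2) ?nnegrE// Hg; apply: sqr_sum_le => n; first exact: kap_ge0.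
have e2 : e n ^+ 2 = 1 by rewrite -[e n ^+ 2]real_normK ?num_real// e1 expr1n.
have E u : (e n * u) ^+ 2 = u ^+ 2 by rewrite exprMn e2 mul1r.
by rewrite /kp -(absJ_lac aphi i0 i1 N n) absJ_sqr !E.
Qed.

(* Centers [2 N n e] are so far apart that at most one of the [N] translates
   exceeds [M / N] at a given point. *)
Lemma spread_sum : exists2 C0 : R, 0 <= C0 & forall N x, (0 < N)%N ->
  \sum_(n <- iota 0 N) kp (x - (2 * N * n)%:R *: evec R i0) <= C0.
Proof.
have [M M0 HM] := @absJ_decay _ _ 1 (tensor (fun=> bump phi0)) (ccs_tensor (fun _ : 'I_d => cpt1_bump0 aphi)).
exists (2 * M); first by rewrite mulr_ge0.
move=> N x N0;
have N0' : 0 < N%:R :> R by rewrite ltr0n.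
have kM y : kp y <= M.
  apply: le_trans (HM y) _; rewrite expr1 ler_pdivrMr ?ltr_pwDl//.
  by rewrite ler_peMr// lerDl.
have kN y : N%:R <= `|y| -> kp y <= M / N%:R.
  move=> Ny; apply: le_trans (HM y) _; rewrite expr1 ler_wpM2l// lef_pV2 ?posrE ?ltr_pwDl//; lra.
have co n : `|x 0 i0 - 2 * N%:R * n%:R| <= `|x - (2 * N * n)%:R *: evec R i0|.
  apply: le_trans (norm_coord _ i0); rewrite !mxE !eqxx mulr1 !natrM.
  exact: lexx.
have [n nN far] : exists2 n, n \in iota 0 N & forall m, m \in iota 0 N -> m != n -> N%:R <= `|x - (2 * N * m)%:R *: evec R i0|.
  have [[n nN near]|no] := pselect (exists2 n, n \in iota 0 N & `|x - (2 * N * n)%:R *: evec R i0| < N%:R).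
    exists n => // m _ mn; apply: le_trans (co m).
    have := le_lt_trans (co n) near; rewrite ltr_norml => /andP[h1 h2].
    move: mn; rewrite neq_ltn => /orP[mn|mn].
      have : m%:R + 1 <= n%:R :> R by rewrite natr1 ler_nat.
      by move=> h; apply: le_trans (ler_norm _); nra.
    have : n%:R + 1 <= m%:R :> R by rewrite natr1 ler_nat.
    by move=> h; rewrite -normrN; apply: le_trans (ler_norm _); nra.
  exists 0%N; first by rewrite mem_iota.
  move=> m mN _; rewrite leNgt; apply/negP => h; apply: no; by exists m.
apply: (@le_trans _ _ (\sum_(m <- iota 0 N) ((m == n)%:R * M + M / N%:R))).
  rewrite big_seq [leRHS]big_seq; apply: ler_sum => m mN.
  have [->|mn] := eqVneq m n; last by rewrite mul0r add0r; exact: kN (far m mN mn).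
  by rewrite mul1r; apply: le_trans (kM _) _; rewrite lerDl divr_ge0.
rewrite big_split/= (@sum_kron _ n _ (fun=> M)) ?iota_uniq//.
rewrite big_const_seq count_predT size_iota iter_addr_0 -[_ *+ N]mulr_natl [N%:R * _]mulrCA divff ?gt_eqF// mulr1; lra.
Qed.

(** The sum [F] of the translates is at most [C0], uniformly in [N], and has [N] times the integral
    of one block; [F ^ r <= C0 ^ (r - 1) * F] then yields [N ^ (1 / r)]. For [p = +oo] the bound
    [C0] is enough. *)
Lemma lac_spread p : (1%:E <= p)%E -> exists2 C1 : R, 0 <= C1 &
  forall N, (0 < N)%N -> exists (e : nat -> R) (a : nat -> Rd), (forall n, `|e n| = 1) /\
    forall g, ct g -> (forall x, 0 <= g x) ->
      (forall x, g x ^+ 2 = lacsum phi0 i0 i1 N e a x 0 ^+ 2 + lacsum phi0 i0 i1 N e a x (- (pi / 2)) ^+ 2) ->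
      (Lpnorm p g <= (C1 * N%:R `^ invp p)%:E)%E.
Proof.
have [C0 C00 HC] := spread_sum.
case: p => [r| |]// => [|_]; last first.
  exists C0 => // N N0; exists (fun=> 1), (fun n => (2 * N * n)%:R *: evec R i0).
  split=> [n|g cg g0 Hg]; first by rewrite normr1.
  rewrite /= powRr0 mulr1; apply/esssup_leP => // x; rewrite ger0_norm//.
  by apply: le_trans (lac_le_sum _ g0 Hg x) (HC _ _ N0) => n; rewrite normr1.
rewrite lee_fin => r1; have r0 : 0 < r by exact: lt_le_trans r1.
have ct1 := ccs_tensor (fun _ : 'I_d => cpt1_bump0 aphi).
have [M M0 HM] := @absJ_decay _ _ (d + d) _ ct1.
have ck : ct kp by exact: ct_kap.
have rk : rl (fun x => (kp x)%:E) by apply: rl_ct => // x; exact: kap_ge0.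
have : (intRd (fun x => (kp x)%:E) < +oo)%E.
  by apply: (intRd_decay rk M0) => x; rewrite lee_fin; exact: HM.
have : (0 <= intRd (fun x => (kp x)%:E))%E by exact: intRd_ge0.
case E : (intRd (fun x => (kp x)%:E)) => [I| |]// I0 _; rewrite lee_fin in I0.
exists ((C0 `^ (r - 1) * I) `^ r^-1); first exact: powR_ge0.
move=> N N0; exists (fun=> 1), (fun n => (2 * N * n)%:R *: evec R i0).
split=> [n|g cg g0 Hg]; first by rewrite normr1.
have [cF iF] := intRd_sum (fun n => (2 * N * n)%:R *: evec R i0) (iota 0 N).
set F := (fun x => \sum_(n <- _) _) in cF iF.
have F0 x : 0 <= F x by apply: sumr_ge0 => n _; exact: kap_ge0.
have gF x : g x <= F x by apply: (lac_le_sum _ g0 Hg) => n; rewrite normr1.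
have rF : rl (fun x => (F x)%:E) by apply: rl_ct.
have X0 : 0 <= C0 `^ (r - 1) * I by rewrite mulr_ge0// powR_ge0.
have -> : ((C0 `^ (r - 1) * I) `^ r^-1 * N%:R `^ invp r%:E)%:E = ((C0 `^ (r - 1) * (N%:R * I))%:E `^ r^-1)%E.
  by rewrite poweR_EFin /= -powRM// mulrA mulrAC.
rewrite /Lpnorm; apply: poweR_le; first by rewrite invr_ge0 ltW.
  by apply: intRd_ge0; exact: rl_normpow.
rewrite E size_iota in iF; rewrite EFinM EFinM -iF -intRdZ ?powR_ge0//.
apply: intRd_le; [exact: rl_normpow|by apply: rlZ; rewrite ?powR_ge0|].
move=> x; rewrite ger0_norm// -EFinM lee_fin.
have r1' : 0 <= r - 1 by rewrite subr_ge0.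
apply: (@le_trans _ _ (F x `^ r)); first exact: powR_le (ltW r0) (g0 x) (gF x).
have -> : F x `^ r = F x `^ (r - 1) * F x.
  by rewrite -{3}(powRr1 (F0 x)) -powRD ?subrK// gt_eqF// implybT.
by apply: ler_wpM2r => //; apply: powR_le => //; exact: HC.
Qed.

(* Adding the blocks one at a time, the parallelogram identity and the concavity
   of [u ^ (r / 2)] let one of the two signs be chosen without losing the bound. *)
Lemma greedy_signs (r : R) j (s : seq nat) (M : R) : 0 < r -> r <= 2 -> 0 <= M -> uniq s ->
  exists e : nat -> R, (forall n, `|e n| = 1) /\
  (intRd (fun x => (`|(\sum_(n <- s) e n * ((2 * pi) ^- d * J (tensor (lacbump phi0 i0 i1 j n)) (x - 0) 0%R)) ^+ 2 +
     (\sum_(n <- s) e n * ((2 * pi) ^- d * J (tensor (lacbump phi0 i0 i1 j n)) (x - 0) (- (pi / 2)))) ^+ 2 +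
     M * kp x ^+ 2| `^ (r / 2))%:E)
  <= intRd (fun x => (`|((size s)%:R + M) * kp x ^+ 2| `^ (r / 2))%:E))%E.
Proof.
move=> r0 r2; pose U n w x := (2 * pi) ^- d * J (tensor (lacbump phi0 i0 i1 j n)) (x - 0) w.
have cU n w : ct (U n w).
  have := @ct_W R d (dirac_dist 0) _ w (ctempered_dirac 0) (ccs_lac aphi i0 i1 j n); congr ct; apply/funext => x.
  by rewrite W_dirac.
have UE n x : U n 0 x ^+ 2 + U n (- (pi / 2)) x ^+ 2 = kp x ^+ 2.
  by rewrite /U -absJ_sqr absJ_lac// subr0.
have cS e w (s' : seq nat) : ct (fun x => \sum_(n <- s') e n * U n w x).
  elim: s' => [|n s' IH].
    by have := @ctZ R d 0 _ (cU 0%N w); congr ct; apply/funext => x; rewrite big_nil mul0r.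
  by have := @ctD R d _ _ (@ctZ R d (e n) _ (cU n w)) IH; congr ct; apply/funext => x; rewrite big_cons.
have ck : ct kp by exact: ct_kap.
have h0 : 0 < r / 2 by rewrite divr_gt0.
have h1 : r / 2 <= 1 by lra.
have c3 (A B : Rd -> R) m : ct A -> ct B -> ct (fun x => A x ^+ 2 + B x ^+ 2 + m * kp x ^+ 2).
  by move=> cA cB; apply: ctD; [apply: ctD; apply: ctM|apply: ctZ; apply: ctM].
elim: s M => [|n s IH] M M0.
  move=> _; exists (fun=> 1); split=> [n|]; first by rewrite normr1.
  apply: intRd_le; [| |move=> x; rewrite !big_nil !expr0n/= !add0r//].
  - by apply: rl_normpow => //; apply: c3; exact: cS (fun=> 1) _ [::].
  - by apply: rl_normpow => //; apply: ctZ; exact: ctM.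
rewrite cons_uniq => /andP[ns us].
have M10 : 0 <= M + 1 by rewrite addr_ge0.
have [e [e1 He]] := IH _ M10 us.
pose A x := \sum_(m <- s) e m * U m 0 x; pose B x := \sum_(m <- s) e m * U m (- (pi / 2)) x.
have cA : ct A by exact: cS.
have cB : ct B by exact: cS.
pose X (v : R) x := (A x + v * U n 0 x) ^+ 2 + (B x + v * U n (- (pi / 2)) x) ^+ 2 + M * kp x ^+ 2.
have cX v : ct (X v) by apply: c3; apply: ctD => //; apply: ctZ.
have X0 v x : 0 <= X v x by rewrite /X !addr_ge0 ?sqr_ge0// mulr_ge0// sqr_ge0.
pose Z x := A x ^+ 2 + B x ^+ 2 + (M + 1) * kp x ^+ 2.
have cZ : ct Z by exact: c3.
have Z0 x : 0 <= Z x by rewrite /Z !addr_ge0 ?sqr_ge0// mulr_ge0// sqr_ge0.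
have XZ x : X 1 x + X (-1) x = 2 * Z x.
  by rewrite /X /Z -(UE n x); ring.
pose IX v := intRd (fun x => (`|X v x| `^ (r / 2))%:E).
have rX v : rl (fun x => (`|X v x| `^ (r / 2))%:E) by exact: rl_normpow.
have rZ : rl (fun x => (`|Z x| `^ (r / 2))%:E) by exact: rl_normpow.
have sum2 : (IX 1%R + IX (-1)%R <= 2%:E * intRd (fun x => (`|Z x| `^ (r / 2))%:E))%E.
  rewrite /IX -intRdD// -intRdZ//; apply: intRd_le; [exact: rlD|exact: rlZ|move=> x /=].
  rewrite -EFinD -EFinM lee_fin !ger0_norm//.
  by apply: le_trans (midpoint_powR h0 h1 (X0 _ _) (X0 _ _)) _; rewrite XZ mulrAC divff ?mul1r// pnatr_eq0.
have [v [v1 Hv]] : exists v : R, `|v| = 1 /\ (IX v <= intRd (fun x => (`|Z x| `^ (r / 2))%:E))%E.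
  have Z0' : (0 <= intRd (fun x => (`|Z x| `^ (r / 2))%:E))%E by exact: intRd_ge0.
  have [h|h] := le_of_sum Z0' sum2; first by exists 1; rewrite normr1.
  by exists (-1); rewrite normrN normr1.
exists (fun m => if m == n then v else e m); split.
  by move=> m; case: ifP.
have EA w x : \sum_(m <- n :: s) (if m == n then v else e m) * U m w x = \sum_(m <- s) e m * U m w x + v * U n w x.
  rewrite big_cons eqxx addrC; congr (_ + _); apply: eq_big_seq => m ms.
  by case: eqP => // E; move: ns; rewrite -E ms.
apply: (@le_trans _ _ (IX v)).
  rewrite le_eqVlt; apply/orP; left; apply/eqP; congr intRd; apply/funext => x.
  by rewrite -/(U _ _ _) !EA.
apply: le_trans Hv _; apply: le_trans He _.
have E : (size (n :: s))%:R + M = (size s)%:R + (M + 1) by rewrite [size (n :: s)]/= -natr1 addrAC addrA.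
by rewrite E.
Qed.

(** [greedy_signs] with [M = 0] compares the integrals of [(g ^ 2) ^ (r / 2)] and
    [(N * kap ^ 2) ^ (r / 2)], whence the factor [N ^ (1 / 2)]. *)
Lemma lac_signs (r : R) : 0 < r -> r <= 2 -> exists2 C1 : R, 0 <= C1 &
  forall N, (0 < N)%N -> exists (e : nat -> R) (a : nat -> Rd), (forall n, `|e n| = 1) /\
    forall g, ct g -> (forall x, 0 <= g x) ->
      (forall x, g x ^+ 2 = lacsum phi0 i0 i1 N e a x 0 ^+ 2 + lacsum phi0 i0 i1 N e a x (- (pi / 2)) ^+ 2) ->
      (Lpnorm r%:E g <= (C1 * N%:R `^ 2^-1)%:E)%E.
Proof.
move=> r0 r2; have r0' : (0 < r%:E)%E by rewrite lte_fin.
have [K K0 HK] := @kap_norm _ d _ aphi _ r0'.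
have ck : ct kp by exact: ct_kap.
exists K; first exact: ltW.
move=> N N0; have [e [e1 He]] := @greedy_signs r N (iota 0 N) 0 r0 r2 (lexx _) (iota_uniq _ _).
exists e, (fun=> 0); split => // g cg g0 Hg.
have P0 : 0 <= N%:R `^ 2^-1 :> R by exact: powR_ge0.
apply: (@le_trans _ _ (Lpnorm r%:E (fun x => (N%:R `^ 2^-1 * kp x)%R))); last first.
  by apply: le_trans (Lp_scale_le r0' P0 ck) _; rewrite -/kp HK -EFinM mulrC.
rewrite /Lpnorm; apply: poweR_le; first by rewrite invr_ge0 ltW.
  by apply: intRd_ge0; exact: rl_normpow.
apply: le_trans (le_trans _ He) _.
  rewrite le_eqVlt; apply/orP; left; apply/eqP; congr intRd; apply/funext => x.
  rewrite mul0r addr0 -Hg ger0_norm// ger0_norm ?sqr_ge0// sqr_powR//.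
rewrite le_eqVlt; apply/orP; left; apply/eqP; congr intRd; apply/funext => x.
rewrite size_iota addr0; have k0 : 0 <= kp x by exact: kap_ge0.
have E : (N%:R `^ 2^-1 * kp x) ^+ 2 = N%:R * kp x ^+ 2.
  by rewrite exprMn -(powR_mulrn 2 P0) -powRrM mulVf ?pnatr_eq0// powRr1.
rewrite -E (ger0_norm (sqr_ge0 _)) (ger0_norm (mulr_ge0 P0 k0)).
by rewrite (sqr_powR _ (mulr_ge0 P0 k0)).
Qed.

End bounds.

Lemma pow2D {R : realType} (a b : R) : 2 `^ a * 2 `^ b = 2 `^ (a + b) :> R.
Proof. by rewrite powRD// pnatr_eq0 implybT. Qed.

(** * Tests with one dilated bump *)

Section dilations.
Context {R : realType} {d : nat}.
Notation Rd := 'rV[R]_d.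
Implicit Types (psi chi g : Rd -> R) (l i : 'I_d) (x z xi : Rd) (w : R) (f : tdist R d) (p q : \bar R).

Lemma cpt1_scale (h : R -> R) (c : R) : 0 < c -> cpt1 h -> cpt1 (fun y : R => h (c * y)).
Proof.
move=> c0 [hs [A HA]]; split; first exact: sm1_scale.
exists (A / c) => y yA; apply: HA; rewrite normrM (gtr0_norm c0) mulrC -ltr_pdivrMr//.
Qed.

Lemma tensor_dscale (h : 'I_d -> R -> R) (s : 'I_d -> R) :
  (fun xi => tensor h (dscale s xi)) = tensor (fun i (y : R) => h i (s i * y)).
Proof. by apply/funext => xi; apply: eq_bigr => i _; rewrite mxE. Qed.

Lemma absJ_dyadic (r : R) (h : 'I_d -> R -> R) (m : 'I_d -> nat) : 0 < r -> (forall i, cpt1 (h i)) ->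
  Lpnorm r%:E (absJ (tensor (fun i (y : R) => h i (2 ^- m i * y)))) =
  ((2 `^ ((\sum_i m i)%:R * (1 - r^-1)))%:E * Lpnorm r%:E (absJ (tensor h)))%E.
Proof.
move=> r0 hc; have s0 i : 0 < 2 ^- m i :> R by rewrite invr_gt0 exprn_gt0.
rewrite -(tensor_dscale h (fun i => 2 ^- m i)) absJ_dscale//.
- congr (_%:E * _)%E; rewrite powRrM powR_mulrn//; congr (_ `^ _).
  by rewrite expr_sum; apply: eq_bigr => i _; rewrite invrK.
- exact: ccs_tensor.
- by rewrite tensor_dscale; apply: ccs_tensor => i; exact: cpt1_scale.
Qed.

Variables (psi0 : Rd -> R) (phi0 : R -> R).
Hypotheses (apsi : admissible_psi0 psi0) (aphi : admissible_phi0 phi0).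
Variables (i0 i1 : 'I_d).
Hypothesis (i01 : i1 != i0).

(** Profile of the test function: a bump in direction [i0], which fixes the isotropic shell, and in
    the other directions a plateau that, dilated by [2 ^ j], contains the support of [phi_n] for
    [n.+2 <= j]. *)
Definition box i (y : R) : R := if i == i0 then bump phi0 (y - 7 / 8) else phi0 (2 * y).
(** Profile of a mixed piece of the dilated [box] once each coordinate is rescaled. *)
Definition shell i (y : R) : R := if i == i0 then bump phi0 (y - 7 / 8) else phij phi0 1 y.
(** The remaining coordinates get index 1, not 0, so that the profile [phij phi0 1] serves in every
    direction but [i0]. *)
Definition dilidx j n : {ffun 'I_d -> nat} := [ffun i => if i == i0 then j else if i == i1 then n else 1%N].

Lemma cpt1_box i : cpt1 (box i).
Proof.
rewrite /box; case: (i == i0); first exact: cpt1_bump.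
have [ps [_ p0]] := aphi; split; first exact: sm1_scale.
by exists 1 => y y1; apply: p0; rewrite normrM ger0_norm//; lra.
Qed.

Lemma cpt1_shell i : cpt1 (shell i).
Proof.
rewrite /shell; case: (i == i0); first exact: cpt1_bump.
split; first exact: (@sm1_phij R phi0 1 aphi).
exists 3 => y y3; apply/eqP/negPn/negP => /(phij_supp aphi)[+ _].
by rewrite expr1 => h; lra.
Qed.

Lemma norm2 j (y : R) : `|2 ^- j * y| = 2 ^- j * `|y|.
Proof. by rewrite normrM [`|2 ^- j|]ger0_norm// invr_ge0 exprn_ge0. Qed.

Lemma bump_dilate j (y : R) : bump phi0 (2 ^- j * y - 7 / 8) != 0 -> 3 / 4 * 2 ^+ j <= `|y| /\ `|y| <= 2 ^+ j.
Proof.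
move=> /(bump_supp aphi); have j0 : 0 < 2 ^+ j :> R by rewrite exprn_gt0.
have -> : y = 2 ^+ j * (2 ^- j * y) by rewrite mulrA divff ?mul1r ?gt_eqF.
rewrite mulKf ?gt_eqF// normrM (gtr0_norm j0); move: (2 ^- j * y) => u.
rewrite ltr_norml => /andP[h1 h2]; have u0 : 0 <= u by lra.
rewrite ger0_norm//; split; nra.
Qed.

Lemma box_psi j j' xi :
  tensor (fun i (y : R) => box i (2 ^- j * y)) xi * psij psi0 j' xi =
  (j' == j)%:R * tensor (fun i (y : R) => box i (2 ^- j * y)) xi.
Proof.
set T := tensor _ xi; have [->|ne] := eqVneq T 0; first by rewrite mul0r mulr0.
have H i : box i (2 ^- j * xi 0 i) != 0 by move/prodf_neq0: ne => /(_ i isT).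
have [_ [_ p0]] := aphi; have j0 : 0 < 2 ^+ j :> R by rewrite exprn_gt0.
have H0 : 3 / 4 * 2 ^+ j <= `|xi 0 i0| /\ `|xi 0 i0| <= 2 ^+ j.
  by apply: bump_dilate; have := H i0; rewrite /box eqxx.
have hj i : `|xi 0 i| <= 2 ^+ j.
  have [->|ne0] := eqVneq i i0; first exact: H0.2.
  rewrite leNgt; apply/negP => h; have := H i; rewrite /box (negbTE ne0) p0 ?eqxx//.
  rewrite normrM ger0_norm// norm2.
  have : 1 < 2 ^- j * `|xi 0 i| by rewrite mulrC ltr_pdivlMr// mul1r.
  lra.
have hi : exists i, 3 / 4 * 2 ^+ j <= `|xi 0 i| by exists i0; exact: H0.1.
by rewrite (psij_shell apsi j' hj hi) mulrC.
Qed.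

Lemma phij_dilate n (y : R) : phij phi0 n.+1 y = phij phi0 1 (2 ^- n * y).
Proof.
rewrite /phij expr0 invr1 mul1r mulrA; congr (phi0 (_ * _) - _).
by rewrite exprS invfM expr1.
Qed.

(** In direction [i0] the bump lies where [phi_j] is 1; elsewhere [phi_n] lies inside the plateau.
    As [phi_n] is [phij phi0 1] dilated by [2 ^ n.-1], the dilation index carries [n.-1]. *)
Lemma box_phi j n xi : (0 < n)%N -> (n.+2 <= j)%N ->
  tensor (fun i (y : R) => box i (2 ^- j * y)) xi * phik phi0 (dilidx j n) xi =
  tensor (fun i (y : R) => shell i (2 ^- (lacidx i0 i1 j n.-1 i) * y)) xi.
Proof.
move=> n0 nj; have [_ [p1 _]] := aphi; have j0 : 0 < 2 ^+ j :> R by rewrite exprn_gt0.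
have K m (y : R) : (m.+2 <= j)%N -> phi0 (2 * (2 ^- j * y)) * phij phi0 m y = phij phi0 m y.
  move=> mj; have [->|ne] := eqVneq (phij phi0 m y) 0; first by rewrite mulr0.
  have [h _] := phij_supp aphi ne.
  have E : `|2 * (2 ^- j * y)| = 2 * `|y| / 2 ^+ j by rewrite normrM norm2 (@ger0_norm _ 2)//; ring.
  rewrite p1 ?mul1r// E ler_pdivrMr// mul1r.
  have : 2 ^+ m.+2 <= 2 ^+ j :> R by rewrite ler_eXn2l ?ltr1n.
  by rewrite !exprS; lra.
rewrite /phik /tensor -big_split/=; apply: eq_bigr => i _; rewrite /box /shell !ffunE.
have [_|ne0] := eqVneq i i0.
  set b := bump _ _; have [->|nb] := eqVneq b 0; first by rewrite mul0r.
  by have [h1 h2] := bump_dilate nb; rewrite (phij_shell aphi j h1 h2) eqxx mulr1.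
have [_|ne1] := eqVneq i i1; first by rewrite K// -phij_dilate prednK.
by rewrite K ?expr0 ?invr1 ?mul1r//; apply: leq_trans nj; rewrite !ltnS.
Qed.

Lemma sum_dilidx j n : (\sum_(i < d) dilidx j n i)%N = (j + (n + (d - 2)))%N.
Proof.
rewrite (bigD1 i0)//= (bigD1 i1)//= !ffunE !eqxx (negbTE i01); congr (_ + (_ + _))%N.
rewrite (eq_bigr (fun=> 1%N)) => [|i /andP[a b]]; last by rewrite ffunE (negbTE a) (negbTE b).
rewrite sum1_card (_ : #|_| = #|~: [set i0; i1]|).
  by rewrite cardsCs finset.setCK cards2 eq_sym i01 card_ord.
by apply: eq_card => i; rewrite !inE negb_or.
Qed.

Lemma dilidx_inj j : injective (dilidx j).
Proof. by move=> n m /ffunP/(_ i1); rewrite !ffunE eqxx (negbTE i01). Qed.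

Lemma shell_norm (r : R) : 0 < r -> exists2 K : R, 0 < K & Lpnorm r%:E (absJ (tensor shell)) = K%:E.
Proof.
move=> r0; have r0' : (0 < r%:E)%E by rewrite lte_fin.
have : (0 < Lpnorm r%:E (absJ (tensor shell)))%E.
  apply: (@absJ_pos _ _ _ _ (\row_i (if i == i0 then 7 / 8 else 7 / 4))) => //; first exact: cpt1_shell.
  apply/prodf_neq0 => i _; have [->|ne] := eqVneq i i0.
    by rewrite mxE /shell eqxx subrr bump0// oner_eq0.
  rewrite mxE /shell (negbTE ne).
  have [_ [p1 p0]] := aphi.
  rewrite /phij expr0 expr1 invr1 mul1r p1 ?p0 ?subr0 ?oner_eq0//.
    by rewrite ger0_norm; lra.
  by rewrite ger0_norm; lra.
have := absJ_fin r0' (ccs_tensor cpt1_shell).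
by case: (Lpnorm _ _) => // K _; rewrite lte_fin => K0; exists K.
Qed.

Lemma box_norm (r : R) : 0 < r -> exists2 K : R, 0 <= K & Lpnorm r%:E (absJ (tensor box)) = K%:E.
Proof.
move=> r0; have r0' : (0 < r%:E)%E by rewrite lte_fin.
have := absJ_fin r0' (ccs_tensor cpt1_box); have := Lpnorm_ge0 r%:E (ct_absJ (ccs_tensor cpt1_box)).
by case: (Lpnorm _ _) => // K K0 _; exists K.
Qed.

(** A kernel whose symbol is dilated by [2 ^ m] in total has norm of order [2 ^ (m (1 - 1 / r))].
    With the weights both norms have exponent [t + (1 - 1 / r)], times [j d] for the isotropic and
    [j + n] for the mixed piece. *)
Lemma dil_dist (r K0 K2 t : R) q j : 0 < r -> (0 < q)%E ->
  Lpnorm r%:E (absJ (tensor box)) = K0%:E -> Lpnorm r%:E (absJ (tensor shell)) = K2%:E ->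
  exists f : tdist R d, [/\ ctempered f,
    (besov_norm psi0 (t * d%:R) r%:E q f <= (2 `^ (j%:R * d%:R * (t + (1 - r^-1))) * K0)%:E)%E &
    forall n, (0 < n)%N -> (n.+2 <= j)%N ->
      ((2 `^ ((\sum_(i < d) dilidx j n i)%:R * t))%:E * Lpnorm r%:E (absDelta (phik phi0 (dilidx j n)) f))%E =
      (2 `^ ((j + n)%:R * (t + (1 - r^-1))) * (2 `^ ((d - 2)%:R * t - (1 - r^-1)) * K2))%:E].
Proof.
move=> r0 q0 H0 H2; have r0' : (0 < r%:E)%E by rewrite lte_fin.
pose h i (y : R) := box i (2 ^- j * y).
have hc i : cpt1 (h i) by apply: cpt1_scale (cpt1_box i); rewrite invr_gt0 exprn_gt0.
have [f [ft Hf]] := @comb_dist R d (fun=> h) (fun=> 1) (fun=> 0) [:: 0%N] (fun=> hc).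
have cc := ccs_tensor hc.
have DJ psi chi : ccs psi -> (forall xi, tensor h xi * psi xi = chi xi) -> absDelta psi f = absJ chi.
  move=> pc E; apply/funext => x; rewrite (@absDelta_absJ _ _ f psi chi x 0 1)// ?normr1 ?mul1r ?subr0// => w.
  by rewrite Hf// big_seq1 subr0; congr (_ * (_ * _)); apply: J_ext => xi; exact: E.
have t0 : (2 == 0 :> R) = false by rewrite pnatr_eq0.
exists f; split => //.
- apply: le_trans (@besov_single _ _ _ apsi _ _ (t * d%:R) f j r0' q0 ft _) _.
    move=> j' jj x; have cp := ccs_psij apsi j'.
    rewrite (@absDelta_absJ _ _ f _ (tensor h) x 0 0)// ?normr0 ?mul0r// => w.
    rewrite Hf// big_seq1 mul0r mul1r.
    have := J_lin (-1) (x - 0) w cc cc; rewrite mulN1r addNr.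
    rewrite (J_ext _ _ (psi' := fun xi => tensor h xi * psij psi0 j' xi)) => [->|xi]; first by rewrite mulr0.
    by rewrite box_psi (negbTE jj) mul0r mulN1r addNr.
  rewrite (DJ _ (tensor h)) => [|| xi]; last by rewrite box_psi eqxx mul1r.
    rewrite (absJ_dyadic (fun=> j) r0 cpt1_box) H0 -!EFinM lee_fin mulrA pow2D.
    rewrite le_eqVlt; apply/orP; left; apply/eqP; congr (_ `^ _ * _).
    rewrite sum_nat_const card_ord natrM; ring.
  exact: ccs_psij.
- move=> n n0 nj; rewrite (DJ _ _ (ccs_phik aphi _) (fun xi => box_phi xi n0 nj)).
  rewrite (absJ_dyadic _ r0 cpt1_shell) H2 sum_lacidx// sum_dilidx -!EFinM !mulrA !pow2D.
  congr ((_ `^ _ * _)%:E); case: n n0 {nj} => // n _; rewrite /= !natrD -natr1; ring.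
Qed.

(** Let [s = t + (1 - 1 / r)]. If [s < 0], the piece [n = 1] of size [2 ^ ((j + 1) s)] beats
    [2 ^ (j d s)], as [d >= 2]. If [s = 0], about [j] pieces of equal size face a bounded isotropic
    norm, which only [q = +oo] allows. *)
Lemma embeds_sigma (r t : R) q : (2 <= d)%N -> 0 < r -> (0 < q)%E ->
  embeds psi0 phi0 (t * d%:R) t r%:E q -> 0 <= t + (1 - r^-1) /\ (t + (1 - r^-1) = 0 -> q = +oo%E).
Proof.
move=> d2 r0 q0; have r0' : (0 < r%:E)%E by rewrite lte_fin.
move=> /(embeds_le apsi r0' q0)[C C0 H].
have [K0 K00 HK0] := box_norm r0; have [K2 K20 HK2] := shell_norm r0.
set s := t + (1 - r^-1); set c := 2 `^ ((d - 2)%:R * t - (1 - r^-1)) * K2.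
have c0 : 0 < c by rewrite mulr_gt0// powR_gt0.
have t0 : (2 == 0 :> R) = false by rewrite pnatr_eq0.
split.
  rewrite leNgt; apply/negP => sn.
  have u1 : 1 < 2 `^ (- s) :> R by apply: powR2_gt1; rewrite oppr_gt0.
  (* The choice [j = m + 3] admits [n = 1]; the power of 2 absorbs the offset in
     [(m + 4) s - (m + 3) d s], leaving [m s (1 - d)]. *)
  apply: (@expr_unbounded _ _ (2 `^ (- (s * (4 - 3 * d%:R))) * (C * K0 / c)) u1) => m.
  have [f [ft fb fm]] := @dil_dist r K0 K2 t q (m + 3) r0 q0 HK0 HK2.
  have m3 : (3 <= m + 3)%N by rewrite leq_addl.
  have := le_trans (mixed_ge aphi t (dilidx (m + 3) 1) r0' q0 ft) (H f _ ft fb).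
  rewrite (fm 1%N isT m3) lee_fin -/s -/c => G.
  have p20 : 0 < 2 `^ (- (s * (4 - 3 * d%:R))) :> R by rewrite powR_gt0.
  have p21 : 0 < 2 `^ ((m + 3)%:R * d%:R * s) :> R by rewrite powR_gt0.
  have : 2 `^ ((m + 3 + 1)%:R * s) / 2 `^ ((m + 3)%:R * d%:R * s) <= C * K0 / c.
    rewrite ler_pdivrMr// mulrAC ler_pdivlMr//; apply: le_trans G _.
    by rewrite mulrCA mulrC.
  rewrite -powRN pow2D => G'.
  apply: le_trans (ler_wpM2l (ltW p20) G'); rewrite -powR_nat pow2D.
  rewrite ler_powR ?ler1n// !natrD.
  have d2' : 2 <= d%:R :> R by rewrite ler_nat.
  have m0 : 0 <= m%:R :> R by [].
  have ms : m%:R * s <= 0 by rewrite mulr_ge0_le0// ltW.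
  have -> : - (s * (4 - 3 * d%:R)) + ((m%:R + 3 + 1) * s + - ((m%:R + 3) * d%:R * s)) = (m%:R * s) * (1 - d%:R) by ring.
  by rewrite mulrN; nra.
move=> s0; case: q q0 H => [q| |]// q0 H; exfalso; rewrite lte_fin in q0.
have cq0 : 0 < c `^ q by rewrite powR_gt0.
have q0' : (0 < q%:E)%E by rewrite lte_fin.
have main m : m%:R <= (C * K0) `^ q / c `^ q.
  have [f [ft fb fm]] := @dil_dist r K0 K2 t q%:E (m + 2) r0 q0' HK0 HK2.
  rewrite -/s s0 mulr0 powRr0 mul1r in fb.
  have M := H f _ ft fb.
  have m0 : (0 <= mixed_norm phi0 t r%:E q%:E f)%E by exact: poweR_ge0.
  have us : uniq (map (dilidx (m + 2)) (iota 1 m)).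
    by rewrite map_inj_uniq ?iota_uniq//; exact: dilidx_inj.
  have := le_trans (@mixed_ge_sum _ _ phi0 r%:E q t f _ q0 us ft) (poweR_le (ltW q0) m0 M).
  rewrite big_map => S; rewrite ler_pdivlMr// -lee_fin -[X in (_ <= X)%E]poweR_EFin.
  apply: le_trans S; rewrite big_seq (eq_bigr (fun=> (c `^ q)%:E)) => [|n]; last first.
    rewrite mem_iota => /andP[n1 nm]; rewrite fm//; last by rewrite addn2 !ltnS; move: nm; rewrite add1n ltnS.
    by rewrite -/s s0 mulr0 powRr0 mul1r poweR_EFin.
  rewrite -big_seq sumEFin lee_fin big_const_seq count_predT size_iota iter_addr_0.
  by rewrite mulr_natl.
have := main (Num.truncn ((C * K0) `^ q / c `^ q)).+1.
by rewrite leNgt truncnS_gt.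
Qed.

End dilations.

(** * Assembly of the two implications *)

Lemma sigpE {R : realType} (p : \bar R) : (0 < p)%E -> sigp p = Num.max 0 (invp p - 1).
Proof.
case: p => [r| |]//; last by move=> _; rewrite /sigp /rho /invp invr1 subrr max_l// sub0r oppr_le0.
rewrite lte_fin => r0; rewrite /sigp /rho /invp; have [r1|r1] := leP 1 r.
  by rewrite invr1 subrr max_l// subr_le0 invf_le1.
by rewrite max_r// subr_ge0 invf_ge1// ltW.
Qed.

Lemma embeds_sufficient {R : realType} {d : nat} (p q : \bar R) (t : R) (psi0 : 'rV[R]_d -> R) (phi0 : R -> R) :
  (0 < p)%E -> (0 < q)%E -> admissible_psi0 psi0 -> admissible_phi0 phi0 ->
  [\/ 0 < t /\ invp p - 1 < t,
      [/\ t = 0, (1%:E < p)%E, (2%:E <= q)%E & (p <= q)%E]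
    | [/\ (p <= 1%:E)%E, t = invp p - 1 & q = +oo%E]] ->
  embeds psi0 phi0 (t * d%:R) t p q.
Proof.
move=> p0 q0 apsi aphi H; have sE := sigpE p0.
(* Each of the three conditions implies [sigp p <= t], which settles [q = +oo] at once. *)
have sup : q = +oo%E -> embeds psi0 phi0 (t * d%:R) t p q.
  move=> ->; apply: sufficiency_sup => //; rewrite sE ge_max; case: H => [[t0 pt]|[-> p1 _ _]|[p1 -> _]].
  - by rewrite !ltW.
  - rewrite lexx/= subr_le0; case: p p1 {p0 sE} => [r| |]//= r1; rewrite lte_fin in r1.
    by rewrite invf_le1// ?ltW// (lt_trans _ r1).
  - rewrite lexx andbT subr_ge0; case: p p0 p1 {sE} => [r| |]//= r0 r1.
    by rewrite invf_ge1// -lee_fin.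
case: q q0 sup H => [q| |]// q0 sup H; last exact: sup.
rewrite lte_fin in q0; case: H => [[t0 pt]|[-> p1 q2 pq]|[_ _ //]].
  by apply: sufficiency_fin => //; apply: coord_bound_gt => //; rewrite sE gt_max t0 pt.
case: p p0 p1 pq {sE sup} => [r| |]// r0 r1 rq; apply: sufficiency_fin => //.
by apply: coord_bound_eq0; rewrite -?lte_fin// ge_max -!lee_fin q2 rq.
Qed.

Lemma embeds_necessary {R : realType} {d : nat} (p q : \bar R) (t : R) (psi0 : 'rV[R]_d -> R) (phi0 : R -> R) :
  (2 <= d)%N -> (0 < p)%E -> (0 < q)%E -> admissible_psi0 psi0 -> admissible_phi0 phi0 ->
  embeds psi0 phi0 (t * d%:R) t p q ->
  [\/ 0 < t /\ invp p - 1 < t,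
      [/\ t = 0, (1%:E < p)%E, (2%:E <= q)%E & (p <= q)%E]
    | [/\ (p <= 1%:E)%E, t = invp p - 1 & q = +oo%E]].
Proof.
move=> d2 p0 q0 apsi aphi H.
pose i0 := Ordinal (ltnW d2 : (0 < d)%N); pose i1 := Ordinal (d2 : (1 < d)%N).
have i01 : i1 != i0 by [].
have t0 := embeds_t_ge0 apsi aphi i01 d2 p0 q0 H.
have spread (u : R) : q = u%:E -> t = 0 -> (1%:E <= p)%E -> u^-1 <= invp p.
  move=> qu tz p1; rewrite qu lte_fin in q0; rewrite qu tz mul0r in H.
  have [C1 C10 HC] := lac_spread aphi i0 i1 p1.
  exact: (lac_necessity apsi aphi i01 p0 q0 C10 H HC).
case: p p0 H spread => [r| |]// r0 H spread; last first.
  have [tz|tz] := eqVneq t 0; last first.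
    by apply: Or31; split; [rewrite lt_neqAle eq_sym tz t0|rewrite /= sub0r (lt_le_trans _ t0)// oppr_lt0].
  case: q q0 H spread => [u| |]// u0 H spread; apply: Or32; last by split; rewrite ?ltry ?leey.
  (* For [p = +oo] and finite [q] the spread centres would give [1 / q <= 0]. *)
  rewrite lte_fin in u0; have := spread u erefl tz (leey _).
  by rewrite leNgt invr_gt0 u0.
have r0' := r0; rewrite lte_fin in r0'.
have [s0 sq] := embeds_sigma apsi aphi i01 d2 r0' q0 H.
(* In case of equality, [t >= 0] forces [r <= 1]. *)
have [te|tne] := eqVneq t (r^-1 - 1).
  apply: Or33; split => //; last by apply: sq; rewrite te; ring.
  by rewrite lee_fin -invf_ge1// -subr_ge0 -te.
have tgt : r^-1 - 1 < t by rewrite lt_neqAle eq_sym tne/=; lra.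
have [tz|tz] := eqVneq t 0; last by apply: Or31; rewrite lt_neqAle eq_sym tz t0.
have r1 : 1 < r by rewrite -invf_lt1//; lra.
apply: Or32; case: q q0 H sq spread => [u| |]// u0 H sq spread; last by split; rewrite ?lte_fin ?leey.
rewrite lte_fin in u0.
have ru : r <= u by rewrite -lef_pV2 ?posrE//; apply: spread => //; rewrite lee_fin ltW.
split; rewrite ?lte_fin ?lee_fin//.
(* For [r > 2] the bound [2 <= u] follows from [r <= u]; the signs are called upon for [r <= 2]. *)
have [r2|r2] := leP r 2; last exact: le_trans (ltW r2) ru.
rewrite tz mul0r in H; have [C1 C10 HC] := lac_signs aphi i0 i1 r0' r2.
by rewrite -lef_pV2 ?posrE//; exact: (lac_necessity apsi aphi i01 r0 u0 C10 H HC).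
Qed.

Theorem theorem3p6 (R : realType) (d : nat) (p q : \bar R) (t : R)
  (psi0 : 'rV[R]_d -> R) (phi0 : R -> R) :
  (2 <= d)%N -> (0 < p)%E -> (0 < q)%E ->
  admissible_psi0 psi0 -> admissible_phi0 phi0 ->
  embeds psi0 phi0 (t * d%:R) t p q <->
  [\/ 0 < t /\ invp p - 1 < t,
      [/\ t = 0, (1%:E < p)%E, (2%:E <= q)%E & (p <= q)%E]
    | [/\ (p <= 1%:E)%E, t = invp p - 1 & q = +oo%E]].
Proof.
move=> d2 p0 q0 apsi aphi; split; first exact: embeds_necessary.
exact: embeds_sufficient.
Qed.
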